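(* Let $m,\lambda,\beta,\gamma,k_BT>0$ be constants, let $K$ satisfy the kernel assumptions (I), (II) and (III) listed in the context, and let $F$ and $\dot W$ be the uncorrelated stationary random distributions described in the context. Let $\Phi=(X,V)$ be a weak stationary solution (in the sense defined in the context) of $$\dot x(t)=v(t),\qquad m\dot v(t)=-\lambda v(t)-\gamma x(t)-\beta\int_{-\infty}^tK(t-s)v(s)\,ds+\sqrt{\beta k_BT}\,F(t)+\sqrt{2\lambda k_BT}\,\dot W(t),$$ and let $x(t)=\langle X,\delta_t\rangle$, $v(t)=\langle V,\delta_t\rangle$ be the associated process. Then $$\mathbb E[\gamma\,x(0)^2]=\mathbb E[m\,v(0)^2]=k_BT.$$
   Context: Fourier conventions. $\widehat f(\omega)=\int_{\mathbb R}f(t)e^{-\mathrm{i}t\omega}dt$. $\mathcal S$ is the Schwartz space on $\mathbb R$ and $\mathcal S'$ its dual; the Fourier transform $\mathcal F[g]$ of $g\in\mathcal S'$ is defined by $\langle\mathcal F[g],\varphi\rangle=\langle g,\widehat\varphi\rangle$, $\varphi\in\mathcal S$. $L^2(\Omega)$ is the space of square-integrable complex-valued random variables; $\delta_t$ is the Dirac distribution at $t$. Completely monotonic functions. $f:(0,\infty)\to[0,\infty)$ belongs to $\mathcal{CM}$ if $f\in C^\infty(0,\infty)$ and $(-1)^nf^{(n)}(t)\ge0$ for all $n\ge0$, $t>0$. Kernel assumptions. $K:\mathbb R\to\mathbb R\cup\{\infty\}$ is real-valued for $t\ne0$ (possibly infinite at $t=0$). (I) (a) $K\in L^1_{loc}(\mathbb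 R)$ is symmetric around zero and positive for all nonzero $t$; (b) $K(t)\to0$ as $t\to\infty$ and $K$ is eventually decreasing; (c) the improper integral $\mathcal K_{\cos}(\omega)=\int_0^\infty K(t)\cos(\omega t)\,dt$ is positive for all nonzero $\omega$. (II) Either (a) $K\in L^1(\mathbb R)$; or (b) $K(t)\sim t^{-1}$ as $t\to\infty$; or (c) there is $\alpha\in(0,1)$ with $K(t)\sim t^{-\alpha}$ as $t\to\infty$. Here $f(t)\sim g(t)$ means $\lim_{t\to\infty}f(t)/g(t)=c$ for some $c\in(0,\infty)$. (III) Either (a) $K\in\mathcal{CM}$ (i.e. its restriction to $(0,\infty)$ is); or (b) $K(t)=\varphi(t^2)$ (for $t\neq0$) with $\varphi\in\mathcal{CM}$. Noise. $F,\dot W:\mathcal S\to L^2(\Omega)$ are stationary random distributions (linear functionals on $\mathcal S$ whose first and second moments are invariant under translation of test functions) with, for $\varphi_1,\varphi_2\in\mathcal S$, $$\mathbb E[\langle\dot W,\varphi_1\rangle\overline{\langle\dot W,\varphi_2\rangle}]=\frac1{2\pi}\int_{\mathbb R}\widehat{\varphi_1}\,\overline{\widehat{\varphi_2}}\,d\omega,\quad \mathbb E[\langle F,\varphi_1\rangle\overline{\langle F,\varphi_2\rangle}]=\frac1{2\pi}\int_{\mathbb R}2\mathcal K_{\cos}(\omega)\widehat{\varphi_1}(\omega)\overline{\widehat{\varphi_2}(\omega)}\,d\omega,\quad \mathbb E[\langle\dot W,\varphi_1\rangle\overline{\langle F,\varphi_2\rangle}]=0.$$ Stationary operators ($d=2$).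 Let $\nu=(\nu_{ij})_{1\le i,j\le2}$ be a Borel measure with values in the Hermitian positive semidefinite matrices, absolutely continuous with respect to Lebesgue measure, with $\int_{\mathbb R}\frac{\|\nu(d\omega)\|}{(1+\omega^2)^p}<\infty$ for some $p\in\mathbb R$. A random measure with respect to $\nu$ is a map $Z=(Z_1,Z_2)$ from the Borel sets $E$ with $\|\nu(E)\|<\infty$ to $L^2(\Omega)^2$ with $\mathbb E[Z(E_1)Z(E_2)^*]=\nu(E_1\cap E_2)$. The associated stationary operator $\Phi=(X,V)$, with spectral measure $\nu$, is $\langle\Phi,g\rangle=\int_{\mathbb R}\mathcal F[g](\omega)\,Z(d\omega)$; componentwise, $\langle X,g\rangle=\int\mathcal F[g]\,dZ_1$ and $\langle V,g\rangle=\int\mathcal F[g]\,dZ_2$, defined for those $g\in\mathcal S'$ whose Fourier transform is a function belonging to $L^2(\nu_{11})$, respectively $L^2(\nu_{22})$. As throughout for solutions of the Langevin system, $\Phi$ is real (real-valued on real-valued test functions). Weak stationary solution. For $\varphi\in\mathcal S$ let $$\Psi(\varphi)(t)=-m\varphi'(t)+\lambda\varphi(t)+\beta\int_0^\infty K(s)\varphi(t+s)\,ds .$$ A stationary operator $\Phi=(X,V)$ is a weak stationary solution if: (a) for all $\varphi\in\mathcal S$, $\mathbb E|\langle V,\Psi(\varphi)\rangle|^2<\infty$ (in particular $\langle V,\Psi(\varphi)\rangle$ is defined); (b) for all $\varphi_1,\varphi_2\in\mathcal S$, $$\mathbb E[\langle X,-\varphi_1'\rangle\overline{\langle X,-\varphi_2'\rangle}]=\mathbb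 E[\langle V,\varphi_1\rangle\overline{\langle V,\varphi_2\rangle}]=\mathbb E[\langle X,-\varphi_1'\rangle\overline{\langle V,\varphi_2\rangle}]$$ and $$\mathbb E\Big[\big(\langle V,\Psi(\varphi_1)\rangle+\langle X,\gamma\varphi_1\rangle\big)\overline{\big(\langle V,\Psi(\varphi_2)\rangle+\langle X,\gamma\varphi_2\rangle\big)}\Big]=k_BT\Big(\beta\,\mathbb E[\langle F,\varphi_1\rangle\overline{\langle F,\varphi_2\rangle}]+2\lambda\,\mathbb E[\langle\dot W,\varphi_1\rangle\overline{\langle\dot W,\varphi_2\rangle}]\Big).$$ *)

(* Defs.v *)
From HB Require Import structures.
From mathcomp Require Import all_boot all_order all_algebra complex.
From mathcomp Require Import all_classical all_reals all_analysis.

Set Implicit Arguments.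
Unset Strict Implicit.
Unset Printing Implicit Defensive.

Import Order.TTheory GRing.Theory Num.Theory.
Import numFieldNormedType.Exports.

Local Open Scope classical_set_scope.
Local Open Scope ring_scope.
Local Open Scope complex_scope.

Notation Re := complex.Re.
Notation Im := complex.Im.
Notation normc := ComplexField.Normc.normc.
Notation leb := lebesgue_measure.

(* Complex-valued functions are handled through their real and imaginary
   parts, since R[i] carries neither a normed module structure over R nor a
   measurable structure in the libraries. *)

Section complex_integration.
Context d (T : measurableType d) (R : realType).
Variable mu : {measure set T -> \bar R}.
Implicit Types (D : set T) (f : T -> R[i]).

Definition Cmeasurable f :=
  measurable_fun setT (fun x => Re (f x)) /\
  measurable_fun setT (fun x => Im (f x)).

Definition Cintegrable D f :=
  mu.-integrable D (fun x => (Re (f x))%:E) /\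
  mu.-integrable D (fun x => (Im (f x))%:E).

Definition Cint D f : R[i] :=
  (\int[mu]_(x in D) Re (f x)) +i* (\int[mu]_(x in D) Im (f x)).

Definition L2c f :=
  (fun x => Re (f x)) \in Lfun mu 2%:E /\ (fun x => Im (f x)) \in Lfun mu 2%:E.

Definition L2dist2 f g : \bar R :=
  (\int[mu]_x ((normc (f x - g x)) ^+ 2)%:E)%E.

End complex_integration.

Section random_variables.
Context d (Omega : measurableType d) (R : realType) (P : probability Omega R).

Definition Cexpectation (U : Omega -> R[i]) : R[i] := Cint P setT U.

Definition Cmoment (U V : Omega -> R[i]) : R[i] :=
  Cexpectation (fun w => U w * conjc (V w)).

End random_variables.

Section schwartz_and_tempered.
Context {R : realType}.
Implicit Types (phi f : R -> R[i]) (T : (R -> R[i]) -> R[i]).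

Definition Cderive (k : nat) f : R -> R[i] := fun t =>
  (derive1n k (fun x => Re (f x)) t) +i* (derive1n k (fun x => Im (f x)) t).

Definition Csmooth f := forall (k : nat) (t : R),
  derivable (derive1n k (fun x => Re (f x))) t 1 /\
  derivable (derive1n k (fun x => Im (f x))) t 1.

Definition schwartz phi := Csmooth phi /\
  forall j k : nat, exists M : R, forall t : R,
    `|t| ^+ j * normc (Cderive k phi t) <= M.

Definition translate (h : R) phi : R -> R[i] := fun t => phi (t - h).

Definition cis (x : R) : R[i] := cos x +i* sin x.

Definition fourier f : R -> R[i] := fun w =>
  Cint leb setT (fun t => f t * cis (- (t * w))).

(* Elements of S' are functionals of which only the values on Schwartz
   functions matter; the last clause is continuity, M being any common bound
   on the seminorms of phi of order at most N. *)
Definition tempered T :=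
  (forall (a : R[i]) phi psi, schwartz phi -> schwartz psi ->
     T (fun t => a * phi t + psi t) = a * T phi + T psi) /\
  exists (N : nat) (C : R), forall phi (M : R), schwartz phi ->
    (forall (j k : nat) (t : R), (j <= N)%N -> (k <= N)%N ->
       `|t| ^+ j * normc (Cderive k phi t) <= M) ->
    normc (T phi) <= C * M.

Definition dist_of_fun f : (R -> R[i]) -> R[i] := fun phi =>
  Cint leb setT (fun t => f t * phi t).

Definition delta (t : R) : (R -> R[i]) -> R[i] := fun phi => phi t.

Definition dist_fourier T : (R -> R[i]) -> R[i] := fun phi => T (fourier phi).

Definition is_dist_function T (h : R -> R[i]) :=
  Cmeasurable h /\
  forall phi, schwartz phi ->
    Cintegrable leb setT (fun w => h w * phi w) /\ T phi = dist_of_fun h phi.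

End schwartz_and_tempered.

(* The Hermitian nonnegative matrix-valued measure nu: sm_diag gives the
   diagonal entries as [0, +oo]-valued measures, and sm_val E is the matrix
   nu(E), meaningful only on the Borel sets E of finite mass.  With the nuclear
   norm (all matrix norms being equivalent), ||nu(E)|| is the trace of nu(E)
   and ||nu(dw)|| is the measure nu_11 + nu_22.  Absolute continuity of the
   off-diagonal entries follows from that of the diagonal by sm_ge0. *)
Definition sm_fin_set (R : realType)
    (diag : 'I_2 -> {measure set (measurableTypeR R) -> \bar R})
    (E : set (measurableTypeR R)) :=
  measurable E /\ forall i, (diag i E < +oo)%E.

Record spectral_measure (R : realType) := SpectralMeasure {
  sm_diag : 'I_2 -> {measure set (measurableTypeR R) -> \bar R} ;
  sm_val : set (measurableTypeR R) -> 'M[R[i]]_2 ;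
  sm_valE : forall E i, sm_fin_set sm_diag E ->
    sm_val E i i = (fine (sm_diag i E))%:C ;
  sm_hermitian : forall E i j, sm_fin_set sm_diag E ->
    sm_val E j i = conjc (sm_val E i j) ;
  sm_ge0 : forall E (u : 'I_2 -> R[i]), sm_fin_set sm_diag E ->
    0 <= \sum_i \sum_j u i * sm_val E i j * conjc (u j) ;
  sm_sigma_additive : forall (E : nat -> set (measurableTypeR R)) i j,
    (forall n, measurable (E n)) -> trivIset setT E ->
    sm_fin_set sm_diag (\bigcup_n E n) ->
    (fun n => \sum_(k < n) Re (sm_val (E k) i j)) @ \oo
      --> Re (sm_val (\bigcup_n E n) i j) /\
    (fun n => \sum_(k < n) Im (sm_val (E k) i j)) @ \oo
      --> Im (sm_val (\bigcup_n E n) i j) ;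
  sm_abs_cont : forall E i, measurable E -> leb E = 0%E ->
    sm_diag i E = 0%E ;
  sm_growth : exists p : R, forall i,
    (\int[sm_diag i]_w ((1 + w ^+ 2) `^ (- p))%:E < +oo)%E
}.

Section stationary_operator.
Context {R : realType} {d : measure_display} {Omega : measurableType d}.
Variables (P : probability Omega R) (nu : spectral_measure R).
Variable Z : 'I_2 -> set (measurableTypeR R) -> Omega -> R[i].

Definition random_measure :=
  (forall E i, sm_fin_set (sm_diag nu) E -> L2c P (Z i E)) /\
  (forall E1 E2 i j,
     sm_fin_set (sm_diag nu) E1 -> sm_fin_set (sm_diag nu) E2 ->
     Cmoment P (Z i E1) (Z j E2) = sm_val nu (E1 `&` E2) i j).

Definition simple_fun (s : seq (R[i] * set (measurableTypeR R))) : R -> R[i] :=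
  fun w => \sum_(p <- s) p.1 * (\1_(p.2) w)%:C.

Definition simple_int i (s : seq (R[i] * set (measurableTypeR R))) :
    Omega -> R[i] := fun w => \sum_(p <- s) p.1 * Z i p.2 w.

(* Y is a version of the L^2 integral of h with respect to Z_i; Y is unique up
   to P-almost sure equality. *)
Definition is_stoch_int i (h : R -> R[i]) (Y : Omega -> R[i]) :=
  L2c P Y /\
  exists s : nat -> seq (R[i] * set (measurableTypeR R)),
    [/\ forall n p, p \in s n -> sm_fin_set (sm_diag nu) p.2,
        L2dist2 (sm_diag nu i) (simple_fun (s n)) h @[n --> \oo] --> 0%E &
        L2dist2 P (simple_int i (s n)) Y @[n --> \oo] --> 0%E].

Definition stoch_int i (h : R -> R[i]) : Omega -> R[i] :=
  xget (fun=> 0) [set Y | is_stoch_int i h Y].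

(* h is a function representing F[g] and lying in L^2(nu_ii); it is unique up
   to Lebesgue-null sets, hence up to nu_ii-null sets. *)
Definition is_symbol i (g : (R -> R[i]) -> R[i]) (h : R -> R[i]) :=
  is_dist_function (dist_fourier g) h /\ L2c (sm_diag nu i) h.

Definition stat_dom i (g : (R -> R[i]) -> R[i]) :=
  tempered g /\ exists h, is_symbol i g h.

(* The pairing of the i-th component of the operator with g in S'. *)
Definition stat_op i (g : (R -> R[i]) -> R[i]) : Omega -> R[i] :=
  stoch_int i (xget (fun=> 0) [set h | is_symbol i g h]).

Definition stat_op_real := forall i (phi : R -> R[i]),
  schwartz phi -> (forall t, Im (phi t) = 0) ->
  {ae P, forall w, Im (stat_op i (dist_of_fun phi) w) = 0}.

End stationary_operator.

Section kernel.
Context {R : realType}.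
Implicit Types (K : R -> \bar R) (f g : R -> R).

Definition completely_monotone f := forall (n : nat) (t : R), 0 < t ->
  derivable (derive1n n f) t 1 /\ 0 <= (-1) ^+ n * derive1n n f t.

Definition equiv_pinfty f g := exists2 c : R, 0 < c &
  (f t / g t) @[t --> +oo] --> c.

Definition kernel_function K :=
  K 0 != -oo%E /\ forall t, t != 0 -> K t \is a fin_num.

(* fine only alters K at the origin, where K may be infinite. *)
Definition Kcos_trunc K (w T : R) : R :=
  \int[leb]_(t in `[0, T]) (fine (K t) * cos (w * t)).

Definition Kcos K (w : R) : R := lim (Kcos_trunc K w T @[T --> +oo]).

Definition kernel_I K :=
  [/\ locally_integrable setT (fun t => fine (K t)),
      (forall t, K (- t) = K t) /\ (forall t, t != 0 -> (0 < K t)%E),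
      K t @[t --> +oo] --> 0%E,
      exists t0 : R, forall s t, t0 <= s -> s <= t -> (K t <= K s)%E &
      forall w, w != 0 -> cvg (Kcos_trunc K w T @[T --> +oo]) /\ 0 < Kcos K w].

Definition kernel_II K :=
  [\/ (@leb R).-integrable setT K,
      equiv_pinfty (fun t => fine (K t)) (fun t => t^-1) |
      exists2 alpha : R, 0 < alpha < 1 &
        equiv_pinfty (fun t => fine (K t)) (fun t => t `^ (- alpha))].

Definition kernel_III K :=
  completely_monotone (fun t => fine (K t)) \/
  exists2 phi : R -> R, completely_monotone phi &
    forall t, t != 0 -> K t = (phi (t ^+ 2))%:E.

End kernel.

Section noise.
Context {R : realType} {d : measure_display} {Omega : measurableType d}.
Variable P : probability Omega R.
Implicit Types F W : (R -> R[i]) -> Omega -> R[i].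

Definition stationary_random_distribution F :=
  [/\ forall phi, schwartz phi -> L2c P (F phi),
      forall (a : R[i]) phi psi, schwartz phi -> schwartz psi ->
        {ae P, forall w, F (fun t => a * phi t + psi t) w
                         = a * F phi w + F psi w},
      forall h phi, schwartz phi ->
        Cexpectation P (F (translate h phi)) = Cexpectation P (F phi) &
      forall h phi psi, schwartz phi -> schwartz psi ->
        Cmoment P (F (translate h phi)) (F (translate h psi))
        = Cmoment P (F phi) (F psi)].

Definition has_spectral_density F (rho : R -> R) :=
  forall phi1 phi2, schwartz phi1 -> schwartz phi2 ->
    Cmoment P (F phi1) (F phi2) = ((2 * pi)^-1)%:C *
      Cint leb setT
        (fun w => (rho w)%:C * fourier phi1 w * conjc (fourier phi2 w)).

Definition noise_pair (K : R -> \bar R) F W :=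
  [/\ stationary_random_distribution F, stationary_random_distribution W,
      has_spectral_density W (fun=> 1),
      has_spectral_density F (fun w => 2 * Kcos K w) &
      forall phi1 phi2, schwartz phi1 -> schwartz phi2 ->
        Cmoment P (W phi1) (F phi2) = 0].

End noise.

Section langevin.
Context {R : realType} {d : measure_display} {Omega : measurableType d}.
Variable P : probability Omega R.
Variables m lambda beta gamma kBT : R.
Variable K : R -> \bar R.

Definition Psi (phi : R -> R[i]) : R -> R[i] := fun t =>
  - m%:C * Cderive 1 phi t + lambda%:C * phi t
  + beta%:C * Cint leb `[0, +oo[ (fun s => (fine (K s))%:C * phi (t + s)).

Definition weak_stationary_solution (F W : (R -> R[i]) -> Omega -> R[i])
    (nu : spectral_measure R)
    (Z : 'I_2 -> set (measurableTypeR R) -> Omega -> R[i]) :=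
  let X f := stat_op P nu Z 0 (dist_of_fun f) in
  let V f := stat_op P nu Z 1 (dist_of_fun f) in
  let dX phi := X (fun t => - Cderive 1 phi t) in
  let force phi w := V (Psi phi) w + X (fun t => gamma%:C * phi t) w in
  [/\ forall phi, schwartz phi ->
        stat_dom nu 1 (dist_of_fun (Psi phi)) /\ L2c P (V (Psi phi)),
      forall phi1 phi2, schwartz phi1 -> schwartz phi2 ->
        Cmoment P (dX phi1) (dX phi2) = Cmoment P (V phi1) (V phi2) /\
        Cmoment P (V phi1) (V phi2) = Cmoment P (dX phi1) (V phi2) &
      forall phi1 phi2, schwartz phi1 -> schwartz phi2 ->
        Cmoment P (force phi1) (force phi2) =
        kBT%:C * (beta%:C * Cmoment P (F phi1) (F phi2)
                  + 2 * lambda%:C * Cmoment P (W phi1) (W phi2))].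

End langevin.

(* Main.v *)
Require Import Defs.
From HB Require Import structures.
From mathcomp Require Import all_boot all_order all_algebra complex.
From mathcomp Require Import all_classical all_reals all_analysis.
From mathcomp Require Import measurable_realfun interval_inference.
From mathcomp Require Import ring lra.

(** Both energies are total masses of spectral measures: [x(0)] pairs the operator
    with a point mass, whose symbol is a pure phase, so that [E |x(0)|^2] and
    [E |v(0)|^2] are [nu_11 (R)] and [nu_22 (R)] once these are known to be finite,
    and squares equal squared moduli because the operator is real
    ([norm2_delta], [stat_op_delta_real], [Cexpectation_sqr_delta]).

    On the Fourier side the equations of motion are algebraic. The relation
    [dot x = v] gives [nu_22 = w^2 nu_11] ([spectral_velocity]). Write
    [H(w) = - i m w + lambda + beta (int_0^oo K(s) e^{i s w} ds) + i gamma / w] for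
    the impedance of the system. The force balance says that [w^2 |H|^2 nu_11] is
    the spectrum of the noise, and the latter has density [(kBT / pi) Re H], by the
    fluctuation-dissipation relation between memory kernel and noise
    ([norm2_force], [norm2_force_noise], [spectral_position]). Hence [nu_22] has
    density [(kBT / pi) Re (1 / H)] and [nu_11] the same density divided by [w^2].

    The two masses are then contour integrals. The function [1 / H] is analytic in
    the upper half plane, since [Re H >= lambda] there: the damped cosine
    transforms of [K] are Poisson means of the positive transform of [K], hence
    positive ([laplace_kernel_ge0]). An analytic function that behaves like
    [i c / z] at infinity has boundary values of total real mass [pi c]
    ([boundary_integral]). For [1 / H] one finds [c = 1 / m], and for
    [i / (gamma z) + 1 / (z^2 H)], which has the real part of [1 / (z^2 H)] on the
    axis and no pole at the origin, [c = 1 / gamma] ([int_conductance],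
    [int_conductance_div_sqr]). This gives [nu_22 (R) = kBT / m] and
    [nu_11 (R) = kBT / gamma] ([velocity_mass], [position_mass]).

    Monotonicity of the kernel and its decay enter through the conditionally
    convergent transform: oscillatory integrals are bounded at frequency [w] by the
    mass of the kernel up to time [1 / |w|], whose singularity at [w = 0] is
    integrable and weaker than [1 / |w|] ([damped_bound], [kbound_mulr]). The
    passage to the Fourier side rests on three facts: the stochastic integral exists
    and is isometric on all of [L^2(nu_ii)] ([is_stoch_int_total],
    [stoch_int_norm2]); averages over modulated Gaussians determine measures and
    distributions, so symbols are unique ([gauss_norm2_unique],
    [dist_function_unique]); and the memory term is a limit of superpositions of
    translations, which act by phases ([is_symbol_Psi]). *)

Set Implicit Arguments.
Unset Strict Implicit.
Unset Printing Implicit Defensive.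

Import Order.TTheory GRing.Theory Num.Theory.
Import numFieldNormedType.Exports.

Local Open Scope classical_set_scope.
Local Open Scope ring_scope.
Local Open Scope complex_scope.

Local Notation Re := complex.Re.
Local Notation Im := complex.Im.

(** * Integrals, complex numbers and derivatives *)

Section integral_tools.
Context d (T : measurableType d) (R : realType).
Variable mu : {measure set T -> \bar R}.
Implicit Types (D : set T) (f g : T -> R).

Lemma integrable_dominated D f g : measurable D -> measurable_fun D f ->
  mu.-integrable D (EFin \o g) -> (forall x, D x -> `|f x| <= g x) ->
  mu.-integrable D (EFin \o f).
Proof.
move=> mD mf ig fg; apply: le_integrable ig => //; first exact/measurable_EFinP.
by move=> x Dx; rewrite /= lee_fin (le_trans (fg _ Dx))// ler_norm.
Qed.

Lemma Rdominated_convergence_ae D (f_ : nat -> T -> R) f g : measurable D ->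
  (forall n, measurable_fun D (f_ n)) -> measurable_fun D f ->
  {ae mu, forall x, D x -> f_ ^~ x @ \oo --> f x} ->
  mu.-integrable D (EFin \o g) ->
  {ae mu, forall x n, D x -> `|f_ n x| <= g x} ->
  mu.-integrable D (EFin \o f) /\
  (\int[mu]_(x in D) f_ n x) @[n --> \oo] --> \int[mu]_(x in D) f x.
Proof.
move=> mD mf_ mf f_f ig fg.
have [] := @dominated_convergence _ _ _ mu D mD (fun n x => (f_ n x)%:E)
  (EFin \o f) (EFin \o g).
- by move=> n; exact/measurable_EFinP.
- exact/measurable_EFinP.
- by apply: filterS f_f => x h Dx; apply: cvg_EFin; [exact: nearW|exact: h].
- exact: ig.
- by apply: filterS fg => x h n Dx; rewrite /= lee_fin; exact: h.
move=> intf _ cvf; split => //.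
rewrite /Rintegral.
apply: fine_cvg; rewrite fineK//; first exact: (integrable_fin_num mD intf).
Qed.

Lemma Rdominated_convergence D (f_ : nat -> T -> R) f g : measurable D ->
  (forall n, measurable_fun D (f_ n)) -> measurable_fun D f ->
  {ae mu, forall x, D x -> f_ ^~ x @ \oo --> f x} ->
  mu.-integrable D (EFin \o g) ->
  (forall n x, D x -> `|f_ n x| <= g x) ->
  mu.-integrable D (EFin \o f) /\
  (\int[mu]_(x in D) f_ n x) @[n --> \oo] --> \int[mu]_(x in D) f x.
Proof.
move=> mD mf_ mf f_f ig fg; apply: (@Rdominated_convergence_ae _ _ _ g) => //.
by apply: aeW => x n; exact: fg.
Qed.

Lemma Rdominated_convergenceT (f_ : nat -> T -> R) f g :
  (forall n, measurable_fun setT (f_ n)) -> measurable_fun setT f ->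
  (forall x, f_ ^~ x @ \oo --> f x) ->
  mu.-integrable setT (EFin \o g) ->
  (forall n x, `|f_ n x| <= g x) ->
  mu.-integrable setT (EFin \o f) /\
  (\int[mu]_x f_ n x) @[n --> \oo] --> \int[mu]_x f x.
Proof.
move=> mf_ mf f_f ig fg; apply: (@Rdominated_convergence _ _ _ g) => //.
by apply: aeW => x _; exact: f_f.
Qed.

Lemma RintegralN D f : measurable D -> mu.-integrable D (EFin \o f) ->
  \int[mu]_(x in D) (- f x) = - \int[mu]_(x in D) f x.
Proof.
move=> mD intf; rewrite -mulN1r -RintegralZl//.
by apply: eq_Rintegral => x _; rewrite mulN1r.
Qed.

Lemma intD D f g : measurable D -> mu.-integrable D (EFin \o f) ->
  mu.-integrable D (EFin \o g) ->
  mu.-integrable D (EFin \o (fun x => f x + g x)).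
Proof. by move=> mD hf hg; exact: (integrableD mD hf hg). Qed.

Lemma intB D f g : measurable D -> mu.-integrable D (EFin \o f) ->
  mu.-integrable D (EFin \o g) ->
  mu.-integrable D (EFin \o (fun x => f x - g x)).
Proof. by move=> mD hf hg; exact: (integrableB mD hf hg). Qed.

Lemma intZ D (c : R) f : measurable D -> mu.-integrable D (EFin \o f) ->
  mu.-integrable D (EFin \o (fun x => c * f x)).
Proof. by move=> mD hf; exact: (integrableZl mD c hf). Qed.

Lemma int_measurable D f : measurable D -> mu.-integrable D (EFin \o f) ->
  measurable_fun D f.
Proof. by move=> mD /integrableP[/measurable_EFinP]. Qed.

End integral_tools.

Section complex_basics.
Context {R : realType}.
Implicit Types (z w : R[i]) (a : R).

Lemma ReDE z w : Re (z + w) = Re z + Re w.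
Proof. by case: z; case: w. Qed.

Lemma ImDE z w : Im (z + w) = Im z + Im w.
Proof. by case: z; case: w. Qed.

Lemma ReNE z : Re (- z) = - Re z.
Proof. by case: z. Qed.

Lemma ImNE z : Im (- z) = - Im z.
Proof. by case: z. Qed.

Lemma ReME z w : Re (z * w) = Re z * Re w - Im z * Im w.
Proof. by case: z; case: w. Qed.

Lemma ImME z w : Im (z * w) = Re z * Im w + Im z * Re w.
Proof. by case: z; case: w. Qed.

Lemma ReVE z : Re z^-1 = Re z / (Re z ^+ 2 + Im z ^+ 2).
Proof. by case: z. Qed.

Lemma ImVE z : Im z^-1 = - Im z / (Re z ^+ 2 + Im z ^+ 2).
Proof. by case: z => a b; rewrite mulNr. Qed.

Lemma ReCE a : Re a%:C = a. Proof. by []. Qed.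

Lemma ImCE a : Im a%:C = 0. Proof. by []. Qed.

Lemma ReJE z : Re (conjc z) = Re z. Proof. by case: z. Qed.

Lemma ImJE z : Im (conjc z) = - Im z. Proof. by case: z. Qed.

Lemma RePE a b : Re (a +i* b) = a. Proof. by []. Qed.

Lemma ImPE a b : Im (a +i* b) = b. Proof. by []. Qed.

(** Rewriting with this collection reduces an identity between complex numbers
    to two real ones. *)
Definition complexE' := (RePE, ImPE, ReDE, ImDE, ReNE, ImNE, ReME, ImME, ReCE, ImCE,
  ReJE, ImJE).

Lemma complex_eqP z w : Re z = Re w -> Im z = Im w -> z = w.
Proof. by case: z => ? ?; case: w => ? ? /= -> ->. Qed.

Lemma normc_sqr z : normc z ^+ 2 = Re z ^+ 2 + Im z ^+ 2.
Proof.
by case: z => a b /=; rewrite sqr_sqrtr// addr_ge0// sqr_ge0.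
Qed.

Lemma normc_ge0 z : 0 <= normc z.
Proof. by case: z => a b /=; rewrite sqrtr_ge0. Qed.

Lemma normc_le_sqr z a : 0 <= a -> Re z ^+ 2 + Im z ^+ 2 <= a ^+ 2 ->
  normc z <= a.
Proof.
by move=> a0; rewrite -normc_sqr ler_pXn2r// nnegrE normc_ge0.
Qed.

Lemma Re_le_normc z : `|Re z| <= normc z.
Proof.
rewrite -(@ler_pXn2r _ 2)// ?nnegrE ?normc_ge0// normc_sqr real_normK ?num_real//.
by rewrite lerDl sqr_ge0.
Qed.

Lemma Im_le_normc z : `|Im z| <= normc z.
Proof.
rewrite -(@ler_pXn2r _ 2)// ?nnegrE ?normc_ge0// normc_sqr real_normK ?num_real//.
by rewrite lerDr sqr_ge0.
Qed.

Lemma normc_le_ReIm z : normc z <= `|Re z| + `|Im z|.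
Proof.
apply: normc_le_sqr; first exact: addr_ge0.
rewrite sqrrD !real_normK ?num_real//.
by have := mulr_ge0 (normr_ge0 (Re z)) (normr_ge0 (Im z)); lra.
Qed.

Lemma normcD_le z w : normc (z + w) <= normc z + normc w.
Proof. exact: le_normcD. Qed.

Lemma normcB_le z w : normc (z - w) <= normc z + normc w.
Proof. by rewrite (le_trans (le_normcD _ _))// normcN. Qed.

Lemma normcC a : normc a%:C = `|a|.
Proof. by rewrite /= expr0n addr0 sqrtr_sqr. Qed.

Lemma normc_gt0 z : z != 0 -> 0 < normc z.
Proof.
move=> z0; rewrite lt_neqAle normc_ge0 andbT eq_sym.
by apply: contra z0 => /eqP /ComplexField.Normc.eq0_normc ->.
Qed.

Lemma normc_cis a : normc (cis a) = 1.
Proof. by rewrite /= cos2Dsin2 sqrtr1. Qed.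

Lemma cisD a b : cis (a + b) = cis a * cis b.
Proof.
by apply: complex_eqP; rewrite !complexE' /= ?cosD ?sinD//; ring.
Qed.

End complex_basics.

Section pointwise_derivatives.
Context {R : realType}.
Implicit Types (f g : R -> R) (x : R).

Lemma der_cst (c x : R) : is_derive x 1 (fun _ : R => c) 0.
Proof. exact: is_derive_cst. Qed.

Lemma der_id (x : R) : is_derive x 1 (fun s : R => s) 1.
Proof. exact: is_derive_id. Qed.

Lemma derD f g x df dg : is_derive x 1 f df -> is_derive x 1 g dg ->
  is_derive x 1 (fun s => f s + g s) (df + dg).
Proof. by move=> hf hg; exact: (@is_deriveD _ _ _ f g). Qed.

Lemma derN f x df : is_derive x 1 f df ->
  is_derive x 1 (fun s => - f s) (- df).
Proof. by move=> hf; exact: (@is_deriveN _ _ _ f). Qed.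

Lemma derB f g x df dg : is_derive x 1 f df -> is_derive x 1 g dg ->
  is_derive x 1 (fun s => f s - g s) (df - dg).
Proof. by move=> hf hg; exact: (@is_deriveB _ _ _ f g). Qed.

Lemma derM f g x df dg : is_derive x 1 f df -> is_derive x 1 g dg ->
  is_derive x 1 (fun s => f s * g s) (df * g x + f x * dg).
Proof.
move=> hf hg; have := @is_deriveM _ _ f g x 1 df dg hf hg.
by rewrite /GRing.scale/= addrC (mulrC (g x)).
Qed.

Lemma derZ (c : R) f x df : is_derive x 1 f df ->
  is_derive x 1 (fun s => c * f s) (c * df).
Proof. by move=> hf; exact: (@is_deriveZ _ _ _ f). Qed.

Lemma derV f x df : f x != 0 -> is_derive x 1 f df ->
  is_derive x 1 (fun s => (f s)^-1) (- df / f x ^+ 2).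
Proof.
move=> f0 hf; have := is_deriveV f0 hf.
by rewrite /GRing.scale/= mulrC mulrN mulNr.
Qed.

Lemma der_comp f g x df dg : is_derive (g x) 1 f df -> is_derive x 1 g dg ->
  is_derive x 1 (fun s => f (g s)) (df * dg).
Proof. by move=> hf hg; exact: (@is_derive1_comp _ f g). Qed.

Lemma derX n f x df : is_derive x 1 f df ->
  is_derive x 1 (fun s => f s ^+ n) (n%:R * f x ^+ n.-1 * df).
Proof.
move=> hf; have := @is_deriveX _ _ f n x 1 df hf.
rewrite /GRing.scale/=.
suff -> : f ^+ n = (fun s => f s ^+ n) by [].
by apply/funext => s; elim: n => [|n ih]; rewrite ?expr0// !exprS -ih.
Qed.

Lemma der_expR f x df : is_derive x 1 f df ->
  is_derive x 1 (fun s => expR (f s)) (df * expR (f x)).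
Proof. by rewrite mulrC => hf; apply: der_comp hf; exact: is_derive_expR. Qed.

Lemma der_cos f x df : is_derive x 1 f df ->
  is_derive x 1 (fun s => cos (f s)) (- df * sin (f x)).
Proof.
move=> hf; rewrite mulNr -mulrN mulrC.
by apply: (der_comp _ hf); exact: is_derive_cos.
Qed.

Lemma der_sin f x df : is_derive x 1 f df ->
  is_derive x 1 (fun s => sin (f s)) (df * cos (f x)).
Proof.
by rewrite mulrC => hf; apply: (der_comp _ hf); exact: is_derive_sin.
Qed.

Lemma der_eq f x df df' : is_derive x 1 f df -> df = df' -> is_derive x 1 f df'.
Proof. by move=> + <-. Qed.

Lemma der_cvg f x df : is_derive x 1 f df -> {for x, continuous f}.
Proof.
by move=> [d _]; apply/differentiable_continuous/derivable1_diffP.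
Qed.

Lemma der_derive1 f x df : is_derive x 1 f df -> derive1 f x = df.
Proof. by move=> [_ h]; rewrite derive1E. Qed.

End pointwise_derivatives.

Section calculus.
Context {R : realType}.
Local Notation mu := (@lebesgue_measure R).

Lemma der_under_integral d (T : measurableType d) (nu : {measure set T -> \bar R})
    (D : set T) (f f' : R -> T -> R) (G : T -> R) (a u v : R) :
  measurable D -> u < a < v ->
  (forall x, u < x < v -> nu.-integrable D (EFin \o f x)) ->
  (forall x t, u < x < v -> D t -> is_derive x 1 (f ^~ t) (f' x t)) ->
  (forall t, 0 <= G t) -> nu.-integrable D (EFin \o G) ->
  (forall x t, u < x < v -> D t -> `|f' x t| <= G t) ->
  is_derive a 1 (fun x => \int[nu]_(t in D) f x t) (\int[nu]_(t in D) f' a t).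
Proof.
move=> mD auv intf derf G0 intG fG.
have Iauv : `]u, v[%classic a by rewrite /= in_itv.
have h1 x : `]u, v[%classic x -> nu.-integrable D (EFin \o f x).
  by rewrite /= in_itv/= => xuv; exact: intf.
have h2 x t : `]u, v[%classic x -> D t -> derivable (f ^~ t) x 1.
  by rewrite /= in_itv/= => xuv Dt; have [] := derf x t xuv Dt.
have h3 x t : `]u, v[%classic x -> D t -> `|partial1of2 f x t| <= G t.
  rewrite /= in_itv/= => xuv Dt; rewrite partial1of2E.
  by have [_ ->] := derf x t xuv Dt; exact: fG.
have h4 := derivable_under_integral mD Iauv h1 h2 G0 intG h3.
have h5 := differentiation_under_integral mD Iauv h1 h2 G0 intG h3.
apply: DeriveDef => //; rewrite -derive1E h5.
apply: eq_Rintegral => t /[!inE] Dt; rewrite partial1of2E.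
by have [_ ->] := derf a t auv Dt.
Qed.

Lemma is_derive_within_continuous (F f : R -> R) (a b : R) :
  (forall x, a <= x <= b -> is_derive x 1 F (f x)) ->
  {within `[a, b], continuous F}.
Proof.
move=> dF; apply: continuous_in_subspaceT => x /[!inE]/=.
by rewrite in_itv/= => /dF; exact: der_cvg.
Qed.

Lemma RFTC2 (F f : R -> R) (a b : R) : a <= b ->
  (forall x, a <= x <= b -> is_derive x 1 F (f x)) ->
  {within `[a, b], continuous f} ->
  \int[mu]_(x in `[a, b]) f x = F b - F a.
Proof.
rewrite le_eqVlt => /predU1P[-> _ _|ab dF cf].
  by rewrite set_itv1 Rintegral_set1 subrr.
have cF x : a <= x <= b -> {for x, continuous F} by move=> /dF; exact: der_cvg.
rewrite /Rintegral (@continuous_FTC2 _ f F)//.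
- split.
  + move=> x; rewrite in_itv/= => /andP[ax xb].
    by have [] := dF x; rewrite ?(ltW ax) ?(ltW xb).
  + by apply: cvg_at_right_filter; apply: cF; rewrite lexx ltW.
  + by apply: cvg_at_left_filter; apply: cF; rewrite lexx ltW.
- move=> x; rewrite in_itv/= => /andP[ax xb].
  by apply: der_derive1; apply: dF; rewrite !ltW.
Qed.

Lemma continuous_integrable_itv (f : R -> R) (a b : R) :
  {within `[a, b], continuous f} -> mu.-integrable `[a, b] (EFin \o f).
Proof.
by move=> cf; apply: continuous_compact_integrable => //; exact: segment_compact.
Qed.

Lemma integrable_cst_itv (c a b : R) : mu.-integrable `[a, b] (EFin \o cst c).
Proof. exact/continuous_integrable_itv/continuous_subspaceT/cst_continuous. Qed.

Lemma measurable_continuous (f : R -> R) : continuous f ->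
  measurable_fun (setT : set (measurableTypeR R)) f.
Proof. exact: continuous_measurable_fun. Qed.

Lemma cvg_invn : (fun n : nat => n%:R^-1 : R) @ \oo --> 0.
Proof. by rewrite -(cvg_shiftS (fun n : nat => n%:R^-1 : R)); exact: cvg_harmonic. Qed.

Lemma cvg_dist_le (N : nat) (u v : nat -> R) (l : R) :
  (forall n, (N <= n)%N -> `|u n - l| <= v n) -> v @ \oo --> 0 -> u @ \oo --> l.
Proof.
move=> uv v0; apply/cvgrPdist_le => e e0.
have /cvgrPdist_le/(_ e e0) h := v0.
near=> n; rewrite distrC (le_trans (uv n _))//.
  by near: n; exists N.
have : `|0 - v n| <= e by near: n.
by rewrite sub0r normrN => /(le_trans (ler_norm _)).
Unshelve. all: by end_near. Qed.

Lemma cvgseq_eq (u v : nat -> R) (l : R) : u =1 v -> u @ \oo --> l -> v @ \oo --> l.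
Proof. by move=> /funext ->. Qed.

Lemma cvgseqD (u v : nat -> R) (a b : R) : u @ \oo --> a -> v @ \oo --> b ->
  (fun n => u n + v n) @ \oo --> a + b.
Proof. exact: cvgD. Qed.

Lemma cvgseqB (u v : nat -> R) (a b : R) : u @ \oo --> a -> v @ \oo --> b ->
  (fun n => u n - v n) @ \oo --> a - b.
Proof. exact: cvgB. Qed.

Lemma cvgseqN (u : nat -> R) (a : R) : u @ \oo --> a ->
  (fun n => - u n) @ \oo --> - a.
Proof. exact: cvgN. Qed.

Lemma cvgseqM (u v : nat -> R) (a b : R) : u @ \oo --> a -> v @ \oo --> b ->
  (fun n => u n * v n) @ \oo --> a * b.
Proof. exact: cvgM. Qed.

Lemma cvgseqZ (c : R) (u : nat -> R) (a : R) : u @ \oo --> a ->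
  (fun n => c * u n) @ \oo --> c * a.
Proof. by apply: cvgseqM; exact: cvg_cst. Qed.

Lemma cvgseqV (u : nat -> R) (a : R) : a != 0 -> u @ \oo --> a ->
  (fun n => (u n)^-1) @ \oo --> a^-1.
Proof. by move=> a0; exact: cvgV. Qed.

Lemma cvgseq_continuous (h : R -> R) (u : nat -> R) (a : R) :
  {for a, continuous h} -> u @ \oo --> a -> (fun n => h (u n)) @ \oo --> h a.
Proof. by move=> ch ua; exact: (continuous_cvg _ ch ua). Qed.

Lemma cvgseq_norm_le (u : nat -> R) (l B : R) : u @ \oo --> l ->
  (forall n, `|u n| <= B) -> `|l| <= B.
Proof.
move=> ul uB; have cv : (fun n => `|u n|) @ \oo --> `|l| by exact: cvg_norm.
rewrite -(cvg_lim _ cv)//; apply: limr_le; last exact: nearW.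
by apply/cvg_ex; eexists; exact: cv.
Qed.

Lemma cvgseq_le (u : nat -> R) (l B : R) : u @ \oo --> l ->
  (forall n, u n <= B) -> l <= B.
Proof.
move=> cv uB.
rewrite -(cvg_lim _ cv)//; apply: limr_le; last exact: nearW.
by apply/cvg_ex; eexists; exact: cv.
Qed.

Lemma cvgseq_near_cst (N : nat) (u : nat -> R) (l : R) :
  (forall n, (N <= n)%N -> u n = l) -> u @ \oo --> l.
Proof. by move=> ul; apply: cvg_near_cst; exists N => // n /= /ul ->. Qed.

(** Boundary values are singular at the zero frequency only. *)
Lemma ae_except (a : R) (Q : R -> Prop) : (forall x, x != a -> Q x) ->
  {ae mu, forall x, Q x}.
Proof.
move=> h; exists [set a]; split => //; first exact: lebesgue_measure_set1.
by move=> x /= /contra_notP; apply => /eqP; exact: h.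
Qed.

Lemma le_Rintegral_cst (f : R -> R) (a b c : R) : a <= b ->
  mu.-integrable `[a, b] (EFin \o f) -> (forall x, a <= x <= b -> f x <= c) ->
  \int[mu]_(x in `[a, b]) f x <= c * (b - a).
Proof.
move=> ab intf fc.
rewrite (_ : c * (b - a) = \int[mu]_(x in `[a, b]) c); last first.
  rewrite Rintegral_cst//= lebesgue_measure_itv/= lte_fin.
  case: ifPn => //= nab; have -> : b = a by apply/eqP; rewrite eq_le ab andbT leNgt.
  by rewrite subrr.
apply: le_Rintegral => //; first exact: integrable_cst_itv. 
Qed.

End calculus.

Section fubini_product_kernel.
Context d1 d2 (T1 : measurableType d1) (T2 : measurableType d2) (R : realType).
Variable m1 : {sigma_finite_measure set T1 -> \bar R}.
Variable m2 : {sigma_finite_measure set T2 -> \bar R}.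

(** The product of the two weights dominates the integrand, which gives joint
    integrability at once. *)
Lemma Rfubini (A : T1 -> R) (B : T2 -> R) (c : T1 -> T2 -> R) (M : R) :
  0 <= M -> m1.-integrable setT (EFin \o A) -> m2.-integrable setT (EFin \o B) ->
  measurable_fun setT (fun z : T1 * T2 => c z.1 z.2) ->
  (forall x y, `|c x y| <= M) ->
  \int[m1]_x (A x * \int[m2]_y (B y * c x y)) =
  \int[m2]_y (B y * \int[m1]_x (A x * c x y)).
Proof.
move=> M0 iA iB mc cM.
have mA := int_measurable measurableT iA.
have mB := int_measurable measurableT iB.
have mc1 x : measurable_fun setT (fun y => c x y).
  exact: (measurableT_comp mc (measurable_pair1 x)).
have mc2 y : measurable_fun setT (fun x => c x y).
  exact: (measurableT_comp mc (measurable_pair2 y)).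
have i1 x : m2.-integrable setT (EFin \o (fun y => B y * c x y)).
  apply: (@integrable_dominated _ _ _ m2 setT _ (fun y => M * `|B y|)) => //.
  - exact: measurable_funM.
  - by apply: intZ => //; exact: integrable_norm.
  - by move=> y _; rewrite normrM mulrC ler_wpM2r.
have i2 y : m1.-integrable setT (EFin \o (fun x => A x * c x y)).
  apply: (@integrable_dominated _ _ _ m1 setT _ (fun x => M * `|A x|)) => //.
  - exact: measurable_funM.
  - by apply: intZ => //; exact: integrable_norm.
  - by move=> x _; rewrite normrM mulrC ler_wpM2r.
pose f (z : T1 * T2) : \bar R := (A z.1 * (B z.2 * c z.1 z.2))%:E.
have mf : measurable_fun setT f.
  apply/measurable_EFinP; apply: measurable_funM.
    exact: (measurableT_comp mA measurable_fst).
  apply: measurable_funM => //.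
  exact: (measurableT_comp mB measurable_snd).
have intf : (m1 \x m2)%E.-integrable setT f.
  apply: (@integrable12ltyP _ _ _ _ _ m1 m2 f mf).2.
  apply: (@le_lt_trans _ _ (\int[m1]_x (`|A x|%:E * (M%:E * \int[m2]_y (`|B y|)%:E)))%E).
    apply: ge0_le_integral => //.
    - by move=> x _; exact: integral_ge0.
    - apply: (measurable_fun_fubini_tonelli_F (abse \o f)) => //=.
      exact: measurableT_comp.
    - apply: emeasurable_funM => //; apply/measurable_EFinP.
      exact: measurableT_comp.
    move=> x _.
    have iBn : m2.-integrable setT (EFin \o (fun y => `|B y|)) by exact: integrable_norm.
    rewrite -integralZl// -integralZl//; last exact: (intZ M measurableT iBn).
    apply: ge0_le_integral => //.
    - apply: measurableT_comp => //.
      exact: (measurableT_comp mf (measurable_pair1 x)).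
    - apply/measurable_EFinP; apply: measurable_funM => //.
      by apply: measurable_funM => //; exact: measurableT_comp.
    - move=> y _ /=; rewrite lee_fin !normrM ler_wpM2l// mulrC ler_wpM2r//.
  have iAn : m1.-integrable setT (EFin \o (fun x => `|A x|)) by exact: integrable_norm.
  have iBn : m2.-integrable setT (EFin \o (fun y => `|B y|)) by exact: integrable_norm.
  have fB := integrable_fin_num measurableT iBn.
  rewrite -(fineK fB) -EFinM integralZr//.
  by rewrite lte_mul_pinfty ?integral_ge0// ?ltry// ?(integrable_fin_num measurableT iAn).
have := Fubini intf; rewrite /Rintegral => h.
transitivity (fine (\int[m1]_x \int[m2]_y f (x, y))%E).
  congr fine; apply: eq_integral => x _.
  rewrite EFinM /Rintegral fineK; last exact: (integrable_fin_num measurableT (i1 x)).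
  by rewrite -integralZl//; exact: i1.
rewrite h; congr fine; apply: eq_integral => y _.
rewrite EFinM /Rintegral fineK; last exact: (integrable_fin_num measurableT (i2 y)).
rewrite -integralZl//; last exact: i2.
by apply: eq_integral => x _; rewrite /f/= -EFinM mulrCA.
Qed.

End fubini_product_kernel.

(** * Boundary values of analytic functions on the upper half plane *)

Section holomorphic.
Context {R : realType}.
Implicit Types (f g : R -> R -> R[i]).

(** Analyticity in the upper half plane is encoded by the Cauchy-Riemann
    equations, [f'] being the complex derivative; all the contour arguments below
    use horizontal lines, for which this is the convenient form. *)
Definition holo f f' := forall x y : R, 0 < y ->
  [/\ is_derive x 1 (fun s => Re (f s y)) (Re (f' x y)),
      is_derive x 1 (fun s => Im (f s y)) (Im (f' x y)),
      is_derive y 1 (fun s => Re (f x s)) (- Im (f' x y)) &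
      is_derive y 1 (fun s => Im (f x s)) (Re (f' x y))].

Lemma holo_cst (c : R[i]) : holo (fun _ _ => c) (fun _ _ => 0).
Proof.
by move=> x y _; split => /=; rewrite ?oppr0; exact: is_derive_cst.
Qed.

Lemma holo_id : holo (fun x y => x +i* y) (fun _ _ => 1).
Proof.
move=> x y _; split => /=; rewrite ?oppr0.
- exact: is_derive_id.
- exact: is_derive_cst.
- exact: is_derive_cst.
- exact: is_derive_id.
Qed.

Lemma holo_eq f f' g g' : holo f f' ->
  (forall x y, 0 < y -> f x y = g x y) ->
  (forall x y, 0 < y -> f' x y = g' x y) -> holo g g'.
Proof.
move=> ff' fg fg' x y y0; have [h1 h2 h3 h4] := ff' x y y0.
rewrite -fg'//; split.
- by under eq_fun => s do rewrite -fg//.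
- by under eq_fun => s do rewrite -fg//.
- apply: (@near_eq_is_derive _ _ _ (fun s => Re (f x s))) => //.
    near=> s; rewrite fg//; near: s.
    exact: (lt_nbhsr y0).
- apply: (@near_eq_is_derive _ _ _ (fun s => Im (f x s))) => //.
    near=> s; rewrite fg//; near: s.
    exact: (lt_nbhsr y0).
Unshelve. all: by end_near. Qed.

Lemma holoD f f' g g' : holo f f' -> holo g g' ->
  holo (fun x y => f x y + g x y) (fun x y => f' x y + g' x y).
Proof.
move=> ff' gg' x y y0; have [h1 h2 h3 h4] := ff' x y y0.
have [k1 k2 k3 k4] := gg' x y y0.
split; rewrite !complexE' ?opprD.
- by under eq_fun do rewrite !complexE'; exact: derD.
- by under eq_fun do rewrite !complexE'; exact: derD.
- by under eq_fun do rewrite !complexE'; exact: derD.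
- by under eq_fun do rewrite !complexE'; exact: derD.
Qed.

Lemma holoM f f' g g' : holo f f' -> holo g g' ->
  holo (fun x y => f x y * g x y)
       (fun x y => f' x y * g x y + f x y * g' x y).
Proof.
move=> ff' gg' x y y0; have [h1 h2 h3 h4] := ff' x y y0.
have [k1 k2 k3 k4] := gg' x y y0.
split; rewrite !complexE'; under eq_fun do rewrite !complexE'.
- by apply: (der_eq (derB (derM h1 k1) (derM h2 k2))); ring.
- by apply: (der_eq (derD (derM h1 k2) (derM h2 k1))); ring.
- by apply: (der_eq (derB (derM h3 k3) (derM h4 k4))); ring.
- by apply: (der_eq (derD (derM h3 k4) (derM h4 k3))); ring.
Qed.

Lemma holoZ (c : R[i]) f f' : holo f f' ->
  holo (fun x y => c * f x y) (fun x y => c * f' x y).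
Proof.
move=> ff'; apply: (holo_eq (holoM (holo_cst c) ff')) => // x y _.
by rewrite mul0r add0r.
Qed.

Let is_derive_div (a b : R -> R) (x da db : R) : b x != 0 ->
  is_derive x 1 a da -> is_derive x 1 b db ->
  is_derive x 1 (fun s => a s / b s) ((da * b x - a x * db) / b x ^+ 2).
Proof.
by move=> b0 ha hb; apply: (der_eq (derM ha (derV b0 hb))); field.
Qed.

Lemma holoV f f' : holo f f' -> (forall x y, 0 < y -> f x y != 0) ->
  holo (fun x y => (f x y)^-1) (fun x y => - f' x y / f x y ^+ 2).
Proof.
move=> ff' f0 x y y0; have [h1 h2 h3 h4] := ff' x y y0.
have q0 : Re (f x y) ^+ 2 + Im (f x y) ^+ 2 != 0.
  by rewrite -normc_sqr expf_neq0// gt_eqF// normc_gt0// f0.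
have q1 : (Re (f x y) ^+ 2 - Im (f x y) ^+ 2) ^+ 2 +
   (Re (f x y) * Im (f x y) + Im (f x y) * Re (f x y)) ^+ 2 != 0.
  rewrite (_ : _ + _ = (Re (f x y) ^+ 2 + Im (f x y) ^+ 2) ^+ 2).
    by rewrite expf_neq0.
  ring.
have dq (t da db : R) (u : R -> R[i]) : is_derive t 1 (fun s => Re (u s)) da ->
  is_derive t 1 (fun s => Im (u s)) db ->
  is_derive t 1 (fun s => Re (u s) ^+ 2 + Im (u s) ^+ 2)
   (2 * Re (u t) * da + 2 * Im (u t) * db).
  by move=> ha hb; apply: (der_eq (derD (derX 2 ha) (derX 2 hb))); rewrite /=; ring.
split.
- under eq_fun do rewrite ReVE.
  apply: (der_eq (@is_derive_div (fun s => Re (f s y))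
    (fun s => Re (f s y) ^+ 2 + Im (f s y) ^+ 2) _ _ _ q0 h1 (dq _ _ _ (f ^~ y) h1 h2))).
  rewrite !complexE' ReVE ImVE expr2 !complexE'/=.
  by rewrite -!expr2; field; rewrite q0 q1.
- under eq_fun do rewrite ImVE.
  apply: (der_eq (@is_derive_div (fun s => - Im (f s y))
    (fun s => Re (f s y) ^+ 2 + Im (f s y) ^+ 2) _ _ _ q0 (derN h2) (dq _ _ _ (f ^~ y) h1 h2))).
  rewrite !complexE' ReVE ImVE expr2 !complexE'/=.
  by rewrite -!expr2; field; rewrite q0 q1.
- under eq_fun do rewrite ReVE.
  apply: (der_eq (@is_derive_div (fun s => Re (f x s))
    (fun s => Re (f x s) ^+ 2 + Im (f x s) ^+ 2) _ _ _ q0 h3 (dq _ _ _ (f x) h3 h4))).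
  rewrite !complexE' ReVE ImVE expr2 !complexE'/=.
  by rewrite -!expr2; field; rewrite q0 q1.
- under eq_fun do rewrite ImVE.
  apply: (der_eq (@is_derive_div (fun s => - Im (f x s))
    (fun s => Re (f x s) ^+ 2 + Im (f x s) ^+ 2) _ _ _ q0 (derN h4) (dq _ _ _ (f x) h3 h4))).
  rewrite !complexE' ReVE ImVE expr2 !complexE'/=.
  by rewrite -!expr2; field; rewrite q0 q1.
Qed.

End holomorphic.

Section contour.
Context {R : realType}.
Local Notation mu := (@lebesgue_measure R).
Variables (f f' : R -> R -> R[i]) (c C : R) (G u0 : R -> R).
Hypothesis ff' : holo f f'.
Hypothesis cf' : forall y, 0 < y -> continuous (fun x => Im (f' x y)).
Hypothesis bf' : forall e, 0 < e ->
  exists M, forall x y, e <= y -> `|Im (f' x y)| <= M.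
Hypothesis c0 : 0 <= c.
Hypothesis C0 : 0 <= C.
Hypothesis f_asym : forall x y, 0 < y -> 1 <= x ^+ 2 + y ^+ 2 ->
  normc (f x y - (c * y / (x ^+ 2 + y ^+ 2) +i* (c * x / (x ^+ 2 + y ^+ 2))))
  <= C / (x ^+ 2 + y ^+ 2).
Hypothesis intG : mu.-integrable `[-1, 1] (EFin \o G).
Hypothesis fG : forall x y, x != 0 -> 0 < y <= 1 -> `|x| <= 1 -> `|Re (f x y)| <= G x.
Hypothesis mu0 : measurable_fun (setT : set (measurableTypeR R)) u0.
Hypothesis f_u0 : forall x, x != 0 ->
  (fun n : nat => Re (f x n.+1%:R^-1)) @ \oo --> u0 x.

Let I (A y : R) : R := \int[mu]_(x in `[- A, A]) Re (f x y).

Let continuous_Ref y : 0 < y -> continuous (fun x => Re (f x y)).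
Proof. by move=> y0 x; have [h _ _ _] := ff' x y0; exact: der_cvg h. Qed.

(** By the Cauchy-Riemann equations, raising the line changes the integral only
    through the two end points. *)
Let der_I (A y : R) : 0 <= A -> 0 < y ->
  is_derive y 1 (I A) (- (Im (f A y) - Im (f (- A) y))).
Proof.
move=> A0 y0.
have [M bM] : exists M, forall x t, y / 2 <= t -> `|Im (f' x t)| <= M.
  by apply: bf'; rewrite divr_gt0.
have M0 : 0 <= M by rewrite (le_trans _ (bM 0 y _))// ler_pdivrMr//; lra.
have -> : - (Im (f A y) - Im (f (- A) y)) =
    \int[mu]_(x in `[- A, A]) (- Im (f' x y)).
  rewrite RintegralN//; last first.
    by apply: continuous_integrable_itv; apply: continuous_subspaceT; exact: cf'.
  congr (- _); apply/esym; apply: (@RFTC2 _ (fun x => Im (f x y))).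
  - by lra.
  - by move=> x _; have [] := ff' x y0.
  - by apply: continuous_subspaceT; exact: cf'.
apply: (@der_under_integral _ _ _ mu _ (fun y x => Re (f x y))
  (fun y x => - Im (f' x y)) (cst M) _ (y / 2) (y + 1)) => //.
- by apply/andP; split; lra.
- move=> t /andP[yt _]; apply: continuous_integrable_itv.
  apply: continuous_subspaceT; apply: continuous_Ref.
  by rewrite (le_lt_trans _ yt)// divr_ge0// ltW.
- move=> t x /andP[yt _] _.
  have t0 : 0 < t by rewrite (le_lt_trans _ yt)// divr_ge0// ltW.
  by have [] := ff' x t0.
- exact: integrable_cst_itv.
- by move=> t x /andP[yt _] _; rewrite normrN bM// ltW.
Qed.

Let Imf_bound (A y : R) : 1 <= `|A| -> 0 < y -> `|Im (f A y)| <= (c + C) / `|A|.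
Proof.
move=> A1 y0; have A0 : 0 < `|A| by lra.
have A2 : 0 < A ^+ 2 by rewrite -real_normK ?num_real// exprn_gt0.
have q0 : 0 < A ^+ 2 + y ^+ 2 by rewrite addr_gt0// exprn_gt0.
have q1 : 1 <= A ^+ 2 + y ^+ 2.
  rewrite (@le_trans _ _ (A ^+ 2))// ?lerDl ?sqr_ge0//.
  by rewrite -real_normK ?num_real// exprn_ege1.
have qA : A ^+ 2 <= A ^+ 2 + y ^+ 2 by rewrite lerDl sqr_ge0.
have := le_trans (Im_le_normc _) (f_asym y0 q1).
rewrite !complexE'/= => h.
have h1 : `|c * A / (A ^+ 2 + y ^+ 2)| <= c / `|A|.
  rewrite !normrM (ger0_norm c0) normfV (ger0_norm (ltW q0)) -mulrA ler_wpM2l//.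
  rewrite ler_pdivrMr// mulrC ler_pdivlMr// -expr2.
  by rewrite real_normK ?num_real.
have h2 : C / (A ^+ 2 + y ^+ 2) <= C / `|A|.
  rewrite ler_wpM2l// lef_pV2 ?posrE//.
  rewrite (le_trans _ qA)// -real_normK ?num_real// expr2.
  by rewrite ler_pMl.
rewrite mulrDl; apply: le_trans (lerD h1 (le_trans h h2)).
by rewrite [leRHS]addrC -lerBlDr -{1}[`|c * A / _|]normrN
  (le_trans (lerB_normD _ _))// ler_norm.
Qed.

Let I_lip (A e Y : R) : 1 <= A -> 0 < e <= Y ->
  `|I A Y - I A e| <= 2 * (c + C) / A * Y.
Proof.
move=> A1 /andP[e0 eY].
have A0 : 0 <= A by lra.
have dI y : e <= y <= Y ->
    is_derive y 1 (I A) (- (Im (f A y) - Im (f (- A) y))).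
  by move=> /andP[ey _]; apply: der_I => //; exact: lt_le_trans ey.
have dI' y : y \in `]e, Y[ ->
    is_derive y 1 (I A) (- (Im (f A y) - Im (f (- A) y))).
  by rewrite in_itv/= => /andP[ey yY]; apply: dI; rewrite !ltW.
have [z] := MVT_segment eY dI' (is_derive_within_continuous dI).
rewrite in_itv/= => /andP[ez zY] ->.
have z0 : 0 < z by exact: lt_le_trans ez.
rewrite normrM normrN (ger0_norm (_ : 0 <= Y - e)) ?subr_ge0//.
apply: ler_pM => //; rewrite ?subr_ge0//; last by lra.
rewrite (le_trans (ler_normB _ _))//.
have h1 := @Imf_bound A z; have h2 := @Imf_bound (- A) z.
rewrite normrN ger0_norm// in h1 h2.
by rewrite -mulrA mulr_natl mulr2n lerD ?h1 ?h2//.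
Qed.

Let der_atan_scale (Y x : R) : 0 < Y ->
  is_derive x 1 (fun s => atan (s / Y)) (Y / (x ^+ 2 + Y ^+ 2)).
Proof.
move=> Y0; have Y1 : Y != 0 by rewrite gt_eqF.
have q0 : 0 < x ^+ 2 + Y ^+ 2 by rewrite ltr_wpDl ?sqr_ge0// exprn_gt0.
have h : is_derive x 1 (fun s : R => s / Y) Y^-1.
  by apply: (der_eq (derM (der_id x) (der_cst Y^-1 x))); ring.
apply: (der_eq (der_comp (is_derive1_atan _) h)).
have q1 : 1 + (x / Y) ^+ 2 != 0 by rewrite gt_eqF// ltr_pwDl// sqr_ge0.
by field; rewrite Y1 (gt_eqF q0) andbT/=.
Qed.

Let continuous_cauchy (Y : R) : 0 < Y ->
  continuous (fun x : R => Y / (x ^+ 2 + Y ^+ 2)).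
Proof.
move=> Y0 x; have q0 : 0 < x ^+ 2 + Y ^+ 2 by rewrite ltr_wpDl ?sqr_ge0// exprn_gt0.
apply: (der_cvg (derM (der_cst Y x) (derV _ (derD (derX 2 (der_id x))
  (der_cst (Y ^+ 2) x))))).
by rewrite gt_eqF.
Qed.

(** At large height [f] is compared with [i c / z], whose integral over a
    horizontal segment is explicit. *)
Let I_top (A Y : R) : 0 <= A -> 1 <= Y ->
  `|I A Y - 2 * c * atan (A / Y)| <= C * pi / Y.
Proof.
move=> A0 Y1; have Y0 : 0 < Y by lra.
have cv (b : R) : {within `[- A, A], continuous
    (fun x : R => b * (Y / (x ^+ 2 + Y ^+ 2)))}.
  apply: continuous_subspaceT => x; apply: cvgM; first exact: cvg_cst.
  exact: continuous_cauchy.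
have Icauchy (b : R) : \int[mu]_(x in `[- A, A]) (b * (Y / (x ^+ 2 + Y ^+ 2)))
    = 2 * b * atan (A / Y).
  have db x : - A <= x <= A ->
    is_derive x 1 (fun x => b * atan (x / Y)) (b * (Y / (x ^+ 2 + Y ^+ 2))).
    by move=> _; apply: derZ; exact: der_atan_scale.
  rewrite (RFTC2 _ db (cv b)); last by lra.
  by rewrite mulNr atanN; ring.
rewrite -Icauchy.
have cf : {within `[- A, A], continuous (fun x => Re (f x Y))}.
  by apply: continuous_subspaceT; exact: continuous_Ref.
rewrite -RintegralB//; try exact: continuous_integrable_itv.
have cB : {within `[- A, A], continuous
    (fun x => Re (f x Y) - c * (Y / (x ^+ 2 + Y ^+ 2)))}.
  apply: continuous_subspaceT => x; apply: cvgB; first exact: continuous_Ref.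
  by apply: cvgM; [exact: cvg_cst|exact: continuous_cauchy].
apply: (le_trans (le_normr_Rintegral _ _)) => //.
  exact: continuous_integrable_itv.
apply: (@le_trans _ _ (2 * (C / Y) * atan (A / Y))).
  rewrite -Icauchy; apply: le_Rintegral => //.
  - apply: continuous_integrable_itv => x.
    by apply: cvg_norm; exact: cB.
  - exact: continuous_integrable_itv.
  move=> x _.
  have q1 : 1 <= x ^+ 2 + Y ^+ 2.
    by rewrite (@le_trans _ _ (Y ^+ 2))// ?lerDr ?sqr_ge0// exprn_ege1.
  have := le_trans (Re_le_normc _) (f_asym Y0 q1).
  rewrite !complexE'/= mulrA => /le_trans; apply.
  by rewrite mulrA divfK// gt_eqF.
have h := ltW (atan_ltpi2 (A / Y)).
rewrite (_ : C * pi / Y = 2 * (C / Y) * (pi / 2)); last by field; rewrite gt_eqF.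
by rewrite ler_wpM2l// mulr_ge0// divr_ge0// ltW.
Qed.

(** The half-width [n ^ 2] and the intermediate height [n] make both the
    contribution of the vertical sides and that of the top of order [1 / n]. *)
Let I_bound (n : nat) (e : R) : (0 < n)%N -> 0 < e <= 1 ->
  `|I (n%:R ^+ 2) e - 2 * c * atan n%:R| <= (C * pi + 2 * (c + C)) / n%:R.
Proof.
move=> n0 /andP[e0 e1].
have n1 : 1 <= n%:R :> R by rewrite ler1n.
have n2 : 1 <= n%:R ^+ 2 :> R by rewrite exprn_ege1.
have nn0 : n%:R != 0 :> R by rewrite gt_eqF// (lt_le_trans ltr01).
have h1 := @I_top (n%:R ^+ 2) n%:R (le_trans ler01 n2) n1.
rewrite expr2 mulfK// -expr2 in h1.
have h2 : `|I (n%:R ^+ 2) n%:R - I (n%:R ^+ 2) e| <= 2 * (c + C) / n%:R ^+ 2 * n%:R.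
  by apply: I_lip => //; rewrite e0 (le_trans e1).
have -> : I (n%:R ^+ 2) e - 2 * c * atan n%:R =
  (I (n%:R ^+ 2) n%:R - 2 * c * atan n%:R) -
  (I (n%:R ^+ 2) n%:R - I (n%:R ^+ 2) e) by ring.
apply: (le_trans (ler_normB _ _)); rewrite [leRHS]mulrDl lerD//.
apply: (le_trans h2); rewrite le_eqVlt; apply/orP; left; apply/eqP; field => //.
Qed.

(** Near the origin the bound is the given [G], which may be unbounded; elsewhere
    the behaviour at infinity provides a constant. *)
Let dom (x : R) := c + C + `|(G \_ `[-1, 1]) x|.

Let intdom (A : R) : mu.-integrable `[- A, A] (EFin \o dom).
Proof.
apply: intD => //; first exact: integrable_cst_itv.
apply: integrable_norm.
apply: (@integrableS _ _ _ mu setT) => //.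
by rewrite -restrict_EFin; apply/integrable_restrict; rewrite ?setTI.
Qed.

Let f_dom (x y : R) : x != 0 -> 0 < y <= 1 -> `|Re (f x y)| <= dom x.
Proof.
move=> x0 /andP[y0 y1]; rewrite /dom.
have [x1|x1] := leP `|x| 1.
  rewrite patchE ifT; last by rewrite inE/= in_itv/= -ler_norml.
  apply: (le_trans (fG x0 _ x1)); first by rewrite y0.
  by rewrite (le_trans (ler_norm _))// lerDr addr_ge0.
have q1 : 1 <= x ^+ 2 + y ^+ 2.
  rewrite (@le_trans _ _ (x ^+ 2))// ?lerDl ?sqr_ge0//.
  by rewrite -real_normK ?num_real// exprn_ege1// ltW.
have q0 : 0 < x ^+ 2 + y ^+ 2 by exact: lt_le_trans q1.
have := le_trans (Re_le_normc _) (f_asym y0 q1).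
rewrite !complexE'/= => h.
have h1 : `|c * y / (x ^+ 2 + y ^+ 2)| <= c.
  rewrite !normrM (ger0_norm c0) normfV (ger0_norm (ltW q0)) (gtr0_norm y0).
  rewrite ler_pdivrMr// ler_wpM2l// (le_trans y1)//.
have h2 : C / (x ^+ 2 + y ^+ 2) <= C.
  by rewrite ler_pdivrMr// ler_peMr.
have h3 : `|Re (f x y)| <= c + C.
  apply: le_trans (lerD h1 (le_trans h h2)).
  by rewrite [leRHS]addrC -lerBlDr -{1}[`|c * y / _|]normrN
    (le_trans (lerB_normD _ _))// ler_norm.
by rewrite (le_trans h3)// lerDl.
Qed.

(** The boundary values of an analytic function on the upper half plane that
    behaves like [i c / z] at infinity carry total mass [pi * c]: integrals
    over horizontal lines do not depend on the height. *)
Lemma cvg_boundary_integral :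
  (fun n : nat => \int[mu]_(x in `[- (n%:R ^+ 2), n%:R ^+ 2]) u0 x) @ \oo
    --> pi * c.
Proof.
have mf k : measurable_fun (setT : set (measurableTypeR R)) (fun x => Re (f x k.+1%:R^-1)).
  by apply: measurable_continuous; apply: continuous_Ref; rewrite invr_gt0.
have step n : (0 < n)%N ->
    `|\int[mu]_(x in `[- (n%:R ^+ 2), n%:R ^+ 2]) u0 x - 2 * c * atan n%:R|
    <= (C * pi + 2 * (c + C)) / n%:R.
  move=> n0.
  have [] := @Rdominated_convergence_ae _ _ _ mu `[- (n%:R ^+ 2), n%:R ^+ 2]
      (fun k x => Re (f x k.+1%:R^-1)) u0 dom.
  - exact: measurable_itv.
  - by move=> k; exact: measurable_funTS.
  - exact: measurable_funTS.
  - by apply: (@ae_except _ 0) => x x0 _; exact: f_u0.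
  - exact: intdom.
  - by apply: (@ae_except _ 0) => x x0 k _; apply: (f_dom x0); rewrite invr_gt0 ltr0n/= invf_le1 ?ler1n.
  move=> _ cvI.
  have : (fun k => `|I (n%:R ^+ 2) k.+1%:R^-1 - 2 * c * atan n%:R|) @ \oo -->
    `|\int[mu]_(x in `[- (n%:R ^+ 2), n%:R ^+ 2]) u0 x - 2 * c * atan n%:R|.
    by apply: cvg_norm; apply: cvgB => //; exact: cvg_cst.
  move=> /[dup] cv; move/cvg_lim => <- //.
  apply: limr_le; first by apply/cvg_ex; eexists; exact: cv.
  apply: nearW => k; apply: I_bound => //.
  by rewrite invr_gt0 ltr0n/= invf_le1 ?ler1n.
have at2 : (fun n : nat => 2 * c * atan n%:R) @ \oo --> pi * c.
  rewrite (_ : pi * c = 2 * c * (pi / 2)); last by field.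
  apply: cvgM; first exact: cvg_cst.
  by apply: cvg_comp (@cvgy_atan R); exact: cvgr_idn.
have sm : (fun n : nat => (C * pi + 2 * (c + C)) / n%:R) @ \oo --> 0.
  rewrite -[X in _ --> X](mulr0 (C * pi + 2 * (c + C))).
  apply: cvgM; first exact: cvg_cst.
  exact: cvg_invn.
have d0 : (fun n : nat => \int[mu]_(x in `[- (n%:R ^+ 2), n%:R ^+ 2]) u0 x
    - 2 * c * atan n%:R) @ \oo --> 0.
  by apply: (@cvg_dist_le _ 1%N) sm => n n0; rewrite subr0; exact: step.
have := cvgseqD d0 at2; rewrite add0r => h.
by apply: cvgseq_eq h => n; rewrite subrK.
Qed.

(** For nonnegative boundary values the limit along growing intervals is the
    Lebesgue integral, by monotone convergence. *)
Lemma boundary_integral : (forall x, 0 <= u0 x) ->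
  (\int[mu]_x (u0 x)%:E = (pi * c)%:E)%E.
Proof.
move=> u00.
pose F (n : nat) : set (measurableTypeR R) := `[- (n%:R ^+ 2), n%:R ^+ 2]%classic.
have FT : \bigcup_n F n = setT.
  apply/seteqP; split => // x _.
  exists (Num.truncn `|x|).+1 => //; rewrite /F/= in_itv/= -ler_norml.
  have := ltW (truncnS_gt `|x|).
  by move/le_trans; apply; rewrite expr2 ler_peMr// ler1n.
have := @ge0_nondecreasing_set_cvg_integral _ (measurableTypeR R) R F (EFin \o u0) mu.
rewrite FT => /(_ _ _ _ _)/cvg_lim <-//; last 4 first.
- move=> m n mn; apply/subsetPset => x; rewrite /F/= !in_itv/= -!ler_norml.
  by move=> /le_trans; apply; rewrite ler_pXn2r ?nnegrE// ler_nat.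
- by move=> i; exact: measurable_itv.
- by move=> i; apply/measurable_EFinP; exact: measurable_funTS.
- by move=> i x _; rewrite lee_fin.
apply/cvg_lim => //.
have mf k : measurable_fun (setT : set (measurableTypeR R)) (fun x => Re (f x k.+1%:R^-1)).
  by apply: measurable_continuous; apply: continuous_Ref; rewrite invr_gt0.
have intu n : mu.-integrable (F n) (EFin \o u0).
  have [] := @Rdominated_convergence_ae _ _ _ mu (F n)
      (fun k x => Re (f x k.+1%:R^-1)) u0 dom => //.
  - exact: measurable_itv.
  - by move=> k; exact: measurable_funTS.
  - exact: measurable_funTS.
  - by apply: (@ae_except _ 0) => x x0 _; exact: f_u0.
  - exact: intdom.
  - by apply: (@ae_except _ 0) => x x0 k _; apply: (f_dom x0); rewrite invr_gt0 ltr0n/= invf_le1 ?ler1n.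
apply: cvg_EFin; last exact: cvg_boundary_integral.
apply: nearW => n; have mF : measurable (F n) by exact: measurable_itv.
exact: (integrable_fin_num mF (intu n)).
Qed.

End contour.

(** * Translations, exponentials and Cauchy densities *)

Section translation.
Context {R : realType}.
Local Notation mu := (@lebesgue_measure R).
Local Notation mR := (measurableTypeR R).

Let shift_fun (h : R) : mR -> mR := fun x => x + h.

Let measurable_shift h : measurable_fun setT (shift_fun h).
Proof.
apply: measurable_continuous => x; apply: cvgD; [exact: cvg_id|exact: cvg_cst].
Qed.

(** The translated measure agrees with Lebesgue measure on half-open intervals. *)
Lemma lebesgue_measure_shift h (A : set mR) : measurable A ->
  pushforward mu (shift_fun h) A = mu A.
Proof.
move=> mA; apply/esym.
apply: (@lebesgue_measure_unique R (pushforward mu (shift_fun h))) => //.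
move=> _ [[a b] _ <-] /=.
rewrite /pushforward (_ : _ @^-1` _ = `]a - h, b - h]%classic).
  rewrite !lebesgue_measure_itv/= !lte_fin ltrD2r.
  by case: ifPn => // _; rewrite -!EFinD; congr EFin; ring.
by apply/seteqP; split => x; rewrite /shift_fun /= !in_itv/= ltrBlDr lerBrDr.
Qed.

Lemma integral_shift h (f : R -> \bar R) :
  measurable_fun (setT : set mR) f -> (forall x, 0 <= f x)%E ->
  (\int[mu]_x f (x + h)%R = \int[mu]_x f x)%E.
Proof.
move=> mf f0.
transitivity (\int[pushforward mu (shift_fun h)]_x f x)%E.
  by rewrite ge0_integral_pushforward.
by apply: eq_measure_integral => A mA _; exact: lebesgue_measure_shift.
Qed.

Lemma integrable_shift h (f : R -> R) : mu.-integrable setT (EFin \o f) ->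
  mu.-integrable setT (EFin \o (fun x => f (x + h))).
Proof.
move=> /integrableP[mf fi].
have mfs : measurable_fun (setT : set mR) (fun x => f (x + h)).
  apply: measurableT_comp (measurable_shift h) => //.
  exact/measurable_EFinP.
apply/integrableP; split; first exact/measurable_EFinP.
rewrite (_ : (\int[mu]_x _ = \int[mu]_x (fun x : R => `|f x|%:E) (x + h)%R)%E)//.
rewrite (@integral_shift h (fun x : R => `|f x|%:E))//.
apply/measurable_EFinP/measurableT_comp => //; exact/measurable_EFinP.
Qed.

Lemma Rintegral_shift h (f : R -> R) : mu.-integrable setT (EFin \o f) ->
  \int[mu]_x f (x + h) = \int[mu]_x f x.
Proof.
move=> intf; rewrite /Rintegral; congr fine.
have mf : measurable_fun (setT : set mR) (EFin \o f) by case/integrableP: intf.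
transitivity (\int[pushforward mu (shift_fun h)]_x (EFin \o f) x)%E.
  by rewrite integral_pushforward//; exact: integrable_shift.
by apply: eq_measure_integral => A mA _; exact: lebesgue_measure_shift.
Qed.

End translation.

Section half_line.
Context {R : realType}.
Local Notation mu := (@lebesgue_measure R).
Local Notation mR := (measurableTypeR R).

Lemma integrable_expN (y : R) : 0 < y ->
  mu.-integrable `[0, +oo[ (EFin \o (fun s => expR (- (y * s)))).
Proof.
move=> y0.
have cexp : continuous (fun s : R => expR (- (y * s))).
  by move=> s; exact: (der_cvg (der_expR (derN (derZ y (der_id s))))).
apply/integrableP; split.
  by apply/measurable_EFinP; apply: measurable_funTS; exact: measurable_continuous.
under eq_integral do rewrite /= ger0_norm ?expR_ge0//.
rewrite (@ge0_continuous_FTC2y _ _ (fun s : R => - expR (- (y * s)) / y) 0 0).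
- by rewrite -EFinB ltry.
- by move=> s _; rewrite expR_ge0.
- exact: continuous_subspaceT.
- rewrite -[X in _ --> X](mul0r y^-1); apply: cvgM; last exact: cvg_cst.
  rewrite -oppr0; apply: cvgN.
  apply: (@cvg_comp _ _ _ (fun s : R => y * s) (fun u => expR (- u)) _ +oo%R).
    exact: gt0_cvgMry.
  exact: cvgr_expR.
- by move=> s _; have [] := derM (derN (der_expR (derN (derZ y (der_id s))))) (der_cst y^-1 s).
- apply: cvg_at_right_filter.
  exact: (der_cvg (derM (derN (der_expR (derN (derZ y (der_id (0 : R)))))) (der_cst y^-1 (0 : R)))).
- move=> s _.
  rewrite (der_derive1 (derM (derN (der_expR (derN (derZ y (der_id s))))) (der_cst y^-1 s))).
  by field; rewrite gt_eqF.
Qed.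

(** The primitive is an arctangent, which is bounded. *)
Lemma integral_cauchy (y x : R) : 0 < y ->
  mu.-integrable setT (EFin \o (fun u => y / ((u - x) ^+ 2 + y ^+ 2))).
Proof.
move=> y0.
have cy : continuous (fun u : R => y / (u ^+ 2 + y ^+ 2)).
  move=> u; have q0 : u ^+ 2 + y ^+ 2 != 0.
    by rewrite gt_eqF// ltr_wpDl ?sqr_ge0// exprn_gt0.
  by apply: (der_cvg (derM (der_cst y u) (derV _ (derD (derX 2 (der_id u)) (der_cst (y ^+ 2) u))))).
apply: (@integrable_shift _ (- x) (fun u => y / (u ^+ 2 + y ^+ 2))).
have ge0 (u : R) : 0 <= y / (u ^+ 2 + y ^+ 2).
  by rewrite divr_ge0 ?ltW// ltr_wpDl ?sqr_ge0// exprn_gt0.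
apply/integrableP; split.
  by apply/measurable_EFinP; exact: measurable_continuous.
under eq_integral do rewrite /= ger0_norm//.
rewrite ge0_symfun_integralT//; last by move=> u /=; rewrite sqrrN.
rewrite (_ : [set x | _] = `[0, +oo[%classic); last first.
  by apply/seteqP; split => u /=; rewrite in_itv/= andbT.
have dat (s : R) : is_derive s 1 (fun s => atan (s / y)) (y / (s ^+ 2 + y ^+ 2)).
  have h : is_derive s 1 (fun s : R => s / y) y^-1.
    by apply: (der_eq (derM (der_id s) (der_cst y^-1 s))); ring.
  apply: (der_eq (der_comp (is_derive1_atan _) h)).
  have q0 : 0 < s ^+ 2 + y ^+ 2 by rewrite ltr_wpDl ?sqr_ge0// exprn_gt0.
  have q1 : 1 + (s / y) ^+ 2 != 0 by rewrite gt_eqF// ltr_pwDl// sqr_ge0.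
  by field; rewrite (gt_eqF y0) (gt_eqF q0) andbT/=.
rewrite (@ge0_continuous_FTC2y _ _ (fun s : R => atan (s / y)) 0 (pi / 2)).
- by rewrite -EFinB -EFinM ltry.
- by move=> s _.
- exact: continuous_subspaceT.
- apply: (@cvg_comp _ _ _ (fun s : R => s / y) (fun u => atan u) _ +oo%R).
    by apply: gt0_cvgMly; [rewrite invr_gt0|exact: cvg_id].
  exact: cvgy_atan.
- by move=> s _; have [] := dat s.
- by apply: cvg_at_right_filter; exact: der_cvg (dat 0).
- by move=> s _; exact: der_derive1.
Qed.

End half_line.

(** * Calculus of analytic functions bounded on half planes *)

Section smooth_in_half_plane.
Context {R : realType}.
Implicit Types f g : R -> R -> R[i].

(** Bounds hold on each half plane [y >= e], away from the real axis, where the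
    boundary values may be singular. *)
Definition hp_bounded f := forall e : R, 0 < e ->
  exists M, forall x y, e <= y -> normc (f x y) <= M.

Definition hp_away0 f := forall e : R, 0 < e ->
  exists2 r, 0 < r & forall x y, e <= y -> r <= normc (f x y).

(** A second derivative is required because it makes [f'] continuous, and the
    boundedness of [f'] allows differentiation under the integral sign. *)
Definition hp_smooth f f' :=
  [/\ holo f f', exists f'', holo f' f'' & hp_bounded f'].

Lemma hp_bounded_cst (c : R[i]) : hp_bounded (fun _ _ => c).
Proof. by move=> e _; exists (normc c). Qed.

Lemma hp_boundedD f g : hp_bounded f -> hp_bounded g ->
  hp_bounded (fun x y => f x y + g x y).
Proof.
move=> hf hg e e0; have [M hM] := hf e e0; have [N hN] := hg e e0.
exists (M + N) => x y ey; rewrite (le_trans (normcD_le _ _))// lerD ?hM ?hN//.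
Qed.

Lemma hp_boundedM f g : hp_bounded f -> hp_bounded g ->
  hp_bounded (fun x y => f x y * g x y).
Proof.
move=> hf hg e e0; have [M hM] := hf e e0; have [N hN] := hg e e0.
exists (M * N) => x y ey; rewrite ComplexField.Normc.normcM.
by rewrite ler_pM ?normc_ge0 ?hM ?hN.
Qed.

Lemma hp_boundedV f : hp_away0 f -> hp_bounded (fun x y => (f x y)^-1).
Proof.
move=> hf e e0; have [r r0 hr] := hf e e0.
exists r^-1 => x y ey; rewrite ComplexField.Normc.normcV lef_pV2 ?hr ?posrE//.
by rewrite (lt_le_trans r0)// hr.
Qed.

Lemma hp_smooth_cst c : hp_smooth (fun _ _ => c) (fun _ _ => 0).
Proof.
split; [exact: holo_cst|exists (fun _ _ => 0); exact: holo_cst|].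
exact: hp_bounded_cst.
Qed.

Lemma hp_smooth_id : hp_smooth (fun x y => x +i* y) (fun _ _ => 1).
Proof.
split; [exact: holo_id|exists (fun _ _ => 0); exact: holo_cst|].
exact: hp_bounded_cst.
Qed.

Lemma hp_smoothD f f' g g' : hp_smooth f f' -> hp_smooth g g' ->
  hp_smooth (fun x y => f x y + g x y) (fun x y => f' x y + g' x y).
Proof.
move=> [h1 [f'' h2] h3] [k1 [g'' k2] k3]; split.
- exact: holoD.
- by eexists; exact: holoD h2 k2.
- exact: hp_boundedD.
Qed.

Lemma hp_smoothM f f' g g' : hp_smooth f f' -> hp_smooth g g' ->
  hp_bounded f -> hp_bounded g ->
  hp_smooth (fun x y => f x y * g x y)
            (fun x y => f' x y * g x y + f x y * g' x y).
Proof.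
move=> [h1 [f'' h2] h3] [k1 [g'' k2] k3] bf bg; split.
- exact: holoM.
- by eexists; exact: holoD (holoM h2 k1) (holoM h1 k2).
- by apply: hp_boundedD; exact: hp_boundedM.
Qed.

Lemma hp_smoothZ c f f' : hp_smooth f f' ->
  hp_smooth (fun x y => c * f x y) (fun x y => c * f' x y).
Proof.
move=> [h1 [f'' h2] h3]; split.
- exact: holoZ.
- by eexists; exact: holoZ h2.
- by apply: hp_boundedM => //; exact: hp_bounded_cst.
Qed.

Lemma hp_smoothV f f' : hp_smooth f f' -> hp_away0 f ->
  hp_smooth (fun x y => (f x y)^-1) (fun x y => - f' x y / f x y ^+ 2).
Proof.
move=> [h1 [f'' h2] h3] af.
have f0 x y : 0 < y -> f x y != 0.
  move=> y0; have [r r0 hr] := af y y0.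
  apply/eqP => fE; have := hr x y (lexx y).
  by rewrite fE ComplexField.Normc.normc0 leNgt r0.
have hV := holoV h1 f0.
split => //.
  have k := holoM (holoZ (- 1) h2) (holoM hV hV).
  eexists; apply: (holo_eq k) => x y y0; last by reflexivity.
  by rewrite mulN1r expr2 invfM.
move=> e e0.
have [M hM] := hp_boundedM h3 (hp_boundedM (hp_boundedV af) (hp_boundedV af)) e0.
exists M => x y ey; have := hM x y ey.
by rewrite expr2 invfM mulNr normcN.
Qed.

Lemma hp_away0_id : hp_away0 (fun x y => x +i* y).
Proof.
move=> e e0; exists e => // x y ey; apply: le_trans (Im_le_normc _) => /=.
by rewrite (le_trans ey)// ler_norm.
Qed.

Lemma hp_smooth_continuous f f' : hp_smooth f f' ->
  forall y, 0 < y -> continuous (fun x => Im (f' x y)).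
Proof.
move=> [_ [f'' h2] _] y y0 x; have [_ h _ _] := h2 x y y0; exact: der_cvg h.
Qed.

Lemma hp_smooth_bound f f' : hp_smooth f f' ->
  forall e, 0 < e -> exists M, forall x y, e <= y -> `|Im (f' x y)| <= M.
Proof.
move=> [_ _ h] e e0; have [M hM] := h e e0; exists M => x y ey.
exact: le_trans (Im_le_normc _) (hM x y ey).
Qed.

End smooth_in_half_plane.

(** * The Laplace transform as an analytic function *)

Section laplace.
Context {R : realType}.
Local Notation mu := (@lebesgue_measure R).
Local Notation mR := (measurableTypeR R).
Implicit Types q : R -> R.

Definition exp_integrable q :=
  measurable_fun (`[0, +oo[%classic : set mR) q /\
  forall y : R, 0 < y ->
    mu.-integrable `[0, +oo[ (EFin \o (fun s => `|q s| * expR (- (y * s)))).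

(** [s <= (2 / y) e^{y s / 2}] absorbs the extra factor into half of the damping. *)
Lemma exp_integrable_mulr q : exp_integrable q ->
  exp_integrable (fun s => s * q s).
Proof.
move=> [mq iq].
have mi : measurable (`[0, +oo[%classic : set mR) by exact: measurable_itv.
have mq1 : measurable_fun (`[0, +oo[%classic : set mR) (fun s : R => s * q s).
  by apply: measurable_funM => //; exact: measurable_funTS.
split=> // y y0; have y2 : 0 < y / 2 by rewrite divr_gt0.
have cexp : continuous (fun s : R => expR (- (y * s))).
  by move=> s; exact: (der_cvg (der_expR (derN (derZ y (der_id s))))).
apply: (@integrable_dominated _ _ _ mu _ _
  (fun s => 2 / y * (`|q s| * expR (- (y / 2 * s))))) => //.
- apply: measurable_funM; first exact: measurableT_comp.
  by apply: measurable_funTS; exact: measurable_continuous.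
- by apply: intZ => //; exact: iq.
move=> s; rewrite /= in_itv/= andbT => s0.
rewrite !normrM !normr_id (ger0_norm s0) (ger0_norm (expR_ge0 _)).
rewrite (_ : - (y * s) = - (y / 2 * s) + - (y / 2 * s)); last by field.
rewrite expRD.
have h : s * expR (- (y / 2 * s)) <= 2 / y.
  rewrite expRN ler_pdivrMr ?expR_gt0// mulrAC ler_pdivlMr//.
  rewrite (_ : s * y = 2 * (y / 2 * s)); last by field.
  by rewrite ler_wpM2l// (le_trans _ (expR_ge1Dx _))// lerDr.
rewrite (_ : s * `|q s| * _ = (s * expR (- (y / 2 * s))) *
  (`|q s| * expR (- (y / 2 * s)))); last by ring.
by rewrite ler_wpM2r// mulr_ge0// expR_ge0.
Qed.

Definition laplace_part q (th x y : R) :=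
  \int[mu]_(s in `[0, +oo[) (q s * (expR (- (y * s)) * cos (x * s + th))).

(** [laplace q x y = int_0^oo q s e^{i s z} ds] at [z = x + i y]; the sine
    transform is the cosine transform with phase [- pi / 2]. *)
Definition laplace q (x y : R) : R[i] :=
  laplace_part q 0 x y +i* laplace_part q (- (pi / 2)) x y.

Definition laplace_abs q (y : R) :=
  \int[mu]_(s in `[0, +oo[) (`|q s| * expR (- (y * s))).

Let mitv : measurable (`[0, +oo[%classic : set mR).
Proof. exact: measurable_itv. Qed.

Let mlap q (th x y : R) : exp_integrable q ->
  measurable_fun (`[0, +oo[%classic : set mR)
   (fun s => q s * (expR (- (y * s)) * cos (x * s + th))).
Proof.
move=> [mq _]; apply: measurable_funM => //; apply: measurable_funTS.
apply: measurable_continuous => s.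
have h1 := der_expR (derN (derZ y (der_id s))).
have h2 := der_cos (derD (derZ x (der_id s)) (der_cst th s)).
exact: (der_cvg (derM h1 h2)).
Qed.

Let lap_le q (th x y s : R) : `|q s * (expR (- (y * s)) * cos (x * s + th))|
  <= `|q s| * expR (- (y * s)).
Proof.
rewrite !normrM ler_wpM2l// (ger0_norm (expR_ge0 _)) ler_piMr ?expR_ge0//.
exact: cos_max.
Qed.

Lemma integrable_laplace q (th x y : R) : exp_integrable q -> 0 < y ->
  mu.-integrable `[0, +oo[
    (EFin \o (fun s => q s * (expR (- (y * s)) * cos (x * s + th)))).
Proof.
move=> hq y0; apply: (@integrable_dominated _ _ _ mu _ _
  (fun s => `|q s| * expR (- (y * s)))) => //.
- exact: mlap.
- exact: hq.2.
Qed.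

Lemma laplace_part_bound q (th x e y : R) : exp_integrable q -> 0 < e -> e <= y ->
  `|laplace_part q th x y| <= laplace_abs q e.
Proof.
move=> hq e0 ey; have y0 := lt_le_trans e0 ey.
have i1 := integrable_laplace th x hq y0.
apply: (le_trans (le_normr_Rintegral mitv i1)).
apply: le_Rintegral => //; first exact: integrable_norm.
  exact: hq.2.
move=> s; rewrite /= in_itv/= andbT => s0.
apply: (le_trans (lap_le _ _ _ _ _)); rewrite ler_wpM2l// ler_expR lerN2.
by rewrite ler_wpM2r.
Qed.

Lemma laplace_bound q (x e y : R) : exp_integrable q -> 0 < e -> e <= y ->
  normc (laplace q x y) <= 2 * laplace_abs q e.
Proof.
move=> hq e0 ey; apply: (le_trans (normc_le_ReIm _)).
by rewrite mulr_natl mulr2n lerD// laplace_part_bound.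
Qed.

Let cos_shift (u : R) : cos (u + pi / 2) = - sin u.
Proof. by rewrite cosD cos_pihalf sin_pihalf; ring. Qed.

Let der_lap_x q (th x y : R) : exp_integrable q -> 0 < y ->
  is_derive x 1 (fun x => laplace_part q th x y)
    (laplace_part (fun s => s * q s) (th + pi / 2) x y).
Proof.
move=> hq y0; have hq1 := exp_integrable_mulr hq.
apply: (@der_under_integral _ _ mR mu `[0, +oo[
  (fun x s => q s * (expR (- (y * s)) * cos (x * s + th)))
  (fun x s => (s * q s) * (expR (- (y * s)) * cos (x * s + (th + pi / 2))))
  (fun s => `|s * q s| * expR (- (y * s))) x (x - 1) (x + 1)) => //.
- by apply/andP; split; lra.
- by move=> u _; exact: integrable_laplace.
- move=> u s _ _.
  have h := der_cos (derD (derM (der_id u) (der_cst s u)) (der_cst th u)).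
  apply: (der_eq (derZ (q s) (derZ (expR (- (y * s))) h))).
  by rewrite addrA cos_shift; ring.
- exact: hq1.2.
- by move=> u s _ _; exact: (lap_le (fun s => s * q s)).
Qed.

Let der_lap_y q (th x y : R) : exp_integrable q -> 0 < y ->
  is_derive y 1 (laplace_part q th x)
    (- laplace_part (fun s => s * q s) th x y).
Proof.
move=> hq y0; have hq1 := exp_integrable_mulr hq.
have y2 : 0 < y / 2 by rewrite divr_gt0.
rewrite -RintegralN//; last exact: integrable_laplace.
apply: (@der_under_integral _ _ mR mu `[0, +oo[
  (fun y s => q s * (expR (- (y * s)) * cos (x * s + th)))
  (fun y s => - ((s * q s) * (expR (- (y * s)) * cos (x * s + th))))
  (fun s => `|s * q s| * expR (- (y / 2 * s))) y (y / 2) (y + 1)) => //.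
- by apply/andP; split; lra.
- by move=> u /andP[yu _]; apply: integrable_laplace => //; exact: lt_trans yu.
- move=> u s _ _.
  have h := der_expR (derN (derM (der_id u) (der_cst s u))).
  by apply: (der_eq (derZ (q s) (derM h (der_cst (cos (x * s + th)) u)))); ring.
- exact: hq1.2.
- move=> u s /andP[yu _]; rewrite /= in_itv/= andbT => s0.
  rewrite normrN; apply: (le_trans (lap_le (fun s => s * q s) _ _ _ _)).
  by rewrite ler_wpM2l// ler_expR lerN2 ler_wpM2r// ltW.
Qed.

Let laplace_part_pi q (th x y : R) : exp_integrable q -> 0 < y ->
  laplace_part q (th + pi) x y = - laplace_part q th x y.
Proof.
move=> hq y0; rewrite /laplace_part -RintegralN//; last exact: integrable_laplace.
by apply: eq_Rintegral => s _; rewrite addrA cosDpi; ring.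
Qed.

(** Differentiation under the integral multiplies the kernel by [i s]. *)
Lemma holo_laplace q : exp_integrable q ->
  holo (laplace q) (fun x y => 'i%C * laplace (fun s => s * q s) x y).
Proof.
move=> hq x y y0; have hq1 := exp_integrable_mulr hq.
have e1 : 0 + pi / 2 = - (pi / 2) + pi :> R by field.
split; rewrite !complexE'/= ?mul0r ?mul1r ?add0r ?sub0r ?addr0.
- have := @der_lap_x q 0 x y hq y0.
  by rewrite e1 laplace_part_pi.
- have := @der_lap_x q (- (pi / 2)) x y hq y0.
  by rewrite addNr.
- exact: der_lap_y.
- exact: der_lap_y.
Qed.

End laplace.

(** * The Fourier transform of the Poisson kernel *)

Section poisson_kernel.
Context {R : realType}.
Local Notation mu := (@lebesgue_measure R).
Local Notation mR := (measurableTypeR R).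
Variables (s y : R).
Hypothesis s0 : 0 <= s.
Hypothesis y0 : 0 < y.

(** [L] being the Laplace transform of this truncated exponential, the function
    [f = i L / (z + i y)] defined below equals
    [(e^{i s z} - e^{- s y}) / (z ^ 2 + y ^ 2)]; in this form it is visibly
    analytic at [i y]. *)
Let q : R -> R := (fun t => expR (- ((s - t) * y))) \_ `[0, s].

Let cont_q : continuous (fun t : R => expR (- ((s - t) * y))).
Proof.
move=> t.
exact: (der_cvg (der_expR (derN (derM (derB (der_cst s t) (der_id t)) (der_cst y t))))).
Qed.

Let q_le1 t : `|q t| <= 1.
Proof.
rewrite /q patchE; case: ifPn => [|_]; last by rewrite normr0.
rewrite inE/= in_itv/= => /andP[_ ts].
rewrite ger0_norm ?expR_ge0// -[leRHS]expR0 ler_expR oppr_le0.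
by rewrite mulr_ge0 ?subr_ge0// ltW.
Qed.

Let exp_q : exp_integrable q.
Proof.
have mq : measurable_fun (setT : set mR) q.
  rewrite /q; apply/(measurable_restrictT _ _).1; first exact: measurable_itv.
  by apply: measurable_funTS; exact: measurable_continuous.
split; first exact: measurable_funTS.
move=> v v0; apply: (@integrable_dominated _ _ _ mu _ _
  (fun s => expR (- (v * s)))) => //.
- apply: measurable_funTS; apply: measurable_funM.
    exact: measurableT_comp.
  apply: measurable_continuous => t.
  exact: (der_cvg (der_expR (derN (derZ v (der_id t))))).
- exact: integrable_expN.
move=> t _; rewrite normrM normr_id (ger0_norm (expR_ge0 _)).
by rewrite ler_piMl ?expR_ge0.
Qed.

Let E (v t : R) := expR (- ((s - t) * y)) * expR (- (v * t)).

Let part_E th u v : laplace_part q th u v =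
  \int[mu]_(t in `[0, s]) (E v t * cos (u * t + th)).
Proof.
rewrite /laplace_part.
rewrite (_ : `[0, s]%classic = `[0, +oo[%classic `&` `[0, s]%classic); last first.
  apply/seteqP; split => t /=; rewrite !in_itv/= ?andbT; last by case.
  by move=> /andP[-> ->].
rewrite Rintegral_mkcondr; apply: eq_Rintegral => t _.
by rewrite /q !patchE; case: ifPn => _; rewrite ?mul0r// /E mulrA.
Qed.

Let der_E (v t : R) : is_derive t 1 (E v) ((y - v) * E v t).
Proof.
have h1 := der_expR (derN (derM (derB (der_cst s t) (der_id t)) (der_cst y t))).
have h2 := der_expR (derN (derZ v (der_id t))).
by apply: (der_eq (derM h1 h2)); rewrite /E; ring.
Qed.

Let cont_E th u v : continuous (fun t => E v t * cos (u * t + th)).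
Proof.
move=> t.
exact: (der_cvg (derM (der_E v t) (der_cos (derD (derZ u (der_id t)) (der_cst th t))))).
Qed.

(** Integration by parts gives the closed form of [L] in real terms. *)
Let ibp th u v :
  (y - v) * laplace_part q th u v + u * laplace_part q (th + pi / 2) u v =
  expR (- (v * s)) * cos (u * s + th) - expR (- (y * s)) * cos th.
Proof.
have ci a b : mu.-integrable `[0, s] (EFin \o (fun t => E a t * cos (u * t + b))).
  by apply: continuous_integrable_itv; apply: continuous_subspaceT; exact: cont_E.
rewrite !part_E -!RintegralZl// -RintegralD//; try exact: intZ.
have dE (t : R) : 0 <= t <= s -> is_derive t 1 (fun t => E v t * cos (u * t + th))
   ((y - v) * (E v t * cos (u * t + th)) + u * (E v t * cos (u * t + (th + pi / 2)))).
  move=> _; have h := der_cos (derD (derZ u (der_id t)) (der_cst th t)).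
  apply: (der_eq (derM (der_E v t) h)).
  rewrite (_ : cos (u * t + (th + pi / 2)) = - sin (u * t + th)); first by ring.
  by rewrite addrA cosD cos_pihalf sin_pihalf; ring.
rewrite (RFTC2 s0 dE).
  rewrite /E subrr subr0 !mulr0 mul0r add0r oppr0 expR0 mul1r mulr1.
  by rewrite (mulrC s y).
apply: continuous_subspaceT => t; apply: cvgD; apply: cvgM; (try exact: cvg_cst);
  exact: cont_E.
Qed.

Let part_le th u v : 0 <= v -> `|laplace_part q th u v| <= s.
Proof.
move=> v0; rewrite part_E.
have ci : mu.-integrable `[0, s] (EFin \o (fun t => E v t * cos (u * t + th))).
  by apply: continuous_integrable_itv; apply: continuous_subspaceT; exact: cont_E.
apply: (le_trans (le_normr_Rintegral _ ci)) => //.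
rewrite -[leRHS]subr0 -[leRHS]mul1r; apply: le_Rintegral_cst => //.
  exact: integrable_norm.
move=> t /andP[t0 ts]; rewrite normrM -[leRHS]mulr1 ler_pM// ?cos_max//.
rewrite /E normrM !(ger0_norm (expR_ge0 _)) mulr_ile1 ?expR_ge0//.
  by rewrite -[leRHS]expR0 ler_expR oppr_le0 mulr_ge0 ?subr_ge0// ltW.
by rewrite -[leRHS]expR0 ler_expR oppr_le0 mulr_ge0.
Qed.

Let L := laplace q.

Let L_le u v : 0 <= v -> normc (L u v) <= 2 * s.
Proof.
move=> v0; apply: (le_trans (normc_le_ReIm _)).
by rewrite mulr_natl mulr2n lerD// part_le.
Qed.

Let w (u v : R) : R[i] := (u +i* v) + (0 +i* y).

Let w_ge u v : 0 <= v -> normc (u +i* v) <= normc (w u v).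
Proof.
move=> v0; apply: normc_le_sqr; first exact: normc_ge0.
rewrite normc_sqr /w/= addr0 lerD2l ler_pXn2r ?nnegrE ?addr_ge0 ?(ltW y0)//.
by rewrite lerDl ltW.
Qed.

Let w_gey u v : 0 <= v -> y <= normc (w u v).
Proof.
move=> v0; apply: le_trans (Im_le_normc _) => /=.
by rewrite (le_trans _ (ler_norm _))// lerDr.
Qed.

Let f (u v : R) : R[i] := ('i%C * L u v) * (w u v)^-1.

Let smooth_f : exists f', hp_smooth f f'.
Proof.
have exp_q1 := exp_integrable_mulr exp_q.
have bL (q' : R -> R) : exp_integrable q' -> hp_bounded (laplace q').
  by move=> hq e e0; exists (2 * laplace_abs q' e) => u v ev; exact: laplace_bound.
have sL : hp_smooth L (fun u v => 'i%C * laplace (fun s => s * q s) u v).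
  split; first exact: holo_laplace.
    by eexists; apply: holoZ; apply: holo_laplace.
  by apply: hp_boundedM; [exact: hp_bounded_cst|exact: bL].
have sw := hp_smoothD (@hp_smooth_id R) (hp_smooth_cst (0 +i* y)).
have aw : hp_away0 w.
  by move=> e e0; exists y => // u v ev; apply: w_gey; rewrite (le_trans (ltW e0)).
eexists; apply: hp_smoothM.
- exact: hp_smoothZ sL.
- exact: hp_smoothV sw aw.
- by apply: hp_boundedM; [exact: hp_bounded_cst|exact: bL].
- exact: hp_boundedV.
Qed.

Let normc_f u v : normc (f u v) = normc (L u v) / normc (w u v).
Proof.
rewrite /f !ComplexField.Normc.normcM ComplexField.Normc.normcV.
by rewrite [normc 'i%C]/= expr0n expr1n add0r sqrtr1 mul1r.
Qed.

(** The numerator of [f] is bounded in the upper half plane, hence the decay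
    [1 / z ^ 2]. *)
Let f_asym u v : 0 < v -> 1 <= u ^+ 2 + v ^+ 2 ->
  normc (f u v) <= (3 + 2 * s * y) / (u ^+ 2 + v ^+ 2).
Proof.
move=> v0 uv1; rewrite normc_f.
have z0 : 0 < normc (u +i* v).
  by rewrite -(@ltr_pXn2r _ 2)// ?nnegrE ?normc_ge0// expr0n normc_sqr/= (lt_le_trans ltr01).
rewrite -(normc_sqr (u +i* v)) expr2 invfM mulrA.
apply: ler_pM; rewrite ?normc_ge0 ?invr_ge0 ?normc_ge0//; last first.
  rewrite lef_pV2 ?posrE//; first exact: w_ge (ltW v0).
  by rewrite (lt_le_trans z0)// w_ge// ltW.
rewrite ler_pdivlMr//.
have h1 : normc (u +i* v) <= normc ((y - v) +i* u) + y.
  rewrite (_ : u +i* v = - ('i%C * ((y - v) +i* u)) + (0 +i* y)); last first.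
    by apply: complex_eqP => /=; ring.
  apply: (le_trans (normcD_le _ _)); rewrite normcN ComplexField.Normc.normcM.
  rewrite lerD//.
    by rewrite [normc 'i%C]/= expr0n expr1n add0r sqrtr1 mul1r.
  by rewrite /= expr0n add0r sqrtr_sqr gtr0_norm.
apply: (@le_trans _ _ (normc (L u v) * normc ((y - v) +i* u) + normc (L u v) * y)).
  by rewrite -mulrDr ler_wpM2l ?normc_ge0.
rewrite lerD//; last by rewrite ler_wpM2r ?(ltW y0)// L_le// ltW.
rewrite -ComplexField.Normc.normcM.
have e1 := ibp 0 u v; have e2 := ibp (- (pi / 2)) u v.
rewrite add0r addr0 cos0 mulr1 in e1.
rewrite addNr cosN cos_pihalf mulr0 subr0 in e2.
have e3 : laplace_part q (pi / 2) u v = - laplace_part q (- (pi / 2)) u v.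
  rewrite !part_E -RintegralN//; last first.
    by apply: continuous_integrable_itv; apply: continuous_subspaceT; exact: cont_E.
  apply: eq_Rintegral => t _; rewrite -mulrN; congr (_ * _).
  by rewrite cosB cosD cos_pihalf sin_pihalf; ring.
rewrite e3 in e1.
apply: (le_trans (normc_le_ReIm _)); rewrite /L /laplace.
move: (laplace_part q 0 u v) (laplace_part q (- (pi / 2)) u v) e1 e2 {e3} => A B e1 e2.
rewrite !complexE'.
rewrite (_ : _ - _ = expR (- (v * s)) * cos (u * s) - expR (- (y * s))); last first.
  by rewrite -e1; ring.
rewrite (_ : A * u + B * (y - v) = expR (- (v * s)) * cos (u * s - pi / 2)); last first.
  by rewrite -e2; ring.
have x1 (a : R) : 0 <= a -> `|expR (- (a * s))| <= 1.
  move=> a0; rewrite ger0_norm ?expR_ge0// -[leRHS]expR0 ler_expR oppr_le0.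
  by rewrite mulr_ge0.
have x2 (a b : R) : 0 <= a -> `|expR (- (a * s)) * cos b| <= 1.
  by move=> a0; rewrite normrM mulr_ile1// ?x1// cos_max.
have := ler_normB (expR (- (v * s)) * cos (u * s)) (expR (- (y * s))).
have := x2 v (u * s) (ltW v0); have := x2 v (u * s - pi / 2) (ltW v0).
by have := x1 y (ltW y0); lra.
Qed.

Let u0 (u : R) := (cos (u * s) - expR (- (y * s))) / (u ^+ 2 + y ^+ 2).

Let qpos (u : R) : 0 < u ^+ 2 + y ^+ 2.
Proof. by rewrite ltr_wpDl ?sqr_ge0// exprn_gt0. Qed.

Let cont_cauchy : continuous (fun u : R => (u ^+ 2 + y ^+ 2)^-1).
Proof.
move=> u; apply: (der_cvg (derV _ (derD (derX 2 (der_id u)) (der_cst (y ^+ 2) u)))).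
by rewrite gt_eqF.
Qed.

Let cont_cos : continuous (fun u : R => cos (u * s)).
Proof. by move=> u; exact: (der_cvg (der_cos (derM (der_id u) (der_cst s u)))). Qed.

Let cont_u0 : continuous u0.
Proof.
move=> u; apply: cvgM; last exact: cont_cauchy.
by apply: cvgB; [exact: cont_cos|exact: cvg_cst].
Qed.

Let cvg_part th u :
  (fun n : nat => laplace_part q th u n.+1%:R^-1) @ \oo --> laplace_part q th u 0.
Proof.
rewrite part_E; under eq_fun do rewrite part_E.
have [] := @Rdominated_convergence _ _ _ mu `[0, s]
  (fun n t => E n.+1%:R^-1 t * cos (u * t + th)) (fun t => E 0 t * cos (u * t + th))
  (cst 1) => //.
- by move=> n; apply: measurable_funTS; apply: measurable_continuous; exact: cont_E.
- by apply: measurable_funTS; apply: measurable_continuous; exact: cont_E.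
- apply: aeW => t _; apply: cvgseqM; last exact: cvg_cst.
  apply: cvgseqZ.
  apply: (@cvgseq_continuous _ (fun v => expR (- (v * t)))); last exact: cvg_harmonic.
  exact: (der_cvg (der_expR (derN (derM (der_id (0 : R)) (der_cst t (0 : R)))))).
- exact: integrable_cst_itv.
move=> n t; rewrite /= in_itv/= => /andP[t0 ts].
rewrite normrM -[leRHS]mulr1 ler_pM// ?cos_max//.
rewrite /E normrM !(ger0_norm (expR_ge0 _)) mulr_ile1 ?expR_ge0//.
  by rewrite -[leRHS]expR0 ler_expR oppr_le0 mulr_ge0 ?subr_ge0// ltW.
by rewrite -[leRHS]expR0 ler_expR oppr_le0 mulr_ge0.
Qed.

Let f_u0 u : (fun n : nat => Re (f u n.+1%:R^-1)) @ \oo --> u0 u.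
Proof.
have ReF v : Re (f u v) = (laplace_part q 0 u v * (v + y) -
    laplace_part q (- (pi / 2)) u v * u) / (u ^+ 2 + (v + y) ^+ 2).
  have wR : Re (w u v) = u by rewrite /w !complexE'/= addr0.
  have wI : Im (w u v) = v + y by rewrite /w !complexE'/=.
  rewrite /f ReME ImME ReVE ImVE wR wI /L /laplace.
  move: (laplace_part q 0 u v) (laplace_part q (- (pi / 2)) u v) => A B.
  by rewrite !complexE'; ring.
under eq_fun do rewrite ReF.
have -> : u0 u = (laplace_part q 0 u 0 * (0 + y) -
    laplace_part q (- (pi / 2)) u 0 * u) / (u ^+ 2 + (0 + y) ^+ 2).
  rewrite /u0 add0r; congr (_ / _).
  have e1 := ibp 0 u 0.
  have e3 : laplace_part q (pi / 2) u 0 = - laplace_part q (- (pi / 2)) u 0.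
    rewrite !part_E -RintegralN//; last first.
      by apply: continuous_integrable_itv; apply: continuous_subspaceT; exact: cont_E.
    apply: eq_Rintegral => t _; rewrite -mulrN; congr (_ * _).
    by rewrite cosB cosD cos_pihalf sin_pihalf; ring.
  rewrite add0r addr0 subr0 cos0 mulr1 e3 mul0r oppr0 expR0 mul1r in e1.
  by rewrite -e1; ring.
have cv : (fun n : nat => n.+1%:R^-1 + y) @ \oo --> 0 + y.
  by apply: cvgseqD; [exact: cvg_harmonic|exact: cvg_cst].
apply: cvgseqM.
  apply: cvgseqB.
    by apply: cvgseqM => //; exact: cvg_part.
  by apply: cvgseqM; [exact: cvg_part|exact: cvg_cst].
apply: cvgseqV; first by rewrite add0r gt_eqF.
apply: cvgseqD; first exact: cvg_cst.
apply: (@cvgseq_continuous _ (fun x => x ^+ 2)) => //; exact: exprn_continuous.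
Qed.

Let cvg_u0 :
  (fun n : nat => \int[mu]_(u in `[- (n%:R ^+ 2), n%:R ^+ 2]) u0 u) @ \oo --> 0.
Proof.
have [f' sf] := smooth_f.
have := @cvg_boundary_integral R f f' 0 (3 + 2 * s * y) (cst (2 * s / y)) u0.
rewrite mulr0; apply => //.
- by case: sf.
- exact: (hp_smooth_continuous sf).
- exact: (hp_smooth_bound sf).
- by rewrite addr_ge0// mulr_ge0 ?(ltW y0)// mulr_ge0.
- move=> u v v0 uv1; rewrite !mul0r.
  rewrite (_ : f u v - (0 +i* 0) = f u v); last by rewrite subr0.
  exact: f_asym.
- exact: integrable_cst_itv.
- move=> u v _ /andP[v0 _] _; apply: (le_trans (Re_le_normc _)).
  rewrite normc_f ler_pM ?normc_ge0 ?invr_ge0 ?normc_ge0 ?L_le ?(ltW v0)//.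
  by rewrite lef_pV2 ?posrE ?w_gey ?(ltW v0)// (lt_le_trans y0)// w_gey// ltW.
- exact: measurable_continuous.
Qed.

(** The boundary values of [f] integrate to zero since [f] decays like
    [1 / z ^ 2]; their numerator is [cos (u s) - e^{- y s}]. *)
Lemma cvg_poisson :
  (fun n : nat => \int[mu]_(u in `[- (n%:R ^+ 2), n%:R ^+ 2])
     (y / (u ^+ 2 + y ^+ 2) * cos (u * s))) @ \oo --> pi * expR (- (y * s)).
Proof.
have dat (u : R) : is_derive u 1 (fun u => atan (u / y)) (y / (u ^+ 2 + y ^+ 2)).
  have h : is_derive u 1 (fun u : R => u / y) y^-1.
    by apply: (der_eq (derM (der_id u) (der_cst y^-1 u))); ring.
  apply: (der_eq (der_comp (is_derive1_atan _) h)).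
  have q1 : 1 + (u / y) ^+ 2 != 0 by rewrite gt_eqF// ltr_pwDl// sqr_ge0.
  by field; rewrite (gt_eqF y0) (gt_eqF (qpos u)) andbT/=.
have ci n : mu.-integrable `[- (n%:R ^+ 2), n%:R ^+ 2] (EFin \o u0).
  by apply: continuous_integrable_itv; apply: continuous_subspaceT.
have cc : continuous (fun u : R => y / (u ^+ 2 + y ^+ 2)).
  by move=> u; apply: cvgM; [exact: cvg_cst|exact: cont_cauchy].
have ic n : mu.-integrable `[- (n%:R ^+ 2), n%:R ^+ 2]
    (EFin \o (fun u : R => y / (u ^+ 2 + y ^+ 2))).
  by apply: continuous_integrable_itv; apply: continuous_subspaceT.
have split_n (n : nat) : y * \int[mu]_(u in `[- (n%:R ^+ 2), n%:R ^+ 2]) u0 u +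
   expR (- (y * s)) * (2 * atan (n%:R ^+ 2 / y)) =
   \int[mu]_(u in `[- (n%:R ^+ 2), n%:R ^+ 2]) (y / (u ^+ 2 + y ^+ 2) * cos (u * s)).
  have -> : 2 * atan (n%:R ^+ 2 / y) =
      \int[mu]_(u in `[- (n%:R ^+ 2), n%:R ^+ 2]) (y / (u ^+ 2 + y ^+ 2)).
    have dn (u : R) : - (n%:R ^+ 2) <= u <= n%:R ^+ 2 ->
      is_derive u 1 (fun u => atan (u / y)) (y / (u ^+ 2 + y ^+ 2)) by [].
    rewrite (RFTC2 _ dn); [by rewrite mulNr atanN; ring| |exact: continuous_subspaceT].
    by rewrite ge0_cp// ?sqr_ge0.
  rewrite -!RintegralZl// -RintegralD//; try exact: intZ.
  by apply: eq_Rintegral => u _; rewrite /u0; field; rewrite gt_eqF.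
have cat : (fun n : nat => 2 * atan (n%:R ^+ 2 / y)) @ \oo --> 2 * (pi / 2); last first.
  have := cvgseqD (@cvgseqZ R y _ _ cvg_u0) (@cvgseqZ R (expR (- (y * s))) _ _ cat).
  rewrite mulr0 add0r (_ : expR (- (y * s)) * _ = pi * expR (- (y * s))); last by field.
  by move=> h; exact: (cvgseq_eq split_n h).
apply: cvgseqZ.
suff hM : (fun n : nat => n%:R ^+ 2 / y) @ \oo --> +oo%R.
  exact: (cvg_comp _ _ hM (@cvgy_atan R)).
have cn : (n%:R : R) @[n --> \oo] --> +oo by exact: cvgr_idn.
apply/cvgryPge => A; have /cvgryPge/(_ (Num.max (A * y) 1)) := cn.
apply: filterS => n; rewrite ge_max => /andP[An n1].
by rewrite ler_pdivlMr// (le_trans An)// expr2 ler_peMl// (le_trans _ n1).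
Qed.

End poisson_kernel.

(** * Oscillatory integrals of a decreasing kernel *)

Section kernel_estimates.
Context {R : realType}.
Local Notation mu := (@lebesgue_measure R).
Variables (k dk : R -> R) (a C : R).
Hypothesis k_loc : forall T, mu.-integrable `[0, T] (EFin \o k).
Hypothesis k_gt0 : forall t, 0 < t -> 0 < k t.
Hypothesis k_der : forall t : R, 0 < t -> is_derive t 1 k (dk t).
Hypothesis dk_le0 : forall t, 0 < t -> dk t <= 0.
Hypothesis dk_cont : forall t, 0 < t -> {for t, continuous dk}.
Hypothesis a01 : 0 < a < 1.
Hypothesis k_decay : forall t, 1 <= t -> k t <= C * t `^ (- a).

Definition damped (y th x s : R) := k s * expR (- (y * s)) * cos (x * s + th).

Lemma kernel_nonincreasing s t : 0 < s -> s <= t -> k t <= k s.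
Proof.
move=> s0 st.
have dI u : s <= u <= t -> is_derive u 1 k (dk u).
  by move=> /andP[su _]; apply: k_der; exact: lt_le_trans su.
have dI' u : u \in `]s, t[ -> is_derive u 1 k (dk u).
  by rewrite in_itv/= => /andP[su ut]; apply: dI; rewrite !ltW.
have [z] := MVT_segment st dI' (is_derive_within_continuous dI).
rewrite in_itv/= => /andP[sz _] e.
by rewrite -subr_le0 e mulr_le0_ge0 ?subr_ge0// dk_le0// (lt_le_trans s0).
Qed.

Let expN_le1 (y s : R) : 0 <= y -> 0 <= s -> expR (- (y * s)) <= 1.
Proof. by move=> y0 s0; rewrite -expR0 ler_expR oppr_le0 mulr_ge0. Qed.

Let cont_damped_factor (y th x : R) :
  continuous (fun s : R => expR (- (y * s)) * cos (x * s + th)).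
Proof.
move=> s.
have h1 := der_expR (derN (derZ y (der_id s))).
have h2 := der_cos (derD (derZ x (der_id s)) (der_cst th s)).
exact: (der_cvg (derM h1 h2)).
Qed.

Lemma damped_le (y th x s : R) : 0 <= y -> 0 <= s -> `|damped y th x s| <= `|k s|.
Proof.
move=> y0 s0; rewrite /damped -mulrA normrM ler_piMr// normrM.
by rewrite mulr_ile1// ?(ger0_norm (expR_ge0 _)) ?expN_le1// cos_max.
Qed.

Lemma measurable_damped (y th x : R) (D : set (measurableTypeR R)) : measurable D ->
  measurable_fun D k -> measurable_fun D (damped y th x).
Proof.
move=> mD mk; rewrite (_ : damped y th x =
  (fun s => k s * (expR (- (y * s)) * cos (x * s + th)))); last first.
  by apply/funext => s; rewrite /damped mulrA.
apply: measurable_funM => //; apply: measurable_funTS.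
exact: measurable_continuous.
Qed.

Lemma integrable_damped (y th x T : R) : 0 <= y ->
  mu.-integrable `[0, T] (EFin \o damped y th x).
Proof.
move=> y0; have mD : measurable (`[0, T]%classic : set (measurableTypeR R)).
  exact: measurable_itv.
have mk := int_measurable mD (k_loc T).
apply: (@integrable_dominated _ _ _ mu _ _ (fun s : measurableTypeR R => `|k s|)) => //.
- exact: measurable_damped.
- exact: integrable_norm.
- by move=> s; rewrite /= in_itv/= => /andP[s0 _]; exact: damped_le.
Qed.

(** Second mean value estimate: integrating by parts, a decreasing kernel
    integrated against an oscillation of frequency [x] beyond [A] contributes at
    most [2 k A / |x|]. *)
Lemma damped_tail (y th x A B : R) : 0 <= y -> x != 0 -> 0 < A -> A <= B ->
  `|\int[mu]_(s in `[A, B]) damped y th x s| <= 2 * k A / `|x|.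
Proof.
move=> y0 x0 A0 AB.
pose kap s := k s * expR (- (y * s)).
pose dkap s := (dk s - y * k s) * expR (- (y * s)).
have dE (s : R) : 0 < s -> is_derive s 1 kap (dkap s).
  move=> s0; have h1 := der_expR (derN (derZ y (der_id s))).
  by apply: (der_eq (derM (k_der s0) h1)); rewrite /dkap; ring.
have kap_ge0 s : 0 < s -> 0 <= kap s.
  by move=> s0; rewrite mulr_ge0 ?expR_ge0// ltW// k_gt0.
have dkap_le0 s : 0 < s -> dkap s <= 0.
  move=> s0; rewrite mulr_le0_ge0 ?expR_ge0// subr_le0.
  by rewrite (le_trans (dk_le0 s0))// mulr_ge0// ltW// k_gt0.
have cdkap s : 0 < s -> {for s, continuous dkap}.
  move=> s0; apply: cvgM; first (apply: cvgB; first exact: dk_cont).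
    by apply: cvgM; [exact: cvg_cst|exact: der_cvg (k_der s0)].
  exact: (der_cvg (der_expR (derN (derZ y (der_id s))))).
have dsin (s : R) : is_derive s 1 (fun s => sin (x * s + th) / x) (cos (x * s + th)).
  have h := der_sin (derD (derZ x (der_id s)) (der_cst th s)).
  by apply: (der_eq (derM h (der_cst x^-1 s))); field.
have csin (s : R) : {for s, continuous (fun s : R => sin (x * s + th) / x)}.
  exact: der_cvg (dsin s).
have within (h : R -> R) : (forall s, 0 < s -> {for s, continuous h}) ->
    {within `[A, B], continuous h}.
  move=> ch; apply: continuous_in_subspaceT => s /[!inE]/=.
  by rewrite in_itv/= => /andP[As _]; apply: ch; exact: lt_le_trans As.
have c1 : {within `[A, B], continuous (fun s => dkap s * (sin (x * s + th) / x))}.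
  by apply: within => s s0; apply: cvgM; [exact: cdkap|exact: csin].
have c2 : {within `[A, B], continuous (damped y th x)}.
  apply: within => s s0; apply: cvgM; first exact: der_cvg (dE s s0).
  exact: der_cvg (der_cos (derD (derZ x (der_id s)) (der_cst th s))).
have c3 : {within `[A, B], continuous (fun s => - dkap s / `|x|)}.
  apply: within => s s0; apply: cvgM; last exact: cvg_cst.
  by apply: cvgN; exact: cdkap.
(* integration by parts, the primitive of the oscillation being bounded by 1 / |x| *)
have parts : \int[mu]_(s in `[A, B]) damped y th x s =
   (kap B * (sin (x * B + th) / x) - kap A * (sin (x * A + th) / x)) -
   \int[mu]_(s in `[A, B]) (dkap s * (sin (x * s + th) / x)).
  apply/eqP; rewrite -subr_eq opprK; apply/eqP.
  rewrite -RintegralD//; try exact: continuous_integrable_itv.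
  apply: (@RFTC2 _ (fun s => kap s * (sin (x * s + th) / x))) => //.
    move=> s /andP[As _]; have s0 : 0 < s by exact: lt_le_trans As.
    by apply: (der_eq (derM (dE s s0) (dsin s))); rewrite /damped /kap addrC.
  apply: within => s s0; apply: cvgD.
    apply: cvgM; first exact: der_cvg (dE s s0).
    exact: der_cvg (der_cos (derD (derZ x (der_id s)) (der_cst th s))).
  by apply: cvgM; [exact: cdkap|exact: csin].
have B0 : 0 < B by exact: lt_le_trans AB.
have sinx s : `|sin (x * s + th) / x| <= `|x|^-1.
  by rewrite normrM normfV ler_piMl ?invr_ge0// sin_max.
have bpart : `|\int[mu]_(s in `[A, B]) (dkap s * (sin (x * s + th) / x))|
    <= (kap A - kap B) / `|x|.
  apply: (le_trans (le_normr_Rintegral _ _)) => //.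
    exact: continuous_integrable_itv.
  (* monotonicity: the total variation of kap telescopes *)
  have -> : (kap A - kap B) / `|x| = \int[mu]_(s in `[A, B]) (- dkap s / `|x|).
    have dn s : A <= s <= B -> is_derive s 1 (fun s => - kap s / `|x|) (- dkap s / `|x|).
      move=> /andP[As _]; have s0 : 0 < s by exact: lt_le_trans As.
      by apply: (der_eq (derM (derN (dE s s0)) (der_cst `|x|^-1 s))); ring.
    by rewrite (RFTC2 AB dn c3); ring.
  apply: le_Rintegral => //; try exact: continuous_integrable_itv.
    by apply: continuous_integrable_itv => s; apply: cvg_norm; exact: c1.
  move=> s; rewrite /= in_itv/= => /andP[As _].
  have s0 : 0 < s by exact: lt_le_trans As.
  by rewrite normrM ler0_norm ?dkap_le0// ler_wpM2l// oppr_ge0 dkap_le0.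
have kA : kap A <= k A.
  by rewrite ler_piMr ?expN_le1 ?(ltW (k_gt0 A0))// ltW.
rewrite parts; apply: (le_trans (ler_normB _ _)).
apply: (@le_trans _ _ (2 * kap A / `|x|)); last first.
  by rewrite ler_wpM2r// ?invr_ge0// ler_wpM2l.
rewrite (_ : 2 * kap A / `|x| = (kap B / `|x| + kap A / `|x|) + (kap A - kap B) / `|x|);
  last by ring.
rewrite lerD// (le_trans (ler_normB _ _))//.
by rewrite lerD// normrM ger0_norm ?kap_ge0// ler_wpM2l// kap_ge0.
Qed.

Definition kmass (T : R) := \int[mu]_(s in `[0, T]) `|k s|.

Lemma damped_le_kmass (y th x T : R) : 0 <= y ->
  `|\int[mu]_(s in `[0, T]) damped y th x s| <= kmass T.
Proof.
move=> y0; have h := integrable_damped th x T y0.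
apply: (le_trans (le_normr_Rintegral _ h)) => //.
apply: le_Rintegral => //.
- exact: integrable_norm.
- by apply: integrable_norm; exact: k_loc.
- by move=> s; rewrite /= in_itv/= => /andP[s0 _]; exact: damped_le.
Qed.

Lemma split_itv (f : R -> R) (A B : R) : 0 <= A -> A <= B ->
  mu.-integrable `[0, B] (EFin \o f) ->
  \int[mu]_(s in `[0, B]) f s =
  \int[mu]_(s in `[0, A]) f s + \int[mu]_(s in `[A, B]) f s.
Proof.
move=> A0 AB intf.
have := @Rintegral_itvB R f (BLeft 0) (BRight B) A intf.
rewrite !bnd_simp => /(_ A0 AB) /eqP; rewrite subr_eq => /eqP ->.
rewrite addrC; congr (_ + _); rewrite Rintegral_itv_obnd_cbnd//.
apply: integrableS intf => //.
by apply: subset_itv; rewrite bnd_simp.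
Qed.

Lemma kmass_ge0 T : 0 <= kmass T.
Proof. exact: Rintegral_ge0. Qed.

Lemma kmass_nd S T : S <= T -> kmass S <= kmass T.
Proof.
move=> ST; have [S0|S0] := leP 0 S; last first.
  rewrite /kmass (_ : `[0, S]%classic = set0) ?Rintegral_set0 ?Rintegral_ge0//.
  by apply/seteqP; split => // s; rewrite /= in_itv/= => /andP[]; lra.
rewrite /kmass (@split_itv _ S T)//; last first.
  by apply: integrable_norm; exact: k_loc.
by rewrite lerDl Rintegral_ge0.
Qed.

Lemma le_kmass A : 0 < A -> k A * A <= kmass A.
Proof.
move=> A0; rewrite /kmass.
have intk : mu.-integrable `[0, A] (EFin \o (fun s => `|k s|)).
  by apply: integrable_norm; exact: k_loc.
have intk' : mu.-integrable `]0, A] (EFin \o (fun s => `|k s|)).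
  by apply: integrableS intk => //; apply: subset_itv; rewrite bnd_simp.
rewrite -Rintegral_itv_obnd_cbnd//.
have -> : k A * A = \int[mu]_(s in `]0, A]) k A.
  by rewrite Rintegral_cst//= lebesgue_measure_itv/= lte_fin A0/= subr0.
apply: le_Rintegral => //.
  apply: (@integrableS _ _ _ mu `[0, A]) => //.
    by apply: subset_itv; rewrite bnd_simp.
  exact: integrable_cst_itv.
move=> s; rewrite /= in_itv/= => /andP[s0 sA].
by rewrite ger0_norm ?(ltW (k_gt0 s0))// kernel_nonincreasing.
Qed.

(** Up to [1 / |x|] the integrand is bounded by the kernel; beyond, oscillation
    takes over, and [k A * A] is again at most the mass of the kernel on [[0, A]]. *)
Lemma damped_bound_kmass (y th x T : R) : 0 <= y -> x != 0 ->
  `|\int[mu]_(s in `[0, T]) damped y th x s| <= 3 * kmass `|x|^-1.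
Proof.
move=> y0 x0; have ax0 : 0 < `|x| by rewrite normr_gt0.
have iax0 : 0 < `|x|^-1 by rewrite invr_gt0.
have [Tx|xT] := leP T `|x|^-1.
  rewrite (le_trans (damped_le_kmass _ _ _ y0))// (le_trans (kmass_nd Tx))//.
  by rewrite ler_peMl ?kmass_ge0// ler1n.
rewrite (@split_itv _ `|x|^-1) ?(ltW iax0) ?(ltW xT)//; last exact: integrable_damped.
apply: (le_trans (ler_normD _ _)).
have h1 := damped_le_kmass th x `|x|^-1 y0.
have h2 := damped_tail th y0 x0 iax0 (ltW xT).
have h3 := le_kmass iax0.
by rewrite -mulrA in h2; lra.
Qed.

End kernel_estimates.

Section kernel_bounds.
Context {R : realType}.
Local Notation mu := (@lebesgue_measure R).
Variables (k dk : R -> R) (a C : R).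
Hypothesis k_loc : forall T, mu.-integrable `[0, T] (EFin \o k).
Hypothesis k_gt0 : forall t, 0 < t -> 0 < k t.
Hypothesis k_der : forall t : R, 0 < t -> is_derive t 1 k (dk t).
Hypothesis dk_le0 : forall t, 0 < t -> dk t <= 0.
Hypothesis dk_cont : forall t, 0 < t -> {for t, continuous dk}.
Hypothesis a01 : 0 < a < 1.
Hypothesis k_decay : forall t, 1 <= t -> k t <= C * t `^ (- a).


Let b_gt0 : 0 < 1 - a. Proof. by case/andP: a01 => ? ?; lra. Qed.

Let C_gt0 : 0 < C.
Proof.
have := k_decay (lexx 1); rewrite powR1 mulr1; apply: lt_le_trans.
exact: k_gt0.
Qed.

(** A bound on the transform of the kernel at frequency [x]: the mass on
    [[0, 1 / |x|]] of a kernel decaying like [t ^ (- a)] grows like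
    [|x| ^ (- (1 - a))], which is integrable at the origin. *)
Definition kbound (x : R) := 3 * (kmass k 1 + C / (1 - a)) * (1 + `|x| `^ (- (1 - a))).

Let kmass_powR (T : R) : 1 <= T -> kmass k T <= kmass k 1 + C / (1 - a) * T `^ (1 - a).
Proof.
move=> T1; rewrite [X in X <= _]/kmass (@split_itv _ _ 1 T)//; last first.
  by apply: integrable_norm; exact: k_loc.
rewrite lerD2l.
have dp (s : R) : 1 <= s <= T -> is_derive s 1
    (fun s => C / (1 - a) * s `^ (1 - a)) (C * s `^ (- a)).
  move=> /andP[s1 _]; have s0 : 0 < s by exact: lt_le_trans s1.
  apply: (der_eq (derZ _ (is_derive1_powR (1 - a) s0))).
  rewrite (_ : 1 - a - 1 = - a); last by ring.
  by field; rewrite gt_eqF.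
have cp : {within `[1, T], continuous (fun s => C * s `^ (- a))}.
  apply: continuous_in_subspaceT => s /[!inE]/=; rewrite in_itv/= => /andP[s1 _].
  have s0 : 0 < s by exact: lt_le_trans s1.
  exact: (der_cvg (derZ C (is_derive1_powR (- a) s0))).
apply: (@le_trans _ _ (\int[mu]_(s in `[1, T]) (C * s `^ (- a)))).
  apply: le_Rintegral => //.
  - apply: integrable_norm.
    apply: integrableS (k_loc T) => //.
    by apply: subset_itv; rewrite bnd_simp.
  - exact: continuous_integrable_itv.
  - move=> s; rewrite /= in_itv/= => /andP[s1 _].
    by rewrite ger0_norm ?k_decay// ltW// k_gt0// (lt_le_trans ltr01).
rewrite (RFTC2 T1 dp cp) gerBl mulr_ge0 ?powR_ge0//.
by rewrite divr_ge0// ltW.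
Qed.

Lemma kmass_le_kbound x : x != 0 -> 3 * kmass k `|x|^-1 <= kbound x.
Proof.
move=> x0; rewrite /kbound -mulrA ler_wpM2l//.
have ax0 : 0 < `|x| by rewrite normr_gt0.
have C0 : 0 <= C / (1 - a) by rewrite divr_ge0// ltW.
have K0 := kmass_ge0 k 1; have P0 := powR_ge0 `|x| (- (1 - a)).
have [x1|x1] := leP 1 `|x|.
  have := kmass_nd k_loc (_ : `|x|^-1 <= 1); rewrite invf_le1// => /(_ x1) h.
  rewrite (le_trans h)// mulrDr mulr1 -addrA lerDl addr_ge0//.
  by rewrite mulr_ge0// addr_ge0.
have := @kmass_powR `|x|^-1; rewrite invf_ge1// (ltW x1) => /(_ isT).
rewrite -(powR_inv1 (normr_ge0 x)) -powRrM mulN1r.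
move: (`|x| `^ (- (1 - a))) P0 => p p0 /le_trans; apply.
by have := mulr_ge0 K0 p0; lra.
Qed.

Lemma damped_bound (y th x T : R) : 0 <= y -> x != 0 ->
  `|\int[mu]_(s in `[0, T]) damped k y th x s| <= kbound x.
Proof.
move=> y0 x0; apply: le_trans (kmass_le_kbound x0).
exact: (damped_bound_kmass k_loc k_gt0 k_der dk_le0 dk_cont).
Qed.

Lemma kbound_ge0 x : 0 <= kbound x.
Proof.
apply: mulr_ge0; last by rewrite addr_ge0// powR_ge0.
by rewrite mulr_ge0// addr_ge0 ?kmass_ge0// divr_ge0// ltW.
Qed.

(** Although the bound may blow up at zero frequency, multiplication by the
    frequency leaves at most linear growth. *)
Lemma kbound_mulr : exists2 M, 0 <= M & forall x, `|x| * kbound x <= M * (1 + `|x|).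
Proof.
pose M := 3 * (kmass k 1 + C / (1 - a)).
have M0 : 0 <= M by rewrite mulr_ge0// addr_ge0 ?kmass_ge0// divr_ge0// ltW.
exists (M * 2) => [|x]; first by rewrite mulr_ge0.
have [->|x0] := eqVneq x 0; first by rewrite normr0 mul0r addr0 mulr1 mulr_ge0.
have ax0 : 0 < `|x| by rewrite normr_gt0.
rewrite /kbound -/M mulrCA -[leRHS]mulrA ler_wpM2l// mulrDr mulr1.
suff : `|x| * `|x| `^ (- (1 - a)) <= 1 + `|x| by lra.
rewrite -{1}(powRr1 (ltW ax0)) -powRD; last first.
  by apply/implyP => _; rewrite gt_eqF.
rewrite (_ : 1 + - (1 - a) = a); last by ring.
case/andP: a01 => a0 a1.
have [x1|x1] := leP 1 `|x|.
  apply: (@le_trans _ _ (`|x| `^ 1)); first by rewrite ler_powR// ltW.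
  by rewrite powRr1 ?(ltW ax0)// lerDr.
apply: (@le_trans _ _ 1); last by rewrite lerDl.
have := @ge0_ler_powR _ _ (ltW a0) `|x| 1; rewrite powR1; apply; rewrite ?nnegrE//.
exact: ltW.
Qed.

Let absp_itv (n : nat) : (0 < n)%N ->
  \int[mu]_(x in `[n%:R^-1, 1]) (`|x| `^ (- (1 - a))) <= a^-1.
Proof.
move=> n0; case/andP: a01 => a0 a1.
have n1 : 0 < n%:R^-1 :> R by rewrite invr_gt0 ltr0n.
have n2 : n%:R^-1 <= 1 :> R by rewrite invf_le1 ?ltr0n// ler1n.
have dp (s : R) : n%:R^-1 <= s <= 1 -> is_derive s 1
    (fun s => a^-1 * s `^ a) (`|s| `^ (- (1 - a))).
  move=> /andP[ns _]; have s0 : 0 < s by exact: lt_le_trans ns.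
  apply: (der_eq (derZ _ (is_derive1_powR a s0))).
  rewrite (gtr0_norm s0) (_ : - (1 - a) = a - 1); last by ring.
  by rewrite mulrA mulVf ?mul1r// gt_eqF.
have cp : {within `[n%:R^-1, 1], continuous (fun s : R => `|s| `^ (- (1 - a)))}.
  apply: continuous_in_subspaceT => s /[!inE]/=; rewrite in_itv/= => /andP[ns _].
  have s0 : 0 < s by exact: lt_le_trans ns.
  have h := der_cvg (is_derive1_powR (- (1 - a)) s0).
  apply: (@continuous_comp _ _ _ (fun x : R => `|x|) (fun x => x `^ (- (1 - a)))).
    exact: norm_continuous.
  by rewrite gtr0_norm.
rewrite (RFTC2 n2 dp cp) powR1 mulr1 gerBl.
by rewrite mulr_ge0 ?powR_ge0// invr_ge0 ltW.
Qed.

Let absp_itvN (n : nat) : (0 < n)%N ->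
  \int[mu]_(x in `[- 1, - n%:R^-1]) (`|x| `^ (- (1 - a))) <= a^-1.
Proof.
move=> n0; have n2 : n%:R^-1 <= 1 :> R by rewrite invf_le1 ?ltr0n// ler1n.
have n1 : 0 < n%:R^-1 :> R by rewrite invr_gt0 ltr0n.
apply: le_trans (absp_itv n0).
rewrite /Rintegral integration_by_substitution_oppr//; last first.
  apply: continuous_in_subspaceT => s /[!inE]/=; rewrite in_itv/= => /andP[_ ns].
  have s0 : 0 < `|s| by rewrite normr_gt0 lt_eqF//; lra.
  have h := der_cvg (is_derive1_powR (- (1 - a)) s0).
  apply: (@continuous_comp _ _ _ (fun x : R => `|x|) (fun x => x `^ (- (1 - a)))) => //.
  exact: norm_continuous.
rewrite le_eqVlt; apply/orP; left; apply/eqP; congr fine.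
by apply: eq_integral => x _; rewrite fctE /= normrN.
Qed.

Let mabsp : measurable_fun (setT : set (measurableTypeR R))
  (fun x : R => `|x| `^ (- (1 - a))).
Proof.
exact: (measurableT_comp (measurable_powR (R := R) (- (1 - a)))
  (measurable_continuous (@norm_continuous R R))).
Qed.

Let integrable_absp : mu.-integrable `[- 1, 1] (EFin \o (fun x : R => `|x| `^ (- (1 - a)))).
Proof.
case/andP: a01 => a0 a1.
pose F (n : nat) : set (measurableTypeR R) :=
  `[- 1, - n.+1%:R^-1]%classic `|` `[n.+1%:R^-1, 1]%classic.
have mF n : measurable (F n) by apply: measurableU; exact: measurable_itv.
have Fx n (x : R) : F n x <->
    (- 1 <= x <= - n.+1%:R^-1) \/ (n.+1%:R^-1 <= x <= 1).
  by rewrite /F/= !in_itv.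
have FU : \bigcup_n F n = `[- 1, 1]%classic `\ 0.
  apply/seteqP; split => x /=; rewrite in_itv/=.
    move=> [n _ /Fx]; have n2 : n.+1%:R^-1 <= 1 :> R by rewrite invf_le1 ?ltr0n// ler1n.
    have n1 : 0 < n.+1%:R^-1 :> R by rewrite invr_gt0 ltr0n.
    move: (n.+1%:R^-1) n1 n2 (x : R) => e n1 n2 {}x.
    by move=> [/andP[h1 h2]|/andP[h1 h2]]; split;
      [apply/andP; split; lra|move=> x0; lra|apply/andP; split; lra|move=> x0; lra].
  move=> -[/andP[h1 h2] /eqP x0].
  have ax0 : 0 < `|x| by rewrite normr_gt0.
  have [n nx] := ltr_add_invr ax0; rewrite add0r in nx.
  exists n => //; apply/Fx.
  have [xp|xn] := ltP 0 x.
    by right; rewrite gtr0_norm// in nx; rewrite (ltW nx).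
  by left; rewrite ler0_norm// in nx; rewrite h1/= lerNr ltW.
have nFn n : (0 < n.+1%:R^-1 :> R) by rewrite invr_gt0 ltr0n.
apply/integrableP; split; first exact/measurable_EFinP/measurable_funTS.
rewrite (_ : (\int[mu]_(x in _) _ = \int[mu]_(x in \bigcup_n F n)
   (`|x| `^ (- (1 - a)))%:E)%E); last first.
  rewrite FU integral_setD1_EFin//=.
  - by apply: eq_integral => x _; rewrite ger0_norm// powR_ge0.
  - by apply: measurableD => //; exact: measurable_itv.
  - exact/measurable_EFinP/measurable_funTS.
have ndF : {homo F : n m / (n <= m)%N >-> (n <= m)%O}.
  move=> m n mn; apply/subsetPset => x /Fx h'; apply/Fx; move: h'.
  have h : n.+1%:R^-1 <= m.+1%:R^-1 :> R by rewrite lef_pV2 ?posrE ?ltr0n// ler_nat.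
  move: (n.+1%:R^-1) (m.+1%:R^-1) (x : R) h => e e' {}x h.
  by move=> [/andP[h1 h2]|/andP[h1 h2]]; [left|right]; apply/andP; split; lra.
have mfF i : measurable_fun (F i) (fun x : measurableTypeR R => (`|x| `^ (- (1 - a)))%:E).
  exact/measurable_EFinP/measurable_funTS.
have ge0F i (x : measurableTypeR R) : F i x -> (0 <= (`|x| `^ (- (1 - a)))%:E)%E.
  by rewrite lee_fin powR_ge0.
have cv := @ge0_nondecreasing_set_cvg_integral _ (measurableTypeR R) R F
  _ mu ndF mF mfF ge0F.
rewrite -(cvg_lim _ cv)//.
apply: (@le_lt_trans _ _ (a^-1 + a^-1)%:E); last by rewrite ltry.
apply: lime_le; first by apply/cvg_ex; eexists; exact: cv.
apply: nearW => n.
have cw (A B : R) : 0 < A \/ B < 0 -> {within `[A, B], continuous (fun s : R => `|s| `^ (- (1 - a)))}.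
  move=> AB; apply: continuous_in_subspaceT => s /[!inE]/=; rewrite in_itv/= => /andP[h1 h2].
  have s0 : 0 < `|s|.
    by rewrite normr_gt0; case: AB => h; [rewrite gt_eqF//; lra|rewrite lt_eqF//; lra].
  have h := der_cvg (is_derive1_powR (- (1 - a)) s0).
  apply: (@continuous_comp _ _ _ (fun x : R => `|x|) (fun x => x `^ (- (1 - a)))) => //.
  exact: norm_continuous.
rewrite /F ge0_integral_setU//=; last 2 first.
- exact/measurable_EFinP/measurable_funTS.
- apply/disj_setPS => x [] /=; rewrite !in_itv/= => /andP[_ h1] /andP[h2 _].
  move: (n.+1%:R^-1) (nFn n) (x : R) h1 h2 => e e0 {}x h1 h2.
  by have := lt_le_trans e0 (le_trans h2 h1); rewrite oppr_gt0 => /(lt_trans e0); rewrite ltxx.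
rewrite EFinD leeD//.
- rewrite -[leLHS]fineK; first by rewrite lee_fin; exact: absp_itvN.
  apply: integrable_fin_num => //; apply: continuous_integrable_itv; apply: cw.
  by right; rewrite oppr_lt0.
- rewrite -[leLHS]fineK; first by rewrite lee_fin; exact: absp_itv.
  apply: integrable_fin_num => //; apply: continuous_integrable_itv; apply: cw.
  by left.
Qed.

Lemma integrable_kbound : mu.-integrable `[- 1, 1] (EFin \o kbound).
Proof.
rewrite /kbound; apply: intZ => //; apply: intD => //.
  exact: (integrable_cst_itv 1).
Qed.

End kernel_bounds.

Section kernel_transform.
Context {R : realType}.
Local Notation mu := (@lebesgue_measure R).
Variables (k dk : R -> R) (a C : R).
Hypothesis k_loc : forall T, mu.-integrable `[0, T] (EFin \o k).
Hypothesis k_gt0 : forall t, 0 < t -> 0 < k t.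
Hypothesis k_der : forall t : R, 0 < t -> is_derive t 1 k (dk t).
Hypothesis dk_le0 : forall t, 0 < t -> dk t <= 0.
Hypothesis dk_cont : forall t, 0 < t -> {for t, continuous dk}.
Hypothesis a01 : 0 < a < 1.
Hypothesis k_decay : forall t, 1 <= t -> k t <= C * t `^ (- a).


Lemma kernel_cvg0 : k n%:R @[n --> \oo] --> 0.
Proof.
case/andP: a01 => a0 a1.
apply: (@cvg_dist_le _ 1%N _ (fun n : nat => C * (n%:R `^ a)^-1)).
  move=> n n0; have n1 : 1 <= n%:R :> R by rewrite ler1n.
  rewrite subr0 ger0_norm; first by rewrite -powRN k_decay.
  by rewrite ltW// k_gt0// (lt_le_trans ltr01).
rewrite -[X in _ --> X](mulr0 C); apply: cvgseqZ.
have h : (fun n : nat => (n%:R^-1 : R) `^ a) @ \oo --> 0.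
  apply/cvgrPdist_le => e e0.
  have /cvgrPdist_le h := @cvg_invn R.
  have ea : 0 < e `^ a^-1 by rewrite powR_gt0.
  have := h _ ea; apply: filterS => n; rewrite !sub0r !normrN => hn.
  rewrite ger0_norm ?powR_ge0//.
  have := @ge0_ler_powR _ _ (ltW a0) (n%:R^-1) (e `^ a^-1).
  rewrite !nnegrE powR_ge0 invr_ge0 ler0n => /(_ isT isT).
  rewrite -powRrM mulVf ?gt_eqF// powRr1 ?(ltW e0)//; apply.
  by rewrite ger0_norm// in hn.
apply: (cvgseq_eq _ h) => n.
by rewrite -(powR_inv1 (ler0n R n)) -powRrM mulN1r powRN.
Qed.

Let bound_tail (x : R) (y th : R) (m n : nat) : 0 <= y -> x != 0 -> (0 < m)%N -> (m <= n)%N ->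
  `|\int[mu]_(s in `[0, n%:R]) damped k y th x s -
    \int[mu]_(s in `[0, m%:R]) damped k y th x s| <= 2 * k m%:R / `|x|.
Proof.
move=> y0 x0 m0 mn; rewrite (@split_itv _ _ m%:R n%:R)//; first last.
- exact: (integrable_damped k_loc).
- by rewrite ler_nat.
rewrite addrAC subrr add0r.
apply: (damped_tail k_gt0 k_der dk_le0 dk_cont) => //; first by rewrite ltr0n.
by rewrite ler_nat.
Qed.

(** The conditionally convergent transform
    [int_0^oo k s e^{- y s} cos (x s + th) ds]. *)
Definition ktrans (y th x : R) : R :=
  limn (fun n : nat => \int[mu]_(s in `[0, n%:R]) damped k y th x s).

Lemma cvg_ktrans y th x : 0 <= y -> x != 0 ->
  (fun n : nat => \int[mu]_(s in `[0, n%:R]) damped k y th x s) @ \oo -->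
  ktrans y th x.
Proof.
move=> y0 x0; apply/cauchy_cvgP/cauchy_exP => e e0.
have ax0 : 0 < `|x| by rewrite normr_gt0.
have : (fun n : nat => 2 * k n%:R / `|x|) @ \oo --> 2 * 0 / `|x|.
  by apply: cvgseqM; [apply: cvgseqZ; exact: kernel_cvg0|exact: cvg_cst].
rewrite mulr0 mul0r => /cvgrPdist_lt/(_ _ e0)[N _ hN].
exists (\int[mu]_(s in `[0, N.+1%:R]) damped k y th x s).
exists N.+1 => // n /= Nn.
have := hN N.+1 (leqnSn N); rewrite sub0r normrN => hN'.
rewrite /ball/= distrC.
apply: (le_lt_trans (bound_tail _ y0 x0 _ Nn)) => //.
by apply: le_lt_trans hN'; exact: ler_norm.
Qed.

Lemma ktrans_tail y th x (m : nat) : 0 <= y -> x != 0 -> (0 < m)%N ->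
  `|ktrans y th x - \int[mu]_(s in `[0, m%:R]) damped k y th x s| <= 2 * k m%:R / `|x|.
Proof.
move=> y0 x0 m0.
have cv : (fun n : nat => `|\int[mu]_(s in `[0, n%:R]) damped k y th x s -
     \int[mu]_(s in `[0, m%:R]) damped k y th x s|) @ \oo -->
  `|ktrans y th x - \int[mu]_(s in `[0, m%:R]) damped k y th x s|.
  by apply: cvg_norm; apply: cvgseqB; [exact: cvg_ktrans|exact: cvg_cst].
rewrite -(cvg_lim _ cv)//; apply: limr_le; first by apply/cvg_ex; eexists; exact: cv.
by near=> n; apply: bound_tail => //; near: n; exists m.
Unshelve. all: by end_near. Qed.

Lemma ktrans_bound y th x : 0 <= y -> x != 0 -> `|ktrans y th x| <= kbound k a C x.
Proof.
move=> y0 x0.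
apply: (cvgseq_norm_le (@cvg_ktrans y th x y0 x0)) => n.
exact: (damped_bound k_loc k_gt0 k_der dk_le0 dk_cont a01 k_decay).
Qed.

(** Abel's theorem: the tails are small uniformly in the damping, so that the
    damping may be removed in the limit. *)
Lemma ktrans_abel th x : x != 0 ->
  (fun n : nat => ktrans n.+1%:R^-1 th x) @ \oo --> ktrans 0 th x.
Proof.
move=> x0; have ax0 : 0 < `|x| by rewrite normr_gt0.
apply/cvgrPdist_le => e e0.
have : (fun n : nat => 2 * k n%:R / `|x|) @ \oo --> 2 * 0 / `|x|.
  by apply: cvgseqM; [apply: cvgseqZ; exact: kernel_cvg0|exact: cvg_cst].
have e4 : 0 < e / 4 by rewrite divr_gt0.
rewrite mulr0 mul0r => /cvgrPdist_lt/(_ _ e4)[N _ hN].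
have := hN N.+1 (leqnSn N); rewrite sub0r normrN => hN'.
have {}hN : 2 * k N.+1%:R / `|x| <= e / 4.
  by apply/ltW; apply: le_lt_trans hN'; exact: ler_norm.
have cw : (fun n : nat => n.+1%:R^-1 * N.+1%:R * kmass k N.+1%:R) @ \oo -->
    0 * N.+1%:R * kmass k N.+1%:R.
  apply: cvgseqM; last exact: cvg_cst.
  by apply: cvgseqM; [exact: cvg_harmonic|exact: cvg_cst].
rewrite !mul0r in cw.
have e2 : 0 < e / 2 by rewrite divr_gt0.
have /cvgrPdist_le/(_ _ e2) := cw.
apply: filterS => n; rewrite sub0r normrN => hn.
have y0 : 0 <= n.+1%:R^-1 :> R by rewrite invr_ge0.
have t1 := ktrans_tail th (lexx 0) x0 (ltn0Sn N).
have t2 := ktrans_tail th y0 x0 (ltn0Sn N).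
have t3 : `|\int[mu]_(s in `[0, N.+1%:R]) damped k 0 th x s -
    \int[mu]_(s in `[0, N.+1%:R]) damped k n.+1%:R^-1 th x s| <=
    n.+1%:R^-1 * N.+1%:R * kmass k N.+1%:R.
  have i0 := integrable_damped k_loc th x N.+1%:R (lexx 0).
  have i1 := integrable_damped k_loc th x N.+1%:R y0.
  rewrite -RintegralB//.
  apply: (le_trans (le_normr_Rintegral _ _)) => //; first exact: intB.
  rewrite /kmass -RintegralZl//; last by apply: integrable_norm; exact: k_loc.
  apply: le_Rintegral => //.
  - by apply: integrable_norm; exact: intB.
  - by apply: intZ => //; apply: integrable_norm; exact: k_loc.
  move=> s; rewrite /= in_itv/= => /andP[s0 sN].
  rewrite /damped mul0r oppr0 expR0 mulr1 -mulrA -mulrBr normrM mulrC.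
  rewrite ler_wpM2r// -{1}[cos _]mul1r -mulrBl normrM.
  rewrite (@le_trans _ _ `|1 - expR (- (n.+1%:R^-1 * s))|)//.
    by rewrite ler_piMr// cos_max.
  have ns0 : 0 <= n.+1%:R^-1 * s by rewrite mulr_ge0.
  have E1 : expR (- (n.+1%:R^-1 * s)) <= 1 by rewrite -[leRHS]expR0 ler_expR oppr_le0.
  rewrite ger0_norm ?subr_ge0//.
  apply: (@le_trans _ _ (n.+1%:R^-1 * s)); last by rewrite ler_wpM2l.
  by rewrite lerBlDl -lerBlDr expR_ge1Dx.
have hn' := le_trans (ler_norm _) hn.
have tri (p q r s A B D : R) : `|p - q| <= A -> `|q - r| <= B -> `|s - r| <= D ->
    `|p - s| <= A + B + D.
  rewrite (distrC s) => h1 h2 h3.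
  rewrite (_ : p - s = (p - q) + (q - r) + (r - s)); last by ring.
  by rewrite (le_trans (ler_normD _ _))// lerD// (le_trans (ler_normD _ _))// lerD.
rewrite (_ : e = e / 4 + e / 2 + e / 4); last by field.
exact: tri (le_trans t1 hN) (le_trans t3 hn') (le_trans t2 hN).
Qed.

Lemma continuous_damped_freq y th T : 0 <= y ->
  continuous (fun x => \int[mu]_(s in `[0, T]) damped k y th x s).
Proof.
move=> y0 x.
have := @continuity_under_integral _ _ _ mu (fun x s => damped k y th x s) `[0, T]
  (measurable_itv _) (x - 1) (x + 1) _ _ (fun s => `|k s|) _ _ x.
apply.
- by move=> u _; exact: (integrable_damped k_loc).
- apply: aeW => s _ u _.
  apply: (der_cvg (derM (der_cst _ _) (der_cos (derD (derM (der_id u) (der_cst s u)) (der_cst th u))))).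
- by apply: integrable_norm; exact: k_loc.
- move=> u _; apply: aeW => s; rewrite /= in_itv/= => /andP[s0 _].
  exact: damped_le.
- by rewrite inE/= in_itv/=; apply/andP; split; lra.
Qed.

Lemma measurable_ktrans y th : 0 <= y ->
  measurable_fun (setT : set (measurableTypeR R)) (ktrans y th).
Proof.
move=> y0.
pose h x := if x == 0 :> R then ktrans y th 0 else 0.
pose g (n : nat) (x : R) :=
  if x == 0 then ktrans y th 0 else \int[mu]_(s in `[0, n%:R]) damped k y th x s.
apply: (@measurable_fun_cvg _ (measurableTypeR R) R setT g) => //.
  move=> n; apply: measurable_fun_ifT => //.
    by apply: (measurable_fun_eqr) => //.
  by apply: measurable_continuous; exact: continuous_damped_freq.
move=> x _; rewrite /g; case: eqVneq => [->|x0]; first exact: cvg_cst.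
exact: cvg_ktrans.
Qed.

End kernel_transform.

(** * Positivity of the damped cosine transform *)

Section kernel_positivity.
Context {R : realType}.
Local Notation mu := (@lebesgue_measure R).
Variables (k dk : R -> R) (a C : R).
Hypothesis k_loc : forall T, mu.-integrable `[0, T] (EFin \o k).
Hypothesis k_gt0 : forall t, 0 < t -> 0 < k t.
Hypothesis k_der : forall t : R, 0 < t -> is_derive t 1 k (dk t).
Hypothesis dk_le0 : forall t, 0 < t -> dk t <= 0.
Hypothesis dk_cont : forall t, 0 < t -> {for t, continuous dk}.
Hypothesis a01 : 0 < a < 1.
Hypothesis k_decay : forall t, 1 <= t -> k t <= C * t `^ (- a).

Hypothesis k_cos : forall w, w != 0 -> 0 <= ktrans k 0 0 w.
Local Notation mR := (measurableTypeR R).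

Let mk : measurable_fun (`[0, +oo[%classic : set mR) k.
Proof.
rewrite (_ : `[0, +oo[%classic = `[0, 1]%classic `|` `]0, +oo[%classic); last first.
  apply/seteqP; split => t /=; rewrite !in_itv/= !andbT.
    rewrite le_eqVlt => /predU1P[<-|t0]; last by right.
    by left; rewrite eqxx ler01.
  by case=> [/andP[]//|/ltW].
apply/measurable_funU; [exact: measurable_itv|exact: measurable_itv|split].
  exact: (int_measurable _ (k_loc 1)).
apply: open_continuous_measurable_fun; first exact: interval_open.
move=> t /[!inE]/=; rewrite in_itv/= andbT => t0.
exact: der_cvg (k_der t0).
Qed.

Lemma exp_integrable_kernel : exp_integrable k.
Proof.
split; first exact: mk.
move=> y y0.
have mi : measurable (`[0, +oo[%classic : set mR) by exact: measurable_itv.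
have cexp : continuous (fun s : R => expR (- (y * s))).
  by move=> s; exact: (der_cvg (der_expR (derN (derZ y (der_id s))))).
apply: (@integrable_dominated _ _ _ mu _ _
  (fun s => `|(k \_ `[0, 1]) s| + k 1 * expR (- (y * s)))) => //.
- apply: measurable_funM; first exact: (measurableT_comp (@normr_measurable R setT) mk).
  by apply: measurable_funTS; exact: measurable_continuous.
- apply: intD => //; last by apply: intZ => //; exact: integrable_expN.
  apply: integrable_norm; apply: (@integrableS _ _ _ mu setT) => //.
  by rewrite -restrict_EFin; apply/integrable_restrict; rewrite ?setTI//; exact: k_loc.
move=> s; rewrite /= in_itv/= andbT => s0.
rewrite patchE.
case: ifPn; rewrite ?inE ?notin_setE/= in_itv/= s0/=.
  move=> _; rewrite -[leLHS]addr0 lerD//; last first.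
    by rewrite mulr_ge0 ?expR_ge0// ltW// k_gt0.
  have e1 : expR (- (y * s)) <= 1.
    by rewrite -[leRHS]expR0 ler_expR oppr_le0 mulr_ge0// ltW.
  rewrite normrM (ger0_norm (expR_ge0 _)).
  by rewrite normr_id; move: (expR _) e1 (normr_ge0 (k s)) => u u1 v0; rewrite -[leRHS]mulr1 ler_wpM2l.
move=> /negP; rewrite -ltNge => s1.
rewrite normr0 add0r normrM (ger0_norm (expR_ge0 _)) ler_wpM2r ?expR_ge0//.
rewrite normr_id ger0_norm; last by apply/ltW/k_gt0; exact: lt_trans s1.
by apply: (kernel_nonincreasing k_der dk_le0) => //; exact: ltW.
Qed.

Lemma cvg_integral_half_line (f : R -> R) :
  mu.-integrable `[0, +oo[ (EFin \o f) ->
  (fun n : nat => \int[mu]_(s in `[0, n%:R]) f s) @ \oo -->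
  \int[mu]_(s in `[0, +oo[) f s.
Proof.
move=> intf.
have mi : measurable (`[0, +oo[%classic : set mR) by exact: measurable_itv.
have mf := int_measurable mi intf.
have E n : \int[mu]_(s in `[0, n%:R]) f s =
    \int[mu]_(s in `[0, +oo[) (f \_ `[0, n%:R]) s.
  rewrite -Rintegral_mkcondr; congr Rintegral.
  apply/seteqP; split => t /=; rewrite !in_itv/= ?andbT; last by case.
  by move=> /andP[-> ->].
under eq_fun do rewrite E.
have [] := @Rdominated_convergence _ _ _ mu `[0, +oo[ (fun n => f \_ `[0, n%:R])
  f (fun s => `|f s|) => //.
- move=> n; have mn : measurable (`[0, n%:R]%classic : set mR) by exact: measurable_itv.
  have [h _] := measurable_restrict f mn mi; apply: h.
  by apply: (measurable_funS mi _ mf) => t [].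
- apply: aeW => s; rewrite /= in_itv/= andbT => s0.
  apply: (@cvgseq_near_cst _ (Num.truncn s).+1) => n sn.
  rewrite patchE ifT// inE/= in_itv/= s0/=.
  by rewrite (le_trans (ltW (truncnS_gt s)))// ler_nat.
- exact: integrable_norm.
- by move=> n s _; rewrite patchE; case: ifPn => // _; rewrite normr0.
Qed.

Lemma ktransE y th x : 0 < y -> x != 0 -> laplace_part k th x y = ktrans k y th x.
Proof.
move=> y0 x0; have hk := exp_integrable_kernel.
rewrite /laplace_part.
have := cvg_integral_half_line (integrable_laplace th x hk y0).
move=> /cvg_lim <-//; congr (limn _); apply/funext => n.
by apply: eq_Rintegral => s _; rewrite /damped mulrA.
Qed.

(** Cosine transforms of the truncated kernel. They need not be positive, but their
    limits are, and Poisson averages pass to that limit. *)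
Let J (T : R) (u : R) := \int[mu]_(s in `[0, T]) damped k 0 0 u s.

Let J_cont T : continuous (J T).
Proof. exact: (continuous_damped_freq k_loc). Qed.

Let J_le T u : `|J T u| <= kmass k T.
Proof. exact: (damped_le_kmass k_loc). Qed.

Let w (y u : R) := y / (u ^+ 2 + y ^+ 2).

Let w_ge0 y u : 0 < y -> 0 <= w y u.
Proof.
move=> y0; rewrite divr_ge0 ?(ltW y0)//.
by rewrite addr_ge0 ?sqr_ge0.
Qed.

Let w_le y u : 0 < y -> w y u <= y^-1.
Proof.
move=> y0; have q0 : 0 < u ^+ 2 + y ^+ 2 by rewrite ltr_wpDl ?sqr_ge0// exprn_gt0.
rewrite ler_pdivrMr// -ler_pdivrMl ?invr_gt0// invrK -expr2.
by rewrite lerDr sqr_ge0.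
Qed.

Let int_w y x : 0 < y -> mu.-integrable setT (EFin \o (fun u => w y (u - x))).
Proof. exact: integral_cauchy. Qed.

Let int_w0 y : 0 < y -> mu.-integrable setT (EFin \o w y).
Proof.
by move=> y0; have := int_w 0 y0; under eq_fun do rewrite subr0.
Qed.

(** Dominated convergence: the truncated transforms are bounded by [kbound],
    which is integrable near the origin and bounded elsewhere. *)
Let limJ y x : 0 < y -> exists2 l : R, 0 <= l &
  (fun n : nat => \int[mu]_u (w y (u - x) * J n%:R u)) @ \oo --> l.
Proof.
move=> y0.
pose h (u : R) := w y (u - x) * (if u == 0 then 0 else ktrans k 0 0 u).
pose M := 3 * (kmass k 1 + C / (1 - a)).
have M0 : 0 <= M.
  have := kbound_ge0 k_gt0 a01 k_decay 1; rewrite /kbound normr1 powR1 -/M.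
  by rewrite pmulr_lge0.
have [] := @Rdominated_convergence_ae _ _ _ mu setT
  (fun n u => w y (u - x) * J n%:R u) h
  (fun u => y^-1 * `|(kbound k a C \_ `[-1, 1]) u| + 2 * M * w y (u - x)) => //.
- move=> n; apply: measurable_funM; first exact: (int_measurable _ (int_w x y0)).
  by apply: measurable_continuous; exact: J_cont.
- apply: measurable_funM; first exact: (int_measurable _ (int_w x y0)).
  apply: measurable_fun_ifT => //; first by apply: measurable_fun_eqr.
  exact: (measurable_ktrans k_loc k_gt0 k_der dk_le0 dk_cont a01 k_decay).
- apply: (@ae_except _ 0) => u u0 _; apply: cvgseqM; first exact: cvg_cst.
  rewrite (negbTE u0).
  exact: (cvg_ktrans k_loc k_gt0 k_der dk_le0 dk_cont a01 k_decay).
- apply: intD => //; last by apply: intZ => //; exact: int_w.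
  apply: intZ => //; apply: integrable_norm.
  rewrite -restrict_EFin; apply/integrable_restrict; rewrite ?setTI//.
  exact: integrable_kbound.
- apply: (@ae_except _ 0) => u u0 n _; rewrite normrM (ger0_norm (w_ge0 _ y0)).
  have hJ : `|J n%:R u| <= kbound k a C u.
    exact: (damped_bound k_loc k_gt0 k_der dk_le0 dk_cont a01 k_decay).
  rewrite patchE; case: ifPn => [_|].
    rewrite -[leLHS]addr0 lerD//; last first.
      by rewrite mulr_ge0 ?w_ge0// mulr_ge0.
    rewrite ler_pM ?w_ge0 ?w_le//; apply: (le_trans hJ); exact: ler_norm.
  rewrite notin_setE/= in_itv/= -ler_norml => /negP; rewrite -ltNge => u1.
  rewrite normr0 mulr0 add0r mulrC ler_wpM2r ?w_ge0//.
  apply: (le_trans hJ); rewrite /kbound -/M mulrC ler_wpM2r//.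
  suff : `|u| `^ (- (1 - a)) <= 1 by lra.
  rewrite powRN invf_le1 ?powR_gt0 ?normr_gt0//.
  have := @ler_powR R `|u| (ltW u1) 0 (1 - a).
  by rewrite powRr0; apply; case/andP: a01 => ? ?; lra.
move=> _ cv; exists (\int[mu]_u h u) => //.
apply: Rintegral_ge0 => u _; rewrite /h; case: eqVneq => [_|u0]; first by rewrite mulr0.
by rewrite mulr_ge0 ?w_ge0 ?k_cos.
Qed.

Let J2_integrable y x T : 0 < y -> mu.-integrable setT (EFin \o (fun u => w y (u - x) * J T u)).
Proof.
move=> y0; have iw := int_w x y0.
apply: (@integrable_dominated _ _ _ mu setT _ (fun u => kmass k T * w y (u - x))) => //.
- apply: measurable_funM; first exact: (int_measurable _ iw).
  by apply: measurable_continuous; exact: J_cont.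
- exact: intZ.
- by move=> u _; rewrite normrM (ger0_norm (w_ge0 _ y0)) mulrC ler_wpM2r ?w_ge0.
Qed.

Let J_shift y x T : 0 < y ->
  \int[mu]_u (w y u * J T (u + x)) = \int[mu]_u (w y (u - x) * J T u).
Proof.
move=> y0; have := Rintegral_shift x (J2_integrable x T y0) => <-.
by apply: eq_Rintegral => u _; rewrite addrK.
Qed.

(** Write [pi e^{- y s}] as the Fourier transform of the Poisson kernel, exchange
    the integrals, and linearise [cos (x s) cos (u s)]. *)
Let poisson_mean y x T : 0 < y ->
  pi * \int[mu]_(s in `[0, T]) damped k y 0 x s =
  2^-1 * (\int[mu]_u (w y (u - x) * J T u) + \int[mu]_u (w y (u + x) * J T u)).
Proof.
move=> y0.
pose P (n : nat) (s : R) := \int[mu]_(u in `[- (n%:R ^+ 2), n%:R ^+ 2]) (w y u * cos (u * s)).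
have cw : continuous (w y).
  move=> u; have q0 : u ^+ 2 + y ^+ 2 != 0.
    by rewrite gt_eqF// ltr_wpDl ?sqr_ge0// exprn_gt0.
  by apply: (der_cvg (derM (der_cst y u) (derV _ (derD (derX 2 (der_id u)) (der_cst (y ^+ 2) u))))).
have mi : measurable (`[0, T]%classic : set mR) by exact: measurable_itv.
have cvP s : 0 <= s -> (fun n => P n s) @ \oo --> pi * expR (- (y * s)).
  by move=> s0; exact: cvg_poisson.
have iw (n : nat) : mu.-integrable `[- (n%:R ^+ 2), n%:R ^+ 2] (EFin \o w y).
  by apply: continuous_integrable_itv; apply: continuous_subspaceT.
have iwc (n : nat) s : mu.-integrable `[- (n%:R ^+ 2), n%:R ^+ 2]
    (EFin \o (fun u => w y u * cos (u * s))).
  apply: continuous_integrable_itv; apply: continuous_subspaceT => u.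
  by apply: cvgM; [exact: cw|exact: (der_cvg (der_cos (derM (der_id u) (der_cst s u))))].
pose W := \int[mu]_u w y u.
have P_le n s : `|P n s| <= W.
  rewrite (le_trans (le_normr_Rintegral _ (iwc n s)))//.
  rewrite /W Rintegral_mkcond.
  apply: le_Rintegral => //.
  - rewrite -restrict_EFin; apply/integrable_restrict; rewrite ?setTI//.
    exact: integrable_norm.
  - exact: int_w0.
  - move=> u _; rewrite patchE; case: ifPn => _; last exact: w_ge0.
    by rewrite normrM (ger0_norm (w_ge0 _ y0)) ler_piMr ?w_ge0// cos_max.
have mP n : continuous (P n).
  move=> s; have := @continuity_under_integral _ _ _ mu (fun s u => w y u * cos (u * s))
    `[- (n%:R ^+ 2), n%:R ^+ 2] (measurable_itv _) (s - 1) (s + 1) _ _ (w y) _ _ s.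
  apply.
  - by move=> t _; exact: iwc.
  - apply: aeW => u _ t _.
    exact: (der_cvg (derZ (w y u) (der_cos (derM (der_cst u t) (der_id t))))).
  - exact: iw.
  - move=> t _; apply: aeW => u _.
    by rewrite normrM (ger0_norm (w_ge0 _ y0)) ler_piMr ?w_ge0// cos_max.
  - by rewrite inE/= in_itv/=; apply/andP; split; lra.
have ik := integrable_damped k_loc 0 x T (lexx 0).
have c1 : (fun n => \int[mu]_(s in `[0, T]) (damped k 0 0 x s * P n s)) @ \oo -->
   pi * \int[mu]_(s in `[0, T]) damped k y 0 x s.
  rewrite -RintegralZl//; last exact: (integrable_damped k_loc _ _ _ (ltW y0)).
  have [] := @Rdominated_convergence _ _ _ mu `[0, T]
    (fun n s => damped k 0 0 x s * P n s) (fun s => pi * damped k y 0 x s)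
    (fun s => W * `|damped k 0 0 x s|) => //.
  - move=> n; apply: measurable_funM; first exact: (int_measurable mi ik).
    by apply: measurable_funTS; apply: measurable_continuous.
  - apply: measurable_funM => //; apply: (int_measurable mi).
    exact: (integrable_damped k_loc _ _ _ (ltW y0)).
  - apply: aeW => s; rewrite /= in_itv/= => /andP[s0 _].
    rewrite (_ : pi * _ = damped k 0 0 x s * (pi * expR (- (y * s)))).
      by apply: cvgseqZ; exact: cvP.
    by rewrite /damped mul0r oppr0 expR0; ring.
  - by apply: intZ => //; exact: integrable_norm.
  - by move=> n s _; rewrite normrM mulrC ler_wpM2r.
have wJ T' z : mu.-integrable setT (EFin \o (fun u => w y u * J T' (u + z))).
  apply: (@integrable_dominated _ _ _ mu setT _ (fun u => kmass k T' * w y u)) => //.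
  - apply: measurable_funM; first exact: (int_measurable _ (int_w0 y0)).
    apply: measurable_continuous => u.
    apply: (@continuous_comp _ _ _ (fun u : R => u + z) (J T')); last exact: J_cont.
    by apply: cvgD; [exact: cvg_id|exact: cvg_cst].
  - by apply: intZ => //; exact: int_w0.
  - by move=> u _; rewrite normrM (ger0_norm (w_ge0 _ y0)) mulrC ler_wpM2r ?w_ge0.
(* the exchange is done on bounded intervals, where everything is integrable *)
have swap n : \int[mu]_(s in `[0, T]) (damped k 0 0 x s * P n s) =
    \int[mu]_(u in `[- (n%:R ^+ 2), n%:R ^+ 2])
      (2^-1 * (w y u * J T (u + x)) + 2^-1 * (w y u * J T (u - x))).
  rewrite Rintegral_mkcond [RHS]Rintegral_mkcond.
  transitivity (\int[mu]_s ((damped k 0 0 x \_ `[0, T]) s *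
      \int[mu]_u ((w y \_ `[- (n%:R ^+ 2), n%:R ^+ 2]) u * cos (u * s)))).
    apply: eq_Rintegral => s _; rewrite !patchE; case: ifPn => _; last by rewrite mul0r.
    congr (_ * _); rewrite /P Rintegral_mkcond; apply: eq_Rintegral => u _.
    by rewrite !patchE; case: ifPn => _; rewrite ?mul0r.
  rewrite (@Rfubini _ _ _ _ _ mu mu _ _ (fun s u => cos (u * s)) 1)//; last 4 first.
  - by rewrite -restrict_EFin; apply/integrable_restrict; rewrite ?setTI.
  - by rewrite -restrict_EFin; apply/integrable_restrict; rewrite ?setTI.
  - apply: (measurableT_comp (measurable_continuous (@continuous_cos R))).
    exact: measurable_funM.
  - by move=> s u; exact: cos_max.
  apply: eq_Rintegral => u _; rewrite !patchE; case: ifPn => _; last by rewrite mul0r.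
  rewrite [RHS](_ : _ = w y u * (2^-1 * (J T (u + x) + J T (u - x)))); last by ring.
  congr (_ * _).
  have ij z : mu.-integrable `[0, T] (EFin \o damped k 0 0 z).
    exact: (integrable_damped k_loc _ _ _ (lexx 0)).
  rewrite /J -RintegralD// -RintegralZl//; last exact: intD.
  rewrite [RHS]Rintegral_mkcond; apply: eq_Rintegral => s _.
  rewrite !patchE; case: ifPn => _; last by rewrite mul0r.
  by rewrite /damped !addr0 mulrDl mulrBl cosD cosB; field.
have c2 : (fun n => \int[mu]_(s in `[0, T]) (damped k 0 0 x s * P n s)) @ \oo -->
   2^-1 * (\int[mu]_u (w y (u - x) * J T u) + \int[mu]_u (w y (u + x) * J T u)).
  pose F (u : R) := 2^-1 * (w y u * J T (u + x)) + 2^-1 * (w y u * J T (u - x)).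
  have iF : mu.-integrable setT (EFin \o F) by apply: intD => //; exact: intZ.
  have -> : 2^-1 * (\int[mu]_u (w y (u - x) * J T u) + \int[mu]_u (w y (u + x) * J T u))
      = \int[mu]_u F u.
    rewrite RintegralD//; try exact: intZ.
    rewrite (RintegralZl 2^-1 measurableT (wJ T x)) (RintegralZl 2^-1 measurableT (wJ T (- x))) -mulrDr.
    have e1 := J_shift x T y0.
    have e2 : \int[mu]_u (w y u * J T (u - x)) = \int[mu]_u (w y (u + x) * J T u).
      rewrite (J_shift (- x) T y0).
      by apply: eq_Rintegral => u _; rewrite opprK.
    by rewrite e1 e2.
  have sw n : \int[mu]_u (F \_ `[- (n%:R ^+ 2), n%:R ^+ 2]) u =
      \int[mu]_(s in `[0, T]) (damped k 0 0 x s * P n s).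
    by rewrite -Rintegral_mkcond swap.
  apply: (cvgseq_eq sw).
  have mF := int_measurable measurableT iF.
  have [] := @Rdominated_convergence _ _ _ mu setT
    (fun n => F \_ `[- (n%:R ^+ 2), n%:R ^+ 2]) F (fun u => `|F u|) => //.
  - move=> n; apply/(measurable_restrictT _ _).1; first exact: measurable_itv.
    exact: measurable_funTS.
  - apply: aeW => u _; apply: (@cvgseq_near_cst _ (Num.truncn `|u|).+1) => n sn.
    rewrite patchE ifT// inE/= in_itv/= -ler_norml.
    have un : `|u| <= n%:R by rewrite (le_trans (ltW (truncnS_gt _)))// ler_nat.
    rewrite (le_trans un)// expr2 ler_peMr// ler1n.
    exact: leq_trans sn.
  - exact: integrable_norm.
  - by move=> n u _; rewrite patchE; case: ifPn => // _; rewrite normr0.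
exact: (cvg_unique _ c1 c2).
Qed.

(** Positivity of the cosine transform is inherited by the damped kernels, whose
    transform is a Poisson mean of the undamped one. *)
Lemma laplace_kernel_ge0 x y : 0 < y -> 0 <= laplace_part k 0 x y.
Proof.
move=> y0; have hk := exp_integrable_kernel.
have [l1 l10 c1] := limJ x y0.
have [l2 l20 c2] := limJ (- x) y0.
have c3 := cvgseqZ (c := 2^-1) (cvgseqD c1 c2).
have c4 := cvgseqZ (c := pi) (cvg_integral_half_line (integrable_laplace 0 x hk y0)).
have e : pi * \int[mu]_(s in `[0, +oo[) (k s * (expR (- (y * s)) * cos (x * s + 0))) =
    2^-1 * (l1 + l2).
  suff c5 : (fun n : nat => pi * \int[mu]_(s in `[0, n%:R])
      (k s * (expR (- (y * s)) * cos (x * s + 0)))) @ \oo --> 2^-1 * (l1 + l2).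
    exact: (cvg_unique _ c4 c5).
  apply: (cvgseq_eq _ c3) => n.
  under [X in _ * (_ + X)]eq_Rintegral do rewrite opprK.
  rewrite -poisson_mean//; congr (_ * _); apply: eq_Rintegral => s _.
  by rewrite /damped mulrA.
rewrite /laplace_part -(pmulr_rge0 _ (@pi_gt0 R)) e.
by rewrite mulr_ge0// addr_ge0.
Qed.

End kernel_positivity.

(** * The two spectral integrals *)

Section complex_sequences.
Context {R : realType}.
Implicit Types (u v : nat -> R[i]) (a b : R[i]).

Definition ccvg u a :=
  (fun n => Re (u n)) @ \oo --> Re a /\ (fun n => Im (u n)) @ \oo --> Im a.

Lemma ccvg_cst a : ccvg (fun=> a) a.
Proof. by split; exact: cvg_cst. Qed.

Lemma ccvgD u v a b : ccvg u a -> ccvg v b -> ccvg (fun n => u n + v n) (a + b).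
Proof.
move=> [u1 u2] [v1 v2]; split; under eq_fun do rewrite !complexE'; rewrite !complexE';
  exact: cvgseqD.
Qed.

Lemma ccvgM u v a b : ccvg u a -> ccvg v b -> ccvg (fun n => u n * v n) (a * b).
Proof.
move=> [u1 u2] [v1 v2]; split; under eq_fun do rewrite !complexE'; rewrite !complexE'.
  by apply: cvgseqB; exact: cvgseqM.
by apply: cvgseqD; exact: cvgseqM.
Qed.

Lemma ccvgZ u a b : ccvg u a -> ccvg (fun n => b * u n) (b * a).
Proof. exact/ccvgM/ccvg_cst. Qed.

Lemma ccvgV u a : a != 0 -> ccvg u a -> ccvg (fun n => (u n)^-1) a^-1.
Proof.
move=> a0 [u1 u2].
have q0 : Re a ^+ 2 + Im a ^+ 2 != 0.
  by rewrite -normc_sqr expf_neq0// gt_eqF// normc_gt0.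
have hV : (fun n => (Re (u n) ^+ 2 + Im (u n) ^+ 2)^-1) @ \oo -->
    (Re a ^+ 2 + Im a ^+ 2)^-1.
  apply: cvgseqV => //; rewrite !expr2; under eq_fun do rewrite !expr2.
  by apply: cvgseqD; exact: cvgseqM.
split.
  by under eq_fun do rewrite ReVE; rewrite ReVE; exact: cvgseqM.
by under eq_fun do rewrite ImVE; rewrite ImVE; apply: cvgseqM => //; exact: cvgseqN.
Qed.

Lemma measurable_invr :
  measurable_fun (setT : set (measurableTypeR R)) (fun x : R => x^-1).
Proof.
have mN : measurable ([set~ 0] : set (measurableTypeR R)).
  exact: measurableC.
rewrite (_ : [eta GRing.inv] = (fun x : R => x^-1) \_ [set~ 0]); last first.
  apply/funext => x; rewrite patchE; case: ifPn => //.
  by rewrite notin_setE/= => /contrapT ->; rewrite invr0.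
have [hN _] := measurable_restrictT (fun x : R => x^-1) mN.
apply: hN; apply: open_continuous_measurable_fun.
  exact/closed_openC/closed_eq.
by move=> x /[!inE]/= /eqP x0; exact: inv_continuous.
Qed.

(** To be used before [complexE'], whose projection rules would unfold the
    quotients. *)
Definition complexV' :=
  (@ReDE R, @ImDE R, @ReNE R, @ImNE R, @ReME R, @ImME R, @ReVE R, @ImVE R).

End complex_sequences.

Section spectral_integrals.
Context {R : realType}.
Local Notation mu := (@lebesgue_measure R).
Local Notation mR := (measurableTypeR R).
Variables (k dk : R -> R) (a C : R).
Hypothesis k_loc : forall T, mu.-integrable `[0, T] (EFin \o k).
Hypothesis k_gt0 : forall t, 0 < t -> 0 < k t.
Hypothesis k_der : forall t : R, 0 < t -> is_derive t 1 k (dk t).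
Hypothesis dk_le0 : forall t, 0 < t -> dk t <= 0.
Hypothesis dk_cont : forall t, 0 < t -> {for t, continuous dk}.
Hypothesis a01 : 0 < a < 1.
Hypothesis k_decay : forall t, 1 <= t -> k t <= C * t `^ (- a).
Hypothesis k_cos : forall w, w != 0 -> 0 <= ktrans k 0 0 w.
Variables m lam bet gam : R.
Hypotheses (m0 : 0 < m) (lam0 : 0 < lam) (bet0 : 0 < bet) (gam0 : 0 < gam).

Let hk : exp_integrable k.
Proof. exact: (exp_integrable_kernel k_loc k_gt0 k_der dk_le0). Qed.

Let part_eq y th x : 0 < y -> x != 0 -> laplace_part k th x y = ktrans k y th x.
Proof. exact: (ktransE k_loc k_gt0 k_der dk_le0). Qed.

Let Kp := laplace k.

Let Kp_ge0 x y : 0 < y -> 0 <= Re (Kp x y).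
Proof.
exact: (laplace_kernel_ge0 k_loc k_gt0 k_der dk_le0 dk_cont a01 k_decay k_cos).
Qed.

Let Kp_kbound x y : 0 < y -> x != 0 -> normc (Kp x y) <= 2 * kbound k a C x.
Proof.
move=> y0 x0; apply: (le_trans (normc_le_ReIm _)); rewrite mulr_natl mulr2n.
by apply: lerD; rewrite /Kp /laplace !complexE' part_eq//;
  exact: (ktrans_bound k_loc k_gt0 k_der dk_le0 dk_cont a01 k_decay _ (ltW y0)).
Qed.

Let Kp_far : exists2 M, 0 <= M & forall x y, 0 < y -> 1 <= x ^+ 2 + y ^+ 2 ->
  normc (Kp x y) <= M.
Proof.
have [M M0 hM] := kbound_mulr k_gt0 a01 k_decay.
have L0 : 0 <= laplace_abs k 2^-1.
  by apply: le_trans (laplace_part_bound 0 0 hk _ (lexx 2^-1)) => //; rewrite invr_gt0.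
exists (2 * laplace_abs k 2^-1 + 6 * M); first by rewrite addr_ge0// mulr_ge0.
move=> x y y0 q1.
have [y2|y2] := leP 2^-1 y.
  apply: (le_trans (laplace_bound x hk _ y2)); first by rewrite invr_gt0.
  by rewrite lerDl mulr_ge0.
have x1 : 2^-1 <= `|x|.
  have : 2^-1 ^+ 2 <= `|x| ^+ 2.
    rewrite real_normK ?num_real//; have : y ^+ 2 <= 2^-1 ^+ 2 by rewrite ler_pXn2r ?nnegrE ?invr_ge0// ltW.
    by move: (x ^+ 2) (y ^+ 2) q1 => u v; rewrite expr2; lra.
  by rewrite ler_pXn2r// nnegrE invr_ge0.
have x0 : x != 0 by rewrite -normr_gt0 (lt_le_trans _ x1)// invr_gt0.
apply: (le_trans (Kp_kbound y0 x0)).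
have := hM x; have := kbound_ge0 k_gt0 a01 k_decay x.
move: (kbound k a C x) => b b0 h.
have h1 : b * `|x| <= 3 * M * `|x|.
  rewrite mulrC; apply: (le_trans h); have : M * (1 - 2 * `|x|) <= 0.
    by rewrite mulr_ge0_le0//; lra.
  by move: x1; move: (`|x|) => t; lra.
rewrite ler_pM2r ?normr_gt0// in h1; lra.
Qed.

Let int_expN_le (y : R) : 0 < y -> \int[mu]_(s in `[0, +oo[) expR (- (y * s)) <= y^-1.
Proof.
move=> y0; apply: (cvgseq_le (cvg_integral_half_line (integrable_expN y0))) => n.
have dF (s : R) : 0 <= s <= n%:R ->
    is_derive s 1 (fun s => - y^-1 * expR (- (y * s))) (expR (- (y * s))).
  move=> _; apply: (der_eq (derZ _ (der_expR (derN (derZ y (der_id s)))))).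
  by field; rewrite gt_eqF.
rewrite (RFTC2 _ dF)//; last first.
  apply: continuous_subspaceT => s.
  exact: (der_cvg (der_expR (derN (derZ y (der_id s))))).
rewrite mulr0 oppr0 expR0 mulr1 opprK mulNr addrC lerBlDr lerDl.
by rewrite mulr_ge0 ?expR_ge0// invr_ge0 ltW.
Qed.

(** Used where the height dominates: damping controls the tail of the kernel. *)
Let part_small y th x (T : R) : 0 < y -> 0 < T ->
  `|laplace_part k th x y| <= kmass k T + k T / y.
Proof.
move=> y0 T0; apply: (le_trans (laplace_part_bound th x hk y0 (lexx y))).
have mi : measurable (`[0, +oo[%classic : set mR) by exact: measurable_itv.
have mT : measurable (`[0, T]%classic : set mR) by exact: measurable_itv.
have ikT : mu.-integrable setT (EFin \o (fun s => `|(k \_ `[0, T]) s|)).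
  apply: integrable_norm.
  by rewrite -restrict_EFin; apply/integrable_restrict; rewrite ?setTI//; exact: k_loc.
have ik : mu.-integrable `[0, +oo[ (EFin \o (fun s => `|(k \_ `[0, T]) s|)).
  exact: (@integrableS _ _ _ mu setT).
have ie := integrable_expN y0.
apply: (@le_trans _ _ (\int[mu]_(s in `[0, +oo[) (`|(k \_ `[0, T]) s| + k T * expR (- (y * s))))).
  apply: le_Rintegral => //.
  - by case: hk => _; apply.
  - by apply: intD => //; exact: intZ.
  move=> s; rewrite /= in_itv/= andbT => s0.
  rewrite patchE; case: ifPn; rewrite ?inE ?notin_setE/= in_itv/= s0/=.
    move=> _; rewrite -[leLHS]addr0 lerD//; last first.
      by rewrite mulr_ge0 ?expR_ge0// ltW// k_gt0.
    have e1 : expR (- (y * s)) <= 1.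
      by rewrite -[leRHS]expR0 ler_expR oppr_le0 mulr_ge0// ltW.
    by move: (expR _) e1 (normr_ge0 (k s)) => u u1 v0; rewrite -[leRHS]mulr1 ler_wpM2l.
  move=> /negP; rewrite -ltNge => s1.
  rewrite normr0 add0r ler_wpM2r ?expR_ge0//.
  rewrite ger0_norm; last by apply/ltW/k_gt0; exact: lt_trans s1.
  by apply: (kernel_nonincreasing k_der dk_le0) => //; exact: ltW.
rewrite RintegralD//; last exact: intZ.
apply: lerD.
  rewrite /kmass [leRHS]Rintegral_mkcond.
  have -> : (fun s => `|k s|) \_ `[0, T] = fun s => `|(k \_ `[0, T]) s|.
    by apply/funext => s; rewrite !patchE; case: ifPn; rewrite ?normr0.
  rewrite Rintegral_mkcond; apply: le_Rintegral => //.
    by rewrite -restrict_EFin; apply/integrable_restrict; rewrite ?setTI.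
  move=> s _; rewrite [leLHS]patchE; case: ifPn => _ //.
  exact: normr_ge0.
rewrite RintegralZl// ler_wpM2l ?int_expN_le//.
by rewrite ltW// k_gt0.
Qed.

(** Used where the frequency dominates: oscillation controls the tail. *)
Let part_small_x y th x (T : nat) : 0 < y -> x != 0 -> (0 < T)%N ->
  `|laplace_part k th x y| <= kmass k T%:R + 2 * (k T%:R / `|x|).
Proof.
move=> y0 x0 T0; rewrite part_eq//.
have h1 := ktrans_tail k_loc k_gt0 k_der dk_le0 dk_cont a01 k_decay th (ltW y0) x0 T0.
have h2 := damped_le_kmass k_loc th x T%:R (ltW y0).
move: h1 h2; move: (\int[mu]_(s in _) _) => J.
rewrite mulrA; move: (2 * _ / _) => e h1 h2.
have -> : ktrans k y th x = J + (ktrans k y th x - J) by ring.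
exact: le_trans (ler_normD _ _) (lerD h2 h1).
Qed.

(** The kernel transform may blow up at the origin, but more slowly than [1 / z]:
    beyond a large time [T] the kernel is small, and its tail contributes
    [k T / |z|]. *)
Let zKp_small e : 0 < e -> exists2 r, 0 < r & forall x y, 0 < y -> x != 0 ->
  normc (x +i* y) <= r -> normc ((x +i* y) * Kp x y) <= e.
Proof.
move=> e0; have := kernel_cvg0 k_gt0 a01 k_decay.
move=> /cvgrPdist_le/(_ (e / 16))[]; first by rewrite divr_gt0.
move=> N _ hN; pose T := N.+1.
have kT : k T%:R <= e / 16.
  have := hN T (leqnSn N); rewrite sub0r normrN; apply: le_trans; exact: ler_norm.
have kT0 : 0 < k T%:R by rewrite k_gt0// ltr0n.
have M0 := kmass_ge0 k T%:R.
pose r := e / (8 * (kmass k T%:R + 1)).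
have r0 : 0 < r by rewrite divr_gt0// mulr_gt0// ltr_wpDl.
exists r => // x y y0 x0 zr.
have rM : 4 * r * kmass k T%:R <= e / 2.
  rewrite /r; set M := kmass _ _ in M0 *.
  have -> : 4 * (e / (8 * (M + 1))) * M = e / 2 * (M / (M + 1)).
    by field; rewrite gt_eqF// ltr_wpDl.
  rewrite -[leRHS]mulr1 ler_wpM2l ?divr_ge0 ?(ltW e0)//.
  by rewrite ler_pdivrMr ?ltr_wpDl// mul1r lerDl.
have xr : `|x| <= r by apply: le_trans zr; exact: (Re_le_normc (x +i* y)).
have yr : y <= r.
  by apply: le_trans zr; apply: le_trans (Im_le_normc (x +i* y)); exact: ler_norm.
have zxy := normc_le_ReIm (x +i* y); rewrite /= in zxy.
rewrite ComplexField.Normc.normcM.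
have Kn := normc_le_ReIm (Kp x y).
(* the larger of the two coordinates controls |z| *)
have [xy|xy] := leP y `|x|.
  have h1 := part_small_x 0 y0 x0 (ltn0Sn N).
  have h2 := part_small_x (- (pi / 2)) y0 x0 (ltn0Sn N).
  rewrite -/T -/(Re (Kp x y)) in h1.
  have x1 : 0 < `|x| by rewrite normr_gt0.
  apply: (@le_trans _ _ ((2 * `|x|) * (2 * (kmass k T%:R + 2 * (k T%:R / `|x|))))).
    apply: ler_pM; rewrite ?normc_ge0//.
      by apply: (le_trans zxy); rewrite (gtr0_norm y0); lra.
    by apply: (le_trans Kn); rewrite /Kp/= [leRHS]mulr_natl mulr2n lerD.
  have -> : 2 * `|x| * (2 * (kmass k T%:R + 2 * (k T%:R / `|x|))) =
    4 * `|x| * kmass k T%:R + 8 * k T%:R by field; rewrite gt_eqF.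
  have : 4 * `|x| * kmass k T%:R <= 4 * r * kmass k T%:R by rewrite ler_wpM2r// ler_wpM2l.
  lra.
have T0 : 0 < T%:R :> R by rewrite ltr0n.
have h1 := part_small 0 x y0 T0.
have h2 := part_small (- (pi / 2)) x y0 T0.
apply: (@le_trans _ _ ((2 * y) * (2 * (kmass k T%:R + k T%:R / y)))).
  apply: ler_pM; rewrite ?normc_ge0//.
    by apply: (le_trans zxy); rewrite (gtr0_norm y0); lra.
  by apply: (le_trans Kn); rewrite /Kp/= [leRHS]mulr_natl mulr2n lerD.
have -> : 2 * y * (2 * (kmass k T%:R + k T%:R / y)) =
  4 * y * kmass k T%:R + 4 * k T%:R by field; rewrite gt_eqF.
have : 4 * y * kmass k T%:R <= 4 * r * kmass k T%:R by rewrite ler_wpM2r// ler_wpM2l.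
lra.
Qed.

Let z (x y : R) : R[i] := x +i* y.

(** [G] is the impedance without the spring and [H] the full impedance
    [- i m z + lam + bet (int_0^oo k s e^{i s z} ds) + i gam / z], of which the
    resistance and the reactance below are the boundary values. *)
Let G (x y : R) : R[i] := (0 -i* m) * z x y + (lam%:C + bet%:C * Kp x y).

Let H (x y : R) : R[i] := G x y + (0 +i* gam) * (z x y)^-1.

Let zsqr x y : normc (z x y) ^+ 2 = x ^+ 2 + y ^+ 2.
Proof. exact: normc_sqr. Qed.

Let z_neq0 x y : 0 < y -> z x y != 0.
Proof. by move=> y0; apply/eqP => -[_] /eqP; rewrite gt_eqF. Qed.

(** Each of the four terms of [H] has a nonnegative real part, and friction
    contributes [lam]. *)
Let ReH_ge x y : 0 < y -> lam <= Re (H x y).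
Proof.
move=> y0; have := Kp_ge0 x y0; rewrite /H /G.
move: (Kp x y) => K0 A0; rewrite !complexV' !complexE'.
have q0 : 0 < x ^+ 2 + y ^+ 2 by rewrite ltr_wpDl ?sqr_ge0// exprn_gt0.
have := mulr_ge0 (ltW gam0) (divr_ge0 (ltW y0) (ltW q0)).
move: (mulr_ge0 (ltW m0) (ltW y0)) (mulr_ge0 (ltW bet0) A0).
rewrite !mul0r !mulNr mulrN; move: (m * y) (bet * _) (gam * _) => u v w; lra.
Qed.

Let normH_ge x y : 0 < y -> lam <= normc (H x y).
Proof.
move=> y0; apply: (le_trans (ReH_ge x y0)); apply: le_trans (Re_le_normc _).
exact: ler_norm.
Qed.

Let H_neq0 x y : 0 < y -> H x y != 0.
Proof.
move=> y0; apply/eqP => HE; have := normH_ge x y0.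
by rewrite HE ComplexField.Normc.normc0 leNgt lam0.
Qed.

Let smooth_Kp : hp_smooth Kp (fun x y => 'i%C * laplace (fun s => s * k s) x y).
Proof.
split; first exact: holo_laplace.
  eexists; apply: holoZ; apply: holo_laplace; exact: exp_integrable_mulr.
move=> e e0; exists (2 * laplace_abs (fun s => s * k s) e) => x y ey.
rewrite ComplexField.Normc.normcM.
have -> : normc ('i%C : R[i]) = 1 by rewrite /= expr0n add0r expr1n sqrtr1.
by rewrite mul1r; apply: laplace_bound => //; exact: exp_integrable_mulr.
Qed.

Let smooth_zV : exists f', hp_smooth (fun x y => (z x y)^-1) f'.
Proof. eexists; apply: hp_smoothV; [exact: hp_smooth_id|exact: hp_away0_id]. Qed.

Let smooth_H : exists f', hp_smooth H f'.
Proof.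
have [f' hf'] := smooth_zV; eexists.
apply: hp_smoothD; last by apply: hp_smoothZ; exact: hf'.
apply: hp_smoothD; first by apply: hp_smoothZ; exact: hp_smooth_id.
apply: hp_smoothD; first exact: hp_smooth_cst.
by apply: hp_smoothZ; exact: smooth_Kp.
Qed.

Let away0_H : hp_away0 H.
Proof. by move=> e e0; exists lam => // x y ey; apply: normH_ge; exact: lt_le_trans ey. Qed.

Let smooth_HV : exists f', hp_smooth (fun x y => (H x y)^-1) f'.
Proof. by have [f' hf'] := smooth_H; eexists; apply: hp_smoothV; [exact: hf'|]. Qed.

(** On the real axis [i / (gam z)] is imaginary, so that the real part is that of
    [1 / (z ^ 2 H)]; it removes the pole at the origin, where [H] behaves like
    [i gam / z]. *)
Let f2 (x y : R) : R[i] :=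
  (0 +i* gam^-1) * (z x y)^-1 + ((z x y)^-1 * (z x y)^-1) * (H x y)^-1.

Let smooth_f2 : exists f', hp_smooth f2 f'.
Proof.
have [f' hf'] := smooth_zV; have [g' hg'] := smooth_HV; eexists.
have bz := hp_boundedV (@hp_away0_id R).
apply: hp_smoothD; first by apply: hp_smoothZ; exact: hf'.
apply: (hp_smoothM (hp_smoothM hf' hf' bz bz) hg'); first exact: hp_boundedM.
exact: hp_boundedV.
Qed.

Let izV c x y : 0 < y -> (0 +i* c) * (z x y)^-1 =
  (c * y / (x ^+ 2 + y ^+ 2)) +i* (c * x / (x ^+ 2 + y ^+ 2)).
Proof.
by move=> y0; apply: complex_eqP; rewrite !complexV' !complexE'; ring.
Qed.

(** [m z - i H] stays bounded at infinity. *)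
Let asym1 : exists2 D, 0 <= D & forall x y, 0 < y -> 1 <= x ^+ 2 + y ^+ 2 ->
  normc ((H x y)^-1 - (m^-1 * y / (x ^+ 2 + y ^+ 2) +i* (m^-1 * x / (x ^+ 2 + y ^+ 2))))
    <= D / (x ^+ 2 + y ^+ 2).
Proof.
have [M M0 hM] := Kp_far.
pose D := lam + bet * M + gam.
have D0 : 0 < D by rewrite addr_gt0// ltr_pwDl// mulr_ge0// ltW.
exists (D / m * ((1 + D / lam) / m)); first by rewrite mulr_ge0// divr_ge0 ?(ltW m0) ?(ltW D0)// addr_ge0// divr_ge0// ltW.
move=> x y y0 q1; rewrite -izV// -zsqr.
have z1 : 1 <= normc (z x y).
  by rewrite -(@ler_pXn2r _ 2)// ?nnegrE ?normc_ge0// zsqr expr1n.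
have z0 : 0 < normc (z x y) by exact: lt_le_trans z1.
have zx0 := z_neq0 x y0; have Hx0 := H_neq0 x y0.
pose N := (0 -i* 1) * (lam%:C + bet%:C * Kp x y) + gam%:C * (z x y)^-1.
have mz : m%:C * z x y - (0 +i* 1) * H x y = N.
  rewrite /N /H /G; have ii : (0 +i* 1) * (0 -i* m) = m%:C :> R[i].
    by apply: complex_eqP; rewrite !complexE'; ring.
  have ig : (0 +i* 1) * (0 +i* gam) = - gam%:C :> R[i].
    by apply: complex_eqP; rewrite !complexE'; ring.
  have i1 : (0 -i* 1) = - (0 +i* 1) :> R[i].
    by apply: complex_eqP; rewrite !complexE'; ring.
  by rewrite i1 !mulrDr !mulrA ii ig; ring.
(* N = m z - i H collects the terms of H that are bounded at infinity *)
have NE : (H x y)^-1 - (0 +i* m^-1) * (z x y)^-1 = N * m^-1%:C * (z x y)^-1 * (H x y)^-1.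
  rewrite -mz.
  have -> : (0 +i* m^-1) = (0 +i* 1) * m^-1%:C :> R[i].
    by apply: complex_eqP; rewrite !complexE'; ring.
  have mm : m%:C * m^-1%:C = 1 :> R[i].
    by apply: complex_eqP; rewrite !complexE'; field; rewrite gt_eqF.
  move: (z x y) (H x y) (m%:C) (m^-1%:C) mm zx0 Hx0 => zz HH mu1 mu2 mm zz0 HH0.
  have -> : (mu1 * zz - (0 +i* 1) * HH) * mu2 * zz^-1 * HH^-1 =
      (mu1 * mu2) * HH^-1 - (0 +i* 1) * mu2 * zz^-1.
    by field; rewrite zz0 HH0.
  by rewrite mm mul1r.
have Nle : normc N <= D.
  rewrite /N (le_trans (normcD_le _ _))// lerD//.
    rewrite ComplexField.Normc.normcM.
    have -> : normc (0 -i* 1 : R[i]) = 1 by rewrite /= expr0n add0r sqrrN expr1n sqrtr1.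
    rewrite mul1r (le_trans (normcD_le _ _))// normcC gtr0_norm// lerD2l.
    rewrite ComplexField.Normc.normcM normcC gtr0_norm// ler_wpM2l ?(ltW bet0)//.
    exact: hM.
  rewrite ComplexField.Normc.normcM normcC gtr0_norm// ComplexField.Normc.normcV.
  by rewrite ler_piMr ?(ltW gam0)// invf_le1.
(* H grows at least linearly: m z = N + i H with N bounded and |H| >= lam *)
have HN : m * normc (z x y) <= normc (H x y) * (1 + D / lam).
  have : m * normc (z x y) <= D + normc (H x y).
    have e : m%:C * z x y = N + (0 +i* 1) * H x y.
      by rewrite -mz subrK.
    have -> : m * normc (z x y) = normc (N + (0 +i* 1) * H x y).
      by rewrite -e ComplexField.Normc.normcM normcC gtr0_norm.
    rewrite (le_trans (normcD_le _ _))// lerD//.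
    rewrite ComplexField.Normc.normcM.
    have -> : normc (0 +i* 1 : R[i]) = 1 by rewrite /= expr0n add0r expr1n sqrtr1.
    by rewrite mul1r.
  move=> /le_trans; apply; rewrite mulrDr mulr1 addrC lerD2l mulrCA.
  by rewrite ler_peMr ?(ltW D0)// ler_pdivlMr// mul1r normH_ge.
rewrite NE !ComplexField.Normc.normcM !ComplexField.Normc.normcV normcC.
rewrite gtr0_norm ?invr_gt0//.
have h0 : 0 < normc (H x y) by rewrite (lt_le_trans lam0)// normH_ge.
move: (normc (z x y)) (normc (H x y)) (normc N) z0 h0 HN Nle (normc_ge0 N)
  => u h n u0 h0 Hn nD n0.
have E0 : 0 < 1 + D / lam by rewrite ltr_pwDl// divr_ge0 ?ltW.
have -> : D / m * ((1 + D / lam) / m) / u ^+ 2 =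
    D * (m^-1 / u) * ((1 + D / lam) / (m * u)) by field; rewrite !gt_eqF.
rewrite -[n * _ / u]mulrA; apply: ler_pM => //.
- by rewrite !mulr_ge0// ?invr_ge0// ltW.
- by rewrite invr_ge0 ltW.
- by rewrite ler_pM2r// divr_gt0// invr_gt0.
- rewrite -[X in X <= _]mul1r ler_pdivrMr// mulrAC ler_pdivlMr ?mulr_gt0//.
  by rewrite mul1r [leRHS]mulrC.
Qed.

Let asym2 x y : 0 < y -> 1 <= x ^+ 2 + y ^+ 2 ->
  normc (f2 x y - (gam^-1 * y / (x ^+ 2 + y ^+ 2) +i* (gam^-1 * x / (x ^+ 2 + y ^+ 2))))
    <= lam^-1 / (x ^+ 2 + y ^+ 2).
Proof.
move=> y0 q1; rewrite -izV// /f2 addrAC subrr add0r -zsqr.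
rewrite !ComplexField.Normc.normcM !ComplexField.Normc.normcV mulrC -invfM -expr2.
rewrite ler_wpM2r ?invr_ge0 ?exprn_ge0 ?normc_ge0//.
by rewrite lef_pV2 ?posrE ?normH_ge// (lt_le_trans lam0)// normH_ge.
Qed.

(** Near the origin [z H] is close to [i gam]; elsewhere [Re H >= lam] suffices. *)
Let zH_ge : exists2 c, 0 < c & forall x y, 0 < y -> x != 0 ->
  c <= normc (z x y) * normc (H x y).
Proof.
have e0 : 0 < gam / (4 * bet) by rewrite divr_gt0// mulr_gt0.
have [r1 r10 hr] := zKp_small e0.
pose r := Num.min 1 (Num.min r1 (gam / (4 * (m + lam)))).
have ml0 : 0 < m + lam by rewrite addr_gt0.
have r0 : 0 < r by rewrite !lt_min ltr01 r10 divr_gt0// mulr_gt0.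
exists (Num.min (gam / 2) (r * lam)).
  by rewrite lt_min divr_gt0// mulr_gt0.
move=> x y y0 x0; rewrite ge_min.
have [zr|zr] := leP (normc (z x y)) r; last first.
  apply/orP; right; apply: ler_pM; rewrite ?(ltW r0) ?(ltW lam0) ?(ltW zr)//.
  exact: normH_ge.
apply/orP; left.
have [z1 zr1 z2] : [/\ normc (z x y) <= 1, normc (z x y) <= r1 &
    normc (z x y) * (4 * (m + lam)) <= gam].
  have /andP[h1 /andP[h2 h3]] : [&& r <= 1, r <= r1 & r <= gam / (4 * (m + lam))].
    by rewrite /r !ge_min !lexx /= !orbT.
  split; [exact: le_trans h1|exact: le_trans h2|].
  by rewrite -ler_pdivlMr ?mulr_gt0//; exact: le_trans h3.
have hK := hr _ _ y0 x0 zr1.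
have zx0 := z_neq0 x y0.
pose A := (0 -i* m) * z x y * z x y + lam%:C * z x y + bet%:C * (z x y * Kp x y).
have zHE : (0 +i* gam) = z x y * H x y - A.
  by rewrite /A /H /G !mulrDr [z x y * (_ * _^-1)]mulrCA divff//; ring.
have gz : gam <= normc (z x y) * normc (H x y) + normc A.
  rewrite -ComplexField.Normc.normcM.
  have := normcB_le (z x y * H x y) A; rewrite -zHE; apply: le_trans.
  by rewrite /= expr0n add0r sqrtr_sqr ler_norm.
suff Ale : normc A <= gam / 2 by lra.
have nm : normc (0 -i* m : R[i]) = m by rewrite /= expr0n add0r sqrrN sqrtr_sqr gtr0_norm.
have zge := normc_ge0 (z x y).
have h1 : normc ((0 -i* m) * z x y * z x y) <= m * normc (z x y).
  rewrite !ComplexField.Normc.normcM nm ler_piMr// mulr_ge0// ltW//.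
have h2 : normc (lam%:C * z x y) <= lam * normc (z x y).
  by rewrite ComplexField.Normc.normcM normcC gtr0_norm.
have h3 : normc (bet%:C * (z x y * Kp x y)) <= gam / 4.
  rewrite ComplexField.Normc.normcM normcC gtr0_norm//.
  apply: (@le_trans _ _ (bet * (gam / (4 * bet)))); first by rewrite ler_wpM2l// ltW.
  by rewrite le_eqVlt; apply/orP; left; apply/eqP; field; rewrite gt_eqF.
rewrite /A; apply: (le_trans (normcD_le _ _)).
apply: (le_trans (lerD (normcD_le _ _) (lexx _))).
move: h1 h2 h3 z2; move: (normc _) => u; move: (normc _) => v; move: (normc _) => w.
move: (normc (z x y)) => t; lra.
Qed.

(** Algebraically [f2 = i G / (gam z H)]: the singularity left at the origin is
    the mild one of the kernel transform inside [G]. *)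
Let f2_bound : exists2 c, 0 < c & forall x y, x != 0 -> 0 < y <= 1 -> `|x| <= 1 ->
  `|Re (f2 x y)| <= c * (2 * m + lam + 2 * bet * kbound k a C x).
Proof.
have [c c0 hc] := zH_ge; exists (gam * c)^-1; first by rewrite invr_gt0 mulr_gt0.
move=> x y x0 /andP[y0 y1] x1; apply: (le_trans (Re_le_normc _)).
have zx0 := z_neq0 x y0; have Hx0 := H_neq0 x y0.
have gg : gam%:C * gam^-1%:C = 1 :> R[i].
  by apply: complex_eqP; rewrite !complexE'; field; rewrite gt_eqF.
have -> : f2 x y = (0 +i* 1) * gam^-1%:C * G x y * (z x y * H x y)^-1.
  have GE : G x y = H x y - (0 +i* gam) * (z x y)^-1 by rewrite /H addrK.
  have e1 : (0 +i* gam^-1) = (0 +i* 1) * gam^-1%:C :> R[i].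
    by apply: complex_eqP; rewrite !complexE'; ring.
  have e2 : (0 +i* gam) = (0 +i* 1) * gam%:C :> R[i].
    by apply: complex_eqP; rewrite !complexE'; ring.
  have e3 : (0 +i* 1) * (0 +i* 1) = -1 :> R[i].
    by apply: complex_eqP; rewrite !complexE'; ring.
  rewrite GE /f2 e1 e2.
  move: (z x y) (H x y) (gam%:C) (gam^-1%:C) (0 +i* 1 : R[i]) gg zx0 Hx0 e3
    => zz HH g1 g2 ii gg zz0 HH0 i2.
  have -> : ii * g2 * (HH - ii * g1 / zz) / (zz * HH) =
    ii * g2 * HH / (zz * HH) - (ii * ii) * (g1 * g2) / zz / (zz * HH) by ring.
  by rewrite i2 gg; field; rewrite zz0 HH0.
rewrite !ComplexField.Normc.normcM ComplexField.Normc.normcV ComplexField.Normc.normcM.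
have -> : normc (0 +i* 1 : R[i]) = 1 by rewrite /= expr0n add0r expr1n sqrtr1.
rewrite mul1r normcC gtr0_norm ?invr_gt0//.
rewrite -[leLHS]mulrA (invfM gam c) -[leRHS]mulrA ler_pM2l ?invr_gt0// [leRHS]mulrC.
have zle : normc (z x y) <= 2.
  by apply: (le_trans (normc_le_ReIm _)); rewrite /= (gtr0_norm y0); lra.
have Gle : normc (G x y) <= 2 * m + lam + 2 * bet * kbound k a C x.
  rewrite /G addrA (le_trans (normcD_le _ _))// lerD//.
    rewrite (le_trans (normcD_le _ _))// lerD//; last by rewrite normcC gtr0_norm.
    rewrite ComplexField.Normc.normcM.
    have -> : normc (0 -i* m : R[i]) = m by rewrite /= expr0n add0r sqrrN sqrtr_sqr gtr0_norm.
    by rewrite mulrC ler_wpM2r// ltW.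
  rewrite ComplexField.Normc.normcM normcC gtr0_norm// -mulrA mulrCA ler_wpM2l ?(ltW bet0)//.
  exact: Kp_kbound.
apply: ler_pM; rewrite ?normc_ge0 ?invr_ge0 ?mulr_ge0 ?normc_ge0//.
by rewrite lef_pV2 ?posrE ?hc//; apply: lt_le_trans (hc _ _ y0 x0).
Qed.

(** The cosine integral may diverge at zero frequency; the value [0] chosen there
    keeps the function nonnegative. *)
Definition cos_part (x : R) := if x == 0 then 0 else ktrans k 0 0 x.
Definition sin_part (x : R) := ktrans k 0 (- (pi / 2)) x.

Definition resistance x := lam + bet * cos_part x.
Definition reactance x := - m * x + bet * sin_part x + gam * x^-1.
Definition conductance x := resistance x / (resistance x ^+ 2 + reactance x ^+ 2).

Lemma cos_part_ge0 x : 0 <= cos_part x.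
Proof. by rewrite /cos_part; case: eqVneq => // /k_cos. Qed.

Lemma resistance_gt0 x : 0 < resistance x.
Proof. by rewrite ltr_pwDl// mulr_ge0 ?(ltW bet0)// cos_part_ge0. Qed.

Lemma conductance_ge0 x : 0 <= conductance x.
Proof.
by rewrite divr_ge0 ?(ltW (resistance_gt0 x))// addr_ge0 ?sqr_ge0.
Qed.

Lemma measurable_cos_part : measurable_fun (setT : set mR) cos_part.
Proof.
apply: measurable_fun_ifT => //; first by apply: measurable_fun_eqr.
exact: (measurable_ktrans k_loc k_gt0 k_der dk_le0 dk_cont a01 k_decay).
Qed.

Lemma measurable_sin_part : measurable_fun (setT : set mR) sin_part.
Proof. exact: (measurable_ktrans k_loc k_gt0 k_der dk_le0 dk_cont a01 k_decay). Qed.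

Lemma measurable_resistance : measurable_fun (setT : set mR) resistance.
Proof.
apply: measurable_funD => //; apply: measurable_funM => //.
exact: measurable_cos_part.
Qed.

Lemma measurable_reactance : measurable_fun (setT : set mR) reactance.
Proof.
apply: measurable_funD; last by apply: measurable_funM => //; exact: measurable_invr.
apply: measurable_funD; first exact: measurable_funM.
by apply: measurable_funM => //; exact: measurable_sin_part.
Qed.

Lemma measurable_conductance : measurable_fun (setT : set mR) conductance.
Proof.
apply: measurable_funM; first exact: measurable_resistance.
apply: (measurableT_comp measurable_invr); apply: measurable_funD;
  apply: measurable_funX; [exact: measurable_resistance|exact: measurable_reactance].
Qed.

Let Hlim x : x != 0 ->
  ccvg (fun n => H x n.+1%:R^-1) (resistance x +i* reactance x).
Proof.
move=> x0.
have y0 (n : nat) : 0 < n.+1%:R^-1 :> R by rewrite invr_gt0.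
have zlim : ccvg (fun n => z x n.+1%:R^-1) (x +i* 0).
  by split => /=; [exact: cvg_cst|exact: cvg_harmonic].
have Klim : ccvg (fun n => Kp x n.+1%:R^-1) (cos_part x +i* sin_part x).
  split; rewrite !complexE'.
  - rewrite /cos_part (negbTE x0).
    have h := ktrans_abel k_loc k_gt0 k_der dk_le0 dk_cont a01 k_decay (th := 0) x0.
    have e n : ktrans k n.+1%:R^-1 0 x = Re (Kp x n.+1%:R^-1).
      by rewrite /Kp !complexE' part_eq.
    exact: (cvgseq_eq e h).
  - have h := ktrans_abel k_loc k_gt0 k_der dk_le0 dk_cont a01 k_decay (th := - (pi / 2)) x0.
    have e n : ktrans k n.+1%:R^-1 (- (pi / 2)) x = Im (Kp x n.+1%:R^-1).
      by rewrite /Kp !complexE' part_eq.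
    exact: (cvgseq_eq e h).
have z0 : (x +i* 0) != 0 :> R[i] by apply/eqP => -[] /eqP; rewrite (negbTE x0).
have := ccvgD (ccvgD (ccvgZ (0 -i* m) zlim) (ccvgD (ccvg_cst lam%:C) (ccvgZ bet%:C Klim)))
  (ccvgZ (0 +i* gam) (ccvgV z0 zlim)).
congr ccvg; apply: complex_eqP; rewrite !complexV' !complexE' /resistance /reactance; field.
  by rewrite x0.
by rewrite x0.
Qed.

Let Hb_neq0 x : (resistance x +i* reactance x) != 0.
Proof.
by apply/eqP => -[] /eqP; rewrite gt_eqF// resistance_gt0.
Qed.

(** The conductance is the boundary value of [Re (1 / H)], and [1 / H] behaves
    like [i / (m z)] at infinity: only inertia survives. *)
Lemma int_conductance : (\int[mu]_x (conductance x)%:E = (pi / m)%:E)%E.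
Proof.
have [f' sf] := smooth_HV; have [D D0 hD] := asym1.
apply: (@boundary_integral _ (fun x y => (H x y)^-1) f' m^-1 D (cst lam^-1)).
- by case: sf.
- exact: (hp_smooth_continuous sf).
- exact: (hp_smooth_bound sf).
- by rewrite invr_ge0 ltW.
- exact: D0.
- exact: hD.
- exact: integrable_cst_itv.
- move=> x y _ /andP[y0 _] _; apply: (le_trans (Re_le_normc _)).
  rewrite ComplexField.Normc.normcV lef_pV2 ?posrE ?normH_ge//.
  by rewrite (lt_le_trans lam0)// normH_ge.
- exact: measurable_conductance.
- move=> x x0; have [h _] := ccvgV (Hb_neq0 x) (Hlim x0).
  by rewrite ReVE/= in h.
- exact: conductance_ge0.
Qed.

(** The boundary values of [f2] behave like [i / (gam z)] at infinity: only the
    spring survives. *)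
Lemma int_conductance_div_sqr :
  (\int[mu]_x (conductance x / x ^+ 2)%:E = (pi / gam)%:E)%E.
Proof.
have [f' sf] := smooth_f2; have [c c0 hc] := f2_bound.
apply: (@boundary_integral _ f2 f' gam^-1 lam^-1
  (fun x => c * (2 * m + lam + 2 * bet * kbound k a C x))).
- by case: sf.
- exact: (hp_smooth_continuous sf).
- exact: (hp_smooth_bound sf).
- by rewrite invr_ge0 ltW.
- by rewrite invr_ge0 ltW.
- exact: asym2.
- apply: intZ => //; apply: intD => //; first exact: integrable_cst_itv.
  apply: intZ => //; exact: integrable_kbound.
- exact: hc.
- apply: measurable_funM; first exact: measurable_conductance.
  by apply: (measurableT_comp measurable_invr); exact: measurable_funX.
- move=> x x0.
  have zlim : ccvg (fun n => z x n.+1%:R^-1) (x +i* 0).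
    by split => /=; [exact: cvg_cst|exact: cvg_harmonic].
  have z0 : (x +i* 0) != 0 :> R[i] by apply/eqP => -[] /eqP; rewrite (negbTE x0).
  have zV := ccvgV z0 zlim.
  have [h _] := ccvgD (ccvgZ (0 +i* gam^-1) zV)
    (ccvgM (ccvgM zV zV) (ccvgV (Hb_neq0 x) (Hlim x0))).
  move: h; rewrite !complexV' !complexE' -/(conductance x).
  congr (_ --> _).
  rewrite oppr0 mul0r expr0n addr0.
  move: (conductance x) (- reactance x / _) => u v; field.
  by rewrite x0 gt_eqF.
- by move=> x; rewrite divr_ge0 ?conductance_ge0 ?sqr_ge0.
Qed.

End spectral_integrals.

(** * Regularity and decay of the memory kernel *)

Section kernel_regularity.
Context {R : realType}.
Local Notation mu := (@lebesgue_measure R).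
Local Notation mR := (measurableTypeR R).
Variable K : R -> \bar R.
Hypotheses (K_fun : kernel_function K) (K_I : kernel_I K).
Hypotheses (K_II : kernel_II K) (K_III : kernel_III K).

Definition real_kernel (t : R) : R := fine (K t).
Local Notation k := real_kernel.

Lemma real_kernel_integrable T : mu.-integrable `[0, T] (EFin \o k).
Proof.
have [[mk _ ik] _ _ _ _] := K_I.
have mT : measurable (`[0, T]%classic : set mR) by exact: measurable_itv.
apply/integrableP; split; first by apply/measurable_EFinP; exact: measurable_funTS.
by apply: ik => //; exact: segment_compact.
Qed.

Lemma real_kernel_gt0 t : 0 < t -> 0 < k t.
Proof.
move=> t0; have [_ [_ Kpos] _ _ _] := K_I; have [_ Kfin] := K_fun.
have tn0 : t != 0 by rewrite gt_eqF.
by rewrite -lte_fin fineK ?Kpos ?Kfin.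
Qed.

Lemma der_near_eq (f g : R -> R) (x df : R) : (\forall t \near x, f t = g t) ->
  is_derive x 1 f df -> is_derive x 1 g df.
Proof.
move=> fg [h e]; split; first exact: near_eq_derivable h.
by rewrite -e; apply: near_eq_derive; near=> t; apply/esym; near: t.
Unshelve. all: by end_near. Qed.

Lemma completely_monotone_der (f : R -> R) (t : R) : completely_monotone f -> 0 < t ->
  [/\ is_derive t 1 f (derive1 f t), derive1 f t <= 0 &
      {for t, continuous (derive1 f)}].
Proof.
move=> cf t0; split.
- have [h _] := cf 0%N t t0; split => //; rewrite derive1E//.
- by have [_] := cf 1%N t t0; rewrite derive1n1 expr1 mulN1r oppr_ge0.
- have [+ _] := cf 1%N t t0; rewrite derive1n1 => h.
  exact/differentiable_continuous/derivable1_diffP.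
Qed.

(** The chain rule shows that a completely monotone function of [t ^ 2] is
    decreasing as well. *)
Lemma real_kernel_der : exists dk : R -> R, forall t : R, 0 < t ->
  [/\ is_derive t 1 k (dk t), dk t <= 0 & {for t, continuous dk}].
Proof.
case: K_III => [ck|[phi cphi Kphi]].
  by exists (derive1 k) => t t0; exact: completely_monotone_der.
exists (fun t => derive1 phi (t ^+ 2) * (2 * t)) => t t0.
have t20 : 0 < t ^+ 2 by rewrite exprn_gt0.
have [h1 h2 h3] := completely_monotone_der cphi t20.
have dX : is_derive t 1 (fun t : R => t ^+ 2) (2 * t).
  by apply: (der_eq (derX 2 (der_id t))); rewrite expr1 mulr1.
split.
- apply: (@der_near_eq (fun t => phi (t ^+ 2))).
    near=> s; rewrite /k Kphi//; have : 0 < s by near: s; exact: lt_nbhsr.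
    by move=> s0; rewrite gt_eqF.
- by rewrite mulr_le0_ge0// mulr_ge0// ltW.
- apply: cvgM; last by apply: cvgM; [exact: cvg_cst|exact: cvg_id].
  apply: (@continuous_comp _ _ _ (fun t : R => t ^+ 2) (derive1 phi)) => //.
  exact: der_cvg dX.
Unshelve. all: by end_near. Qed.

Let k_noninc s t : 0 < s -> s <= t -> k t <= k s.
Proof.
have [dk hdk] := real_kernel_der.
have h1 (u : R) : 0 < u -> is_derive u 1 k (dk u) by case/hdk.
have h2 u : 0 < u -> dk u <= 0 by case/hdk.
exact: (kernel_nonincreasing h1 h2).
Qed.

(** A power bound near infinity extends down to [1] by monotonicity. *)
Let decay_extend a T M : 0 < a -> 1 <= T -> (forall t, T <= t -> k t <= M * t `^ (- a)) ->
  exists C, forall t, 1 <= t -> k t <= C * t `^ (- a).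
Proof.
move=> a0 T1 h; have k10 := real_kernel_gt0 ltr01.
exists (`|M| + k 1 * T `^ a) => t t1; have t0 : 0 < t by exact: lt_le_trans t1.
have P0 := powR_ge0 t (- a); have P1 := powR_ge0 T a.
have kP : 0 <= k 1 * T `^ a * t `^ (- a) by rewrite !mulr_ge0// ltW.
have MP : 0 <= `|M| * t `^ (- a) by rewrite mulr_ge0.
rewrite mulrDl; have [Tt|tT] := leP T t.
  apply: (le_trans (h t Tt)).
  have : M * t `^ (- a) <= `|M| * t `^ (- a) by rewrite ler_wpM2r// ler_norm.
  lra.
apply: (@le_trans _ _ (k 1 * T `^ a * t `^ (- a))); last by lra.
apply: (le_trans (k_noninc ltr01 t1)).
rewrite -mulrA ler_peMr ?(ltW k10)//.
rewrite powRN ler_pdivlMr ?powR_gt0// mul1r.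
by apply: ge0_ler_powR; rewrite ?nnegrE ?ltW// (lt_trans t0).
Qed.

Let decay_equiv a : 0 < a < 1 ->
  equiv_pinfty k (fun t => t `^ (- a)) ->
  exists C, forall t, 1 <= t -> k t <= C * t `^ (- a).
Proof.
move=> /andP[a0 a1] [c c0 /cvgrPdist_le/(_ 1 ltr01)[A [Areal hA]]].
apply: (@decay_extend a (Num.max 1 (A + 1)) (c + 1)) => //.
  by rewrite le_max lexx.
move=> t; rewrite ge_max => /andP[t1 At].
have t0 : 0 < t by exact: lt_le_trans t1.
have At' : A < t by lra.
have := hA t At'; rewrite ler_norml => /andP[h _].
rewrite -ler_pdivrMr ?powR_gt0//; lra.
Qed.

Let powR_half (t : R) : 1 <= t -> t^-1 <= t `^ (- 2^-1).
Proof.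
move=> t1; rewrite -powR_inv1; last by rewrite (le_trans ler01).
by rewrite ler_powR//; lra.
Qed.

(** A monotone integrable kernel satisfies [t k t <= int k], and [t ^ (- 1)] is
    weakened to [t ^ (- 1 / 2)], so that the three decay alternatives provide the
    same kind of bound. *)
Lemma real_kernel_decay : exists2 a, 0 < a < 1 &
  exists C, forall t, 1 <= t -> k t <= C * t `^ (- a).
Proof.
have h12 : 0 < (2^-1 : R) < 1 by lra.
case: K_II => [intK|Kinv|[al al01 Kal]].
- exists 2^-1 => //; exists (fine (\int[mu]_t `|K t|)%E) => t t1.
  have t0 : 0 < t by exact: lt_le_trans t1.
  have [dk hdk] := real_kernel_der.
  have h1 (u : R) : 0 < u -> is_derive u 1 k (dk u) by case/hdk.
  have h2 u : 0 < u -> dk u <= 0 by case/hdk.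
  have := le_kmass real_kernel_integrable real_kernel_gt0 h1 h2 t0.
  have I0 : (0 <= \int[mu]_t `|K t|)%E by exact: integral_ge0.
  have Ifin : (\int[mu]_t `|K t|)%E \is a fin_num.
    by have /integrableP[_ Koo] := intK; rewrite ge0_fin_numE.
  move=> k1.
  have k2 : kmass k t <= fine (\int[mu]_t `|K t|)%E.
    have mt : measurable (`[0%R, t]%classic : set mR) by exact: measurable_itv.
    have /integrableP[/measurable_EFinP mk _] := real_kernel_integrable t.
    have /integrableP[mK _] := intK.
    rewrite /kmass /Rintegral fine_le//.
      exact: (integrable_fin_num mt (integrable_norm (real_kernel_integrable t))).
    apply: (@le_trans _ _ (\int[mu]_(x in `[0%R, t]) `|K x|)%E).
      apply: ge0_le_integral => //=.
      - apply/measurable_EFinP.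
        exact: (measurableT_comp (@normr_measurable R setT)).
      - by apply: measurableT_comp => //; exact: measurable_funTS.
      - by move=> x _; rewrite /real_kernel; case: (K x) => [r| |] /=; rewrite ?lexx ?leey.
    by apply: ge0_subset_integral => //; exact: measurableT_comp.
  apply: (@le_trans _ _ (fine (\int[mu]_t `|K t|)%E * t^-1)).
    by rewrite -ler_pdivrMr ?invr_gt0// invrK (le_trans k1).
  by rewrite ler_wpM2l ?fine_ge0// powR_half.
- exists 2^-1 => //.
  move: Kinv => [c c0 /cvgrPdist_le/(_ 1 ltr01)[A [Areal hA]]].
  apply: (@decay_extend 2^-1 (Num.max 1 (A + 1)) (c + 1)) => //.
    by rewrite le_max lexx.
  move=> t; rewrite ge_max => /andP[t1 At].
  have t0 : 0 < t by exact: lt_le_trans t1.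
  have At' : A < t by lra.
  have := hA t At'; rewrite ler_norml => /andP[h _].
  apply: (@le_trans _ _ ((c + 1) * t^-1)).
    by rewrite -ler_pdivrMr ?invr_gt0// /real_kernel; move: (_ / _) h => u; lra.
  by rewrite ler_wpM2l ?powR_half//; lra.
- exists al => //; exact: decay_equiv.
Qed.

Lemma ktrans_Kcos w : w != 0 -> ktrans k 0 0 w = Kcos K w.
Proof.
move=> w0; have [_ _ _ _ /(_ w w0)[cK _]] := K_I.
have h : (fun n : nat => Kcos_trunc K w n%:R) @ \oo --> Kcos K w.
  exact: (cvg_comp _ _ cvgr_idn cK).
rewrite -(cvg_lim _ h)//; congr (limn _); apply/funext => n.
apply: eq_Rintegral => s _.
by rewrite /damped mul0r oppr0 expR0 mulr1 addr0.
Qed.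

Lemma ktrans_cos_ge0 w : w != 0 -> 0 <= ktrans k 0 0 w.
Proof.
move=> w0; rewrite ktrans_Kcos//.
by have [_ _ _ _ /(_ w w0)[_ /ltW]] := K_I.
Qed.

End kernel_regularity.

(** * Square integrable complex functions *)

Section conjugation.
Context {R : realType}.
Implicit Types z w : R[i].

Lemma normc_conj z : normc (conjc z) = normc z.
Proof. by case: z => a b /=; rewrite sqrrN. Qed.

Lemma conjcD z w : conjc (z + w) = conjc z + conjc w.
Proof. by apply: complex_eqP; rewrite !complexE'; ring. Qed.

Lemma conjcM z w : conjc (z * w) = conjc z * conjc w.
Proof. by apply: complex_eqP; rewrite !complexE'; ring. Qed.

End conjugation.

Section square_integrable.
Context d (T : measurableType d) (R : realType) (mu : {measure set T -> \bar R}).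
Implicit Types (f g h : T -> R[i]).

(** The squared norm is kept extended-real, so that isometries can be stated
    without integrability assumptions. *)
Definition norm2 f : \bar R := (\int[mu]_x ((normc (f x)) ^+ 2)%:E)%E.

Definition cinner f g : R[i] := Cint mu setT (fun x => f x * conjc (g x)).

Lemma Cmeasurable_cst (c : R[i]) : Cmeasurable (fun _ : T => c).
Proof. by split; exact: measurable_cst. Qed.

Lemma CmeasurableD f g : Cmeasurable f -> Cmeasurable g ->
  Cmeasurable (fun x => f x + g x).
Proof.
move=> [f1 f2] [g1 g2]; split; under eq_fun do rewrite !complexE'; exact: measurable_funD.
Qed.

Lemma CmeasurableN f : Cmeasurable f -> Cmeasurable (fun x => - f x).
Proof.
move=> [f1 f2]; split; under eq_fun do rewrite !complexE';
  exact: (measurableT_comp (@oppr_measurable R setT)).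
Qed.

Lemma CmeasurableB f g : Cmeasurable f -> Cmeasurable g ->
  Cmeasurable (fun x => f x - g x).
Proof. by move=> mf mg; apply: CmeasurableD => //; exact: CmeasurableN. Qed.

Lemma CmeasurableM f g : Cmeasurable f -> Cmeasurable g ->
  Cmeasurable (fun x => f x * g x).
Proof.
move=> [f1 f2] [g1 g2]; split; under eq_fun do rewrite !complexE'.
  by apply: measurable_funB; exact: measurable_funM.
by apply: measurable_funD; exact: measurable_funM.
Qed.

Lemma CmeasurableZ (c : R[i]) f : Cmeasurable f -> Cmeasurable (fun x => c * f x).
Proof. exact/CmeasurableM/Cmeasurable_cst. Qed.

Lemma CmeasurableJ f : Cmeasurable f -> Cmeasurable (fun x => conjc (f x)).
Proof.
move=> [f1 f2]; split; under eq_fun do rewrite !complexE'; first exact: f1.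
exact: (measurableT_comp (@oppr_measurable R setT)).
Qed.

Lemma CmeasurableC (f : T -> R) : measurable_fun setT f -> Cmeasurable (fun x => (f x)%:C).
Proof. by split => //; exact: measurable_cst. Qed.

Lemma measurable_normc2 f : Cmeasurable f ->
  measurable_fun setT (fun x => normc (f x) ^+ 2).
Proof.
move=> [f1 f2]; under eq_fun do rewrite normc_sqr.
by apply: measurable_funD; exact: measurable_funX.
Qed.

Lemma emeasurable_normc2 f : Cmeasurable f ->
  measurable_fun setT (fun x => (normc (f x) ^+ 2)%:E).
Proof. by move=> mf; apply/measurable_EFinP; exact: measurable_normc2. Qed.

Lemma measurable_normc f : Cmeasurable f -> measurable_fun setT (fun x => normc (f x)).
Proof.
move=> mf; have -> : (fun x => normc (f x)) = (fun x => (normc (f x) ^+ 2) `^ 2^-1).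
  apply/funext => x; rewrite -powR_mulrn ?normc_ge0// -powRrM mulfV// powRr1//.
  exact: normc_ge0.
apply: (measurableT_comp (measurable_powR _)); exact: measurable_normc2.
Qed.

Lemma norm2_ge0 f : (0 <= norm2 f)%E.
Proof. by apply: integral_ge0 => x _; rewrite lee_fin exprn_ge0// normc_ge0. Qed.

Lemma norm2_le f g : Cmeasurable f -> Cmeasurable g ->
  (forall x, normc (f x) <= normc (g x)) -> (norm2 f <= norm2 g)%E.
Proof.
move=> mf mg fg; apply: ge0_le_integral => //.
- by move=> x _; rewrite lee_fin exprn_ge0// normc_ge0.
- exact: emeasurable_normc2.
- exact: emeasurable_normc2.
- by move=> x _; rewrite lee_fin ler_pXn2r ?nnegrE ?normc_ge0.
Qed.

(** This form of square integrability is the one that domination proves. *)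
Lemma L2cP f : L2c mu f <-> Cmeasurable f /\ (norm2 f < +oo)%E.
Proof.
have sq (u : T -> R) : measurable_fun setT u ->
    (\int[mu]_x ((u x) ^+ 2)%:E < +oo)%E -> u \in Lfun mu 2%:E.
  move=> mu' iu; rewrite inE; apply/andP; split; rewrite inE//=.
  rewrite /finite_norm unlock/=; apply: poweR_lty.
  apply: le_lt_trans iu; rewrite le_eqVlt; apply/orP; left; apply/eqP.
  by apply: eq_integral => x _ /=; rewrite powR_mulrn// real_normK ?num_real.
have mL (u : T -> R) : u \in Lfun mu 2%:E -> measurable_fun setT u.
  by rewrite inE => /andP[+ _]; rewrite inE.
split => [[f1 f2]|[[m1 m2] fi]].
  have m1 := mL _ f1; have m2 := mL _ f2; split; first by split.
  have /integrableP[_ i1] := Lfun2_integrable_sqr f1.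
  have /integrableP[_ i2] := Lfun2_integrable_sqr f2.
  rewrite /norm2; under eq_integral do rewrite normc_sqr EFinD.
  have m1' : measurable_fun setT (fun x => (Re (f x) ^+ 2)%:E).
    by apply/measurable_EFinP; exact: measurable_funX.
  have m2' : measurable_fun setT (fun x => (Im (f x) ^+ 2)%:E).
    by apply/measurable_EFinP; exact: measurable_funX.
  rewrite ge0_integralD//; try by move=> x _; rewrite lee_fin sqr_ge0.
  apply: lte_add_pinfty.
    apply: le_lt_trans i1; apply: ge0_le_integral => //.
      by move=> x _; rewrite lee_fin sqr_ge0.
      exact: measurableT_comp.
    by move=> x _; rewrite lee_fin ler_norm.
  apply: le_lt_trans i2; apply: ge0_le_integral => //.
    by move=> x _; rewrite lee_fin sqr_ge0.
    exact: measurableT_comp.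
  by move=> x _; rewrite lee_fin ler_norm.
split; apply: sq => //; apply: le_lt_trans fi; apply: ge0_le_integral => //.
- by move=> x _; rewrite lee_fin sqr_ge0.
- by apply/measurable_EFinP; exact: measurable_funX.
- exact: emeasurable_normc2.
- by move=> x _; rewrite lee_fin normc_sqr lerDl sqr_ge0.
- by move=> x _; rewrite lee_fin sqr_ge0.
- by apply/measurable_EFinP; exact: measurable_funX.
- exact: emeasurable_normc2.
- by move=> x _; rewrite lee_fin normc_sqr lerDr sqr_ge0.
Qed.

Lemma L2c_measurable f : L2c mu f -> Cmeasurable f.
Proof. by move=> /L2cP[]. Qed.

Lemma norm2_fin f : L2c mu f -> norm2 f \is a fin_num.
Proof. by move=> /L2cP[_ fi]; rewrite ge0_fin_numE// norm2_ge0. Qed.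

Lemma norm2Z (c : R[i]) f : Cmeasurable f ->
  norm2 (fun x => c * f x) = ((normc c ^+ 2)%:E * norm2 f)%E.
Proof.
move=> mf; rewrite /norm2 -ge0_integralZl//.
- by apply: eq_integral => x _; rewrite ComplexField.Normc.normcM exprMn EFinM.
- exact: emeasurable_normc2.
- by move=> x _; rewrite lee_fin exprn_ge0// normc_ge0.
- by rewrite lee_fin exprn_ge0// normc_ge0.
Qed.

Lemma norm2N f : norm2 (fun x => - f x) = norm2 f.
Proof. by apply: eq_integral => x _; rewrite normcN. Qed.

(** Young's inequality with a free weight, which allows the convergence of norms
    to be deduced below. *)
Lemma normcD_sqr_le (e : R) (a b : R[i]) : 0 < e ->
  normc (a + b) ^+ 2 <= (1 + e) * normc a ^+ 2 + (1 + e^-1) * normc b ^+ 2.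
Proof.
move=> e0; have h : normc (a + b) ^+ 2 <= (normc a + normc b) ^+ 2.
  by rewrite ler_pXn2r ?nnegrE ?addr_ge0 ?normc_ge0// normcD_le.
apply: (le_trans h); move: (normc a) (normc b) => u v.
have s0 : 0 <= e^-1 * (e * u - v) ^+ 2 by rewrite mulr_ge0 ?sqr_ge0// invr_ge0 ltW.
have e1 : e^-1 * (e * u - v) ^+ 2 = e * u ^+ 2 - 2 * (u * v) + e^-1 * v ^+ 2.
  by field; rewrite gt_eqF.
by rewrite e1 in s0; rewrite sqrrD mulr2n; lra.
Qed.

Lemma norm2D_le (e : R) f g : 0 < e -> Cmeasurable f -> Cmeasurable g ->
  (norm2 (fun x => f x + g x)%R <= (1 + e)%:E * norm2 f + (1 + e^-1)%:E * norm2 g)%E.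
Proof.
move=> e0 mf mg; have e1 : 0 <= e^-1 by rewrite invr_ge0 ltW.
have E0 : (0 <= (1 + e)%:E)%E by rewrite lee_fin addr_ge0// ltW.
have E1 : (0 <= (1 + e^-1)%:E)%E by rewrite lee_fin addr_ge0.
have n0 (h : T -> R[i]) : forall x, setT x -> (0 <= (normc (h x) ^+ 2)%:E)%E.
  by move=> x _; rewrite lee_fin exprn_ge0// normc_ge0.
have mf' := emeasurable_normc2 mf; have mg' := emeasurable_normc2 mg.
rewrite {2 3}/norm2 -(ge0_integralZl _ _ mf' (n0 f))// -(ge0_integralZl _ _ mg' (n0 g))//.
rewrite -ge0_integralD//; last 4 first.
- by move=> x _; rewrite mule_ge0// n0.
- exact: measurable_funeM.
- by move=> x _; rewrite mule_ge0// n0.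
- exact: measurable_funeM.
apply: ge0_le_integral => //.
- exact: n0.
- by apply: emeasurable_normc2; exact: CmeasurableD.
- by apply: emeasurable_funD; exact: measurable_funeM.
- by move=> x _; rewrite -!EFinM -EFinD lee_fin normcD_sqr_le.
Qed.

Lemma L2cD f g : L2c mu f -> L2c mu g -> L2c mu (fun x => f x + g x).
Proof.
move=> /L2cP[mf fi] /L2cP[mg gi]; apply/L2cP; split; first exact: CmeasurableD.
apply: le_lt_trans (norm2D_le ltr01 mf mg) _.
apply: lte_add_pinfty; apply: lte_mul_pinfty => //; rewrite lee_fin; lra.
Qed.

Lemma L2cZ (c : R[i]) f : L2c mu f -> L2c mu (fun x => c * f x).
Proof.
move=> /L2cP[mf fi]; apply/L2cP; split; first exact: CmeasurableZ.
by rewrite norm2Z// lte_mul_pinfty// lee_fin exprn_ge0// normc_ge0.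
Qed.

Lemma L2cN f : L2c mu f -> L2c mu (fun x => - f x).
Proof.
move=> /L2cP[mf fi]; apply/L2cP; split; first exact: CmeasurableN.
by rewrite norm2N.
Qed.

Lemma L2cB f g : L2c mu f -> L2c mu g -> L2c mu (fun x => f x - g x).
Proof. by move=> hf hg; apply: L2cD => //; exact: L2cN. Qed.

Lemma L2c0 : L2c mu (fun=> 0).
Proof.
apply/L2cP; split; first exact: Cmeasurable_cst.
rewrite /norm2; under eq_integral do rewrite ComplexField.Normc.normc0 expr0n.
by rewrite integral0.
Qed.

Lemma integrable_normc2 f : L2c mu f -> mu.-integrable setT (EFin \o (fun x => normc (f x) ^+ 2)).
Proof.
move=> /L2cP[mf fi]; apply/integrableP; split; first exact: emeasurable_normc2.
apply: le_lt_trans fi; rewrite le_eqVlt; apply/orP; left; apply/eqP.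
by apply: eq_integral => x _ /=; rewrite ger0_norm// exprn_ge0// normc_ge0.
Qed.

Lemma norm2_Rintegral f : L2c mu f -> norm2 f = (\int[mu]_x (normc (f x) ^+ 2))%:E.
Proof. by move=> hf; rewrite /norm2 /Rintegral fineK// norm2_fin. Qed.

Lemma mulJ_le (a b : R[i]) : normc (a * conjc b) <= normc a ^+ 2 + normc b ^+ 2.
Proof.
rewrite ComplexField.Normc.normcM normc_conj.
have := sqr_ge0 (normc a - normc b); rewrite sqrrB.
have := mulr_ge0 (normc_ge0 a) (normc_ge0 b).
by move: (normc a) (normc b) => u v; rewrite mulr2n; lra.
Qed.

Lemma cinner_integrable f g : L2c mu f -> L2c mu g ->
  Cintegrable mu setT (fun x => f x * conjc (g x)).
Proof.
move=> hf hg; have [m1 m2] := CmeasurableM (L2c_measurable hf) (CmeasurableJ (L2c_measurable hg)).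
have ii := intD measurableT (integrable_normc2 hf) (integrable_normc2 hg).
split.
  apply: (integrable_dominated _ _ ii) => // x _.
  exact: le_trans (Re_le_normc _) (mulJ_le _ _).
apply: (integrable_dominated _ _ ii) => // x _.
exact: le_trans (Im_le_normc _) (mulJ_le _ _).
Qed.

Lemma CintD f g : Cintegrable mu setT f -> Cintegrable mu setT g ->
  Cint mu setT (fun x => f x + g x) = Cint mu setT f + Cint mu setT g.
Proof.
move=> [f1 f2] [g1 g2]; apply: complex_eqP; rewrite !complexE'.
  by rewrite -RintegralD//; apply: eq_Rintegral => x _; rewrite !complexE'.
by rewrite -RintegralD//; apply: eq_Rintegral => x _; rewrite !complexE'.
Qed.

Lemma CintegrableZ (c : R[i]) f : Cintegrable mu setT f ->
  Cintegrable mu setT (fun x => c * f x).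
Proof.
move=> [f1 f2]; split; under eq_fun do rewrite !complexE'.
  by apply: intB => //; exact: intZ.
by apply: intD => //; exact: intZ.
Qed.

Lemma CintZ (c : R[i]) f : Cintegrable mu setT f ->
  Cint mu setT (fun x => c * f x) = c * Cint mu setT f.
Proof.
move=> [f1 f2]; apply: complex_eqP; rewrite !complexE'.
  rewrite -!RintegralZl// -RintegralB//; try exact: intZ.
  by apply: eq_Rintegral => x _; rewrite !complexE'.
rewrite -!RintegralZl// -RintegralD//; try exact: intZ.
by apply: eq_Rintegral => x _; rewrite !complexE'.
Qed.

Lemma cinnerDl f g h : L2c mu f -> L2c mu g -> L2c mu h ->
  cinner (fun x => f x + g x) h = cinner f h + cinner g h.
Proof.
move=> hf hg hh; rewrite -CintD; try exact: cinner_integrable.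
by congr Cint; apply/funext => x; rewrite mulrDl.
Qed.

Lemma cinnerZl (c : R[i]) f g : L2c mu f -> L2c mu g ->
  cinner (fun x => c * f x) g = c * cinner f g.
Proof.
move=> hf hg; rewrite -CintZ; last exact: cinner_integrable.
by congr Cint; apply/funext => x; rewrite mulrA.
Qed.

Lemma cinnerC f g : L2c mu f -> L2c mu g -> cinner f g = conjc (cinner g f).
Proof.
move=> hf hg; have [i1 i2] := cinner_integrable hg hf.
apply: complex_eqP; rewrite !complexE'.
  by apply: eq_Rintegral => x _; rewrite !complexE'; ring.
rewrite -RintegralN//; apply: eq_Rintegral => x _.
by rewrite !complexE'; ring.
Qed.

Lemma cinnerDr f g h : L2c mu f -> L2c mu g -> L2c mu h ->
  cinner h (fun x => f x + g x) = cinner h f + cinner h g.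
Proof.
move=> hf hg hh; rewrite cinnerC//; last exact: L2cD.
by rewrite cinnerDl// conjcD -!cinnerC.
Qed.

Lemma cinnerZr (c : R[i]) f g : L2c mu f -> L2c mu g ->
  cinner g (fun x => c * f x) = conjc c * cinner g f.
Proof.
move=> hf hg; rewrite cinnerC//; last exact: L2cZ.
by rewrite cinnerZl// conjcM -cinnerC.
Qed.

Lemma cinner_norm2 f : L2c mu f -> cinner f f = (fine (norm2 f))%:C.
Proof.
move=> hf; have [i1 i2] := cinner_integrable hf hf.
rewrite norm2_Rintegral//; apply: complex_eqP; rewrite !complexE'.
  by apply: eq_Rintegral => x _; rewrite !complexE' normc_sqr; ring.
rewrite (@eq_Rintegral _ _ _ mu setT (fun=> 0)); last first.
  by move=> x _; rewrite !complexE'; ring.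
by rewrite /Rintegral integral0.
Qed.

Lemma norm2_cinner f : L2c mu f -> norm2 f = (Re (cinner f f))%:E.
Proof. by move=> hf; rewrite cinner_norm2// ReCE fineK// norm2_fin. Qed.

Lemma norm2_sub f g : L2c mu f -> L2c mu g ->
  norm2 (fun x => f x - g x) =
  (Re (cinner f f) + Re (cinner g g) - 2 * Re (cinner f g))%:E.
Proof.
move=> hf hg; have hN : L2c mu (fun x => -1 * g x) by exact: L2cZ.
have -> : (fun x => f x - g x) = (fun x => f x + -1 * g x).
  by apply/funext => x; rewrite mulN1r.
rewrite norm2_cinner; last exact: L2cD.
rewrite cinnerDl ?cinnerDr//; try exact: L2cD.
rewrite !cinnerZl ?cinnerZr// [cinner g f]cinnerC//.
by congr (_%:E); rewrite !complexE'; ring.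
Qed.

(** For every [e > 0],
    [| |a|^2 - |b|^2 | <= e |b|^2 + (1 + 1 / e) |a - b|^2]. *)
Lemma norm2_cvg (F : nat -> T -> R[i]) f : (forall n, L2c mu (F n)) ->
  L2c mu f -> norm2 (fun x => F n x - f x) @[n --> \oo] --> 0%E ->
  norm2 (F n) @[n --> \oo] --> norm2 f.
Proof.
move=> hF hf h.
have hB n := L2cB (hF n) hf.
have pw (e : R) (a b : R[i]) : 0 < e ->
    `|normc a ^+ 2 - normc b ^+ 2| <= e * normc b ^+ 2 + (1 + e^-1) * normc (a - b) ^+ 2.
  move=> e0; have h1 : normc a <= normc b + normc (a - b).
    by have := normcD_le b (a - b); rewrite addrC subrK.
  have h2 : normc b <= normc a + normc (a - b).
    by have := normcB_le a (a - b); rewrite opprB addrC subrK.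
  have := normc_ge0 a; have := normc_ge0 b; have := normc_ge0 (a - b).
  move: (normc a) (normc b) (normc (a - b)) h1 h2 => u v w h1 h2 w0 v0 u0.
  have s0 : 0 <= e^-1 * (e * v - w) ^+ 2 by rewrite mulr_ge0 ?sqr_ge0// invr_ge0 ltW.
  have e1 : e^-1 * (e * v - w) ^+ 2 = e * v ^+ 2 - 2 * (v * w) + e^-1 * w ^+ 2.
    by field; rewrite gt_eqF.
  rewrite e1 in s0.
  have d1 : u ^+ 2 <= (v + w) ^+ 2 by rewrite ler_pXn2r ?nnegrE ?addr_ge0.
  rewrite sqrrD mulr2n in d1.
  have [uw|uw] := leP w v; last first.
    have v2 : v ^+ 2 <= w ^+ 2 by rewrite ler_pXn2r ?nnegrE// ltW.
    have u2 := sqr_ge0 u; rewrite ler_norml; apply/andP; split; last by lra.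
    have : 0 <= e * v ^+ 2 by rewrite mulr_ge0 ?sqr_ge0// ltW.
    have : 0 <= e^-1 * w ^+ 2 by rewrite mulr_ge0 ?sqr_ge0// invr_ge0 ltW.
    by move: s0; lra.
  have d2 : (v - w) ^+ 2 <= u ^+ 2 by rewrite ler_pXn2r ?nnegrE ?subr_ge0//; lra.
  rewrite sqrrB mulr2n in d2; have w2 := sqr_ge0 w.
  by rewrite ler_norml; apply/andP; split; lra.
rewrite (norm2_Rintegral hf); under eq_fun do rewrite (norm2_Rintegral (hF _)).
apply: cvg_EFin; first exact: nearW.
apply/cvgrPdist_le => e e0 /=.
pose M := \int[mu]_x (normc (f x) ^+ 2).
have M0 : 0 <= M by apply: Rintegral_ge0 => x _; rewrite exprn_ge0// normc_ge0.
pose q := e / (2 * (M + 1)).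
have q0 : 0 < q by rewrite divr_gt0// mulr_gt0// ltr_wpDl.
have C0 : 0 < 1 + q^-1 by rewrite ltr_wpDr// invr_ge0 ltW.
have h0 : (fun n => \int[mu]_x (normc (F n x - f x) ^+ 2)) @ \oo --> 0.
  apply: (@cvg_trans _ (fine (norm2 (fun x => F n x - f x)) @[n --> \oo])).
    by apply: near_eq_cvg; apply: nearW => n; rewrite (norm2_Rintegral (hB n)).
  exact: fine_cvg h.
move/cvgrPdist_le : h0 => /(_ (e / (2 * (1 + q^-1))))[].
  by rewrite divr_gt0// mulr_gt0.
move=> N _ hN; exists N => // n /= /hN /=.
rewrite sub0r normrN ger0_norm; last first.
  by apply: Rintegral_ge0 => x _; rewrite exprn_ge0// normc_ge0.
have iF := integrable_normc2 (hF n); have ifn := integrable_normc2 hf.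
have iB := integrable_normc2 (hB n).
move=> hle; rewrite distrC -RintegralB//.
apply: (le_trans (le_normr_Rintegral _ (intB measurableT iF ifn))) => //.
have le1 : \int[mu]_x `|normc (F n x) ^+ 2 - normc (f x) ^+ 2| <=
    q * M + (1 + q^-1) * \int[mu]_x (normc (F n x - f x) ^+ 2).
  rewrite -!RintegralZl// -RintegralD//; try exact: intZ.
  apply: le_Rintegral => //.
  - exact: (integrable_norm (intB measurableT iF ifn)).
  - by apply: intD => //; exact: intZ.
  - by move=> x _; exact: pw.
apply: (le_trans le1).
have q1 : q * M <= e / 2.
  rewrite /q; have -> : e / (2 * (M + 1)) * M = e / 2 * (M / (M + 1)).
    by field; rewrite gt_eqF// ltr_wpDl.
  rewrite ler_piMr ?divr_ge0 ?(ltW e0)//.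
  by rewrite ler_pdivrMr ?ltr_wpDl// mul1r lerDl.
have q2 : (1 + q^-1) * \int[mu]_x (normc (F n x - f x) ^+ 2) <= e / 2.
  rewrite mulrC -ler_pdivlMr// (le_trans hle)//.
  by rewrite invfM mulrA.
by rewrite [leRHS](splitr e) lerD.
Qed.

End square_integrable.

(** * Completeness in mean square *)

Section ereal_sequences.
Context {R : realType}.
Implicit Types (u : nat -> \bar R) (c : nat -> R).

Lemma ecvg0_le u c : (forall n, 0 <= u n)%E -> (forall n, u n <= (c n)%:E)%E ->
  c @ \oo --> 0 -> u @ \oo --> 0%E.
Proof.
move=> u0 uc c0; apply: (@squeeze_cvge _ _ _ _ (fun=> 0%E) _ (EFin \o c)).
- by apply: nearW => n; rewrite u0 uc.
- exact: cvg_cst.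
- by apply: cvg_EFin => //; exact: nearW.
Qed.

Lemma ecvg0_near u (e : R) : u @ \oo --> 0%E -> 0 < e ->
  exists N, forall n, (N <= n)%N -> (u n <= e%:E)%E.
Proof.
move=> /fine_cvgP[[N1 _ h1] h] e0.
move/cvgrPdist_le : h => /(_ e e0)[N2 _ h2].
exists (maxn N1 N2) => n; rewrite geq_max => /andP[n1 n2].
have f1 := h1 n n1; have := h2 n n2; rewrite /= sub0r normrN => h.
by rewrite -(fineK f1) lee_fin (le_trans (ler_norm _)).
Qed.

Lemma geometric_cvg0 (C z : R) : `|z| < 1 -> (fun n => C * z ^+ n) @ \oo --> 0.
Proof. exact: cvg_geometric. Qed.

End ereal_sequences.

Section riesz_fischer.
Context d (T : measurableType d) (R : realType) (mu : {measure set T -> \bar R}).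

(** With summable increments, the weighted sum [g] of the squared increments is
    almost everywhere finite, and controls the tails pointwise. *)
Lemma riesz_fischer_real (u : nat -> T -> R) :
  (forall n, measurable_fun setT (u n)) ->
  (forall n, (\int[mu]_x ((u n.+1 x - u n x) ^+ 2)%:E <= (16^-1 ^+ n)%:E)%E) ->
  exists2 v : T -> R, measurable_fun setT v & exists C : R, forall n,
    (\int[mu]_x ((u n x - v x) ^+ 2)%:E <= (C * 4^-1 ^+ n)%:E)%E.
Proof.
move=> mu_ du.
(* the weights 4 ^ n leave increments of mean 4 ^ - n, still summable *)
pose G (n : nat) (x : T) := (4 ^+ n * (u n.+1 x - u n x) ^+ 2)%:E.
have mD n : measurable_fun setT (fun x => ((u n.+1 x - u n x) ^+ 2)%:E).
  by apply/measurable_EFinP; apply: measurable_funX; exact: measurable_funB.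
have mG n : measurable_fun setT (G n).
  apply/measurable_EFinP; apply: measurable_funM => //.
  by apply: measurable_funX; exact: measurable_funB.
have G0 n x : (0 <= G n x)%E by rewrite lee_fin mulr_ge0 ?sqr_ge0// exprn_ge0.
pose g x := (\sum_(0 <= n <oo) G n x)%E.
have g0 x : (0 <= g x)%E by apply: nneseries_ge0.
have mg : measurable_fun setT g by apply: ge0_emeasurable_sum.
have ig : (\int[mu]_x g x <= (4 / 3)%:E)%E.
  rewrite integral_nneseries//.
  apply: lime_le; first by apply: is_cvg_nneseries => n _ _; exact: integral_ge0.
  apply: nearW => n.
  apply: (@le_trans _ _ (\sum_(0 <= i < n) (4^-1 ^+ i)%:E)%E).
    apply: lee_sum => i _.
    rewrite /G; under eq_integral do rewrite EFinM.
    rewrite ge0_integralZl//; last first.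
      by move=> x _; rewrite lee_fin sqr_ge0.
    apply: (@le_trans _ _ ((4 ^+ i)%:E * (16^-1 ^+ i)%:E)%E).
      by rewrite lee_wpmul2l ?lee_fin ?exprn_ge0.
    rewrite -EFinM lee_fin -exprMn.
    by rewrite (_ : 4 / 16 = 4^-1 :> R)//; field.
  rewrite sumEFin lee_fin.
  have -> : \sum_(0 <= i < n) 4^-1 ^+ i = 4 / 3 * (1 - 4^-1 ^+ n) :> R.
    elim: n => [|n IH]; first by rewrite big_nil expr0 subrr mulr0.
    by rewrite big_nat_recr//= IH exprS; field.
  rewrite ler_piMr// gerBl; exact: exprn_ge0.
have intg : mu.-integrable setT g.
  apply/integrableP; split => //.
  by under eq_integral do rewrite gee0_abs//; exact: le_lt_trans ig (ltry _).
have tail x : g x \is a fin_num -> exists l : R, u ^~ x @ \oo --> l /\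
    forall n, (u n x - l) ^+ 2 <= 4 * fine (g x) * 4^-1 ^+ n.
  move=> gf; pose s := Num.sqrt (fine (g x)).
  have f0 : 0 <= fine (g x) by rewrite fine_ge0.
  have s0 : 0 <= s by exact: sqrtr_ge0.
  have s2 : s ^+ 2 = fine (g x) by rewrite sqr_sqrtr.
  (* a single term of the sum already bounds the n-th increment *)
  have D n : `|u n.+1 x - u n x| <= s * 2^-1 ^+ n.
    have h : (G n x <= g x)%E.
      apply: le_trans (@nneseries_lim_ge R (G^~ x) xpredT 0%N n.+1 _) => //.
      rewrite big_nat_recr//= -[leLHS]add0e leeD2r//.
      by apply: sume_ge0 => i _.
    rewrite -(fineK gf) lee_fin in h.
    rewrite -(@ler_pXn2r _ 2)// ?nnegrE ?mulr_ge0 ?exprn_ge0//.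
    rewrite real_normK ?num_real// exprMn s2 -exprM mulnC exprM.
    rewrite (_ : 2^-1 ^+ 2 = 4^-1); last by field.
    by rewrite exprVn ler_pdivlMr ?exprn_gt0// mulrC.
  have cv : cvgn (u ^~ x).
    have : cvgn (series (telescope (u ^~ x))).
      apply: normed_cvg; apply: (series_le_cvg _ _ D).
      - by move=> n; exact: normr_ge0.
      - by move=> n; rewrite mulr_ge0// exprn_ge0.
      - by apply: is_cvg_geometric_series; rewrite ger0_norm//; lra.
    move=> /cvg_ex[l hl]; apply/cvg_ex; exists (u 0%N x + l).
    have -> : u ^~ x = (fun n => u 0%N x + series (telescope (u ^~ x)) n).
      by apply/funext => n; exact: eq_sum_telescope.
    by apply: cvgD hl; exact: cvg_cst.
  move/cvg_ex : cv => [l hl]; exists l; split => // n.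
  have step k : `|u (n + k)%N x - u n x| <= 2 * s * 2^-1 ^+ n - 2 * s * 2^-1 ^+ (n + k).
    elim: k => [|k IH]; first by rewrite addn0 !subrr normr0.
    have -> : u (n + k.+1)%N x - u n x =
      (u (n + k).+1 x - u (n + k)%N x) + (u (n + k)%N x - u n x) by rewrite addnS; ring.
    apply: (le_trans (ler_normD _ _)); apply: (le_trans (lerD (D _) IH)).
    by rewrite addnS exprS; lra.
  have hlim : (fun k => `|u (n + k)%N x - u n x|) @ \oo --> `|l - u n x|.
    apply: cvg_norm; apply: cvgB; last exact: cvg_cst.
    rewrite -(cvg_shiftn n) in hl.
    by apply: cvgseq_eq hl => k; rewrite addnC.
  have : `|l - u n x| <= 2 * s * 2^-1 ^+ n.
    apply: (cvgseq_le hlim) => k; apply: (le_trans (step k)).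
    by rewrite gerBl mulr_ge0 ?exprn_ge0// mulr_ge0.
  rewrite -(@ler_pXn2r _ 2)// ?nnegrE ?mulr_ge0 ?exprn_ge0//.
  rewrite real_normK ?num_real// -sqrrN opprB => /le_trans; apply.
  rewrite !exprMn s2 -exprM mulnC exprM (_ : 2^-1 ^+ 2 = 4^-1); last by field.
  by rewrite le_eqVlt; apply/orP; left; apply/eqP; ring.
pose v x := fine (limn_esup (fun n => (u n x)%:E)).
have mv : measurable_fun setT v.
  apply: measurableT_comp; first exact: fine_measurable.
  by apply: measurable_fun_limn_esup => n; exact/measurable_EFinP.
exists v => //; exists (16 / 3) => n.
apply: (@le_trans _ _ (\int[mu]_x ((4 * 4^-1 ^+ n)%:E * g x))%E).
  apply: ae_ge0_le_integral => //.
  - by move=> x _; rewrite lee_fin sqr_ge0.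
  - by apply/measurable_EFinP; apply: measurable_funX; exact: measurable_funB.
  - by move=> x _; rewrite mule_ge0// lee_fin mulr_ge0// exprn_ge0.
  - exact: measurable_funeM.
  have := integrable_ae measurableT intg; apply: filterS => x /(_ I) gf _.
  have [l [ul hl]] := tail x gf.
  have -> : v x = l.
    have ec : (fun n => (u n x)%:E) @ \oo --> l%:E by apply: cvg_EFin => //; exact: nearW.
    rewrite /v is_cvg_limn_esupE; last by apply/cvg_ex; exists l%:E.
    by rewrite (cvg_lim _ ec).
  rewrite -(fineK gf) -EFinM lee_fin (le_trans (hl n))//.
  by rewrite le_eqVlt; apply/orP; left; apply/eqP; ring.
rewrite ge0_integralZl//.
apply: (@le_trans _ _ ((4 * 4^-1 ^+ n)%:E * (4 / 3)%:E)%E).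
  by rewrite lee_wpmul2l// lee_fin mulr_ge0// exprn_ge0.
by rewrite -EFinM lee_fin le_eqVlt; apply/orP; left; apply/eqP; field.
Qed.

Lemma riesz_fischer (F : nat -> T -> R[i]) : (forall n, L2c mu (F n)) ->
  (forall n, (norm2 mu (fun x => F n.+1 x - F n x)%R <= (16^-1 ^+ n)%:E)%E) ->
  exists2 f, L2c mu f & norm2 mu (fun x => F n x - f x) @[n --> \oo] --> 0%E.
Proof.
move=> hF dF.
have mF n := L2c_measurable (hF n).
have part (p : R[i] -> R) : (forall z, p z ^+ 2 <= normc z ^+ 2) ->
    (forall n, measurable_fun setT (fun x => p (F n x))) ->
    (forall a b, p (a - b) = p a - p b) ->
    exists2 v : T -> R, measurable_fun setT v & exists C : R, forall n,
    (\int[mu]_x ((p (F n x) - v x) ^+ 2)%:E <= (C * 4^-1 ^+ n)%:E)%E.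
  move=> ple mp pB; apply: riesz_fischer_real => // n.
  apply: le_trans (dF n); apply: ge0_le_integral => //.
  - by move=> x _; rewrite lee_fin sqr_ge0.
  - by apply/measurable_EFinP; apply: measurable_funX; exact: measurable_funB.
  - by apply: emeasurable_normc2; exact: CmeasurableB.
  - by move=> x _; rewrite lee_fin -pB.
have [v1 mv1 [C1 h1]] : exists2 v : T -> R, measurable_fun setT v & exists C : R, forall n,
    (\int[mu]_x ((Re (F n x) - v x) ^+ 2)%:E <= (C * 4^-1 ^+ n)%:E)%E.
  apply: part => [z|n|a b]; last by rewrite !complexE'.
  - by rewrite normc_sqr lerDl sqr_ge0.
  - by case: (mF n).
have [v2 mv2 [C2 h2]] : exists2 v : T -> R, measurable_fun setT v & exists C : R, forall n,
    (\int[mu]_x ((Im (F n x) - v x) ^+ 2)%:E <= (C * 4^-1 ^+ n)%:E)%E.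
  apply: part => [z|n|a b]; last by rewrite !complexE'.
  - by rewrite normc_sqr lerDr sqr_ge0.
  - by case: (mF n).
pose f x := v1 x +i* v2 x.
have mf : Cmeasurable f by split.
have hle n : (norm2 mu (fun x => F n x - f x)%R <= ((C1 + C2) * 4^-1 ^+ n)%:E)%E.
  rewrite mulrDl EFinD; apply: le_trans (leeD (h1 n) (h2 n)).
  have [m1 m2] := CmeasurableB (mF n) mf.
  rewrite -ge0_integralD//.
  - rewrite le_eqVlt; apply/orP; left; apply/eqP; apply: eq_integral => x _.
    by rewrite normc_sqr !complexE' EFinD.
  - by move=> x _; rewrite lee_fin sqr_ge0.
  - apply/measurable_EFinP; apply: measurable_funX.
    by move: m1; under eq_fun do rewrite !complexE'.
  - by move=> x _; rewrite lee_fin sqr_ge0.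
  - apply/measurable_EFinP; apply: measurable_funX.
    by move: m2; under eq_fun do rewrite !complexE'.
exists f.
  have h0 : L2c mu (fun x => F 0%N x - f x).
    apply/L2cP; split; first exact: CmeasurableB.
    exact: le_lt_trans (hle 0%N) (ltry _).
  have -> : f = (fun x => F 0%N x - (F 0%N x - f x)).
    by apply/funext => x; rewrite opprB addrC subrK.
  exact: L2cB.
apply: (ecvg0_le _ hle); first by move=> n; exact: norm2_ge0.
by apply: geometric_cvg0; rewrite ger0_norm//; lra.
Qed.

End riesz_fischer.

Lemma cinner0l d (T : measurableType d) (R : realType) (mu : {measure set T -> \bar R})
  (f : T -> R[i]) : L2c mu f -> cinner mu (fun=> 0) f = 0.
Proof.
move=> hf; have h := cinnerZl 0 (L2c0 mu) hf.
by rewrite (_ : (fun=> 0) = (fun x : T => 0 * (0 : R[i]))) ?h ?mul0r.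
Qed.

Section linear_combinations.
Context {R : realType} {I : eqType}.

(** Simple functions and simple stochastic integrals are both of this form, over
    indicators and over the random measure. *)
Definition lincomb (T : Type) (U : I -> T -> R[i]) (s : seq (R[i] * I)) : T -> R[i] :=
  fun x => \sum_(p <- s) p.1 * U p.2 x.

Lemma lincomb_cons T (U : I -> T -> R[i]) p s :
  lincomb U (p :: s) = (fun x => p.1 * U p.2 x + lincomb U s x).
Proof. by apply/funext => x; rewrite /lincomb big_cons. Qed.

Lemma lincomb_nil T (U : I -> T -> R[i]) : lincomb U [::] = (fun=> 0).
Proof. by apply/funext => x; rewrite /lincomb big_nil. Qed.

Lemma lincomb_addZ T (U : I -> T -> R[i]) (c : R[i]) s t :
  lincomb U (s ++ [seq (c * p.1, p.2) | p <- t]) =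
  (fun x => lincomb U s x + c * lincomb U t x).
Proof.
apply/funext => x; rewrite /lincomb big_cat big_map/=; congr (_ + _).
by rewrite mulr_sumr; apply: eq_bigr => p _; rewrite mulrA.
Qed.

Variables (d1 d2 : measure_display) (T1 : measurableType d1) (T2 : measurableType d2).
Variables (m1 : {measure set T1 -> \bar R}) (m2 : {measure set T2 -> \bar R}).

Lemma L2c_lincomb (U : I -> T1 -> R[i]) s : (forall p, p \in s -> L2c m1 (U p.2)) ->
  L2c m1 (lincomb U s).
Proof.
elim: s => [_|p s IH hs]; first by rewrite lincomb_nil; exact: L2c0.
rewrite lincomb_cons; apply: L2cD; first by apply: L2cZ; apply: hs; rewrite mem_head.
by apply: IH => q qs; apply: hs; rewrite inE qs orbT.
Qed.

Variables (U : I -> T1 -> R[i]) (V : I -> T2 -> R[i]) (D : I -> Prop).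
Hypothesis UL2 : forall i, D i -> L2c m1 (U i).
Hypothesis VL2 : forall i, D i -> L2c m2 (V i).
Hypothesis UV : forall i j, D i -> D j -> cinner m1 (U i) (U j) = cinner m2 (V i) (V j).

Lemma cinner_lincomb s t : (forall p, p \in s -> D p.2) -> (forall p, p \in t -> D p.2) ->
  cinner m1 (lincomb U s) (lincomb U t) = cinner m2 (lincomb V s) (lincomb V t).
Proof.
have tl (p : R[i] * I) s' : (forall q, q \in p :: s' -> D q.2) -> forall q, q \in s' -> D q.2.
  by move=> h q qs; apply: h; rewrite inE qs orbT.
have U' s' : (forall q, q \in s' -> D q.2) -> L2c m1 (lincomb U s').
  by move=> h; apply: L2c_lincomb => q /h; exact: UL2.
have V' s' : (forall q, q \in s' -> D q.2) -> L2c m2 (lincomb V s').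
  move=> h; elim: s' h => [_|p s' IH hs]; first by rewrite lincomb_nil; exact: L2c0.
  rewrite lincomb_cons; apply: L2cD; last exact/IH/tl/hs.
  by apply: L2cZ; apply: VL2; apply: hs; rewrite mem_head.
have z1 := @cinner0l _ _ _ m1; have z2 := @cinner0l _ _ _ m2.
have one i t' : D i -> (forall q, q \in t' -> D q.2) ->
    cinner m1 (lincomb U t') (U i) = cinner m2 (lincomb V t') (V i).
  move=> Di; elim: t' => [_|p t' IH ht].
    by rewrite !lincomb_nil z1 ?z2//; [exact: VL2|exact: UL2].
  have Dp : D p.2 by apply: ht; rewrite mem_head.
  have ht' := tl _ _ ht.
  rewrite !lincomb_cons !cinnerDl ?cinnerZl ?UV ?IH//;
    by [exact: UL2|exact: VL2|exact: U'|exact: V'|apply: L2cZ; exact: UL2|apply: L2cZ; exact: VL2].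
move=> hs ht; elim: s hs => [_|p s IH hs].
  by rewrite !lincomb_nil z1 ?z2//; [exact: V'|exact: U'].
have Dp : D p.2 by apply: hs; rewrite mem_head.
have hs' := tl _ _ hs.
have e1 : cinner m1 (U p.2) (lincomb U t) = cinner m2 (V p.2) (lincomb V t).
  rewrite cinnerC ?one ?[RHS]cinnerC//; by [exact: UL2|exact: VL2|exact: U'|exact: V'].
rewrite !lincomb_cons !cinnerDl ?cinnerZl ?e1 ?IH//;
  by [exact: UL2|exact: VL2|exact: U'|exact: V'|apply: L2cZ; exact: UL2|apply: L2cZ; exact: VL2].
Qed.

(** The norm of a linear combination only depends on the Gram matrix. *)
Lemma norm2_lincomb s : (forall p, p \in s -> D p.2) ->
  norm2 m1 (lincomb U s) = norm2 m2 (lincomb V s).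
Proof.
move=> hs.
have V' : L2c m2 (lincomb V s).
  elim: s hs => [_|p s IH hs]; first by rewrite lincomb_nil; exact: L2c0.
  rewrite lincomb_cons; apply: L2cD; last by apply: IH => q qs; apply: hs; rewrite inE qs orbT.
  by apply: L2cZ; apply: VL2; apply: hs; rewrite mem_head.
rewrite !norm2_cinner ?cinner_lincomb//.
by apply: L2c_lincomb => q /hs; exact: UL2.
Qed.

End linear_combinations.

(** * The stochastic integral *)

Section spectral_masses.
Context {R : realType} (nu : spectral_measure R).
Local Notation mR := (measurableTypeR R).

(** An integer exponent makes the weight a polynomial. *)
Lemma sm_growth_nat : exists q : nat, forall i,
  (\int[sm_diag nu i]_w (((1 + w ^+ 2) ^+ q)^-1)%:E < +oo)%E.
Proof.
have [p hp] := sm_growth nu; exists (Num.truncn p).+1 => i.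
apply: le_lt_trans (hp i).
have c1 : continuous (fun w : R => 1 + w ^+ 2).
  by move=> w; exact: (der_cvg (derD (der_cst 1 w) (derX 2 (der_id w)))).
have p1 (w : R) : 1 <= 1 + w ^+ 2 by rewrite lerDl sqr_ge0.
have mX : measurable_fun (setT : set mR) (fun w : R => 1 + w ^+ 2).
  exact: measurable_continuous.
apply: ge0_le_integral => //.
- by move=> w _; rewrite lee_fin invr_ge0 exprn_ge0// (le_trans ler01).
- apply/measurable_EFinP.
  have -> : (fun w : R => ((1 + w ^+ 2) ^+ (Num.truncn p).+1)^-1) =
      (fun w => (1 + w ^+ 2) `^ (- (Num.truncn p).+1%:R)).
    by apply/funext => w; rewrite powRN powR_mulrn// (le_trans ler01).
  exact: (measurableT_comp (measurable_powR _) mX).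
- apply/measurable_EFinP; exact: (measurableT_comp (measurable_powR _) mX).
- move=> w _; rewrite lee_fin -powR_mulrn ?(le_trans ler01)// -powRN.
  by apply: ler_powR => //; rewrite lerN2 ltW// truncnS_gt.
Qed.

Lemma sm_bounded_fin (n : nat) : sm_fin_set (sm_diag nu) `[- n%:R, n%:R]%classic.
Proof.
pose A : set mR := `[- n%:R, n%:R]%classic.
have mn : measurable A by exact: measurable_itv.
rewrite -/A; split => // i; have [q hq] := sm_growth_nat.
pose c : R := ((1 + n%:R ^+ 2) ^+ q)^-1.
have p1 (w : R) : 0 < 1 + w ^+ 2 by rewrite ltr_pwDl// sqr_ge0.
have c0 : 0 < c by rewrite invr_gt0 exprn_gt0.
have h : (c%:E * sm_diag nu i A < +oo)%E.
  apply: le_lt_trans (hq i).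
  rewrite -(setIT A) -integral_indic// -ge0_integralZl//; last first.
    by rewrite lee_fin ltW.
  - by apply/measurable_EFinP; exact: measurable_indic.
  - have c1 : continuous (fun w : R => ((1 + w ^+ 2) ^+ q)^-1).
      move=> w; have q0 : (1 + w ^+ 2) ^+ q != 0 by rewrite expf_neq0// gt_eqF.
      exact: (der_cvg (@derV R (fun w : R => (1 + w ^+ 2) ^+ q) w _ q0
        (derX q (derD (der_cst 1 w) (derX 2 (der_id w)))))).
    apply: ge0_le_integral => //.
    + by move=> w _; rewrite mule_ge0// lee_fin ltW.
    + by apply: measurable_funeM; apply/measurable_EFinP; exact: measurable_indic.
    + by apply/measurable_EFinP; exact: measurable_continuous.
    + move=> w _; rewrite -EFinM lee_fin indicE.
      case: (boolP (w \in _)) => [|_]; last by rewrite mulr0 invr_ge0 exprn_ge0// ltW.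
      rewrite inE /A/= in_itv/= -ler_norml mulr1 => wn.
      rewrite lef_pV2 ?posrE ?exprn_gt0//.
      apply: lerXn2r; [by rewrite nnegrE ltW|by rewrite nnegrE ltW|rewrite lerD2l].
      by rewrite -real_normK ?num_real// ler_pXn2r ?nnegrE.
rewrite -(@lte_pmul2l _ c%:E)// gt0_muley ?lte_fin//.
Qed.

Lemma sm_fin_setI E F : sm_fin_set (sm_diag nu) E -> measurable F ->
  sm_fin_set (sm_diag nu) (E `&` F).
Proof.
move=> [mE fE] mF; split; first exact: measurableI.
move=> i; apply: le_lt_trans (fE i); apply: le_measure => //; rewrite ?inE//.
  exact: measurableI.
Qed.

End spectral_masses.

Section stochastic_integral.
Context {R : realType} {d : measure_display} {Omega : measurableType d}.
Variables (P : probability Omega R) (nu : spectral_measure R).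
Variable Z : 'I_2 -> set (measurableTypeR R) -> Omega -> R[i].
Hypothesis Z_random : random_measure P nu Z.
Local Notation mR := (measurableTypeR R).
Local Notation fin_set := (sm_fin_set (sm_diag nu)).
Implicit Types (i : 'I_2) (s t : seq (R[i] * set mR)) (h : R -> R[i]).

Definition Cindic (E : set mR) (w : mR) : R[i] := (\1_E w)%:C.

Let simple_funE s : simple_fun s = lincomb Cindic s. Proof. by []. Qed.

Let simple_intE i s : simple_int Z i s = lincomb (Z i) s. Proof. by []. Qed.

Let norm2_Cindic i E : measurable E -> norm2 (sm_diag nu i) (Cindic E) = sm_diag nu i E.
Proof.
move=> mE; rewrite /norm2; under eq_integral.
  move=> w _; rewrite (_ : normc (Cindic E w) ^+ 2 = \1_E w); last first.
    by rewrite normcC indicE; case: (w \in E); rewrite ?normr1 ?normr0 ?expr1n ?expr0n.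
  over.
by rewrite integral_indic// setIT.
Qed.

Let L2c_Cindic i E : fin_set E -> L2c (sm_diag nu i) (Cindic E).
Proof.
move=> [mE fE]; apply/L2cP; split; last by rewrite norm2_Cindic.
by apply: CmeasurableC; exact: measurable_indic.
Qed.

Let cinner_Cindic i E F : fin_set E -> fin_set F ->
  cinner P (Z i E) (Z i F) = cinner (sm_diag nu i) (Cindic E) (Cindic F).
Proof.
move=> fE fF; have fEF := sm_fin_setI fE fF.1.
have [_ h] := Z_random; have := h E F i i fE fF; rewrite /Cmoment /Cexpectation /cinner => ->.
rewrite sm_valE//.
rewrite -(norm2_Cindic i fEF.1) -cinner_norm2; last exact: L2c_Cindic.
congr Cint; apply/funext => w; rewrite /Cindic indicI /= !indicE.
by case: (w \in E); case: (w \in F); apply: complex_eqP; rewrite !complexE' /=; ring.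
Qed.

Let simple_fun_addZ c s t : simple_fun (s ++ [seq (c * p.1, p.2) | p <- t]) =
  (fun w => simple_fun s w + c * simple_fun t w).
Proof. exact: (lincomb_addZ Cindic). Qed.

Let simple_int_addZ i c s t : simple_int Z i (s ++ [seq (c * p.1, p.2) | p <- t]) =
  (fun w => simple_int Z i s w + c * simple_int Z i t w).
Proof. exact: (lincomb_addZ (Z i)). Qed.

Let allfin s := forall p, p \in s -> fin_set p.2.

Lemma L2c_simple_fun i s : allfin s -> L2c (sm_diag nu i) (simple_fun s).
Proof. by move=> hs; rewrite simple_funE; apply: L2c_lincomb => p /hs; exact: L2c_Cindic. Qed.

Lemma L2c_simple_int i s : allfin s -> L2c P (simple_int Z i s).
Proof. by move=> hs; rewrite simple_intE; apply: L2c_lincomb => p /hs fp; have [h _] := Z_random; exact: h. Qed.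

(** The covariances of the random measure are the inner products of indicators. *)
Lemma simple_isometry i s : allfin s ->
  norm2 P (simple_int Z i s) = norm2 (sm_diag nu i) (simple_fun s).
Proof.
move=> hs; apply: (@norm2_lincomb _ _ _ _ _ _ _ _ (Z i) Cindic fin_set) => //.
- by move=> E fE; have [h _] := Z_random; exact: h.
- by move=> E fE; exact: L2c_Cindic.
- by move=> E F fE fF; exact: cinner_Cindic.
Qed.

Let allfin_addZ (c : R[i]) s t : allfin s -> allfin t ->
  allfin (s ++ [seq (c * p.1, p.2) | p <- t]).
Proof.
move=> hs ht p; rewrite mem_cat => /orP[/hs//|/mapP[q qt ->]].
exact: ht qt.
Qed.

Lemma simple_isometry_sub i s t : allfin s -> allfin t ->
  norm2 P (fun w => simple_int Z i s w - simple_int Z i t w) =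
  norm2 (sm_diag nu i) (fun w => simple_fun s w - simple_fun t w).
Proof.
move=> hs ht; have := simple_isometry i (allfin_addZ (c := -1) hs ht).
rewrite simple_int_addZ simple_fun_addZ.
have e T (u v : T -> R[i]) : (fun w => u w + -1 * v w) = (fun w => u w - v w).
  by apply/funext => w; rewrite mulN1r.
by rewrite !e.
Qed.

Lemma stoch_int_norm2 i h Y : L2c (sm_diag nu i) h -> is_stoch_int P nu Z i h Y ->
  norm2 P Y = norm2 (sm_diag nu i) h.
Proof.
move=> hL [YL [s [fs ch cY]]].
have c1 := norm2_cvg (fun n => L2c_simple_fun i (fs n)) hL ch.
have c2 := norm2_cvg (fun n => L2c_simple_int i (fs n)) YL cY.
have e : (fun n => norm2 P (simple_int Z i (s n))) =
    (fun n => norm2 (sm_diag nu i) (simple_fun (s n))).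
  by apply/funext => n; exact: (simple_isometry i (fs n)).
by rewrite e in c2; exact: (cvg_unique _ c2 c1).
Qed.

Lemma norm2_cvgD dT (T : measurableType dT) (mu : {measure set T -> \bar R}) (c : R[i])
    (F G : nat -> T -> R[i]) f g :
  (forall n, L2c mu (F n)) -> (forall n, L2c mu (G n)) -> L2c mu f -> L2c mu g ->
  norm2 mu (fun x => F n x - f x) @[n --> \oo] --> 0%E ->
  norm2 mu (fun x => G n x - g x) @[n --> \oo] --> 0%E ->
  norm2 mu (fun x => (F n x + c * G n x) - (f x + c * g x)) @[n --> \oo] --> 0%E.
Proof.
move=> hF hG hf hg cF cG.
have ub n : (norm2 mu (fun x => (F n x + c * G n x) - (f x + c * g x))%R <=
    2%:E * norm2 mu (fun x => F n x - f x)%R +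
    2%:E * ((normc c ^+ 2)%:E * norm2 mu (fun x => G n x - g x)%R))%E.
  have h1 := L2c_measurable (L2cB (hF n) hf).
  have h2 := L2c_measurable (L2cB (hG n) hg).
  have h3 := CmeasurableZ c h2.
  have := norm2D_le mu ltr01 h1 h3; rewrite invr1 norm2Z//.
  by congr (norm2 _ _ <= _)%E; apply/funext => x; ring.
have fF n := norm2_fin (L2cB (hF n) hf); have fG n := norm2_fin (L2cB (hG n) hg).
apply: (@ecvg0_le _ _ (fun n => 2 * fine (norm2 mu (fun x => F n x - f x)) +
    2 * (normc c ^+ 2 * fine (norm2 mu (fun x => G n x - g x))))).
- by move=> n; exact: norm2_ge0.
- move=> n; have := ub n.
  by rewrite -{1}(fineK (fF n)) -{1}(fineK (fG n)) -!EFinM -EFinD.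
- have cF' : (fun n => fine (norm2 mu (fun x => F n x - f x))) @ \oo --> 0.
    exact: fine_cvg cF.
  have cG' : (fun n => fine (norm2 mu (fun x => G n x - g x))) @ \oo --> 0.
    exact: fine_cvg cG.
  have := cvgseqD (cvgseqZ (c := 2) cF') (cvgseqZ (c := 2) (cvgseqZ (c := normc c ^+ 2) cG')).
  by rewrite !mulr0 addr0.
Qed.

Lemma is_stoch_intD i (c : R[i]) h1 h2 Y1 Y2 :
  L2c (sm_diag nu i) h1 -> L2c (sm_diag nu i) h2 ->
  is_stoch_int P nu Z i h1 Y1 -> is_stoch_int P nu Z i h2 Y2 ->
  is_stoch_int P nu Z i (fun w => h1 w + c * h2 w) (fun w => Y1 w + c * Y2 w).
Proof.
move=> h1L h2L [Y1L [s1 [f1 c1 e1]]] [Y2L [s2 [f2 c2 e2]]].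
split; first by apply: L2cD => //; exact: L2cZ.
exists (fun n => s1 n ++ [seq (c * p.1, p.2) | p <- s2 n]); split.
- by move=> n; apply: allfin_addZ; [exact: f1|exact: f2].
- have h := norm2_cvgD c (fun n => L2c_simple_fun i (f1 n))
    (fun n => L2c_simple_fun i (f2 n)) h1L h2L c1 c2.
  apply: cvg_trans h; apply: near_eq_cvg; apply: nearW => n.
  by rewrite /norm2 /L2dist2 simple_fun_addZ.
- have h := norm2_cvgD c (fun n => L2c_simple_int i (f1 n))
    (fun n => L2c_simple_int i (f2 n)) Y1L Y2L e1 e2.
  apply: cvg_trans h; apply: near_eq_cvg; apply: nearW => n.
  by rewrite /norm2 /L2dist2 simple_int_addZ.
Qed.

Lemma stoch_int_norm2_sub i h1 h2 Y1 Y2 :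
  L2c (sm_diag nu i) h1 -> L2c (sm_diag nu i) h2 ->
  is_stoch_int P nu Z i h1 Y1 -> is_stoch_int P nu Z i h2 Y2 ->
  norm2 P (fun w => Y1 w - Y2 w) = norm2 (sm_diag nu i) (fun w => h1 w - h2 w).
Proof.
move=> h1L h2L s1 s2; have h := is_stoch_intD (-1) h1L h2L s1 s2.
have := stoch_int_norm2 (L2cD h1L (L2cZ (-1) h2L)) h.
have e T (u v : T -> R[i]) : (fun w => u w + -1 * v w) = (fun w => u w - v w).
  by apply/funext => w; rewrite mulN1r.
by rewrite !e.
Qed.

(** Existence for limits of simple functions: the isometry turns a fast Cauchy
    sequence of simple functions into one of random variables. *)
Lemma is_stoch_int_exists i h (s : nat -> seq (R[i] * set mR)) :
  (forall n : nat, allfin (s n)) ->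
  L2c (sm_diag nu i) h ->
  L2dist2 (sm_diag nu i) (simple_fun (s n)) h @[n --> \oo] --> 0%E ->
  exists Y, is_stoch_int P nu Z i h Y.
Proof.
move=> fs hL cs.
have near n : exists N, forall k, (N <= k)%N ->
    (norm2 (sm_diag nu i) (fun w => simple_fun (s k) w - h w)%R <= (4^-1 * 16^-1 ^+ n)%:E)%E.
  by apply: (ecvg0_near cs); rewrite mulr_gt0// exprn_gt0.
have [N hN] := choice near.
pose t n := s (\sum_(k < n.+1) N k)%N.
have Nle n k : (n <= k)%N -> (N n <= \sum_(j < k.+1) N j)%N.
  move=> nk; have nk1 : (n < k.+1)%N by [].
  by rewrite (bigD1 (Ordinal nk1))//= leq_addr.
have hs n : L2c (sm_diag nu i) (simple_fun (t n)) by apply: L2c_simple_fun; exact: fs.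
have dt n k : (n <= k)%N -> (norm2 (sm_diag nu i) (fun w => simple_fun (t k) w - h w)%R <=
    (4^-1 * 16^-1 ^+ n)%:E)%E.
  by move=> nk; apply: hN; exact: Nle.
have [|n|Y YL cY] := @riesz_fischer _ _ _ P (fun n => simple_int Z i (t n)).
- by move=> n; apply: L2c_simple_int; exact: fs.
- rewrite simple_isometry_sub; [|exact: fs|exact: fs].
  have m1 := L2c_measurable (L2cB (hs n.+1) hL).
  have m2 := CmeasurableN (L2c_measurable (L2cB (hs n) hL)).
  have := norm2D_le (sm_diag nu i) ltr01 m1 m2; rewrite invr1 norm2N => h1.
  apply: (@le_trans _ _ (norm2 (sm_diag nu i)
      (fun x => (simple_fun (t n.+1) x - h x) + - (simple_fun (t n) x - h x)))%R).
    rewrite le_eqVlt; apply/orP; left; apply/eqP; congr norm2.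
    by apply/funext => x; ring.
  apply: (le_trans h1).
  apply: (@le_trans _ _ ((1 + 1)%:E * (4^-1 * 16^-1 ^+ n)%:E +
      (1 + 1)%:E * (4^-1 * 16^-1 ^+ n)%:E)%E).
    by apply: leeD; rewrite lee_wpmul2l ?lee_fin//; apply: dt.
  rewrite -!EFinM -EFinD lee_fin le_eqVlt; apply/orP; left; apply/eqP; by field.
exists Y; split => //; exists t; split => //.
- by move=> n; exact: fs.
- apply: (@ecvg0_le _ _ (fun n => 4^-1 * 16^-1 ^+ n)).
  + by move=> n; exact: norm2_ge0.
  + by move=> n; exact: dt.
  + by apply: geometric_cvg0; rewrite ger0_norm//; lra.
Qed.

Import HBNNSimple.

(** A nonnegative function is the increasing limit of simple functions, truncated
    to bounded intervals in order to have finite mass. *)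
Lemma is_stoch_int_nneg i (f : mR -> R) : measurable_fun setT f -> (forall x, 0 <= f x) ->
  L2c (sm_diag nu i) (fun x => (f x)%:C) ->
  exists Y, is_stoch_int P nu Z i (fun x => (f x)%:C) Y.
Proof.
move=> mf f0 fL.
have mfE : measurable_fun setT (EFin \o f) by exact/measurable_EFinP.
pose g := nnsfun_approx measurableT mfE.
pose A (n : nat) : set mR := `[- n%:R, n%:R]%classic.
have fA n : fin_set (A n) by exact: sm_bounded_fin.
pose vals n : seq R := finmap.enum_fset (fset_set (range (g n))).
pose s n : seq (R[i] * set mR) := [seq (y%:C, A n `&` g n @^-1` [set y]) | y <- vals n].
have fs n : allfin (s n).
  by move=> p /mapP[y _ ->] /=; apply: sm_fin_setI => //; exact: measurable_sfunP.
have sE n x : simple_fun (s n) x = (g n x * \1_(A n) x)%:C.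
  rewrite /simple_fun /s big_map/= fimfunEord.
  rewrite -(big_mkord xpredT (fun j => (vals n)`_j * \1_(g n @^-1` [set (vals n)`_j]) x)).
  rewrite -(big_nth 0 xpredT (fun y => y * \1_(g n @^-1` [set y]) x)).
  rewrite mulr_suml.
  have -> : (\sum_(y <- vals n) y * \1_(g n @^-1` [set y]) x * \1_(A n) x)%:C =
      \sum_(y <- vals n) (y * \1_(g n @^-1` [set y]) x * \1_(A n) x)%:C :> R[i].
    by rewrite (big_morph (real_complex R) (rmorphD _) (rmorph0 _)).
  apply: eq_bigr => y _; rewrite indicI.
  by rewrite -rmorphM -mulrA [X in _ * X]mulrC.
apply: (is_stoch_int_exists fs fL).
have ge0 n x : 0 <= g n x * \1_(A n) x by rewrite mulr_ge0// indicE.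
have gle n x : g n x <= f x.
  by rewrite -lee_fin /g nnsfun_approxE le_approx// => y _; rewrite lee_fin.
have gle' n x : g n x * \1_(A n) x <= f x.
  by rewrite (le_trans _ (gle n x))// ler_piMr// indicE; case: (_ \in _).
have sq n x : normc (simple_fun (s n) x - (f x)%:C) ^+ 2 = (g n x * \1_(A n) x - f x) ^+ 2.
  by rewrite sE normc_sqr !complexE'; ring.
have iff := integrable_normc2 fL.
have [] := @Rdominated_convergenceT _ _ _ (sm_diag nu i)
  (fun n x => (g n x * \1_(A n) x - f x) ^+ 2) (fun=> 0) (fun x => normc (f x)%:C ^+ 2).
- move=> n; apply: measurable_funX; apply: measurable_funB => //.
  apply: measurable_funM; last by apply: measurable_indic; case: (fA n).
  exact: measurable_funP.
- exact: measurable_cst.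
- move=> x.
  have c1 : (fun n => g n x) @ \oo --> f x.
    have := @cvg_nnsfun_approx _ _ _ _ measurableT _ mfE _ x I.
    move=> /(_ _)/wrap[]; first by move=> y _; rewrite lee_fin.
    by move=> /fine_cvg.
  have c2 : (fun n => \1_(A n) x : R) @ \oo --> (1 : R).
    apply: (@cvgseq_near_cst _ (Num.truncn `|x|).+1) => n xn.
    rewrite indicE mem_set//= /A/= in_itv/= -ler_norml.
    by rewrite (le_trans (ltW (truncnS_gt _)))// ler_nat.
  have c0 : (fun _ : nat => f x) @ \oo --> f x by exact: cvg_cst.
  have c3 := cvgseqB (cvgseqM c1 c2) c0.
  have := cvgseqM c3 c3; rewrite mulr1 subrr mulr0.
  by apply: cvgseq_eq => n; rewrite expr2.
- exact: iff.
- move=> n x; rewrite ger0_norm ?sqr_ge0// normcC real_normK ?num_real//.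
  have := ge0 n x; have := gle' n x; move: (g n x * _) (f x) => u v uv u0.
  by rewrite -sqrrN ler_pXn2r ?nnegrE//; lra.
move=> _ c0; have hB n := L2cB (L2c_simple_fun i (fs n)) fL.
have e n : norm2 (sm_diag nu i) (fun x => simple_fun (s n) x - (f x)%:C) =
    (\int[sm_diag nu i]_x (g n x * \1_(A n) x - f x) ^+ 2)%:E.
  by rewrite (norm2_Rintegral (hB n)); congr (_%:E); apply: eq_Rintegral => x _.
apply: (@ecvg0_le _ _ (fun n => \int[sm_diag nu i]_x (g n x * \1_(A n) x - f x) ^+ 2)).
- by move=> n; exact: norm2_ge0.
- by move=> n; rewrite -e.
- by move: c0; rewrite /Rintegral integral0.
Qed.

(** By linearity, from the positive and negative parts of the two components. *)
Lemma is_stoch_int_total i h : L2c (sm_diag nu i) h -> exists Y, is_stoch_int P nu Z i h Y.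
Proof.
move=> hL; have [m1 m2] := L2c_measurable hL.
pose pos (u : mR -> R) x := Num.max (u x) 0.
have mpos u : measurable_fun setT u -> measurable_fun setT (pos u).
  by move=> mu; apply: measurable_maxr.
have pos0 u x : 0 <= pos u x by rewrite le_max lexx orbT.
have posle (u : mR -> R) x : `|u x| <= normc (h x) -> `|pos u x| <= normc (h x).
  move=> uh; rewrite ger0_norm ?pos0// /pos ge_max normc_ge0 andbT.
  exact: le_trans (ler_norm _) uh.
have step (u : mR -> R) : measurable_fun setT u -> (forall x, `|u x| <= normc (h x)) ->
    L2c (sm_diag nu i) (fun x => (pos u x)%:C) /\ exists Y, is_stoch_int P nu Z i (fun x => (pos u x)%:C) Y.
  move=> mu uh; have L : L2c (sm_diag nu i) (fun x => (pos u x)%:C).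
    apply/L2cP; have mp : Cmeasurable (fun x => (pos u x)%:C) by apply: CmeasurableC; exact: mpos.
    split => //; have /L2cP[mh fh] := hL.
    by apply: le_lt_trans (norm2_le (sm_diag nu i) mp mh _) fh => x; rewrite normcC posle.
  by split => //; apply: is_stoch_int_nneg => //; exact: mpos.
have [L1 [Y1 h1]] := step (fun x => Re (h x)) m1 (fun x => Re_le_normc (h x)).
have [L2 [Y2 h2]] : L2c (sm_diag nu i) (fun x => (pos (fun x => - Re (h x)) x)%:C) /\
    exists Y, is_stoch_int P nu Z i (fun x => (pos (fun x => - Re (h x)) x)%:C) Y.
  apply: step; first exact: (measurableT_comp (@oppr_measurable R setT)).
  by move=> x; rewrite normrN Re_le_normc.
have [L3 [Y3 h3]] := step (fun x => Im (h x)) m2 (fun x => Im_le_normc (h x)).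
have [L4 [Y4 h4]] : L2c (sm_diag nu i) (fun x => (pos (fun x => - Im (h x)) x)%:C) /\
    exists Y, is_stoch_int P nu Z i (fun x => (pos (fun x => - Im (h x)) x)%:C) Y.
  apply: step; first exact: (measurableT_comp (@oppr_measurable R setT)).
  by move=> x; rewrite normrN Im_le_normc.
have k1 := is_stoch_intD (-1) L1 L2 h1 h2.
have k2 := is_stoch_intD (-1) L3 L4 h3 h4.
have := is_stoch_intD (0 +i* 1) (L2cD L1 (L2cZ (-1) L2)) (L2cD L3 (L2cZ (-1) L4)) k1 k2.
set h' := (fun w : R => _); have -> : h' = h.
  have pE (r : R) : Num.max r 0 - Num.max (- r) 0 = r.
    have [r0|r0] := leP r 0; first by rewrite max_l ?oppr_ge0// opprK add0r.
    by rewrite max_r ?subr0// oppr_le0 ltW.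
  apply/funext => x; apply: complex_eqP; rewrite /h' /pos !complexE' -[RHS]pE; ring.
by move=> k; eexists; exact: k.
Qed.

Lemma stoch_intP i h : L2c (sm_diag nu i) h ->
  is_stoch_int P nu Z i h (stoch_int P nu Z i h).
Proof. by move=> /is_stoch_int_total[Y hY]; apply: (xgetPex (fun=> 0)); exists Y. Qed.

Lemma stat_opP i g : (exists h, is_symbol nu i g h) -> exists2 h, is_symbol nu i g h &
  is_stoch_int P nu Z i h (stat_op P nu Z i g).
Proof.
move=> hg; exists (xget (fun=> 0) [set h | is_symbol nu i g h]).
  exact: (xgetPex (fun=> 0) hg).
by apply: stoch_intP; have [_] := xgetPex (fun=> 0) hg.
Qed.

End stochastic_integral.

(** * Schwartz functions *)

Section schwartz_functions.
Context {R : realType}.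
Local Notation mu := (@lebesgue_measure R).
Local Notation mR := (measurableTypeR R).
Implicit Types (f g : R -> R) (phi psi : R -> R[i]).

(** The real Schwartz class, through which the complex one is handled by
    components. *)
Definition rschwartz f := (forall k (t : R), derivable (derive1n k f) t 1) /\
  forall j k : nat, exists M : R, forall t : R, `|t| ^+ j * `|derive1n k f t| <= M.

Lemma schwartzP phi : schwartz phi <->
  rschwartz (fun t => Re (phi t)) /\ rschwartz (fun t => Im (phi t)).
Proof.
split=> [[sm bd]|[[d1 b1] [d2 b2]]].
  split; split.
  - by move=> k t; have [] := sm k t.
  - move=> j k; have [M hM] := bd j k; exists M => t; apply: le_trans (hM t).
    by rewrite ler_wpM2l//; exact: (Re_le_normc (Cderive k phi t)).
  - by move=> k t; have [] := sm k t.
  - move=> j k; have [M hM] := bd j k; exists M => t; apply: le_trans (hM t).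
    by rewrite ler_wpM2l//; exact: (Im_le_normc (Cderive k phi t)).
split; first by move=> k t; split; [exact: d1|exact: d2].
move=> j k; have [M1 h1] := b1 j k; have [M2 h2] := b2 j k.
exists (M1 + M2) => t; apply: le_trans (lerD (h1 t) (h2 t)); rewrite -mulrDr ler_wpM2l//.
exact: (normc_le_ReIm (Cderive k phi t)).
Qed.

Lemma der_derivable f (t : R) : derivable f t 1 -> is_derive t 1 f (derive1 f t).
Proof. by move=> h; split => //; rewrite derive1E. Qed.

Lemma rschwartz_der f k (t : R) : rschwartz f ->
  is_derive t 1 (derive1n k f) (derive1n k.+1 f t).
Proof. by move=> [d _]; rewrite derive1nS; exact/der_derivable/d. Qed.

Lemma rschwartz_eq f g : f =1 g -> rschwartz f -> rschwartz g.
Proof. by move=> /funext ->. Qed.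

Lemma rschwartz_derive1 f : rschwartz f -> rschwartz (derive1 f).
Proof.
move=> [d b]; split=> [k t|j k].
  by have := d k.+1 t; rewrite derive1Sn.
by have [M hM] := b j k.+1; exists M => t; rewrite -derive1Sn.
Qed.

Let derive1nD f g k : rschwartz f -> rschwartz g ->
  derive1n k (fun t => f t + g t) = (fun t => derive1n k f t + derive1n k g t).
Proof.
move=> hf hg; elim: k => [//|k IH]; rewrite derive1nS IH; apply/funext => t.
exact: (der_derive1 (derD (rschwartz_der k t hf) (rschwartz_der k t hg))).
Qed.

Lemma rschwartzD f g : rschwartz f -> rschwartz g -> rschwartz (fun t => f t + g t).
Proof.
move=> hf hg; split=> [k t|j k].
  rewrite derive1nD//.
  by have [] := derD (rschwartz_der k t hf) (rschwartz_der k t hg).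
have [_ /(_ j k)[M1 h1]] := hf; have [_ /(_ j k)[M2 h2]] := hg.
exists (M1 + M2) => t; rewrite derive1nD//.
apply: le_trans (lerD (h1 t) (h2 t)); rewrite -mulrDr ler_wpM2l//.
exact: ler_normD.
Qed.

Let derive1nZ (c : R) f k : rschwartz f ->
  derive1n k (fun t => c * f t) = (fun t => c * derive1n k f t).
Proof.
move=> hf; elim: k => [//|k IH]; rewrite derive1nS IH; apply/funext => t.
exact: (der_derive1 (derZ c (rschwartz_der k t hf))).
Qed.

Lemma rschwartzZ (c : R) f : rschwartz f -> rschwartz (fun t => c * f t).
Proof.
move=> hf; split=> [k t|j k].
  by rewrite derive1nZ//; have [] := derZ c (rschwartz_der k t hf).
have [_ /(_ j k)[M h]] := hf.
exists (`|c| * M) => t; rewrite derive1nZ// normrM mulrCA ler_wpM2l//.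
Qed.

Let der_shift f df (h t : R) : is_derive (t - h) 1 f df ->
  is_derive t 1 (fun t => f (t - h)) df.
Proof.
move=> hf; have h1 : is_derive t 1 (fun t : R => t - h) 1.
  by apply: (der_eq (derB (der_id t) (der_cst h t))); rewrite subr0.
by apply: (der_eq (@der_comp R f (fun t => t - h) t df 1 hf h1)); rewrite mulr1.
Qed.

Let derive1n_shift f (h : R) k : rschwartz f ->
  derive1n k (fun t => f (t - h)) = (fun t => derive1n k f (t - h)).
Proof.
move=> hf; elim: k => [//|k IH]; rewrite derive1nS IH; apply/funext => t.
exact: (der_derive1 (der_shift (rschwartz_der k (t - h) hf))).
Qed.

Lemma rschwartz_shift (h : R) f : rschwartz f -> rschwartz (fun t => f (t - h)).
Proof.
move=> hf; split=> [k t|j k].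
  by rewrite derive1n_shift//; have [] := der_shift (rschwartz_der k (t - h) hf).
have [_ b] := hf; have [M1 h1] := b j k; have [M2 h2] := b 0%N k.
exists (2 ^+ j * (M1 + `|h| ^+ j * M2)) => t; rewrite derive1n_shift//.
have tj : `|t| ^+ j <= 2 ^+ j * (`|t - h| ^+ j + `|h| ^+ j).
  have th : `|t| <= `|t - h| + `|h| by rewrite -{1}(subrK h t) ler_normD.
  apply: (@le_trans _ _ ((2 * Num.max `|t - h| `|h|) ^+ j)).
    apply: lerXn2r; [by rewrite nnegrE|by rewrite nnegrE mulr_ge0// le_max normr_ge0|].
    by apply: (le_trans th); rewrite mulr_natl mulr2n lerD// le_max lexx ?orbT.
  rewrite exprMn ler_wpM2l ?exprn_ge0//.
  by case: (leP `|t - h| `|h|) => _; rewrite ?lerDr ?lerDl exprn_ge0.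
apply: (le_trans (ler_wpM2r (normr_ge0 _) tj)); rewrite -mulrA ler_wpM2l ?exprn_ge0//.
rewrite mulrDl; apply: lerD; first exact: h1.
rewrite ler_wpM2l ?exprn_ge0//.
by have := h2 (t - h); rewrite expr0 mul1r.
Qed.

Lemma rschwartz_continuous f k : rschwartz f -> continuous (derive1n k f).
Proof. by move=> hf t; exact: der_cvg (rschwartz_der k t hf). Qed.

Lemma rschwartz_bound f k : rschwartz f ->
  exists2 M, 0 <= M & forall t, `|derive1n k f t| <= M.
Proof.
move=> [_ /(_ 0%N k)[M hM]]; exists M => [|t]; last by have := hM t; rewrite expr0 mul1r.
by have := hM 0; rewrite expr0 mul1r; apply: le_trans.
Qed.

Lemma rschwartz_cauchy f : rschwartz f ->
  exists2 M, 0 <= M & forall t, `|f t| <= M * (1 / (t ^+ 2 + 1 ^+ 2)).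
Proof.
move=> [_ b]; have [M0 h0] := b 0%N 0%N; have [M2 h2] := b 2%N 0%N.
have h t : `|f t| * (t ^+ 2 + 1 ^+ 2) <= M2 + M0.
  rewrite mulrDr expr1n mulr1 lerD//; last by have := h0 t; rewrite expr0 mul1r.
  by have := h2 t; rewrite real_normK ?num_real// mulrC.
exists (M2 + M0).
  by apply: le_trans (h 0); rewrite mulr_ge0// addr_ge0// ?sqr_ge0.
move=> t; rewrite mulrA mulr1 ler_pdivlMr//.
by rewrite expr1n ltr_wpDl ?sqr_ge0.
Qed.

Lemma rschwartz_measurable f : rschwartz f -> measurable_fun (setT : set mR) f.
Proof. by move=> hf; apply: measurable_continuous; exact: (@rschwartz_continuous f 0). Qed.

Lemma rschwartz_integrable f : rschwartz f -> mu.-integrable setT (EFin \o f).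
Proof.
move=> hf; have [M M0 h] := rschwartz_cauchy hf.
apply: (@integrable_dominated _ _ _ mu setT _ (fun t => M * (1 / (t ^+ 2 + 1 ^+ 2)))) => //.
- exact: rschwartz_measurable.
- apply: intZ => //; have := @integral_cauchy R 1 0 ltr01.
  by under eq_fun do rewrite subr0.
Qed.

Lemma schwartzD (a : R[i]) phi psi : schwartz phi -> schwartz psi ->
  schwartz (fun t => a * phi t + psi t).
Proof.
move=> /schwartzP[p1 p2] /schwartzP[q1 q2]; apply/schwartzP; split.
  have h := rschwartzD (rschwartzD (rschwartzZ (Re a) p1) (rschwartzZ (- Im a) p2)) q1.
  by apply: rschwartz_eq h => t; rewrite !complexE'; ring.
have h := rschwartzD (rschwartzD (rschwartzZ (Re a) p2) (rschwartzZ (Im a) p1)) q2.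
by apply: rschwartz_eq h => t; rewrite !complexE'; ring.
Qed.

Lemma schwartz0 : schwartz (fun _ : R => 0 : R[i]).
Proof.
have h0 k : derive1n k (fun _ : R => 0 : R) = (fun=> 0).
  elim: k => [//|k IH]; rewrite derive1nS IH; apply/funext => t.
  exact: (der_derive1 (der_cst 0 t)).
have r0 : rschwartz (fun _ : R => 0 : R).
  split=> [k t|j k]; first by rewrite h0; have [] := der_cst (0 : R) t.
  by exists 0 => t; rewrite h0 normr0 mulr0.
by apply/schwartzP; split.
Qed.

Lemma schwartz_eq phi psi : phi =1 psi -> schwartz phi -> schwartz psi.
Proof. by move=> /funext ->. Qed.

Lemma schwartzZ (a : R[i]) phi : schwartz phi -> schwartz (fun t => a * phi t).
Proof.
move=> hp; have := schwartzD a hp schwartz0.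
by apply: schwartz_eq => t; rewrite addr0.
Qed.

Lemma schwartz_translate h phi : schwartz phi -> schwartz (translate h phi).
Proof.
by move=> /schwartzP[p1 p2]; apply/schwartzP; split;
  [exact: (rschwartz_shift h p1)|exact: (rschwartz_shift h p2)].
Qed.

Lemma Cderive1E phi t : Cderive 1 phi t =
  derive1 (fun t => Re (phi t)) t +i* derive1 (fun t => Im (phi t)) t.
Proof. by []. Qed.

Lemma schwartz_Cderive phi : schwartz phi -> schwartz (Cderive 1 phi).
Proof.
by move=> /schwartzP[p1 p2]; apply/schwartzP; split; exact: rschwartz_derive1.
Qed.

Lemma schwartz_Cmeasurable phi : schwartz phi -> Cmeasurable (phi : mR -> R[i]).
Proof. by move=> /schwartzP[p1 p2]; split; exact: rschwartz_measurable. Qed.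

Lemma schwartz_Cintegrable phi : schwartz phi -> Cintegrable mu setT phi.
Proof. by move=> /schwartzP[p1 p2]; split; exact: rschwartz_integrable. Qed.

(** * Modulated Gaussians *)

(** This class is stable under differentiation, so that one decay estimate covers
    all the derivatives of a modulated Gaussian. *)
Definition gaussian (p r : {poly R}) (a q : R) (t : R) :=
  (p.[t] * cos (a * t) + r.[t] * sin (a * t)) * expR (- (q * t ^+ 2)).

Lemma der_horner (p : {poly R}) (t : R) : is_derive t 1 (fun t => p.[t]) (p^`()).[t].
Proof.
elim/poly_ind: p => [|p c IH].
  under eq_fun do rewrite horner0.
  by apply: (der_eq (der_cst 0 t)); rewrite deriv0 horner0.
under eq_fun do rewrite hornerMXaddC.
apply: (der_eq (derD (derM IH (der_id t)) (der_cst c t))).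
by rewrite derivMXaddC hornerD hornerMX; ring.
Qed.

Lemma der_gaussian p r a q (t : R) : is_derive t 1 (gaussian p r a q)
  (gaussian (p^`() + a *: r - (2 * q) *: (p * 'X)) (r^`() - a *: p - (2 * q) *: (r * 'X)) a q t).
Proof.
have da : is_derive t 1 (fun t : R => a * t) a by apply: (der_eq (derZ a (der_id t))); rewrite mulr1.
have dq : is_derive t 1 (fun t : R => - (q * t ^+ 2)) (- (q * (2 * t))).
  by apply: (der_eq (derN (derZ q (derX 2 (der_id t))))); rewrite /=; ring.
apply: (der_eq (derM (derD (derM (der_horner p t) (der_cos da))
  (derM (der_horner r t) (der_sin da))) (der_expR dq))).
by rewrite /gaussian !(hornerD, hornerN, hornerZ, hornerMX); ring.
Qed.

Lemma pow_gaussian_bound (q : R) (n : nat) : 0 < q ->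
  exists M, forall t : R, `|t| ^+ n * expR (- (q * t ^+ 2)) <= M.
Proof.
move=> q0.
have even_bd m : exists M, forall t : R, (t ^+ 2) ^+ m * expR (- (q * t ^+ 2)) <= M.
  case: m => [|m].
    exists 1 => t; rewrite expr0 mul1r -expR0 ler_expR oppr_le0.
    by rewrite mulr_ge0 ?sqr_ge0// ltW.
  exists ((m.+1%:R / q) ^+ m.+1) => t; rewrite expRN.
  rewrite ler_pdivrMr ?expR_gt0//.
  have h : q * t ^+ 2 / m.+1%:R <= expR (q * t ^+ 2 / m.+1%:R).
    by apply: le_trans (expR_ge1Dx _); rewrite lerDr.
  have h0 : 0 <= q * t ^+ 2 / m.+1%:R by rewrite divr_ge0// mulr_ge0 ?sqr_ge0// ltW.
  have : (q * t ^+ 2 / m.+1%:R) ^+ m.+1 <= expR (q * t ^+ 2).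
    have E : q * t ^+ 2 = m.+1%:R * (q * t ^+ 2 / m.+1%:R) by rewrite [RHS]mulrC divfK.
    rewrite {2}E expRM_natl.
    by apply: lerXn2r; rewrite ?nnegrE ?expR_ge0.
  have mq : 0 <= (m.+1%:R / q) ^+ m.+1 by rewrite exprn_ge0// divr_ge0// ltW.
  move=> /(ler_wpM2l mq); rewrite -exprMn.
  have -> : m.+1%:R / q * (q * t ^+ 2 / m.+1%:R) = t ^+ 2.
    have : m.+1%:R != 0 :> R by rewrite pnatr_eq0.
    by move: (m.+1%:R) => c c0; field; rewrite c0 gt_eqF.
  exact.
have [M0 h0] := even_bd 0%N; have [M1 h1] := even_bd n.
exists (M0 + M1) => t; apply: le_trans (lerD (h0 t) (h1 t)).
rewrite -mulrDl ler_wpM2r ?expR_ge0// expr0 -real_normK ?num_real// -exprM mulnC exprM.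
have := exprn_ge0 n (normr_ge0 t); move: (`|t| ^+ n) => u u0.
by have := sqr_ge0 (u - 1); rewrite sqrrB expr1n mulr1 mulr2n; lra.
Qed.

Lemma poly_gaussian_bound (p : {poly R}) (q : R) (n : nat) : 0 < q ->
  exists M, forall t : R, `|t| ^+ n * (`|p.[t]| * expR (- (q * t ^+ 2))) <= M.
Proof.
move=> q0; elim/poly_ind: p n => [n|p c IH n].
  by exists 0 => t; rewrite horner0 normr0 mul0r mulr0.
have [M1 h1] := IH n.+1; have [M2 h2] := pow_gaussian_bound n q0.
exists (M1 + `|c| * M2) => t; rewrite hornerMXaddC.
apply: (@le_trans _ _ (`|t| ^+ n.+1 * (`|p.[t]| * expR (- (q * t ^+ 2))) +
    `|c| * (`|t| ^+ n * expR (- (q * t ^+ 2))))); last first.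
  by apply: lerD; rewrite ?h1// ler_wpM2l.
have : `|p.[t] * t + c| <= `|p.[t]| * `|t| + `|c| by rewrite (le_trans (ler_normD _ _))// normrM.
move=> /(ler_wpM2r (expR_ge0 (- (q * t ^+ 2)))) /(ler_wpM2l (exprn_ge0 n (normr_ge0 t))).
by move=> /le_trans; apply; rewrite [`|t| ^+ n.+1]exprS le_eqVlt; apply/orP; left; apply/eqP; ring.
Qed.

Lemma rschwartz_gaussian p r a q : 0 < q -> rschwartz (gaussian p r a q).
Proof.
move=> q0.
have E k : exists p' r', derive1n k (gaussian p r a q) = gaussian p' r' a q.
  elim: k => [|k [p' [r' E]]]; first by exists p, r.
  rewrite derive1nS E; eexists; eexists; apply/funext => t.
  exact: (der_derive1 (der_gaussian p' r' a q t)).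
split=> [k t|j k]; have [p' [r' ->]] := E k.
  by have [] := der_gaussian p' r' a q t.
have [M1 h1] := poly_gaussian_bound p' j q0; have [M2 h2] := poly_gaussian_bound r' j q0.
exists (M1 + M2) => t; apply: le_trans (lerD (h1 t) (h2 t)).
rewrite -mulrDr -mulrDl ler_wpM2l ?exprn_ge0// /gaussian normrM (ger0_norm (expR_ge0 _)).
rewrite ler_wpM2r ?expR_ge0// (le_trans (ler_normD _ _))// !normrM.
by rewrite lerD// ler_piMr// ?cos_max ?sin_max.
Qed.

End schwartz_functions.

(** * The Fourier transform *)

Section complex_integrals.
Context {R : realType}.
Local Notation mu := (@lebesgue_measure R).
Local Notation mR := (measurableTypeR R).
Implicit Types (f : R -> R) (phi psi : R -> R[i]).

Lemma Cintegrable_measurable phi : Cintegrable mu setT phi -> Cmeasurable (phi : mR -> R[i]).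
Proof. by move=> [i1 i2]; split; [exact: (int_measurable _ i1)|exact: (int_measurable _ i2)]. Qed.

Lemma Cintegrable_norm phi : Cintegrable mu setT phi ->
  mu.-integrable setT (EFin \o (fun t => normc (phi t))).
Proof.
move=> hp; have [i1 i2] := hp.
apply: (@integrable_dominated _ _ _ mu setT _ (fun t => `|Re (phi t)| + `|Im (phi t)|)) => //.
- exact: measurable_normc (Cintegrable_measurable hp).
- by apply: intD => //; exact: integrable_norm.
- by move=> t _; rewrite ger0_norm ?normc_ge0// normc_le_ReIm.
Qed.

Lemma Cintegrable_le phi (g : R -> R) : Cmeasurable (phi : mR -> R[i]) ->
  mu.-integrable setT (EFin \o g) -> (forall t, normc (phi t) <= g t) ->
  Cintegrable mu setT phi.
Proof.
move=> [m1 m2] ig pg; split; apply: (integrable_dominated _ _ ig) => // t _.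
  exact: le_trans (Re_le_normc _) (pg t).
exact: le_trans (Im_le_normc _) (pg t).
Qed.

Lemma normc_Cint_le phi : Cintegrable mu setT phi ->
  normc (Cint mu setT phi) <= 2 * \int[mu]_t normc (phi t).
Proof.
move=> hp; have [i1 i2] := hp; apply: (le_trans (normc_le_ReIm _)).
rewrite mulr_natl mulr2n; apply: lerD.
  apply: (le_trans (le_normr_Rintegral _ i1)) => //; apply: le_Rintegral => //.
  - exact: integrable_norm.
  - exact: Cintegrable_norm.
  - by move=> t _; exact: Re_le_normc.
apply: (le_trans (le_normr_Rintegral _ i2)) => //; apply: le_Rintegral => //.
- exact: integrable_norm.
- exact: Cintegrable_norm.
- by move=> t _; exact: Im_le_normc.
Qed.

Lemma Cintegrable_mul_bounded phi (c : R -> R[i]) (M : R) :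
  Cintegrable mu setT phi -> Cmeasurable (c : mR -> R[i]) ->
  (forall t, normc (c t) <= M) -> Cintegrable mu setT (fun t => phi t * c t).
Proof.
move=> hp mc cM; apply: (Cintegrable_le (g := fun t => M * normc (phi t))).
- exact: CmeasurableM (Cintegrable_measurable hp) mc.
- by apply: intZ => //; exact: Cintegrable_norm.
- by move=> t; rewrite ComplexField.Normc.normcM mulrC ler_wpM2r// normc_ge0.
Qed.

Lemma Cint_shift (h : R) phi : Cintegrable mu setT phi ->
  Cint mu setT (fun t => phi (t - h)) = Cint mu setT phi.
Proof.
by move=> [i1 i2]; apply: complex_eqP; [exact: (Rintegral_shift (- h) i1)|
  exact: (Rintegral_shift (- h) i2)].
Qed.

Lemma Cmeasurable_cis (w : R) : Cmeasurable ((fun t => cis (- (t * w))) : mR -> R[i]).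
Proof.
have c (t : R) := der_id t.
split => /=; apply: measurable_continuous => t.
  exact: (der_cvg (der_cos (derN (derM (der_id t) (der_cst w t))))).
exact: (der_cvg (der_sin (derN (derM (der_id t) (der_cst w t))))).
Qed.

(** The primitive vanishes at both ends. *)
Lemma Rintegral_derive0 (u du : R -> R) (M : R) :
  (forall t : R, is_derive t 1 u (du t)) -> continuous du ->
  mu.-integrable setT (EFin \o du) ->
  (forall t, `|u t| <= M * (1 / (t ^+ 2 + 1 ^+ 2))) -> \int[mu]_t du t = 0.
Proof.
move=> dudt cdu idu uM.
have mdu := int_measurable measurableT idu.
have FTC n : \int[mu]_t (du \_ `[- n%:R, n%:R]) t = u n%:R - u (- n%:R).
  rewrite -Rintegral_mkcond (@RFTC2 _ u)//; first by have := ler0n R n; lra.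
  exact: continuous_subspaceT.
have c1 : (fun n : nat => \int[mu]_t (du \_ `[- n%:R, n%:R]) t) @ \oo --> \int[mu]_t du t.
  have [] := @Rdominated_convergenceT _ _ _ mu (fun n => du \_ `[- n%:R, n%:R]) du
    (fun t => `|du t|) => //.
  - move=> n; apply/(measurable_restrictT _ _).1; first exact: measurable_itv.
    exact: measurable_funTS.
  - move=> t; apply: (@cvgseq_near_cst _ (Num.truncn `|t|).+1) => n tn.
    rewrite patchE ifT// inE/= in_itv/= -ler_norml.
    by rewrite (le_trans (ltW (truncnS_gt _)))// ler_nat.
  - exact: integrable_norm.
  - by move=> n t; rewrite patchE; case: ifPn => // _; rewrite normr0.
have c2 : (fun n : nat => u n%:R - u (- n%:R)) @ \oo --> 0.
  apply: (@cvg_dist_le _ 1%N _ (fun n => 2 * M * n%:R^-1)).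
    move=> n n1; rewrite subr0 (le_trans (ler_normB _ _))//.
    have M0 : 0 <= M.
      have := le_trans (normr_ge0 _) (uM 0); rewrite expr0n add0r expr1n divr1 mulr1.
      exact.
    have nle : 1 / (n%:R ^+ 2 + 1 ^+ 2) <= n%:R^-1 :> R.
      have n0 : 1 <= n%:R :> R by rewrite ler1n.
      rewrite div1r lef_pV2 ?posrE ?ltr_wpDl ?sqr_ge0 ?expr1n//; last by rewrite (lt_le_trans ltr01).
      by rewrite (@le_trans _ _ (n%:R ^+ 2))// ?lerDl// expr2 ler_peMr// (le_trans ler01).
    have := uM n%:R; have := uM (- n%:R); rewrite sqrrN.
    move: (ler_wpM2l M0 nle) => h h1 h2; lra.
  by have := cvgseqZ (c := 2 * M) (@cvg_invn R); rewrite mulr0.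
have c3 := cvgseq_eq (fun n => esym (FTC n)) c2.
exact: (cvg_unique _ c1 c3).
Qed.

(** The phase [th] treats the cosine and sine transforms at once. *)
Definition cos_transform f (th w : R) := \int[mu]_t (f t * cos (t * w + th)).

Lemma cos_transform_integrable f th w : mu.-integrable setT (EFin \o f) ->
  mu.-integrable setT (EFin \o (fun t => f t * cos (t * w + th))).
Proof.
move=> fi; apply: (@integrable_dominated _ _ _ mu setT _ (fun t => `|f t|)) => //.
- apply: measurable_funM; first exact: (int_measurable _ fi).
  apply: measurable_continuous => t.
  exact: (der_cvg (der_cos (derD (derM (der_id t) (der_cst w t)) (der_cst th t)))).
- exact: integrable_norm.
- by move=> t _; rewrite normrM ler_piMr// cos_max.
Qed.

Lemma continuous_cos_transform f th : mu.-integrable setT (EFin \o f) ->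
  continuous (cos_transform f th).
Proof.
move=> fi w; have := @continuity_under_integral _ _ _ mu (fun w t => f t * cos (t * w + th))
  setT measurableT (w - 1) (w + 1) _ _ (fun t => `|f t|) _ _ w.
apply.
- by move=> v _; exact: cos_transform_integrable.
- apply: aeW => t _ v _.
  exact: (der_cvg (derZ (f t) (der_cos (derD (derM (der_cst t v) (der_id v)) (der_cst th v))))).
- exact: integrable_norm.
- by move=> v _; apply: aeW => t _; rewrite normrM ler_piMr// cos_max.
- by rewrite inE/= in_itv/=; apply/andP; split; lra.
Qed.

Lemma cosBpi2 (x : R) : cos (x - pi / 2) = sin x.
Proof. by rewrite cosB cos_pihalf sin_pihalf; ring. Qed.

Lemma fourierE phi w : Cintegrable mu setT phi -> fourier phi w =
  (cos_transform (fun t => Re (phi t)) 0 w + cos_transform (fun t => Im (phi t)) (- (pi / 2)) w)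
  +i* (cos_transform (fun t => Im (phi t)) 0 w - cos_transform (fun t => Re (phi t)) (- (pi / 2)) w).
Proof.
move=> [i1 i2]; apply: complex_eqP; rewrite !complexE' /cos_transform.
  rewrite -RintegralD//; try exact: cos_transform_integrable.
  apply: eq_Rintegral => t _; rewrite !complexE' cosN sinN addr0 cosBpi2; ring.
rewrite -RintegralB//; try exact: cos_transform_integrable.
by apply: eq_Rintegral => t _; rewrite !complexE' cosN sinN addr0 cosBpi2; ring.
Qed.

Lemma fourier_Cintegrable phi w : Cintegrable mu setT phi ->
  Cintegrable mu setT (fun t => phi t * cis (- (t * w))).
Proof.
move=> hp; apply: (Cintegrable_mul_bounded (M := 1) hp (Cmeasurable_cis w)) => t.
by rewrite normc_cis.
Qed.

Lemma fourier_continuous phi : Cintegrable mu setT phi ->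
  continuous (fun w => Re (fourier phi w)) /\ continuous (fun w => Im (fourier phi w)).
Proof.
move=> hp; have [i1 i2] := hp.
split; under eq_fun do rewrite (fourierE _ hp) !complexE'.
  by move=> w; apply: cvgD; exact: continuous_cos_transform.
by move=> w; apply: cvgB; exact: continuous_cos_transform.
Qed.

Lemma fourier_Cmeasurable phi : Cintegrable mu setT phi ->
  Cmeasurable (fourier phi : mR -> R[i]).
Proof.
by move=> /fourier_continuous[c1 c2]; split; exact: measurable_continuous.
Qed.

Lemma fourier_bound phi w : Cintegrable mu setT phi ->
  normc (fourier phi w) <= 2 * \int[mu]_t normc (phi t).
Proof.
move=> hp; apply: (le_trans (normc_Cint_le (fourier_Cintegrable w hp))).
rewrite le_eqVlt; apply/orP; left; apply/eqP; congr (_ * _); apply: eq_Rintegral => t _.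
by rewrite ComplexField.Normc.normcM normc_cis mulr1.
Qed.

Lemma fourierD (a : R[i]) phi psi w : Cintegrable mu setT phi -> Cintegrable mu setT psi ->
  fourier (fun t => a * phi t + psi t) w = a * fourier phi w + fourier psi w.
Proof.
move=> hp hq; have h1 := fourier_Cintegrable w hp; have h2 := fourier_Cintegrable w hq.
rewrite /fourier -CintZ// -CintD//; last exact: CintegrableZ.
by congr Cint; apply/funext => t; ring.
Qed.

Lemma fourierZ (a : R[i]) phi w : Cintegrable mu setT phi ->
  fourier (fun t => a * phi t) w = a * fourier phi w.
Proof.
move=> hp; rewrite /fourier -CintZ; last exact: fourier_Cintegrable.
by congr Cint; apply/funext => t; ring.
Qed.

Lemma fourier_translate (h : R) phi w : Cintegrable mu setT phi ->
  fourier (translate h phi) w = cis (- (h * w)) * fourier phi w.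
Proof.
move=> hp; have h1 := fourier_Cintegrable w hp.
rewrite /fourier -CintZ// -[RHS](Cint_shift h); last exact: CintegrableZ.
congr Cint; apply/funext => t; rewrite /translate mulrCA -cisD; congr (_ * cis _); ring.
Qed.

(** Fubini's theorem, the kernel [e^{- i t w}] being symmetric. *)
Lemma fourier_mul_formula phi psi : Cintegrable mu setT phi -> Cintegrable mu setT psi ->
  Cint mu setT (fun t => phi t * fourier psi t) = Cint mu setT (fun w => fourier phi w * psi w).
Proof.
move=> hp hq; have [p1 p2] := hp; have [q1 q2] := hq.
have fub (f g : R -> R) th : mu.-integrable setT (EFin \o f) -> mu.-integrable setT (EFin \o g) ->
    \int[mu]_t (f t * cos_transform g th t) = \int[mu]_w (g w * cos_transform f th w).
  move=> fi gi.
  have mc : measurable_fun setT (fun z : mR * mR => cos (z.2 * z.1 + th)).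
    apply: (measurableT_comp (measurable_continuous (@continuous_cos R))).
    by apply: measurable_funD => //; exact: measurable_funM.
  have := @Rfubini _ _ _ _ _ mu mu f g (fun t w => cos (w * t + th)) 1 ler01 fi gi mc
    (fun t w => cos_max _).
  rewrite /cos_transform => ->.
  apply: eq_Rintegral => w _; congr (_ * _); apply: eq_Rintegral => t _.
  by rewrite [w * t]mulrC.
have ii (f g : R -> R) th : mu.-integrable setT (EFin \o f) -> mu.-integrable setT (EFin \o g) ->
    mu.-integrable setT (EFin \o (fun t => f t * cos_transform g th t)).
  move=> fi gi; apply: (@integrable_dominated _ _ _ mu setT _
      (fun t => \int[mu]_w `|g w| * `|f t|)) => //.
  - apply: measurable_funM; first exact: (int_measurable _ fi).
    by apply: measurable_continuous; exact: continuous_cos_transform.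
  - by apply: intZ => //; exact: integrable_norm.
  - move=> t _; rewrite normrM mulrC ler_wpM2r//.
    apply: (le_trans (le_normr_Rintegral _ (cos_transform_integrable th t gi))) => //.
    apply: le_Rintegral => //; try exact: integrable_norm.
      by apply: integrable_norm; exact: cos_transform_integrable.
    by move=> w _; rewrite normrM ler_piMr// cos_max.
have alg1 (a b c d : R) : a + b - (c - d) = a + d - (c - b) by ring.
have alg2 (a b c d : R) : a - b + (c + d) = c - b + (a + d) by ring.
apply: complex_eqP; rewrite !complexE'.
  transitivity (
    (\int[mu]_t (Re (phi t) * cos_transform (fun t => Re (psi t)) 0 t) +
     \int[mu]_t (Re (phi t) * cos_transform (fun t => Im (psi t)) (- (pi / 2)) t)) -
    (\int[mu]_t (Im (phi t) * cos_transform (fun t => Im (psi t)) 0 t) -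
     \int[mu]_t (Im (phi t) * cos_transform (fun t => Re (psi t)) (- (pi / 2)) t))).
    rewrite -RintegralD ?ii// -RintegralB ?ii// -RintegralB//; try by [exact: intD (ii _ _ _ _ _) (ii _ _ _ _ _)|exact: intB (ii _ _ _ _ _) (ii _ _ _ _ _)].
    by apply: eq_Rintegral => t _; rewrite (fourierE _ hq) !complexE'; ring.
  transitivity (
    (\int[mu]_t (Re (psi t) * cos_transform (fun t => Re (phi t)) 0 t) +
     \int[mu]_t (Re (psi t) * cos_transform (fun t => Im (phi t)) (- (pi / 2)) t)) -
    (\int[mu]_t (Im (psi t) * cos_transform (fun t => Im (phi t)) 0 t) -
     \int[mu]_t (Im (psi t) * cos_transform (fun t => Re (phi t)) (- (pi / 2)) t))).
    rewrite (fub _ _ _ p1 q1) (fub _ _ _ p1 q2) (fub _ _ _ p2 q2) (fub _ _ _ p2 q1).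
    exact: alg1.
  rewrite -RintegralD ?ii// -RintegralB ?ii// -RintegralB//; try by [exact: intD (ii _ _ _ _ _) (ii _ _ _ _ _)|exact: intB (ii _ _ _ _ _) (ii _ _ _ _ _)].
  by apply: eq_Rintegral => t _; rewrite (fourierE _ hp) !complexE'; ring.
transitivity (
  (\int[mu]_t (Re (phi t) * cos_transform (fun t => Im (psi t)) 0 t) -
   \int[mu]_t (Re (phi t) * cos_transform (fun t => Re (psi t)) (- (pi / 2)) t)) +
  (\int[mu]_t (Im (phi t) * cos_transform (fun t => Re (psi t)) 0 t) +
   \int[mu]_t (Im (phi t) * cos_transform (fun t => Im (psi t)) (- (pi / 2)) t))).
  rewrite -RintegralD ?ii// -RintegralB ?ii// -RintegralD//; try by [exact: intD (ii _ _ _ _ _) (ii _ _ _ _ _)|exact: intB (ii _ _ _ _ _) (ii _ _ _ _ _)].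
  by apply: eq_Rintegral => t _; rewrite (fourierE _ hq) !complexE'; ring.
transitivity (
  (\int[mu]_t (Re (psi t) * cos_transform (fun t => Im (phi t)) 0 t) -
   \int[mu]_t (Re (psi t) * cos_transform (fun t => Re (phi t)) (- (pi / 2)) t)) +
  (\int[mu]_t (Im (psi t) * cos_transform (fun t => Re (phi t)) 0 t) +
   \int[mu]_t (Im (psi t) * cos_transform (fun t => Im (phi t)) (- (pi / 2)) t))).
  rewrite (fub _ _ _ p1 q2) (fub _ _ _ p1 q1) (fub _ _ _ p2 q1) (fub _ _ _ p2 q2).
  exact: alg2.
rewrite -RintegralD ?ii// -RintegralB ?ii// -RintegralD//; try by [exact: intD (ii _ _ _ _ _) (ii _ _ _ _ _)|exact: intB (ii _ _ _ _ _) (ii _ _ _ _ _)].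
by apply: eq_Rintegral => t _; rewrite (fourierE _ hp) !complexE'; ring.
Qed.

End complex_integrals.

Section schwartz_fourier.
Context {R : realType}.
Local Notation mu := (@lebesgue_measure R).
Local Notation mR := (measurableTypeR R).
Implicit Types (f : R -> R) (phi psi h : R -> R[i]).

Lemma cos_transform_derive1 f th w : rschwartz f ->
  cos_transform (derive1 f) th w = w * cos_transform f (th - pi / 2) w.
Proof.
move=> hf; have hf' := rschwartz_derive1 hf.
have [M M0 hM] := rschwartz_cauchy hf.
have i1 := cos_transform_integrable th w (rschwartz_integrable hf').
have i2 := cos_transform_integrable (th - pi / 2) w (rschwartz_integrable hf).
have dc (t : R) := der_cos (derD (derM (der_id t) (der_cst w t)) (der_cst th t)).
have du (t : R) : is_derive t 1 (fun t => f t * cos (t * w + th))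
    (derive1 f t * cos (t * w + th) - w * (f t * cos (t * w + (th - pi / 2)))).
  have d0 : is_derive t 1 f (derive1 f t) := rschwartz_der 0 t hf.
  apply: (der_eq (derM d0 (dc t))).
  by rewrite addrA cosBpi2; ring.
have /eqP : \int[mu]_t (derive1 f t * cos (t * w + th)
    - w * (f t * cos (t * w + (th - pi / 2)))) = 0.
  apply: (Rintegral_derive0 du (M := M)).
  - move=> t; apply: cvgB.
      by apply: cvgM; [exact: (@rschwartz_continuous R (derive1 f) 0 hf' t)|exact: der_cvg (dc t)].
    apply: cvgM; first exact: cvg_cst.
    apply: cvgM; first exact: (@rschwartz_continuous R f 0 hf t).
    exact: (der_cvg (der_cos (derD (derM (der_id t) (der_cst w t)) (der_cst (th - pi / 2) t)))).
  - by apply: intB => //; exact: intZ.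
  - by move=> t; apply: le_trans (hM t); rewrite normrM ler_piMr// cos_max.
rewrite RintegralB//; last exact: intZ.
by rewrite RintegralZl// subr_eq0 => /eqP.
Qed.

Lemma fourier_Cderive phi w : schwartz phi ->
  fourier (Cderive 1 phi) w = (0 +i* w) * fourier phi w.
Proof.
move=> hp; have hd := schwartz_Cintegrable (schwartz_Cderive hp).
have /schwartzP[p1 p2] := hp.
have cpi (f : R -> R) : mu.-integrable setT (EFin \o f) ->
    cos_transform f (- (pi / 2) - pi / 2) w = - cos_transform f 0 w.
  move=> fi; rewrite /cos_transform -RintegralN//; last exact: cos_transform_integrable.
  by apply: eq_Rintegral => t _; rewrite addrA cosBpi2 sinB cos_pihalf sin_pihalf addr0; ring.
rewrite (fourierE w hd) (fourierE w (schwartz_Cintegrable hp)).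
under [X in (cos_transform X _ _ + _) +i* _]funext do rewrite Cderive1E RePE.
apply: complex_eqP; rewrite !complexE'.
  rewrite (cos_transform_derive1 0 w p1) (cos_transform_derive1 (- (pi / 2)) w p2).
  by rewrite cpi ?sub0r; [ring|exact: rschwartz_integrable].
rewrite (cos_transform_derive1 0 w p2) (cos_transform_derive1 (- (pi / 2)) w p1).
by rewrite cpi ?sub0r; [ring|exact: rschwartz_integrable].
Qed.

(** This decay of the values alone is what transforms of Schwartz functions are
    used for. *)
Definition rapid h := forall N : nat, exists M, forall w, `|w| ^+ N * normc (h w) <= M.

(** Differentiation becomes multiplication by the frequency. *)
Lemma rapid_fourier phi : schwartz phi -> rapid (fourier phi).
Proof.
move=> hp N; elim: N phi hp => [|N IH] phi hp.
  exists (2 * \int[mu]_t normc (phi t)) => w; rewrite expr0 mul1r.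
  exact: (fourier_bound w (schwartz_Cintegrable hp)).
have [M hM] := IH _ (schwartz_Cderive hp); exists M => w; apply: le_trans (hM w).
rewrite fourier_Cderive// ComplexField.Normc.normcM.
have -> : normc (0 +i* w) = `|w| by rewrite /= expr0n add0r sqrtr_sqr.
by rewrite exprSr mulrA.
Qed.

Lemma rapid_mul (g : R -> R[i]) h (C : R) (p : nat) : rapid h ->
  (forall w, normc (g w) <= C * (1 + `|w|) ^+ p) -> rapid (fun w => g w * h w).
Proof.
move=> rh gC N.
have [M0 h0] := rh N; have [M1 h1] := rh (N + p)%N.
have C0 : 0 <= C.
  by have := le_trans (normc_ge0 _) (gC 0); rewrite normr0 addr0 expr1n mulr1.
exists (C * (2 ^+ p * (M0 + M1))) => w.
rewrite ComplexField.Normc.normcM.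
have b : normc (g w) <= C * (2 ^+ p * (1 + `|w| ^+ p)).
  apply: (le_trans (gC w)); rewrite ler_wpM2l//.
  apply: (@le_trans _ _ ((2 * Num.max 1 `|w|) ^+ p)).
    apply: lerXn2r; [by rewrite nnegrE addr_ge0|by rewrite nnegrE mulr_ge0// le_max ler01|].
    by rewrite mulr_natl mulr2n lerD// le_max lexx ?orbT.
  rewrite exprMn ler_wpM2l ?exprn_ge0//.
  by case: (leP 1 `|w|) => _; rewrite ?expr1n ?lerDr ?lerDl ?exprn_ge0.
have q0 := exprn_ge0 N (normr_ge0 w).
apply: (@le_trans _ _ (`|w| ^+ N * (C * (2 ^+ p * (1 + `|w| ^+ p)) * normc (h w)))).
  by rewrite ler_wpM2l// ler_wpM2r// normc_ge0.
have -> : `|w| ^+ N * (C * (2 ^+ p * (1 + `|w| ^+ p)) * normc (h w)) =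
    C * (2 ^+ p * (`|w| ^+ N * normc (h w) + `|w| ^+ (N + p) * normc (h w))).
  by rewrite exprD; ring.
by rewrite !ler_wpM2l ?exprn_ge0// lerD.
Qed.

(** A spectral measure has polynomial growth. *)
Lemma rapid_L2c (nu : spectral_measure R) i h : Cmeasurable (h : mR -> R[i]) -> rapid h ->
  L2c (sm_diag nu i) h.
Proof.
move=> mh rh; apply/L2cP; split => //.
have [q hq] := sm_growth_nat nu.
have [M0 h0] := rh 0%N; have [M1 h1] := rh q.
have p0 (w : R) : 0 < (1 + w ^+ 2) ^+ q by rewrite exprn_gt0// ltr_pwDl// sqr_ge0.
pose C := 2 ^+ q * (M0 ^+ 2 + M1 ^+ 2).
have C0 : 0 <= C by rewrite mulr_ge0 ?exprn_ge0// addr_ge0 ?sqr_ge0.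
have hle w : normc (h w) ^+ 2 <= C * ((1 + w ^+ 2) ^+ q)^-1.
  rewrite ler_pdivlMr//.
  have b : (1 + w ^+ 2) ^+ q <= 2 ^+ q * (1 + (`|w| ^+ q) ^+ 2).
    apply: (@le_trans _ _ ((2 * Num.max 1 (w ^+ 2)) ^+ q)).
      apply: lerXn2r; rewrite ?nnegrE.
      - by rewrite addr_ge0 ?sqr_ge0.
      - by rewrite mulr_ge0// le_max ler01.
      - by rewrite mulr_natl mulr2n lerD// le_max lexx ?orbT.
    rewrite exprMn ler_wpM2l ?exprn_ge0//.
    have e : (w ^+ 2) ^+ q = (`|w| ^+ q) ^+ 2.
      by rewrite -real_normK ?num_real// -!exprM mulnC.
    by case: (leP 1 (w ^+ 2)) => _; rewrite ?expr1n ?e ?lerDr ?lerDl ?sqr_ge0.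
  apply: (@le_trans _ _ (normc (h w) ^+ 2 * (2 ^+ q * (1 + (`|w| ^+ q) ^+ 2)))).
    by rewrite ler_wpM2l ?sqr_ge0.
  rewrite mulrCA /C ler_wpM2l ?exprn_ge0// mulrDr mulr1 -exprMn.
  have n0 := normc_ge0 (h w).
  apply: lerD; (apply: lerXn2r; rewrite ?nnegrE//).
  - by apply: le_trans (h0 w); rewrite mulr_ge0// exprn_ge0.
  - by have := h0 w; rewrite expr0 mul1r.
  - by rewrite mulr_ge0// exprn_ge0.
  - by apply: le_trans (h1 w); rewrite mulr_ge0// exprn_ge0.
  - by rewrite mulrC.
have mq : measurable_fun (setT : set mR) (fun w => (((1 + w ^+ 2) ^+ q)^-1)%:E).
  apply/measurable_EFinP; apply: measurable_continuous => w.
  have q0 : (1 + w ^+ 2) ^+ q != 0 by rewrite gt_eqF.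
  exact: (der_cvg (@derV R (fun w : R => (1 + w ^+ 2) ^+ q) w _ q0
        (derX q (derD (der_cst 1 w) (derX 2 (der_id w)))))).
apply: (@le_lt_trans _ _ (\int[sm_diag nu i]_w (C%:E * (((1 + w ^+ 2) ^+ q)^-1)%:E))%E).
  apply: ge0_le_integral => //.
  - by move=> w _; rewrite lee_fin sqr_ge0.
  - exact: emeasurable_normc2.
  - exact: measurable_funeM.
  - by move=> w _; rewrite -EFinM lee_fin.
rewrite ge0_integralZl//; last by move=> w _; rewrite lee_fin invr_ge0 ltW.
exact: lte_mul_pinfty.
Qed.

(** The multiplication formula says that the transform of a Schwartz function
    represents its distributional transform. *)
Lemma is_symbol_schwartz (nu : spectral_measure R) i phi : schwartz phi ->
  is_symbol nu i (dist_of_fun phi) (fourier phi).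
Proof.
move=> hp; have ip := schwartz_Cintegrable hp; have mf := fourier_Cmeasurable ip.
split; last by apply: rapid_L2c => //; exact: rapid_fourier.
split => // psi hq; have iq := schwartz_Cintegrable hq; split.
  have := Cintegrable_mul_bounded iq mf (fun w => fourier_bound w ip).
  by congr Cintegrable; apply/funext => w; rewrite mulrC.
exact: fourier_mul_formula.
Qed.

(** * The Fourier transform of Gaussians *)

(** Modulation by [a] moves the centre of the transform to [a]. *)
Definition cgauss (a q : R) (t : R) : R[i] := (expR (- (q * t ^+ 2)))%:C * cis (a * t).

Definition rgauss (q : R) (t : R) : R := expR (- (q * t ^+ 2)).

Lemma rschwartz_rgauss q : 0 < q -> rschwartz (rgauss q).
Proof.
move=> q0; apply: rschwartz_eq (rschwartz_gaussian 1 0 0 q0) => t.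
by rewrite /gaussian /rgauss hornerC horner0 mul0r cos0; ring.
Qed.

Lemma schwartz_cgauss a q : 0 < q -> schwartz (cgauss a q).
Proof.
move=> q0; apply/schwartzP; split.
  apply: rschwartz_eq (rschwartz_gaussian 1 0 a q0) => t.
  by rewrite /cgauss !complexE' /= /gaussian hornerC horner0; ring.
apply: rschwartz_eq (rschwartz_gaussian 0 1 a q0) => t.
by rewrite /cgauss !complexE' /= /gaussian horner0 hornerC; ring.
Qed.

(** The Gaussian transform solves [F' = - w / (2 q) F], for both phases. *)
Lemma cos_transform_rgauss q th w : 0 < q ->
  cos_transform (rgauss q) th w = cos_transform (rgauss q) th 0 * expR (- (w ^+ 2 / (4 * q))).
Proof.
move=> q0; have hg := rschwartz_rgauss q0; have ig := rschwartz_integrable hg.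
have dg (t : R) : derive1 (rgauss q) t = - (2 * q) * (t * rgauss q t).
  apply: der_derive1.
  have dq : is_derive t 1 (fun t : R => - (q * t ^+ 2)) (- (q * (2 * t))).
    by apply: (der_eq (derN (derZ q (derX 2 (der_id t))))); rewrite /=; ring.
  by apply: (der_eq (der_expR dq)); rewrite /rgauss; ring.
have itg : mu.-integrable setT (EFin \o (fun t => t * rgauss q t)).
  have := intZ (- (2 * q)^-1) measurableT (rschwartz_integrable (rschwartz_derive1 hg)).
  congr (_.-integrable _ _); apply/funext => t /=; congr EFin; rewrite dg.
  by field; rewrite gt_eqF.
have dF (v : R) : is_derive v 1 (cos_transform (rgauss q) th)
    (- (v / (2 * q)) * cos_transform (rgauss q) th v).
  have h := @der_under_integral R _ mR mu setT (fun v t => rgauss q t * cos (t * v + th))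
    (fun v t => - (t * rgauss q t * cos (t * v + (th - pi / 2)))) (fun t => `|t * rgauss q t|)
    v (v - 1) (v + 1) measurableT.
  apply: (der_eq (h _ _ _ _ _ _)).
  - by apply/andP; split; lra.
  - by move=> x _; exact: cos_transform_integrable.
  - move=> x t _ _; apply: (der_eq (derZ (rgauss q t) (der_cos (derD (derM (der_cst t x) (der_id x)) (der_cst th x))))).
    by rewrite addrA cosBpi2; ring.
  - by move=> t; exact: normr_ge0.
  - exact: integrable_norm.
  - by move=> x t _ _; rewrite normrN normrM ler_piMr// cos_max.
  rewrite RintegralN//; last exact: (cos_transform_integrable (th - pi / 2) v itg).
  have h1 : cos_transform (derive1 (rgauss q)) (th - pi / 2) v =
      - (2 * q) * \int[mu]_t (t * rgauss q t * cos (t * v + (th - pi / 2))).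
    rewrite -RintegralZl//; last exact: (cos_transform_integrable (th - pi / 2) v itg).
    by apply: eq_Rintegral => t _; rewrite dg; ring.
  rewrite (cos_transform_derive1 _ _ hg) in h1.
  have h2 : cos_transform (rgauss q) (th - pi / 2 - pi / 2) v = - cos_transform (rgauss q) th v.
    rewrite /cos_transform -RintegralN//; last exact: cos_transform_integrable.
    by apply: eq_Rintegral => t _; rewrite !addrA cosBpi2 sinB cos_pihalf sin_pihalf; ring.
  rewrite h2 in h1; move: h1; rewrite /=.
  move: (\int[mu]_t _) (cos_transform _ _ _) => I F h1.
  have -> : I = - (2 * q)^-1 * (- (2 * q) * I) by field; rewrite gt_eqF.
  by rewrite -h1; field; rewrite gt_eqF.
pose E (v : R) := cos_transform (rgauss q) th v * expR (v ^+ 2 / (4 * q)).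
have dE (v : R) : is_derive v 1 E 0.
  have d2 : is_derive v 1 (fun v : R => v ^+ 2 / (4 * q)) (v / (2 * q)).
    by apply: (der_eq (derM (derX 2 (der_id v)) (der_cst (4 * q)^-1 v))); rewrite /=; field; rewrite gt_eqF.
  by apply: (der_eq (derM (dF v) (der_expR d2))); ring.
have := is_derive_0_is_cst w 0 dE.
rewrite /E expr0n mul0r expR0 mulr1 => <-.
by rewrite -mulrA -expRD subrr expR0 mulr1.
Qed.

Lemma rgauss_mass_gt0 q : 0 < q -> 0 < cos_transform (rgauss q) 0 0.
Proof.
move=> q0; have ig := rschwartz_integrable (rschwartz_rgauss q0).
have -> : cos_transform (rgauss q) 0 0 = \int[mu]_t rgauss q t.
  by apply: eq_Rintegral => t _; rewrite mulr0 addr0 cos0 mulr1.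
have ge : 0 < expR (- q) by exact: expR_gt0.
apply: lt_le_trans ge _.
apply: (@le_trans _ _ (\int[mu]_t ((cst (expR (- q)) \_ `[0, 1]) t))).
  rewrite -Rintegral_mkcond Rintegral_cst//= lebesgue_measure_itv/= lte_fin ltr01.
  by rewrite -EFinD subr0 mulr1.
apply: le_Rintegral => //.
  rewrite -restrict_EFin; apply/integrable_restrict; rewrite ?setTI//.
  exact: integrable_cst_itv.
move=> t _; rewrite patchE; case: ifPn => [|_]; last exact: expR_ge0.
rewrite inE/= in_itv/= => /andP[t0 t1]; rewrite ler_expR lerN2 ler_piMr ?(ltW q0)//.
exact: exprn_ile1.
Qed.

Lemma fourier_cgauss a q w : 0 < q -> fourier (cgauss a q) w =
  (cos_transform (rgauss q) 0 0 * expR (- ((w - a) ^+ 2 / (4 * q))))%:C.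
Proof.
move=> q0; have ig := rschwartz_integrable (rschwartz_rgauss q0).
rewrite -cos_transform_rgauss//; apply: complex_eqP; rewrite !complexE'.
  apply: eq_Rintegral => t _; rewrite /cgauss !complexE' /= cosN sinN /rgauss addr0.
  by rewrite mulrBr cosB [a * t]mulrC; ring.
transitivity (- cos_transform (rgauss q) (- (pi / 2)) (w - a)).
  rewrite /cos_transform -RintegralN//; last exact: cos_transform_integrable.
  apply: eq_Rintegral => t _; rewrite /cgauss !complexE' /= cosN sinN /rgauss cosBpi2.
  by rewrite mulrBr sinB [a * t]mulrC; ring.
rewrite cos_transform_rgauss// (_ : cos_transform _ _ 0 = 0) ?mul0r ?oppr0//.
rewrite /cos_transform /Rintegral (_ : (fun t => _) = cst 0%E) ?integral0//.
by apply/funext => t; rewrite mulr0 cosBpi2 sin0 mulr0.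
Qed.

End schwartz_fourier.

(** * Gaussian averages determine measures *)

Section density_measure.
Context d (T : measurableType d) (R : realType) (nu : {measure set T -> \bar R}).
Variable f : T -> \bar R.
Hypothesis mf : measurable_fun setT f.
Hypothesis f0 : forall x, (0 <= f x)%E.
Hypothesis f_fin : (\int[nu]_x f x < +oo)%E.

Definition density (A : set T) : \bar R := (\int[nu]_(x in A) f x)%E.

Let density0 : density set0 = 0%E. Proof. exact: integral_set0. Qed.

Let density_ge0 A : (0 <= density A)%E.
Proof. by apply: integral_ge0 => x _; exact: f0. Qed.

Let density_sigma_additive : semi_sigma_additive density.
Proof.
move=> F mF tF mUF; rewrite /density ge0_integral_bigcup//; last exact: measurable_funTS.
by apply: is_cvg_nneseries => n _ _; exact: integral_ge0.
Qed.

HB.instance Definition _ := isMeasure.Build _ _ _ density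
  density0 density_ge0 density_sigma_additive.

Let density_fin : fin_num_fun density.
Proof.
move=> A mA; rewrite ge0_fin_numE//; apply: le_lt_trans f_fin.
exact: ge0_subset_integral.
Qed.

HB.instance Definition _ := @Measure_isFinite.Build _ T _ density density_fin.

Definition density_measure : {finite_measure set T -> \bar R} := density.

Import HBNNSimple.

Let integral_density_nnsfun (h : {nnsfun T >-> R}) :
  (\int[density_measure]_x (h x)%:E = \int[nu]_x ((h x)%:E * f x))%E.
Proof.
under [LHS]eq_integral do rewrite fimfunE -fsumEFin//.
rewrite [LHS]ge0_integral_fsum//; last 2 first.
- by move=> r; exact/measurable_EFinP/measurableT_comp.
- by move=> n x _; rewrite EFinM nnfun_muleindic_ge0.
under [RHS]eq_integral.
  move=> x xD; rewrite fimfunE -fsumEFin// ge0_mule_fsuml; last first.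
    by move=> r; rewrite EFinM nnfun_muleindic_ge0.
  over.
rewrite [RHS]ge0_integral_fsum//; last 2 first.
- move=> r; apply: emeasurable_funM => //.
  exact/measurable_EFinP/measurableT_comp.
- by move=> r x _; rewrite mule_ge0// EFinM nnfun_muleindic_ge0.
apply: eq_fsbigr => r _; rewrite integralZl_indic_nnsfun//= integral_indic// setIT.
rewrite [X in (_ * X)%E](_ : _ = (\int[nu]_x (f \_ (h @^-1` [set r])) x)%E); last first.
  by rewrite -integral_mkcond.
have [r0|r0] := leP 0 r; last first.
  have e0 : h @^-1` [set r] = set0.
    apply/seteqP; split => // x /= hx; have hx0 : 0 <= h x by [].
    by move: hx0; rewrite hx leNgt r0.
  rewrite e0 -integral_mkcond integral_set0 mule0.
  by under eq_integral do rewrite indic0 mulr0 mul0e; rewrite integral0.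
rewrite -ge0_integralZl//; last 2 first.
- apply/(measurable_restrictT _ _).1; last exact: measurable_funTS.
  exact: measurable_sfunP.
- by move=> x _; rewrite patchE; case: ifPn.
apply: eq_integral => x _; rewrite patchE indicE; case: ifPn => _.
  by rewrite mulr1.
by rewrite mulr0 mul0e mule0.
Qed.

(** By monotone convergence from simple functions. *)
Lemma integral_density (g : T -> \bar R) : measurable_fun setT g ->
  (forall x, 0 <= g x)%E ->
  (\int[density_measure]_x g x = \int[nu]_x (g x * f x))%E.
Proof.
move=> mg g0; pose g_ := nnsfun_approx measurableT mg.
have cg x : (EFin \o g_^~ x) @ \oo --> g x by apply: cvg_nnsfun_approx.
transitivity (limn (fun n => \int[density_measure]_x (g_ n x)%:E)%E).
  rewrite -monotone_convergence//=.
  - by apply: eq_integral => x _; apply/esym/cvg_lim => //; exact: cg.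
  - by move=> n; exact/measurable_EFinP/measurable_funP.
  - by move=> n x _; rewrite lee_fin.
  - by move=> x _ a b ab; rewrite lee_fin//; exact/lefP/nd_nnsfun_approx.
under eq_fun do rewrite integral_density_nnsfun.
rewrite -monotone_convergence//=.
- apply: eq_integral => x _; apply/cvg_lim => //.
  have [fx|] := boolP (f x \is a fin_num).
    by apply: cvgeMr => //; exact: cg.
  rewrite ge0_fin_numE// -leNgt leye_eq => /eqP ->.
  have [gx0|gx0] := eqVneq (g x) 0%E.
    rewrite gx0 mul0e.
    have e n : (g_ n x)%:E = 0%E.
      have h0 : 0 <= g_ n x by [].
      apply/eqP; rewrite eq_le [X in _ && X]lee_fin h0 andbT -gx0 /g_ nnsfun_approxE.
      exact: le_approx.
    by under eq_fun do rewrite e mul0e; exact: cvg_cst.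
  have gp : (0 < g x)%E by rewrite lt_neqAle eq_sym gx0 g0.
  rewrite gt0_muley//.
  have [N _ hN] : \forall n \near \oo, (0 < (g_ n x)%:E)%E.
    have := cg x => /(_ [set y | (0 < y)%E]); apply.
    by apply: open_nbhs_nbhs; split => //; exact: open_ereal_gt_ereal.
  apply: cvg_near_cst; exists N => // n /hN; exact: gt0_muley.
- by move=> n; apply: emeasurable_funM => //; exact/measurable_EFinP/measurable_funP.
- by move=> n x _; rewrite mule_ge0// lee_fin.
- move=> x _ a b ab; rewrite lee_wpmul2r// lee_fin//; exact/lefP/nd_nnsfun_approx.
Qed.

End density_measure.

Section gaussian_determining.
Context {R : realType}.
Local Notation mu := (@lebesgue_measure R).
Local Notation mR := (measurableTypeR R).

Local Notation mass := (cos_transform (@rgauss R 1) 0 0).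

Let int_rgauss : mu.-integrable setT (EFin \o @rgauss R 1).
Proof. exact: (rschwartz_integrable (rschwartz_rgauss ltr01)). Qed.

Let massE : mass = \int[mu]_u rgauss 1 u.
Proof. by apply: eq_Rintegral => t _; rewrite mulr0 addr0 cos0 mulr1. Qed.

Let mass_gt0 : 0 < mass. Proof. exact: rgauss_mass_gt0. Qed.

(** Unnormalised error function based at minus infinity, so that its limits are
    [0] and [mass]. *)
Let erf (x : R) := \int[mu]_(u in `]-oo, x]) rgauss 1 u.

Let int_rgauss_itv (x : R) : mu.-integrable `]-oo, x] (EFin \o @rgauss R 1).
Proof. by apply: (@integrableS _ _ _ mu setT) => //; exact: measurable_itv. Qed.

Let der_erf (x : R) : is_derive x 1 erf (rgauss 1 x).
Proof.
have c : {for x, continuous (@rgauss R 1)}.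
  exact: (@rschwartz_continuous R _ 0 (rschwartz_rgauss ltr01)).
have x1 : x < x + 1 by lra.
have [||h1 h2] := @continuous_FTC1 R (@rgauss R 1) -oo%O x (x + 1) x1
  (int_rgauss_itv (x + 1)).
- by rewrite ltNyr.
- exact: c.
by split; [exact: h1|rewrite -derive1E h2].
Qed.

Let erf_nd (x y : R) : x <= y -> erf x <= erf y.
Proof.
move=> xy; rewrite /erf Rintegral_mkcond [leRHS]Rintegral_mkcond; apply: le_Rintegral => //.
- rewrite -restrict_EFin; apply/integrable_restrict; rewrite ?setTI//; exact: measurable_itv.
- rewrite -restrict_EFin; apply/integrable_restrict; rewrite ?setTI//; exact: measurable_itv.
move=> u _; rewrite !patchE; case: ifPn; case: ifPn => //.
- by rewrite notin_setE inE/= !in_itv/= => /negP; rewrite -ltNge => /lt_le_trans h /h;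
    rewrite ltNge xy.
- by move=> _ _; exact: expR_ge0.
Qed.

Let erf_ge0 (x : R) : 0 <= erf x.
Proof. by apply: Rintegral_ge0 => u _; exact: expR_ge0. Qed.

Let erf_le (x : R) : erf x <= mass.
Proof.
rewrite massE /erf Rintegral_mkcond; apply: le_Rintegral => //.
- rewrite -restrict_EFin; apply/integrable_restrict; rewrite ?setTI//; exact: measurable_itv.
- by move=> u _; rewrite patchE; case: ifPn => // _; exact: expR_ge0.
Qed.

Let erf_lim (x l : R) (h : R -> R) :
  (forall u, (fun m : nat => (@rgauss R 1 \_ `]-oo, m%:R * x]) u) @ \oo --> h u) ->
  measurable_fun (setT : set mR) h ->
  (fun m : nat => erf (m%:R * x)) @ \oo --> \int[mu]_u h u.
Proof.
move=> hl mh.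
have e m : \int[mu]_u (@rgauss R 1 \_ `]-oo, m%:R * x]) u = erf (m%:R * x).
  by rewrite -Rintegral_mkcond.
apply: (cvgseq_eq e).
have [] := @Rdominated_convergenceT _ _ _ mu (fun m => @rgauss R 1 \_ `]-oo, m%:R * x]) h
  (@rgauss R 1) => //.
- move=> m; apply/(measurable_restrictT _ _).1; first exact: measurable_itv.
  by apply: measurable_funTS; exact: rschwartz_measurable (rschwartz_rgauss ltr01).
- move=> m u; rewrite patchE; case: ifPn => _; last by rewrite normr0; exact: expR_ge0.
  by rewrite ger0_norm// expR_ge0.
Qed.

Let erf_pos (x : R) : 0 < x -> (fun m : nat => erf (m%:R * x)) @ \oo --> mass.
Proof.
move=> x0; rewrite massE; apply: erf_lim => //; last first.
  exact: rschwartz_measurable (rschwartz_rgauss ltr01).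
move=> u; apply: (@cvgseq_near_cst _ (Num.truncn (`|u| / x)).+1) => m um.
rewrite patchE ifT// inE/= in_itv/= -ler_pdivrMr//.
apply: (le_trans _ (le_trans (ltW (truncnS_gt (`|u| / x))) _)); last by rewrite ler_nat.
by rewrite ler_pM2r ?invr_gt0// ler_norm.
Qed.

Let erf_neg (x : R) : x < 0 -> (fun m : nat => erf (m%:R * x)) @ \oo --> 0.
Proof.
move=> x0; have -> : 0 = \int[mu]_u (cst 0 : mR -> R) u by rewrite /Rintegral integral0.
apply: erf_lim => // u; apply: (@cvgseq_near_cst _ (Num.truncn (`|u| / - x)).+1) => m um.
rewrite patchE ifF//; apply/negP; rewrite inE/= in_itv/= leNgt => /negP; apply.
have : `|u| / - x < m%:R.
  by apply: (lt_le_trans (truncnS_gt (`|u| / - x))); rewrite ler_nat.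
rewrite ltr_pdivrMr ?oppr_gt0// mulrN => h.
by have := ler_norm (- u); rewrite normrN; lra.
Qed.

(** The indicator of [c, d] smoothed by the Gaussian of width [1 / m]; it is also an
    average over [a] of Gaussians centred at [a]. *)
Let smooth (m : nat) (c d w : R) := (erf (m%:R * (w - c)) - erf (m%:R * (w - d))) / mass.

Let smoothE (m : nat) (c d w : R) : (0 < m)%N -> c <= d ->
  smooth m c d w = m%:R / mass * \int[mu]_(a in `[c, d]) expR (- (m%:R ^+ 2 * (w - a) ^+ 2)).
Proof.
move=> m0 cd; have mn0 : m%:R != 0 :> R by rewrite pnatr_eq0 -lt0n.
have dm (a : R) : is_derive a 1 (fun a => m%:R * (w - a)) (- m%:R).
  by apply: (der_eq (derZ m%:R (derB (der_cst w a) (der_id a)))); ring.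
have dF (a : R) : c <= a <= d -> is_derive a 1 (fun a => - m%:R^-1 * erf (m%:R * (w - a)))
    (expR (- (m%:R ^+ 2 * (w - a) ^+ 2))).
  move=> _; apply: (der_eq (derZ (- m%:R^-1) (der_comp (der_erf _) (dm a)))).
  by rewrite /rgauss mul1r exprMn; field.
rewrite (RFTC2 cd dF); last first.
  apply: continuous_subspaceT => a.
  have d2 : is_derive a 1 (fun a => - (m%:R ^+ 2 * (w - a) ^+ 2)) (2 * m%:R ^+ 2 * (w - a)).
    by apply: (der_eq (derN (derZ (m%:R ^+ 2) (derX 2 (derB (der_cst w a) (der_id a)))))); rewrite /=; ring.
  exact: der_cvg (der_expR d2).
by rewrite /smooth; field; rewrite mn0 gt_eqF.
Qed.

Let smooth_le1 m c d w : c <= d -> `|smooth m c d w| <= 1.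
Proof.
move=> cd; have h : erf (m%:R * (w - d)) <= erf (m%:R * (w - c)).
  by apply: erf_nd; rewrite ler_wpM2l// lerD2l lerN2.
rewrite ger0_norm ?divr_ge0 ?subr_ge0 ?(ltW mass_gt0)//.
rewrite ler_pdivrMr// mul1r.
have := erf_le (m%:R * (w - c)); have := erf_ge0 (m%:R * (w - d)); lra.
Qed.

Let smooth_lim c d w : c <= d -> w != c -> w != d ->
  (fun m => smooth m c d w) @ \oo --> (\1_(`]c, d]%classic : set mR) w : R).
Proof.
move=> cd wc wd; rewrite indicE mem_setE/= in_itv/=.
have L (e : R) : w != e -> (fun m : nat => erf (m%:R * (w - e))) @ \oo --> mass * (e < w)%R%:R.
  move=> we; have [ew|] := ltP e w; first by rewrite mulr1; apply: erf_pos; rewrite subr_gt0.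
  by move=> we'; rewrite mulr0; apply: erf_neg; rewrite subr_lt0 lt_neqAle we.
have := cvgseqM (cvgseqB (L c wc) (L d wd)) (cvg_cst mass^-1).
move=> /(_ _); congr (_ --> _).
have -> : (w <= d) = ~~ (d < w) by rewrite leNgt.
case: (ltP c w) => cw; case: (ltP d w) => dw /=.
- by rewrite subrr mul0r.
- by rewrite mulr1 mulr0 subr0 divff// gt_eqF.
- by have := le_lt_trans cd dw; rewrite ltNge cw.
- by rewrite mulr0 subrr mul0r.
Qed.

(** Averaging Gaussians over their centres gives smoothed indicators, which tend
    to indicators of intervals except at the end points, where there is no mass. *)
Lemma gauss_measure_unique (m1 m2 : {finite_measure set mR -> \bar R}) :
  (forall a, m1 [set a] = 0%E) -> (forall a, m2 [set a] = 0%E) ->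
  (forall (m : nat) a, (0 < m)%N ->
    \int[m1]_w expR (- (m%:R ^+ 2 * (w - a) ^+ 2)) =
    \int[m2]_w expR (- (m%:R ^+ 2 * (w - a) ^+ 2))) ->
  forall A, measurable A -> m1 A = m2 A.
Proof.
move=> at1 at2 hg.
have msm m c d : measurable_fun (setT : set mR) (smooth m c d).
  have de (w : R) (e : R) : is_derive w 1 (fun w => erf (m%:R * (w - e))) (rgauss 1 (m%:R * (w - e)) * m%:R).
    apply: (@der_comp R erf (fun w => m%:R * (w - e)) w _ m%:R (der_erf _)).
    by apply: (der_eq (derZ m%:R (derB (der_id w) (der_cst e w)))); ring.
  apply: measurable_continuous => w.
  exact: (der_cvg (derM (derB (de w c) (de w d)) (der_cst mass^-1 w))).
(* averages of smoothed indicators are averages over a of Gaussian averages *)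
have fub (nu : {finite_measure set mR -> \bar R}) m c d : (0 < m)%N -> c <= d ->
    \int[nu]_w smooth m c d w =
    m%:R / mass * \int[mu]_(a in `[c, d]) (\int[nu]_w expR (- (m%:R ^+ 2 * (w - a) ^+ 2))).
  move=> m0 cd.
  have i1 : nu.-integrable setT (EFin \o (fun _ : mR => 1 : R)).
    exact: finite_measure_integrable_cst.
  have mi : measurable (`[c, d]%classic : set mR) by exact: measurable_itv.
  have iA : mu.-integrable setT (EFin \o ((fun _ : mR => 1 : R) \_ `[c, d])).
    rewrite -restrict_EFin; apply/integrable_restrict; rewrite ?setTI//.
    exact: integrable_cst_itv.
  have bd (a w : R) : `|expR (- (m%:R ^+ 2 * (w - a) ^+ 2))| <= 1.
    by rewrite ger0_norm ?expR_ge0// -expR0 ler_expR oppr_le0 mulr_ge0 ?sqr_ge0.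
  have mc : measurable_fun setT (fun z : mR * mR => expR (- (m%:R ^+ 2 * (z.2 - z.1) ^+ 2))).
    apply: measurableT_comp => //; apply: measurableT_comp => //.
    by apply: measurable_funM => //; apply: measurable_funX; exact: measurable_funB.
  have := @Rfubini _ _ _ _ _ mu nu _ _ (fun a w => expR (- (m%:R ^+ 2 * (w - a) ^+ 2)))
    1 ler01 iA i1 mc bd => fb.
  have e1 : \int[mu]_(a in `[c, d]) (\int[nu]_w expR (- (m%:R ^+ 2 * (w - a) ^+ 2))) =
      \int[mu]_a (((fun _ : mR => 1 : R) \_ `[c, d]) a *
        \int[nu]_w (1 * expR (- (m%:R ^+ 2 * (w - a) ^+ 2)))).
    rewrite Rintegral_mkcond; apply: eq_Rintegral => a _; rewrite !patchE.
    case: ifPn => _; last by rewrite mul0r.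
    by rewrite mul1r; apply: eq_Rintegral => w _; rewrite mul1r.
  rewrite e1 fb -RintegralZl//; last first.
    have is_ : nu.-integrable setT (EFin \o smooth m c d).
      apply: (@integrable_dominated _ _ _ nu setT _ (fun=> 1)) => // w _.
      exact: smooth_le1.
    have := intZ (m%:R / mass)^-1 measurableT is_; congr (_.-integrable _ _).
    apply/funext => w /=; congr EFin; rewrite smoothE// mul1r mulKf ?mulf_neq0 ?invr_neq0//.
    - rewrite Rintegral_mkcond; apply: eq_Rintegral => a _; rewrite !patchE.
      by case: ifPn => _; rewrite ?mul1r ?mul0r.
    - by rewrite pnatr_eq0 -lt0n.
    - by rewrite gt_eqF.
  apply: eq_Rintegral => w _; rewrite smoothE// mul1r; congr (_ * _).
  rewrite Rintegral_mkcond; apply: eq_Rintegral => a _; rewrite !patchE.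
  by case: ifPn => _; rewrite ?mul1r ?mul0r.
have lim (nu : {finite_measure set mR -> \bar R}) c d : (forall a, nu [set a] = 0%E) -> c <= d ->
    (fun m => \int[nu]_w smooth m c d w) @ \oo --> fine (nu `]c, d]%classic).
  move=> at0 cd.
  have mi : measurable (`]c, d]%classic : set mR) by exact: measurable_itv.
  have [] := @Rdominated_convergence_ae _ _ _ nu setT (fun m => smooth m c d)
    (fun w => \1_(`]c, d]%classic : set mR) w) (fun=> 1) => //.
  - exact: measurable_indic.
  - exists ([set c] `|` [set d]); split.
    + exact: measurableU.
    + apply/eqP; rewrite -measure_le0; apply: (le_trans (measureU2 _ _ _)) => //.
      rewrite -(adde0 0%E).
      by apply: leeD; rewrite le_eqVlt; apply/orP; left; apply/eqP; exact: at0.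
    + move=> w /=; apply: contra_notP => /not_orP[/eqP wc /eqP wd] _.
      exact: smooth_lim.
  - exact: finite_measure_integrable_cst.
  - by apply: aeW => w m _; exact: smooth_le1.
  by move=> _; rewrite /Rintegral integral_indic// setIT.
move=> A mA; apply: (@measure_unique _ R mR (R.-ocitv.-measurable : set (set mR))
  (fun n : nat => `]- n%:R, n%:R]%classic : set mR) _ _ _ _ m1 m2 _ _ A mA) => //.
- by move=> X Y; exact: measurableI.
- by move=> n; exists (- n%:R, n%:R) => //=; have := ler0n R n; lra.
- apply/seteqP; split => // x _; exists (Num.truncn `|x|).+1 => //=.
  have := truncnS_gt `|x|; move: (_.+1%:R) => n; rewrite in_itv/= ltr_norml => /andP[h1 h2].
  by rewrite h1 ltW.
- move=> _ [[c d] /= _ <-].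
  have [cd|dc] := leP c d; last first.
    by rewrite set_itv_ge ?measure0// bnd_simp -leNgt ltW.
  have c1 := lim m1 c d at1 cd; have c2 := lim m2 c d at2 cd.
  have e : fine (m1 `]c, d]%classic) = fine (m2 `]c, d]%classic).
    have c2' : (fun m => \int[m1]_w smooth m c d w) @ \oo --> fine (m2 `]c, d]%classic).
      apply: cvg_trans c2; apply: near_eq_cvg.
      exists 1%N => // m /= m0; rewrite !fub//; congr (_ * _).
      by apply: eq_Rintegral => a _; rewrite hg.
    exact: (cvg_unique _ c1 c2').
  have mi : measurable (`]c, d]%classic : set mR) by exact: measurable_itv.
  by rewrite -(fineK (fin_num_measure m1 _ mi)) e fineK// fin_num_measure.
- move=> n; rewrite -ge0_fin_numE//; apply: fin_num_measure; exact: measurable_itv.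
Qed.

End gaussian_determining.

Section gaussian_testing.
Context {R : realType}.
Local Notation mu := (@lebesgue_measure R).
Local Notation mR := (measurableTypeR R).

Lemma gauss_product (m : nat) (a : R) : exists q b K, [/\ 0 < q, 0 < K &
  forall w : R, expR (- w ^+ 2) * expR (- (m%:R ^+ 2 * (w - a) ^+ 2)) =
    K * expR (- (q * (w - b) ^+ 2))].
Proof.
pose q : R := m%:R ^+ 2 + 1; have q0 : 0 < q by rewrite ltr_wpDl// sqr_ge0.
pose b := m%:R ^+ 2 * a / q.
exists q, b, (expR (q * b ^+ 2 - m%:R ^+ 2 * a ^+ 2)); split => //; first exact: expR_gt0.
move=> w; rewrite -!expRD; congr expR; rewrite /b /q; field.
by rewrite gt_eqF.
Qed.

(** Multiplication by [e^{- w ^ 2}] makes both weighted measures finite, and keeps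
    the hypothesis, a product of two Gaussians being a Gaussian. *)
Lemma gauss_test_unique (n1 n2 : {measure set mR -> \bar R}) (f1 f2 : mR -> R) :
  (forall a, n1 [set a] = 0%E) -> (forall a, n2 [set a] = 0%E) ->
  measurable_fun setT f1 -> measurable_fun setT f2 ->
  (forall w, 0 <= f1 w) -> (forall w, 0 <= f2 w) ->
  (\int[n1]_w (f1 w * expR (- w ^+ 2))%:E < +oo)%E ->
  (\int[n2]_w (f2 w * expR (- w ^+ 2))%:E < +oo)%E ->
  (forall q a : R, 0 < q -> (\int[n1]_w (f1 w * expR (- (q * (w - a) ^+ 2)))%:E =
     \int[n2]_w (f2 w * expR (- (q * (w - a) ^+ 2)))%:E)%E) ->
  forall g : mR -> \bar R, measurable_fun setT g -> (forall w, 0 <= g w)%E ->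
  (\int[n1]_w (g w * (f1 w)%:E) = \int[n2]_w (g w * (f2 w)%:E))%E.
Proof.
move=> at1 at2 mf1 mf2 f10 f20 fin1 fin2 hg g mg g0.
have me : measurable_fun (setT : set mR) (fun w : mR => expR (- w ^+ 2)).
  by apply: measurableT_comp => //; apply: measurableT_comp => //; exact: measurable_funX.
have mF (f : mR -> R) : measurable_fun setT f ->
    measurable_fun setT (fun w => (f w * expR (- w ^+ 2))%:E).
  by move=> mf; apply/measurable_EFinP; exact: measurable_funM.
have F0 (f : mR -> R) : (forall w, 0 <= f w) ->
    forall w, (0 <= (f w * expR (- w ^+ 2))%:E)%E.
  by move=> f0 w; rewrite lee_fin mulr_ge0// expR_ge0.
pose m1 := density_measure (mF f1 mf1) (F0 f1 f10) fin1.
pose m2 := density_measure (mF f2 mf2) (F0 f2 f20) fin2.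
have mq q a : measurable_fun (setT : set mR) (fun w : mR => expR (- (q * (w - a) ^+ 2))).
  apply: measurableT_comp => //; apply: measurableT_comp => //; apply: measurable_funM => //.
  by apply: measurable_funX; exact: measurable_funB.
have eqm : forall A, measurable A -> m1 A = m2 A.
  apply: gauss_measure_unique.
  - move=> a; have : (\int[n1]_(w in [set a]) (f1 w * expR (- w ^+ 2))%:E = 0)%E => //.
    by apply: null_set_integral => //; exact: measurable_funTS (mF f1 mf1).
  - move=> a; have : (\int[n2]_(w in [set a]) (f2 w * expR (- w ^+ 2))%:E = 0)%E => //.
    by apply: null_set_integral => //; exact: measurable_funTS (mF f2 mf2).
  move=> m a m0; rewrite /Rintegral; congr fine.
  have [q [b [K [q0 K0 e]]]] := gauss_product m a.
  have mE : measurable_fun (setT : set mR) (fun w => (expR (- (m%:R ^+ 2 * (w - a) ^+ 2)))%:E).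
    by apply/measurable_EFinP; exact: (mq (m%:R ^+ 2) a).
  have E0 (w : mR) : (0 <= (expR (- (m%:R ^+ 2 * (w - a) ^+ 2)))%:E)%E.
    by rewrite lee_fin expR_ge0.
  rewrite (integral_density (mF f1 mf1) (F0 f1 f10) fin1 mE E0).
  rewrite (integral_density (mF f2 mf2) (F0 f2 f20) fin2 mE E0).
  have E (n : {measure set mR -> \bar R}) (f : mR -> R) : measurable_fun setT f -> (forall w, 0 <= f w) ->
      (\int[n]_w ((expR (- (m%:R ^+ 2 * (w - a) ^+ 2)))%:E * (f w * expR (- w ^+ 2))%:E) =
      K%:E * \int[n]_w (f w * expR (- (q * (w - b) ^+ 2)))%:E)%E.
    move=> mf f0; pose G (w : mR) := (f w * expR (- (q * (w - b) ^+ 2)))%:E.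
    have mG : measurable_fun setT G by apply/measurable_EFinP; exact: (measurable_funM mf (mq q b)).
    have G0 w : (setT : set mR) w -> (0 <= G w)%E by move=> _; rewrite lee_fin mulr_ge0// expR_ge0.
    have K0' : 0 <= K by exact: ltW.
    rewrite -(ge0_integralZl_EFin n measurableT G0 mG K0').
    apply: eq_integral => w _; rewrite /G -!EFinM; congr EFin.
    by rewrite mulrCA (mulrC (expR (- (m%:R ^+ 2 * _)))) e mulrCA.
  by rewrite (E n1 f1 mf1 f10) (E n2 f2 mf2 f20) (hg q b q0).
have mG : measurable_fun setT (fun w => (g w * (expR (w ^+ 2))%:E)%E).
  apply: emeasurable_funM => //; apply/measurable_EFinP.
  by apply: measurableT_comp => //; exact: measurable_funX.
have G0 w : (0 <= g w * (expR (w ^+ 2))%:E)%E by rewrite mule_ge0// lee_fin expR_ge0.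
have E (f : mR -> R) w : (g w * (f w)%:E = g w * (expR (w ^+ 2))%:E * (f w * expR (- w ^+ 2))%:E)%E.
  rewrite -muleA -EFinM; congr (_ * _%:E)%E.
  by rewrite mulrCA -expRD subrr expR0 mulr1.
under eq_integral do rewrite E; under [RHS]eq_integral do rewrite E.
rewrite -(integral_density (mF f1 mf1) (F0 f1 f10) fin1)//.
rewrite -(integral_density (mF f2 mf2) (F0 f2 f20) fin2)//.
by apply: eq_measure_integral => A mA _; exact: eqm.
Qed.

Lemma rschwartz_gauss_shift q a : 0 < q ->
  rschwartz (fun w : R => expR (- (q * (w - a) ^+ 2))).
Proof. by move=> q0; exact: (rschwartz_shift a (rschwartz_rgauss q0)). Qed.

(** The positive and negative parts have the same Gaussian averages, hence the
    same integral against the indicator of each other's support. *)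
Lemma gauss_test_zero_real (r : mR -> R) : measurable_fun setT r ->
  (forall q a, 0 < q -> mu.-integrable setT (EFin \o (fun w => r w * expR (- (q * (w - a) ^+ 2))))) ->
  (forall q a, 0 < q -> \int[mu]_w (r w * expR (- (q * (w - a) ^+ 2))) = 0) ->
  mu [set w | r w != 0] = 0%E.
Proof.
move=> mr ir r0.
pose p w := Num.max (r w) 0; pose n w := Num.max (- r w) 0.
have mp : measurable_fun (setT : set mR) p by exact: measurable_maxr.
have mn : measurable_fun (setT : set mR) n.
  by apply: measurable_maxr => //; exact: (measurableT_comp (@oppr_measurable R setT)).
have p0 w : 0 <= p w by rewrite le_max lexx orbT.
have n0 w : 0 <= n w by rewrite le_max lexx orbT.
have pr w : p w <= `|r w| by rewrite ge_max normr_ge0 ler_norm.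
have nr w : n w <= `|r w| by rewrite ge_max normr_ge0 -normrN ler_norm.
have pn w : p w - n w = r w.
  rewrite /p /n; have [w0|w0] := leP (r w) 0; first by rewrite max_l ?oppr_ge0// opprK add0r.
  by rewrite max_r ?subr0// oppr_le0 ltW.
have mq q a : measurable_fun (setT : set mR) (fun w : mR => expR (- (q * (w - a) ^+ 2))).
  apply: measurableT_comp => //; apply: measurableT_comp => //; apply: measurable_funM => //.
  by apply: measurable_funX; exact: measurable_funB.
have ii (f : mR -> R) q a : 0 < q -> measurable_fun setT f -> (forall w, 0 <= f w) ->
    (forall w, f w <= `|r w|) ->
    mu.-integrable setT (EFin \o (fun w => f w * expR (- (q * (w - a) ^+ 2)))).
  move=> q0 mf f0 fr; apply: (@integrable_dominated _ _ _ mu setT _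
    (fun w => `|r w * expR (- (q * (w - a) ^+ 2))|)) => //.
  - exact: measurable_funM.
  - by apply: integrable_norm; exact: ir.
  - by move=> w _; rewrite !normrM (ger0_norm (expR_ge0 _)) (ger0_norm (f0 w)) ler_wpM2r ?expR_ge0.
have fin (f : mR -> R) : measurable_fun setT f -> (forall w, 0 <= f w) ->
    (forall w, f w <= `|r w|) -> (\int[mu]_w (f w * expR (- w ^+ 2))%:E < +oo)%E.
  move=> mf f0 fr; have := ii f 1 0 ltr01 mf f0 fr.
  under eq_fun do rewrite mul1r subr0.
  move=> /integrableP[_]; apply: le_lt_trans; rewrite le_eqVlt; apply/orP; left; apply/eqP.
  by apply: eq_integral => w _ /=; rewrite ger0_norm// mulr_ge0// expR_ge0.
have at0 (a : R) : mu [set a] = 0%E by exact: lebesgue_measure_set1.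
have key := @gauss_test_unique mu mu p n at0 at0 mp mn p0 n0 (fin p mp p0 pr) (fin n mn n0 nr).
have {}key : forall g : mR -> \bar R, measurable_fun setT g -> (forall w, 0 <= g w)%E ->
    (\int[mu]_w (g w * (p w)%:E) = \int[mu]_w (g w * (n w)%:E))%E.
  apply: key => q a q0.
  have ip := ii p q a q0 mp p0 pr; have in_ := ii n q a q0 mn n0 nr.
  rewrite -(fineK (integrable_fin_num measurableT ip)) -(fineK (integrable_fin_num measurableT in_)).
  congr EFin; apply/eqP; rewrite -subr_eq0; apply/eqP.
  have := r0 q a q0; have := RintegralB measurableT ip in_; rewrite /Rintegral/= => <- h.
  by rewrite -[RHS]h; congr fine; apply: eq_integral => w _; rewrite -mulrBl pn.
have half (A : set mR) (u v : mR -> R) : measurable A -> measurable_fun setT u ->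
    (forall w, 0 <= u w) -> (forall w, A w -> v w = 0) -> (forall w, A w -> 0 < u w) ->
    (\int[mu]_w ((\1_A w)%:E * (u w)%:E) = \int[mu]_w ((\1_A w)%:E * (v w)%:E))%E ->
    mu A = 0%E.
  move=> mA mu' u0 v0 upos e.
  have z : (\int[mu]_w ((\1_A w)%:E * (u w)%:E) = 0)%E.
    rewrite e; apply: integral0_eq => w _; rewrite indicE; case: (boolP (w \in A)) => [|_].
      by rewrite inE => /v0 ->; rewrite mule0.
    by rewrite mul0e.
  have mI : measurable_fun (setT : set mR) (fun w => ((\1_A w)%:E * (u w)%:E)%E).
    by apply: emeasurable_funM; apply/measurable_EFinP => //; exact: measurable_indic.
  have z' : (\int[mu]_w `|(\1_A w)%:E * (u w)%:E| = 0)%E.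
    rewrite -[RHS]z; apply: eq_integral => w _.
    by rewrite gee0_abs// mule_ge0// lee_fin// indicE.
  have /ae_eq_integral_abs := z' => /(_ measurableT mI)[N [mN N0 hN]].
  apply/eqP; rewrite -measure_le0 -N0; apply: le_measure; rewrite ?inE//.
  move=> w Aw; apply: hN => /= /(_ I); rewrite indicE mem_set// mul1e => -[/eqP].
  by rewrite gt_eqF// upos.
have mpos : measurable [set w : mR | 0 < p w].
  have := mp measurableT _ (measurable_itv `]0, +oo[); rewrite setTI.
  congr measurable; apply/seteqP; split => w /=; by rewrite in_itv/= andbT.
have mneg : measurable [set w : mR | 0 < n w].
  have := mn measurableT _ (measurable_itv `]0, +oo[); rewrite setTI.
  congr measurable; apply/seteqP; split => w /=; by rewrite in_itv/= andbT.
have h1 : mu [set w | 0 < p w] = 0%E.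
  apply: (half _ p n) => //; last first.
    apply: key; first exact/measurable_EFinP/measurable_indic.
    by move=> w; rewrite lee_fin indicE.
  move=> w /=; rewrite /p /n lt_max ltxx orbF => w0.
  by rewrite max_r// oppr_le0 ltW.
have h2 : mu [set w | 0 < n w] = 0%E.
  apply: (half _ n p) => //; last first.
    apply/esym/key; first exact/measurable_EFinP/measurable_indic.
    by move=> w; rewrite lee_fin indicE.
  move=> w /=; rewrite /p /n lt_max ltxx orbF oppr_gt0 => w0.
  by rewrite max_r// ltW.
apply/eqP; rewrite -measure_le0.
apply: (@le_trans _ _ (mu ([set w | 0 < p w] `|` [set w | 0 < n w]))).
  apply: le_measure; rewrite ?inE.
  - have := mr measurableT _ (measurableC (measurable_set1 0)); rewrite setTI.
    by congr measurable; apply/seteqP; split => w /=; [move/eqP|move/eqP].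
  - exact: measurableU.
  move=> w /=; rewrite neq_lt /p /n !lt_max !ltxx !orbF oppr_gt0 => /orP[?|?];
    by [right|left].
apply: (le_trans (measureU2 _ _ _)) => //; rewrite -(adde0 0%E).
by apply: leeD; rewrite le_eqVlt; apply/orP; left; apply/eqP; [exact: h1|exact: h2].
Qed.

End gaussian_testing.

(** * Symbols of stationary operators *)

Section symbols.
Context {R : realType}.
Local Notation mu := (@lebesgue_measure R).
Local Notation mR := (measurableTypeR R).
Implicit Types (h : R -> R[i]) (g : (R -> R[i]) -> R[i]).

Lemma schwartz_gauss_shift q a : 0 < q ->
  schwartz (fun w : R => (expR (- (q * (w - a) ^+ 2)))%:C).
Proof.
move=> q0; apply/schwartzP; split; first exact: rschwartz_gauss_shift.
by have /schwartzP[] := @schwartz0 R.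
Qed.

(** A tempered distribution is represented by at most one function, since
    Gaussians separate locally integrable functions. *)
Lemma dist_function_unique T h h' : is_dist_function T h -> is_dist_function T h' ->
  {ae mu, forall w : mR, h w = h' w}.
Proof.
move=> [[m1 m2] H] [[m1' m2'] H'].
have part (u u' : mR -> R) : measurable_fun setT u -> measurable_fun setT u' ->
    (forall q a, 0 < q ->
      [/\ mu.-integrable setT (EFin \o (fun w => u w * expR (- (q * (w - a) ^+ 2)))),
          mu.-integrable setT (EFin \o (fun w => u' w * expR (- (q * (w - a) ^+ 2)))) &
          \int[mu]_w (u w * expR (- (q * (w - a) ^+ 2))) =
          \int[mu]_w (u' w * expR (- (q * (w - a) ^+ 2)))]) ->
    {ae mu, forall w : mR, u w = u' w}.
  move=> mu1 mu2 hq.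
  have mB : measurable_fun (setT : set mR) (fun w => u w - u' w) by exact: measurable_funB.
  have e q a : (fun w => (u w - u' w) * expR (- (q * (w - a) ^+ 2))) =
      (fun w => u w * expR (- (q * (w - a) ^+ 2)) - u' w * expR (- (q * (w - a) ^+ 2))).
    by apply/funext => w; rewrite mulrBl.
  exists [set w | u w - u' w != 0]; split.
  - have := mB measurableT _ (measurableC (measurable_set1 (0 : R))); rewrite setTI.
    congr measurable; apply/seteqP; split => w /=; first by move/eqP.
    by move/eqP.
  - apply: gauss_test_zero_real => // q a q0; have [i1 i2 i3] := hq q a q0.
      by rewrite e; exact: intB.
    by rewrite e RintegralB// i3 subrr.
  - by move=> w /= uw; rewrite subr_eq0; apply/eqP.
have hRe : {ae mu, forall w : mR, Re (h w) = Re (h' w)}.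
  apply: part => // q a q0; have sg := schwartz_gauss_shift a q0.
  have [[i1 _] e1] := H _ sg; have [[i1' _] e1'] := H' _ sg.
  have eR (f : R -> R[i]) : (fun w => Re (f w * (expR (- (q * (w - a) ^+ 2)))%:C)) =
      (fun w => Re (f w) * expR (- (q * (w - a) ^+ 2))).
    by apply/funext => w; rewrite !complexE'; ring.
  split.
  - by rewrite -eR.
  - by rewrite -eR.
  - by rewrite -(eR h) -(eR h'); have := congr1 (fun z : R[i] => Re z) (etrans (esym e1) e1').
have hIm : {ae mu, forall w : mR, Im (h w) = Im (h' w)}.
  apply: part => // q a q0; have sg := schwartz_gauss_shift a q0.
  have [[_ i1] e1] := H _ sg; have [[_ i1'] e1'] := H' _ sg.
  have eI (f : R -> R[i]) : (fun w => Im (f w * (expR (- (q * (w - a) ^+ 2)))%:C)) =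
      (fun w => Im (f w) * expR (- (q * (w - a) ^+ 2))).
    by apply/funext => w; rewrite !complexE'; ring.
  split.
  - by rewrite -eI.
  - by rewrite -eI.
  - by rewrite -(eI h) -(eI h'); have := congr1 (fun z : R[i] => Im z) (etrans (esym e1) e1').
by apply: filterS2 hRe hIm => w; exact: complex_eqP.
Qed.

Lemma norm2_ae d (T : measurableType d) (nu : {measure set T -> \bar R}) (f g : T -> R[i]) :
  Cmeasurable f -> Cmeasurable g -> {ae nu, forall x, f x = g x} -> norm2 nu f = norm2 nu g.
Proof.
move=> mf mg fg; apply: ge0_ae_eq_integral => //.
- exact: emeasurable_normc2.
- exact: emeasurable_normc2.
- by move=> x _; rewrite lee_fin sqr_ge0.
- by move=> x _; rewrite lee_fin sqr_ge0.
- by apply: filterS fg => x e _; rewrite e.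
Qed.

Context {d : measure_display} {Omega : measurableType d}.
Variables (P : probability Omega R) (nu : spectral_measure R).
Variable Z : 'I_2 -> set (measurableTypeR R) -> Omega -> R[i].
Hypothesis Z_random : random_measure P nu Z.

Lemma sm_ae i (Q : mR -> Prop) : {ae mu, forall w, Q w} -> {ae sm_diag nu i, forall w, Q w}.
Proof. by move=> [N [mN N0 QN]]; exists N; split => //; exact: sm_abs_cont. Qed.

(** Two symbols of the same distribution agree almost everywhere for Lebesgue
    measure, hence for the spectral measure, so that any of them computes the
    operator. *)
Lemma stat_op_symbol i g h : is_symbol nu i g h ->
  is_stoch_int P nu Z i h (stat_op P nu Z i g).
Proof.
move=> hg; have [h' hg' [YL [s [fs ch cY]]]] := stat_opP Z_random (ex_intro _ h hg).
split => //; exists s; split => //.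
apply: cvg_trans ch; apply: near_eq_cvg; apply: nearW => n.
have ms : Cmeasurable (simple_fun (s n)) := L2c_measurable (L2c_simple_fun i (fs n)).
apply: (@norm2_ae _ _ (sm_diag nu i) (fun w => simple_fun (s n) w - h' w)
   (fun w => simple_fun (s n) w - h w)).
- apply: CmeasurableB => //; exact: (L2c_measurable hg'.2).
- apply: CmeasurableB => //; exact: (L2c_measurable hg.2).
- by apply: filterS (sm_ae i (dist_function_unique hg'.1 hg.1)) => w ->.
Qed.

Lemma stat_op_L2c i g h : is_symbol nu i g h -> L2c P (stat_op P nu Z i g).
Proof. by move=> /stat_op_symbol[]. Qed.

Lemma stat_op_norm2 i g h : is_symbol nu i g h ->
  norm2 P (stat_op P nu Z i g) = norm2 (sm_diag nu i) h.
Proof. by move=> hg; exact: (stoch_int_norm2 Z_random hg.2 (stat_op_symbol hg)). Qed.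

Lemma stat_op_norm2_sub i g1 g2 h1 h2 : is_symbol nu i g1 h1 -> is_symbol nu i g2 h2 ->
  norm2 P (fun w => stat_op P nu Z i g1 w - stat_op P nu Z i g2 w) =
  norm2 (sm_diag nu i) (fun w => h1 w - h2 w).
Proof.
move=> hg1 hg2.
exact: (stoch_int_norm2_sub Z_random hg1.2 hg2.2 (stat_op_symbol hg1) (stat_op_symbol hg2)).
Qed.

End symbols.

(** * Riemann sums for the memory term *)

Section riemann_sums.
Context {R : realType}.
Local Notation mu := (@lebesgue_measure R).
Local Notation mR := (measurableTypeR R).
Variable k : R -> R.
Hypothesis k_loc : forall T, mu.-integrable `[0, T] (EFin \o k).
Implicit Types (f df : R -> R) (delta L : R).

(** The weights are the exact masses of the cells: the kernel may be singular at
    the origin, and only the smoothness of the integrand matters. *)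
Definition cell_mass delta (j : nat) :=
  \int[mu]_(s in `[j%:R * delta, j.+1%:R * delta]) k s.

Definition riemann_sum delta (J : nat) f :=
  \sum_(j < J) cell_mass delta j * f (j%:R * delta).

Lemma bounded_derivative_lipschitz f df L : (forall s : R, is_derive s 1 f (df s)) ->
  (forall s, `|df s| <= L) -> forall s t, `|f t - f s| <= L * `|t - s|.
Proof.
move=> hf hL.
have h s t : s <= t -> `|f t - f s| <= L * `|t - s|.
  move=> st.
  have d1 u : u \in `]s, t[ -> is_derive u 1 f (df u) by move=> _; exact: hf.
  have d2 u : s <= u <= t -> is_derive u 1 f (df u) by move=> _; exact: hf.
  have [z _ ->] := MVT_segment st d1 (is_derive_within_continuous d2).
  by rewrite normrM ler_wpM2r.
move=> s t; have [st|/ltW ts] := leP s t; first exact: h.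
by rewrite distrC [X in _ <= _ * X]distrC; exact: h.
Qed.

Lemma kernel_mul_integrable f T : continuous f ->
  mu.-integrable `[0, T] (EFin \o (fun s => k s * f s)).
Proof.
move=> cf; have mT : measurable (`[0, T]%classic : set mR) by exact: measurable_itv.
have [M hM] : exists M, forall s, s \in `[0, T] -> `|f s| <= M.
  have [T0|T0] := leP 0 T; last first.
    by exists 0 => s; rewrite in_itv/= => /andP[]; lra.
  have cn : {within `[0, T], continuous (fun s => `|f s|)}.
    apply: continuous_subspaceT => s; apply: continuous_comp; first exact: cf.
    exact: norm_continuous.
  by have [c _ hc] := EVT_max T0 cn; exists `|f c|.
apply: (@integrable_dominated _ _ _ mu _ _ (fun s : mR => M * `|k s|)) => //.
- apply: measurable_funM; first exact: (int_measurable mT (k_loc T)).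
  by apply: measurable_funTS; exact: measurable_continuous.
- by apply: intZ => //; exact: integrable_norm.
- by move=> s sT; rewrite normrM mulrC ler_wpM2r// hM.
Qed.

Lemma riemann_sum_error f df L delta J : 0 < delta ->
  (forall s : R, is_derive s 1 f (df s)) -> (forall s, `|df s| <= L) ->
  `|riemann_sum delta J f - \int[mu]_(s in `[0, J%:R * delta]) (k s * f s)| <=
  L * delta * kmass k (J%:R * delta).
Proof.
move=> d0 hf hL; have lip := bounded_derivative_lipschitz hf hL.
have cf : continuous f by move=> s; exact: (der_cvg (hf s)).
have L0 : 0 <= L by exact: le_trans (hL 0).
elim: J => [|J IH].
  rewrite /riemann_sum big_ord0 mul0r set_itv1 Rintegral_set1 subrr normr0.
  by rewrite !mulr_ge0 ?kmass_ge0// ltW.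
set A := J%:R * delta; set B := J.+1%:R * delta.
have A0 : 0 <= A by rewrite mulr_ge0// ltW.
have AB : A <= B by rewrite ler_pM2r// ler_nat.
have BA : B - A = delta by rewrite /A /B -natr1; ring.
have sub : (`[A, B]%classic : set R) `<=` `[0, B]%classic.
  by move=> s /=; rewrite !in_itv/= => /andP[s1 ->]; rewrite (le_trans A0).
have mi : measurable (`[A, B]%classic : set mR) by exact: measurable_itv.
have m0 : measurable (`[0, B]%classic : set mR) by exact: measurable_itv.
have ik : mu.-integrable `[A, B] (EFin \o k) by exact: (integrableS m0 mi sub (k_loc B)).
have ikf : mu.-integrable `[A, B] (EFin \o (fun s => k s * f s)).
  exact: (integrableS m0 mi sub (kernel_mul_integrable B cf)).
have ikA : mu.-integrable `[A, B] (EFin \o (fun s => f A * k s)) by exact: intZ.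
rewrite /riemann_sum big_ord_recr/= -/(riemann_sum delta J f) -/A -/B.
rewrite (@split_itv R _ A B A0 AB (kernel_mul_integrable B cf)).
have -> : kmass k B = kmass k A + \int[mu]_(s in `[A, B]) `|k s|.
  by apply: split_itv => //; apply: integrable_norm; exact: k_loc.
have -> : cell_mass delta J * f A = \int[mu]_(s in `[A, B]) (f A * k s).
  by rewrite RintegralZl// mulrC.
rewrite mulrDr opprD addrACA -RintegralB//; apply: (le_trans (ler_normD _ _)); apply: lerD => //.
have iB := intB mi ikA ikf.
apply: (le_trans (le_normr_Rintegral mi iB)).
rewrite -RintegralZl//; last exact: integrable_norm.
apply: le_Rintegral => //.
- exact: integrable_norm.
- by apply: intZ => //; exact: integrable_norm.
move=> s /=; rewrite in_itv/= => /andP[s1 s2].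
rewrite [k s * _]mulrC -mulrBl normrM ler_wpM2r// distrC.
apply: (le_trans (lip _ _)); rewrite ler_wpM2l// ger0_norm ?subr_ge0//.
by rewrite -BA lerB.
Qed.

(** The grid ends exactly at [n], and is fine enough for the mesh times the mass of
    the kernel on [[0, n]] to be at most [1 / (n + 1)]. *)
Definition mesh (n : nat) : R := (n.+1%:R * (Num.truncn (kmass k n%:R)).+1%:R)^-1.

Definition half_line_sum (n : nat) f :=
  riemann_sum (mesh n) (n * (n.+1 * (Num.truncn (kmass k n%:R)).+1)) f.

Lemma half_line_sum_error f df L n :
  (forall s : R, is_derive s 1 f (df s)) -> (forall s, `|df s| <= L) ->
  `|half_line_sum n f - \int[mu]_(s in `[0, n%:R]) (k s * f s)| <= L * n.+1%:R^-1.
Proof.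
move=> hf hL; have L0 : 0 <= L by exact: le_trans (hL 0).
have M0 : 0 <= kmass k n%:R by exact: kmass_ge0.
have n0 : 0 < n.+1%:R :> R by [].
pose M : R := (Num.truncn (kmass k n%:R)).+1%:R; have M1 : 0 < M by [].
have kM : kmass k n%:R <= M by exact/ltW/truncnS_gt.
have d0 : 0 < mesh n by rewrite invr_gt0 mulr_gt0.
have e : (n * (n.+1 * (Num.truncn (kmass k n%:R)).+1))%:R * mesh n = n%:R.
  clear kM d0; rewrite /mesh !natrM -/M; move: n0 M1; move: (n.+1%:R) (M) => x y x0 y0.
  by field; rewrite !gt_eqF.
have := riemann_sum_error (n * (n.+1 * (Num.truncn (kmass k n%:R)).+1)) d0 hf hL.
rewrite -/(half_line_sum n f) e => h; apply: (le_trans h).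
rewrite -mulrA ler_wpM2l// /mesh -/M invfM -mulrA ler_piMr ?invr_ge0//.
by rewrite mulrC ler_pdivrMr// mul1r.
Qed.

End riemann_sums.

Section memory_approximation.
Context {R : realType}.
Local Notation mu := (@lebesgue_measure R).
Local Notation mR := (measurableTypeR R).
Variables (k dk : R -> R) (a C : R).
Hypothesis k_loc : forall T, mu.-integrable `[0, T] (EFin \o k).
Hypothesis k_gt0 : forall t, 0 < t -> 0 < k t.
Hypothesis k_der : forall t : R, 0 < t -> is_derive t 1 k (dk t).
Hypothesis dk_le0 : forall t, 0 < t -> dk t <= 0.
Hypothesis dk_cont : forall t, 0 < t -> {for t, continuous dk}.
Hypothesis a01 : 0 < a < 1.
Hypothesis k_decay : forall t, 1 <= t -> k t <= C * t `^ (- a).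
Variables m lam bet gam : R.
Implicit Types (f : R -> R) (phi : R -> R[i]).

Let hk : exp_integrable k.
Proof. exact: (exp_integrable_kernel k_loc k_gt0 k_der dk_le0). Qed.

Let envelope f M t s := M * `|(k \_ `[0, 1]) s| + k 1 * `|f (s + t)|.

Let k1_ge0 : 0 <= k 1. Proof. exact/ltW/k_gt0. Qed.

Let envelope_int f M t : mu.-integrable setT (EFin \o f) ->
  mu.-integrable setT (EFin \o envelope f M t).
Proof.
move=> fi; apply: intD => //; apply: intZ => //; apply: integrable_norm => //.
  by rewrite -restrict_EFin; apply/integrable_restrict; rewrite ?setTI//; exact: k_loc.
exact: (integrable_shift t fi).
Qed.

Let envelope_ge f M t s : (forall s, `|f s| <= M) -> 0 <= s ->
  `|k s * f (t + s)| <= envelope f M t s.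
Proof.
move=> fM s0; have M0 : 0 <= M by exact: le_trans (fM 0).
rewrite /envelope patchE [t + s]addrC normrM; case: ifPn; rewrite ?inE ?notin_setE/= in_itv/= s0/=.
  by move=> _; rewrite mulrC -[leLHS]addr0 lerD ?mulr_ge0// ler_wpM2r.
move=> /negP; rewrite -ltNge => s1.
rewrite normr0 mulr0 add0r ler_wpM2r//.
rewrite ger0_norm; last by apply/ltW/k_gt0; exact: lt_trans s1.
by apply: (kernel_nonincreasing k_der dk_le0) => //; exact: ltW.
Qed.

Let mhalf : measurable (`[0, +oo[%classic : set mR).
Proof. exact: measurable_itv. Qed.

(** Near the origin [f] is bounded and the kernel integrable; beyond [1] the kernel
    is at most [k 1] and [f] is integrable. *)
Lemma memory_integrable f t : rschwartz f ->
  mu.-integrable `[0, +oo[ (EFin \o (fun s => k s * f (t + s))).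
Proof.
move=> hf; have [M M0 fM] := rschwartz_bound 0 hf.
have ie := envelope_int M t (rschwartz_integrable hf).
apply: (@integrable_dominated _ _ _ mu _ _ (envelope f M t)) => //.
- apply: measurable_funM; first by case: hk.
  apply: measurable_funTS; apply: measurable_continuous => s.
  have d0 : is_derive (t + s) 1 f (derive1 f (t + s)) := rschwartz_der 0 (t + s) hf.
  exact: (der_cvg (@der_comp R f (fun s => t + s) s _ _ d0 (derD (der_cst t s) (der_id s)))).
- by apply: (integrableS _ _ _ ie).
- by move=> s /=; rewrite in_itv/= andbT => s0; exact: envelope_ge.
Qed.

(** The bound is uniform in [t] by translation invariance. *)
Lemma memory_bound f : rschwartz f -> exists2 B, 0 <= B & forall t (n : nat),
  `|\int[mu]_(s in `[0, n%:R]) (k s * f (t + s))| <= B.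
Proof.
move=> hf; have [M M0 fM] := rschwartz_bound 0 hf.
have fi := rschwartz_integrable hf.
pose B := \int[mu]_s (M * `|(k \_ `[0, 1]) s|) + \int[mu]_s (k 1 * `|f s|).
exists B => [|t n].
  by apply: addr_ge0; apply: Rintegral_ge0 => // s _; rewrite mulr_ge0.
have mn : measurable (`[0, n%:R]%classic : set mR) by exact: measurable_itv.
have sub : (`[0, n%:R]%classic : set mR) `<=` `[0, +oo[%classic.
  by move=> s /=; rewrite !in_itv/= andbT => /andP[].
have ii := integrableS mhalf mn sub (memory_integrable t hf).
have ie := envelope_int M t fi.
apply: (le_trans (le_normr_Rintegral mn ii)).
have -> : B = \int[mu]_s envelope f M t s.
  have i1 : mu.-integrable setT (EFin \o (fun s => M * `|(k \_ `[0, 1]) s|)).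
    apply: intZ => //; apply: integrable_norm => //.
    by rewrite -restrict_EFin; apply/integrable_restrict; rewrite ?setTI//; exact: k_loc.
  have i2 : mu.-integrable setT (EFin \o (fun s => k 1 * `|f s|)).
    by apply: intZ => //; exact: integrable_norm.
  have i2' := integrable_shift t i2.
  by rewrite /envelope RintegralD// (Rintegral_shift t i2).
have ien : mu.-integrable `[0, n%:R] (EFin \o envelope f M t) by exact: (integrableS _ _ _ ie).
apply: (@le_trans _ _ (\int[mu]_(s in `[0, n%:R]) envelope f M t s)).
  apply: le_Rintegral => //; first exact: integrable_norm.
  by move=> s /=; rewrite in_itv/= => /andP[s0 _]; exact: envelope_ge.
rewrite Rintegral_mkcond; apply: le_Rintegral => //.
  by rewrite -restrict_EFin; apply/integrable_restrict; rewrite ?setTI.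
move=> s _; rewrite patchE; case: ifPn => // _.
by rewrite addr_ge0// mulr_ge0.
Qed.

Let shift_der f t : rschwartz f -> forall s : R,
  is_derive s 1 (fun s => f (t + s)) (derive1 f (t + s)).
Proof.
move=> hf s; have d0 : is_derive (t + s) 1 f (derive1 f (t + s)) := rschwartz_der 0 (t + s) hf.
apply: (der_eq (@der_comp R f (fun s => t + s) s _ _ d0 (derD (der_cst t s) (der_id s)))).
by rewrite add0r mulr1.
Qed.

Let cvg_invS : (fun n : nat => n.+1%:R^-1 : R) @ \oo --> 0.
Proof. by have := @cvg_harmonic R. Qed.

Lemma half_line_sum_memory f t : rschwartz f ->
  (fun n => half_line_sum k n (fun s => f (t + s))) @ \oo -->
  \int[mu]_(s in `[0, +oo[) (k s * f (t + s)).
Proof.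
move=> hf; have [L L0 fL] := rschwartz_bound 1 hf.
have c1 := cvg_integral_half_line (memory_integrable t hf).
have c2 : (fun n => half_line_sum k n (fun s => f (t + s)) -
    \int[mu]_(s in `[0, n%:R]) (k s * f (t + s))) @ \oo --> 0.
  apply: (@cvg_dist_le R 0 _ (fun n => L * n.+1%:R^-1)).
    move=> n _; rewrite subr0.
    apply: (half_line_sum_error k_loc n (shift_der t hf)) => s.
    exact: fL.
  by have := cvgseqZ (c := L) cvg_invS; rewrite mulr0.
have := cvgseqD c2 c1; rewrite add0r; apply: cvgseq_eq => n.
by rewrite subrK.
Qed.

Lemma half_line_sum_bound f : rschwartz f -> exists2 B, 0 <= B & forall t (n : nat),
  `|half_line_sum k n (fun s => f (t + s))| <= B.
Proof.
move=> hf; have [L L0 fL] := rschwartz_bound 1 hf.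
have [B B0 hB] := memory_bound hf; exists (B + L); first exact: addr_ge0.
move=> t n.
have h := half_line_sum_error k_loc n (shift_der t hf) (fun s => fL (t + s)).
have n1 : L * n.+1%:R^-1 <= L by rewrite ler_piMr// invf_le1// ler1n.
have := ler_normD (half_line_sum k n (fun s => f (t + s)) -
  \int[mu]_(s in `[0, n%:R]) (k s * f (t + s))) (\int[mu]_(s in `[0, n%:R]) (k s * f (t + s))).
rewrite subrK => /le_trans; apply; rewrite addrC; apply: lerD; first exact: hB.
exact: le_trans h n1.
Qed.

Let osc th w (s : R) := cos (w * s + th).

Let osc_der th w (s : R) : is_derive s 1 (osc th w) (- w * sin (w * s + th)).
Proof.
apply: (der_eq (der_cos (derD (derZ w (der_id s)) (der_cst th s)))).
by rewrite addr0 mulr1.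
Qed.

Let osc_der_le th w (s : R) : `|- w * sin (w * s + th)| <= `|w|.
Proof. by rewrite normrM normrN ler_piMr// sin_max. Qed.

Let damped0 th w s : damped k 0 th w s = k s * osc th w s.
Proof. by rewrite /damped mul0r oppr0 expR0 mulr1. Qed.

(** The mesh error is at most [|w| / (n + 1)] because the derivative of the
    oscillation is bounded by [|w|]. *)
Lemma half_line_sum_osc th w : w != 0 ->
  (fun n => half_line_sum k n (fun s => cos (w * s + th))) @ \oo --> ktrans k 0 th w.
Proof.
move=> w0.
have c1 : (fun n : nat => \int[mu]_(s in `[0, n%:R]) damped k 0 th w s) @ \oo --> ktrans k 0 th w.
  exact: (cvg_ktrans k_loc k_gt0 k_der dk_le0 dk_cont a01 k_decay).
have c2 : (fun n => half_line_sum k n (osc th w) -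
    \int[mu]_(s in `[0, n%:R]) damped k 0 th w s) @ \oo --> 0.
  apply: (@cvg_dist_le R 0 _ (fun n => `|w| * n.+1%:R^-1)).
    move=> n _; rewrite subr0.
    under [X in _ - X]eq_Rintegral do rewrite damped0.
    exact: (half_line_sum_error k_loc n (osc_der th w) (osc_der_le th w)).
  by have := cvgseqZ (c := `|w|) cvg_invS; rewrite mulr0.
have := cvgseqD c2 c1; rewrite add0r; apply: cvgseq_eq => n.
by rewrite subrK.
Qed.

Lemma half_line_sum_osc_bound th w (n : nat) : w != 0 ->
  `|half_line_sum k n (fun s => cos (w * s + th))| <= kbound k a C w + `|w|.
Proof.
move=> w0.
have h := half_line_sum_error k_loc n (osc_der th w) (osc_der_le th w).
have n1 : `|w| * n.+1%:R^-1 <= `|w| by rewrite ler_piMr// invf_le1// ler1n.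
have b : `|\int[mu]_(s in `[0, n%:R]) damped k 0 th w s| <= kbound k a C w.
  exact: (damped_bound k_loc k_gt0 k_der dk_le0 dk_cont a01 k_decay).
have e : \int[mu]_(s in `[0, n%:R]) damped k 0 th w s =
    \int[mu]_(s in `[0, n%:R]) (k s * osc th w s).
  by apply: eq_Rintegral => s _; rewrite damped0.
rewrite e in b.
have := ler_normD (half_line_sum k n (osc th w) -
  \int[mu]_(s in `[0, n%:R]) (k s * osc th w s)) (\int[mu]_(s in `[0, n%:R]) (k s * osc th w s)).
rewrite subrK => /le_trans; apply; rewrite addrC; apply: lerD; first exact: b.
exact: le_trans h n1.
Qed.

End memory_approximation.

(** * Dominated convergence and superpositions of translations *)

Section complex_domination.
Context d (T : measurableType d) (R : realType).
Variable mu : {measure set T -> \bar R}.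
Implicit Types (f : T -> R[i]) (F : nat -> T -> R[i]).

Lemma ccvg_eq (u v : nat -> R[i]) l : u =1 v -> ccvg u l -> ccvg v l.
Proof. by move=> /funext ->. Qed.

Lemma ccvg_unique (u : nat -> R[i]) l l' : ccvg u l -> ccvg u l' -> l = l'.
Proof.
move=> [c1 c2] [c1' c2']; apply: complex_eqP.
  exact: (cvg_unique _ c1 c1').
exact: (cvg_unique _ c2 c2').
Qed.

Lemma ccvgB (u v : nat -> R[i]) a b : ccvg u a -> ccvg v b -> ccvg (fun n => u n - v n) (a - b).
Proof.
move=> [u1 u2] [v1 v2]; split; under eq_fun do rewrite !complexE'; rewrite !complexE';
  exact: cvgseqB.
Qed.

Lemma ccvg_normc_le (u : nat -> R[i]) l (B : R) : 0 <= B -> ccvg u l ->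
  (forall n, normc (u n) <= B) -> normc l <= B.
Proof.
move=> B0 [c1 c2] uB; apply: normc_le_sqr => //.
have c3 : (fun n => Re (u n) ^+ 2 + Im (u n) ^+ 2) @ \oo --> Re l ^+ 2 + Im l ^+ 2.
  by rewrite !expr2; under eq_fun do rewrite !expr2; apply: cvgseqD; exact: cvgseqM.
apply: (cvgseq_le c3) => n; rewrite -normc_sqr.
by rewrite ler_pXn2r ?nnegrE ?normc_ge0.
Qed.

Lemma Cmeasurable_cvg F f : (forall n, Cmeasurable (F n)) -> (forall x, ccvg (F ^~ x) (f x)) ->
  Cmeasurable f.
Proof.
move=> mF cF; split.
  apply: (@measurable_fun_cvg _ T R setT (fun n x => Re (F n x))) => [n|x _].
    by case: (mF n).
  by case: (cF x).
apply: (@measurable_fun_cvg _ T R setT (fun n x => Im (F n x))) => [n|x _].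
  by case: (mF n).
by case: (cF x).
Qed.

Lemma Cdominated_convergence F f (g : T -> R) : (forall n, Cmeasurable (F n)) ->
  (forall x, ccvg (F ^~ x) (f x)) -> mu.-integrable setT (EFin \o g) ->
  (forall n x, normc (F n x) <= g x) ->
  Cintegrable mu setT f /\ ccvg (fun n => Cint mu setT (F n)) (Cint mu setT f).
Proof.
move=> mF cF ig Fg; have [mf1 mf2] := Cmeasurable_cvg mF cF.
have [|||i1 c1] := @Rdominated_convergenceT _ T R mu (fun n x => Re (F n x)) (fun x => Re (f x)) g _ mf1 _ ig.
- by move=> n; case: (mF n).
- by move=> x; case: (cF x).
- by move=> n x; exact: le_trans (Re_le_normc _) (Fg n x).
have [|||i2 c2] := @Rdominated_convergenceT _ T R mu (fun n x => Im (F n x)) (fun x => Im (f x)) g _ mf2 _ ig.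
- by move=> n; case: (mF n).
- by move=> x; case: (cF x).
- by move=> n x; exact: le_trans (Im_le_normc _) (Fg n x).
by [].
Qed.

(** The squared distance to the limit is dominated by [4 |G|^2]. *)
Lemma norm2_dominated F f (G : T -> R[i]) : (forall n, Cmeasurable (F n)) ->
  (forall x, ccvg (F ^~ x) (f x)) -> L2c mu G ->
  (forall n x, normc (F n x) <= normc (G x)) ->
  L2c mu f /\ norm2 mu (fun x => F n x - f x) @[n --> \oo] --> 0%E.
Proof.
move=> mF cF hG FG; have mf := Cmeasurable_cvg mF cF.
have fG x : normc (f x) <= normc (G x).
  by apply: (ccvg_normc_le (normc_ge0 _) (cF x)) => n; exact: FG.
have hf : L2c mu f.
  apply/L2cP; split => //; apply: (@le_lt_trans _ _ (norm2 mu G)); last by case/L2cP: hG.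
  by apply: (norm2_le mu) => //; exact: (L2c_measurable hG).
have hF n : L2c mu (F n).
  apply/L2cP; split => //; apply: (@le_lt_trans _ _ (norm2 mu G)); last by case/L2cP: hG.
  by apply: (norm2_le mu) => //; exact: (L2c_measurable hG).
split => //.
have ig : mu.-integrable setT (EFin \o (fun x => 4 * normc (G x) ^+ 2)).
  by apply: intZ => //; exact: integrable_normc2.
have [||||_ c] := @Rdominated_convergenceT _ T R mu (fun n x => normc (F n x - f x) ^+ 2) (fun=> 0)
  (fun x => 4 * normc (G x) ^+ 2) _ _ _ ig.
- by move=> n; apply: measurable_normc2; exact: CmeasurableB.
- exact: measurable_cst.
- move=> x; have [c1 c2] := ccvgB (cF x) (ccvg_cst (f x)).
  rewrite subrr in c1 c2; have := cvgseqD (cvgseqM c1 c1) (cvgseqM c2 c2).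
  by rewrite /= !mul0r addr0; apply: cvgseq_eq => n; rewrite normc_sqr !expr2.
- move=> n x; rewrite ger0_norm ?sqr_ge0//.
  have h : normc (F n x - f x) <= 2 * normc (G x).
    by apply: (le_trans (normcB_le _ _)); rewrite mulr_natl mulr2n lerD.
  apply: (@le_trans _ _ ((2 * normc (G x)) ^+ 2)); last by rewrite exprMn; lra.
  by rewrite ler_pXn2r ?nnegrE ?normc_ge0// mulr_ge0 ?normc_ge0.
apply: (@ecvg0_le _ _ (fun n => \int[mu]_x normc (F n x - f x) ^+ 2)).
- by move=> n; exact: norm2_ge0.
- by move=> n; rewrite norm2_Rintegral//; exact: L2cB.
- by move: c; rewrite /Rintegral integral0.
Qed.

End complex_domination.

Section shift_sums.
Context {R : realType}.
Local Notation mR := (measurableTypeR R).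
Implicit Types (phi : R -> R[i]) (c s : nat -> R).

Lemma schwartz_shift phi (s : R) : schwartz phi -> schwartz (fun t => phi (t + s)).
Proof.
move=> hp; have := schwartz_translate (- s) hp.
by apply: schwartz_eq => t; rewrite /translate opprK.
Qed.

Lemma fourier_shift phi (s w : R) : schwartz phi ->
  fourier (fun t => phi (t + s)) w = cis (s * w) * fourier phi w.
Proof.
move=> hp; have := fourier_translate (- s) w (schwartz_Cintegrable hp).
by rewrite mulNr opprK /translate; under eq_fun do rewrite opprK.
Qed.

Lemma schwartz_shift_sum c s J phi : schwartz phi ->
  schwartz (fun t => \sum_(j < J) (c j)%:C * phi (t + s j)).
Proof.
move=> hp; elim: J => [|J IH].
  by apply: schwartz_eq (@schwartz0 R) => t; rewrite big_ord0.
have := schwartzD (c J)%:C (schwartz_shift (s J) hp) IH.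
by apply: schwartz_eq => t; rewrite big_ord_recr/= addrC.
Qed.

(** A superposition of translations acts on the Fourier side by a combination of
    phases. *)
Lemma fourier_shift_sum c s J phi w : schwartz phi ->
  fourier (fun t => \sum_(j < J) (c j)%:C * phi (t + s j)) w =
  (\sum_(j < J) (c j)%:C * cis (s j * w)) * fourier phi w.
Proof.
move=> hp; elim: J => [|J IH].
  rewrite big_ord0 mul0r.
  have e : (fun t => \sum_(j < 0) (c j)%:C * phi (t + s j)) = (fun t => 0 * phi t).
    by apply/funext => t; rewrite big_ord0 mul0r.
  by rewrite e fourierZ ?mul0r//; exact: schwartz_Cintegrable.
have e : (fun t => \sum_(j < J.+1) (c j)%:C * phi (t + s j)) =
    (fun t => (c J)%:C * phi (t + s J) + \sum_(j < J) (c j)%:C * phi (t + s j)).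
  by apply/funext => t; rewrite big_ord_recr/= addrC.
rewrite e fourierD.
- by rewrite fourier_shift// IH big_ord_recr/=; ring.
- by apply: schwartz_Cintegrable; exact: schwartz_shift.
- exact: (schwartz_Cintegrable (schwartz_shift_sum c s J hp)).
Qed.

End shift_sums.

(** * The Fourier symbol of the force operator *)

Section memory_symbol.
Context {R : realType}.
Local Notation mu := (@lebesgue_measure R).
Local Notation mR := (measurableTypeR R).
Variables (k dk : R -> R) (a C : R).
Hypothesis k_loc : forall T, mu.-integrable `[0, T] (EFin \o k).
Hypothesis k_gt0 : forall t, 0 < t -> 0 < k t.
Hypothesis k_der : forall t : R, 0 < t -> is_derive t 1 k (dk t).
Hypothesis dk_le0 : forall t, 0 < t -> dk t <= 0.
Hypothesis dk_cont : forall t, 0 < t -> {for t, continuous dk}.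
Hypothesis a01 : 0 < a < 1.
Hypothesis k_decay : forall t, 1 <= t -> k t <= C * t `^ (- a).
Variables m lam bet : R.
Hypotheses (m_gt0 : 0 < m) (lam_gt0 : 0 < lam) (bet_gt0 : 0 < bet).
Implicit Types (n : nat) (f : R -> R) (phi g : R -> R[i]).

Definition half_line_csum n (phi : R -> R[i]) : R[i] :=
  \sum_(j < n * (n.+1 * (Num.truncn (kmass k n%:R)).+1))
    (cell_mass k (mesh k n) j)%:C * phi (j%:R * mesh k n).

Lemma half_line_csumE n phi : half_line_csum n phi =
  half_line_sum k n (fun s => Re (phi s)) +i* half_line_sum k n (fun s => Im (phi s)).
Proof.
apply: complex_eqP; rewrite /half_line_csum /half_line_sum /riemann_sum !complexE'.
  rewrite (big_morph (fun z : R[i] => Re z) (@ReDE R) (erefl : Re (0 : R[i]) = 0)).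
  by apply: eq_bigr => j _; rewrite !complexE'; ring.
rewrite (big_morph (fun z : R[i] => Im z) (@ImDE R) (erefl : Im (0 : R[i]) = 0)).
by apply: eq_bigr => j _; rewrite !complexE'; ring.
Qed.

(** With finite sums in place of the memory integral the function stays in the
    Schwartz class, which [Psi phi] itself may leave when the kernel decays slowly. *)
Definition Psi_approx n phi t : R[i] :=
  - m%:C * Cderive 1 phi t + lam%:C * phi t + bet%:C * half_line_csum n (fun s => phi (t + s)).

Definition Psi_kernel phi t : R[i] :=
  - m%:C * Cderive 1 phi t + lam%:C * phi t
  + bet%:C * Cint mu `[0, +oo[ (fun s => (k s)%:C * phi (t + s)).

Definition impedance_approx n w : R[i] :=
  - m%:C * (0 +i* w) + lam%:C + bet%:C * half_line_csum n (fun s => cis (s * w)).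

(** The impedance [- i m w + lam + bet (int_0^oo k s e^{i s w} ds)] at real
    frequency, without the spring. *)
Definition impedance w : R[i] :=
  resistance k lam bet w +i* (- m * w + bet * sin_part k w).

Let memory_sum n phi t := half_line_csum n (fun s => phi (t + s)).

Let schwartz_memory_sum n phi : schwartz phi -> schwartz (memory_sum n phi).
Proof.
by move=> hp; exact: (schwartz_shift_sum (cell_mass k (mesh k n)) (fun j => j%:R * mesh k n) _ hp).
Qed.

Let fourier_memory_sum n phi w : schwartz phi -> fourier (memory_sum n phi) w =
  half_line_csum n (fun s => cis (s * w)) * fourier phi w.
Proof.
by move=> hp; exact: (fourier_shift_sum (cell_mass k (mesh k n)) (fun j => j%:R * mesh k n) _ w hp).
Qed.

Lemma schwartz_Psi_approx n phi : schwartz phi -> schwartz (Psi_approx n phi).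
Proof.
move=> hp; have h1 := schwartzZ lam%:C hp.
have h2 := schwartzD (- m%:C) (schwartz_Cderive hp) h1.
have := schwartzD bet%:C (schwartz_memory_sum n hp) h2.
by apply: schwartz_eq => t; rewrite addrC.
Qed.

Lemma fourier_Psi_approx n phi w : schwartz phi ->
  fourier (Psi_approx n phi) w = impedance_approx n w * fourier phi w.
Proof.
move=> hp; have h1 := schwartzZ lam%:C hp.
have h2 := schwartzD (- m%:C) (schwartz_Cderive hp) h1.
have e : Psi_approx n phi = (fun t => bet%:C * memory_sum n phi t +
    (- m%:C * Cderive 1 phi t + lam%:C * phi t)).
  by apply/funext => t; rewrite addrC.
rewrite e fourierD; [|exact: schwartz_Cintegrable (schwartz_memory_sum n hp)|
  exact: schwartz_Cintegrable h2].
rewrite fourierD; [|exact: schwartz_Cintegrable (schwartz_Cderive hp)|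
  exact: schwartz_Cintegrable h1].
rewrite fourierZ; last exact: schwartz_Cintegrable.
rewrite fourier_Cderive// fourier_memory_sum// /impedance_approx.
by ring.
Qed.

Let cos_sum n w : half_line_csum n (fun s => cis (s * w)) =
  half_line_sum k n (fun s => cos (w * s + 0)) +i*
  half_line_sum k n (fun s => cos (w * s + - (pi / 2))).
Proof.
rewrite half_line_csumE; congr (half_line_sum k n _ +i* half_line_sum k n _); apply/funext => s.
  by rewrite addr0 mulrC.
by rewrite cosBpi2 mulrC.
Qed.

Lemma impedance_cvg w : w != 0 -> ccvg (impedance_approx ^~ w) (impedance w).
Proof.
move=> w0.
have osc th : (fun n => half_line_sum k n (fun s => cos (w * s + th))) @ \oo --> ktrans k 0 th w.
  exact: (half_line_sum_osc k_loc k_gt0 k_der dk_le0 dk_cont a01 k_decay).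
have cs : ccvg (fun n => half_line_csum n (fun s => cis (s * w)))
    (ktrans k 0 0 w +i* sin_part k w).
  apply: (@ccvg_eq R (fun n => half_line_sum k n (fun s => cos (w * s + 0)) +i*
    half_line_sum k n (fun s => cos (w * s + - (pi / 2))))); first by move=> n; rewrite cos_sum.
  by split; exact: osc.
have := ccvgD (ccvg_cst (- m%:C * (0 +i* w) + lam%:C)) (ccvgZ bet%:C cs).
congr ccvg; rewrite /impedance /resistance /cos_part (negbTE w0).
by apply: complex_eqP; rewrite !complexE' /=; ring.
Qed.

(** The factor [|w|] compensates the singularity of the kernel transform at zero
    frequency. *)
Lemma impedance_approx_bound : exists2 B, 0 <= B & forall n w,
  `|w| * normc (impedance_approx n w) <= B * (1 + `|w|) ^+ 2.
Proof.
have [M M0 hM] := kbound_mulr k_gt0 a01 k_decay.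
pose B := m + lam + 2 * bet * (M + 1).
have B0 : 0 <= B by rewrite !addr_ge0 ?(ltW m_gt0) ?(ltW lam_gt0)// !mulr_ge0 ?addr_ge0 ?(ltW bet_gt0).
exists B => // n w; have [->|w0] := eqVneq w 0.
  by rewrite normr0 mul0r mulr_ge0// exprn_ge0// addr_ge0.
have osc th : `|half_line_sum k n (fun s => cos (w * s + th))| <= kbound k a C w + `|w|.
  exact: (half_line_sum_osc_bound k_loc k_gt0 k_der dk_le0 dk_cont a01 k_decay).
have hs : normc (half_line_csum n (fun s => cis (s * w))) <= 2 * (kbound k a C w + `|w|).
  rewrite cos_sum; apply: (le_trans (normc_le_ReIm _)); rewrite /= mulr_natl mulr2n.
  by apply: lerD; exact: osc.
have nw : normc (0 +i* w : R[i]) = `|w| by rewrite /= expr0n add0r sqrtr_sqr.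
have nG : normc (impedance_approx n w) <= m * `|w| + lam + bet * (2 * (kbound k a C w + `|w|)).
  apply: (le_trans (normcD_le _ _)); apply: lerD.
    apply: (le_trans (normcD_le _ _)); apply: lerD.
      by rewrite ComplexField.Normc.normcM normcN normcC nw (gtr0_norm m_gt0).
    by rewrite normcC gtr0_norm.
  by rewrite ComplexField.Normc.normcM normcC (gtr0_norm bet_gt0) ler_pM2l.
apply: (@le_trans _ _ (`|w| * (m * `|w| + lam + bet * (2 * (kbound k a C w + `|w|))))).
  by rewrite ler_wpM2l.
have kw := hM w; have x0 := normr_ge0 w.
move: (`|w|) (kbound k a C w) x0 kw => x b x0 kw.
have -> : x * (m * x + lam + bet * (2 * (b + x))) =
    m * x ^+ 2 + lam * x + 2 * bet * (x * b + x ^+ 2) by ring.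
apply: (@le_trans _ _ (m * x ^+ 2 + lam * x + 2 * bet * (M * (1 + x) + x ^+ 2))).
  by rewrite lerD2l ler_pM2l ?mulr_gt0// lerD2r.
rewrite /B -subr_ge0.
have -> : (m + lam + 2 * bet * (M + 1)) * (1 + x) ^+ 2 -
   (m * x ^+ 2 + lam * x + 2 * bet * (M * (1 + x) + x ^+ 2)) =
   m * (1 + 2 * x) + lam * (1 + x + x ^+ 2) + 2 * bet * (M * (x + x ^+ 2) + (1 + 2 * x)) by ring.
have x2 := sqr_ge0 x.
by rewrite !addr_ge0 ?mulr_ge0 ?addr_ge0 ?mulr_ge0 ?addr_ge0 ?mulr_ge0 ?(ltW m_gt0) ?(ltW lam_gt0) ?(ltW bet_gt0).
Qed.

Let cint_memory phi t : Cint mu `[0, +oo[ (fun s => (k s)%:C * phi (t + s)) =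
  (\int[mu]_(s in `[0, +oo[) (k s * Re (phi (t + s)))) +i*
  (\int[mu]_(s in `[0, +oo[) (k s * Im (phi (t + s)))).
Proof.
by apply: complex_eqP; rewrite !complexE'; apply: eq_Rintegral => s _;
  rewrite !complexE'; ring.
Qed.

Lemma Psi_approx_cvg phi t : schwartz phi -> ccvg (fun n => Psi_approx n phi t) (Psi_kernel phi t).
Proof.
move=> /schwartzP[p1 p2].
have cs : ccvg (fun n => memory_sum n phi t)
    (Cint mu `[0, +oo[ (fun s => (k s)%:C * phi (t + s))).
  rewrite cint_memory.
  apply: (@ccvg_eq R (fun n => half_line_sum k n (fun s => Re (phi (t + s))) +i*
    half_line_sum k n (fun s => Im (phi (t + s))))).
    by move=> n; rewrite /memory_sum half_line_csumE.
  have c1 := half_line_sum_memory k_loc k_gt0 k_der dk_le0 (t := t) p1.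
  have c2 := half_line_sum_memory k_loc k_gt0 k_der dk_le0 (t := t) p2.
  split; [exact: c1|exact: c2].
exact: (ccvgD (ccvg_cst (- m%:C * Cderive 1 phi t + lam%:C * phi t)) (ccvgZ bet%:C cs)).
Qed.

Lemma schwartz_bounded phi : schwartz phi -> exists2 M, 0 <= M & forall t, normc (phi t) <= M.
Proof.
move=> /schwartzP[p1 p2].
have [M1 M10 h1] := rschwartz_bound 0 p1; have [M2 M20 h2] := rschwartz_bound 0 p2.
exists (M1 + M2); first exact: addr_ge0.
by move=> t; apply: (le_trans (normc_le_ReIm _)); apply: lerD; [exact: h1|exact: h2].
Qed.

Lemma Psi_approx_bound phi : schwartz phi -> exists2 B, 0 <= B & forall n t,
  normc (Psi_approx n phi t) <= B.
Proof.
move=> hp; have [M1 M10 h1] := schwartz_bounded hp.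
have [M2 M20 h2] := schwartz_bounded (schwartz_Cderive hp).
have /schwartzP[p1 p2] := hp.
have [B1 B10 hB1] := half_line_sum_bound k_loc k_gt0 k_der dk_le0 p1.
have [B2 B20 hB2] := half_line_sum_bound k_loc k_gt0 k_der dk_le0 p2.
exists (m * M2 + lam * M1 + bet * (B1 + B2)).
  by rewrite !addr_ge0 ?mulr_ge0 ?addr_ge0 ?(ltW m_gt0) ?(ltW lam_gt0) ?(ltW bet_gt0).
move=> n t; apply: (le_trans (normcD_le _ _)); apply: lerD.
  apply: (le_trans (normcD_le _ _)); apply: lerD.
    by rewrite ComplexField.Normc.normcM normcN normcC (gtr0_norm m_gt0) ler_pM2l.
  by rewrite ComplexField.Normc.normcM normcC (gtr0_norm lam_gt0) ler_pM2l.
rewrite ComplexField.Normc.normcM normcC (gtr0_norm bet_gt0) ler_pM2l// half_line_csumE.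
by apply: (le_trans (normc_le_ReIm _)); apply: lerD; [exact: hB1|exact: hB2].
Qed.

End memory_symbol.

Section memory_symbol_limit.
Context {R : realType}.
Local Notation mu := (@lebesgue_measure R).
Local Notation mR := (measurableTypeR R).

Lemma rapid_Cintegrable (h : R -> R[i]) : Cmeasurable (h : mR -> R[i]) -> rapid h ->
  Cintegrable mu setT h.
Proof.
move=> mh rh; have [M0 h0] := rh 0%N; have [M2 h2] := rh 2%N.
apply: (Cintegrable_le (g := fun t => (M0 + M2) * (1 / (t ^+ 2 + 1 ^+ 2)))) => //.
  by apply: intZ => //; have := @integral_cauchy R 1 0 ltr01; under eq_fun do rewrite subr0.
move=> t; have q0 : 0 < t ^+ 2 + 1 ^+ 2 by rewrite expr1n ltr_wpDl// sqr_ge0.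
rewrite mul1r ler_pdivlMr// expr1n mulrDr mulr1 addrC; apply: lerD.
  by have := h0 t; rewrite expr0 mul1r.
by have := h2 t; rewrite real_normK ?num_real// mulrC.
Qed.

Lemma rapid_bounded (h : R -> R[i]) : rapid h -> exists M, forall w, normc (h w) <= M.
Proof. by move=> /(_ 0%N)[M hM]; exists M => w; have := hM w; rewrite expr0 mul1r. Qed.

Variables (k dk : R -> R) (a C : R).
Hypothesis k_loc : forall T, mu.-integrable `[0, T] (EFin \o k).
Hypothesis k_gt0 : forall t, 0 < t -> 0 < k t.
Hypothesis k_der : forall t : R, 0 < t -> is_derive t 1 k (dk t).
Hypothesis dk_le0 : forall t, 0 < t -> dk t <= 0.
Hypothesis dk_cont : forall t, 0 < t -> {for t, continuous dk}.
Hypothesis a01 : 0 < a < 1.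
Hypothesis k_decay : forall t, 1 <= t -> k t <= C * t `^ (- a).
Variables m lam bet : R.
Hypotheses (m_gt0 : 0 < m) (lam_gt0 : 0 < lam) (bet_gt0 : 0 < bet).
Variable g : R -> R[i].
Hypothesis hg : schwartz g.

Let phi := Cderive 1 g.
Let hphi : schwartz phi. Proof. exact: schwartz_Cderive. Qed.

Let phiE w : fourier phi w = (0 +i* w) * fourier g w.
Proof. exact: fourier_Cderive. Qed.

Let nI (w : R) : normc (0 +i* w : R[i]) = `|w|.
Proof. by rewrite /= expr0n add0r sqrtr_sqr. Qed.

Let approx n w := impedance_approx k m lam bet n w * fourier phi w.
Let symbol w := impedance k m lam bet w * fourier phi w.

Let mapprox n : Cmeasurable (approx n : mR -> R[i]).
Proof.
have h := schwartz_Psi_approx k m lam bet n hphi.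
have := fourier_Cmeasurable (schwartz_Cintegrable h).
by congr Cmeasurable; apply/funext => w; rewrite fourier_Psi_approx.
Qed.

Let approx_cvg w : ccvg (approx ^~ w) (symbol w).
Proof.
have [->|w0] := eqVneq w 0.
  have f0 : fourier phi 0 = 0 by rewrite phiE (_ : 0 +i* 0 = 0 :> R[i])// mul0r.
  apply: (@ccvg_eq R (fun=> 0)); first by move=> n; rewrite /approx f0 mulr0.
  by rewrite /symbol f0 mulr0; exact: ccvg_cst.
apply: ccvgM; last exact: ccvg_cst.
exact: (impedance_cvg k_loc k_gt0 k_der dk_le0 dk_cont a01 k_decay).
Qed.

Let weight (B : R) (p : nat) (w : R) : R[i] := (B * (1 + `|w|) ^+ p)%:C.

Let mweight B p : Cmeasurable (weight B p : mR -> R[i]).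
Proof.
apply: CmeasurableC; apply: measurable_funM => //; apply: measurable_funX.
by apply: measurable_funD => //; apply: measurable_continuous; exact: norm_continuous.
Qed.

Let envelope B p w := weight B p w * fourier g w.

Let rapid_envelope B p : 0 <= B -> rapid (envelope B p).
Proof.
move=> B0; apply: (rapid_mul (C := B) (p := p)); first exact: rapid_fourier.
by move=> w; rewrite /weight normcC ger0_norm// mulr_ge0// exprn_ge0// addr_ge0.
Qed.

Let menvelope B p : Cmeasurable (envelope B p : mR -> R[i]).
Proof. exact: (CmeasurableM (mweight B p) (fourier_Cmeasurable (schwartz_Cintegrable hg))). Qed.

Let dominated : exists2 B, 0 <= B & forall (c : R -> R[i]) p,
  (forall w, normc (c w) <= (1 + `|w|) ^+ p) ->
  forall n w, normc (c w * approx n w) <= normc (envelope B (p + 2) w).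
Proof.
have [B B0 hB] := impedance_approx_bound k_loc k_gt0 k_der dk_le0 dk_cont a01 k_decay m_gt0 lam_gt0 bet_gt0.
exists B => // c p hc n w.
have w1 : 0 <= 1 + `|w| by rewrite addr_ge0.
rewrite /approx /envelope /weight phiE !ComplexField.Normc.normcM nI normcC.
rewrite (ger0_norm (mulr_ge0 B0 (exprn_ge0 (p + 2) w1))).
have -> : normc (c w) * (normc (impedance_approx k m lam bet n w) * (`|w| * normc (fourier g w))) =
  normc (c w) * (`|w| * normc (impedance_approx k m lam bet n w)) * normc (fourier g w) by ring.
rewrite ler_wpM2r ?normc_ge0// exprD [X in _ <= X]mulrCA.
apply: ler_pM => //; first exact: normc_ge0.
by rewrite mulr_ge0// normc_ge0.
Qed.

(** The transform of a derivative vanishes at the origin, which tames the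
    impedance there and allows domination by the transform of [g]. *)
Lemma Psi_symbol_cvg (nu : spectral_measure R) i (c : R -> R[i]) p :
  Cmeasurable (c : mR -> R[i]) -> (forall w, normc (c w) <= (1 + `|w|) ^+ p) ->
  L2c (sm_diag nu i) (fun w => c w * symbol w) /\
  norm2 (sm_diag nu i) (fun w => c w * approx n w - c w * symbol w) @[n --> \oo] --> 0%E.
Proof.
move=> mc hc; have [B B0 hB] := dominated.
apply: (@norm2_dominated _ _ _ (sm_diag nu i) (fun n w => c w * approx n w) _ (envelope B (p + 2))).
- by move=> n; apply: CmeasurableM => //; exact: mapprox.
- by move=> w; apply: ccvgM; [exact: ccvg_cst|exact: approx_cvg].
- by apply: rapid_L2c; [exact: menvelope|exact: rapid_envelope].
- exact: hB.
Qed.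

Let msymbol : Cmeasurable (symbol : mR -> R[i]).
Proof. exact: (Cmeasurable_cvg mapprox approx_cvg). Qed.

Let symbol_bound : exists M, forall n w, normc (approx n w) <= M /\ normc (symbol w) <= M.
Proof.
have [B B0 hB] := dominated.
have h n w : normc (approx n w) <= normc (envelope B (0 + 2) w).
  rewrite -[approx n w]mul1r; apply: (hB (fun=> 1) 0%N) => v.
  by rewrite expr0 normcC normr1.
have [M hM] := rapid_bounded (rapid_envelope (0 + 2) B0).
have M0 : 0 <= M by exact: le_trans (normc_ge0 _) (hM 0).
have {}h n w : normc (approx n w) <= M by exact: le_trans (h n w) (hM w).
exists M => n w; split => //; exact: (ccvg_normc_le M0 (approx_cvg w)).
Qed.

(** The memory term of [Psi] is a limit of superpositions of translations,
    each of which acts by a phase on the Fourier side. *)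
Lemma is_symbol_Psi (nu : spectral_measure R) i :
  is_symbol nu i (dist_of_fun (Psi_kernel k m lam bet phi)) symbol.
Proof.
split; last first.
  have [] := @Psi_symbol_cvg nu i (fun=> 1) 0.
  - exact: Cmeasurable_cst.
  - by move=> w; rewrite expr0 normcC normr1.
  - by move=> h _; move: h; under eq_fun do rewrite mul1r.
split => // psi hpsi; have ipsi := schwartz_Cintegrable hpsi.
have [M hM] := symbol_bound.
have isym : Cintegrable mu setT (fun w => symbol w * psi w).
  have := Cintegrable_mul_bounded ipsi msymbol (fun w => (hM 0%N w).2).
  by congr Cintegrable; apply/funext => w; rewrite mulrC.
split => //.
have [B B0 hB] := Psi_approx_bound k_loc k_gt0 k_der dk_le0 m_gt0 lam_gt0 bet_gt0 hphi.
have ifpsi := rapid_Cintegrable (fourier_Cmeasurable ipsi) (rapid_fourier hpsi).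
have mfpsi := Cintegrable_measurable ifpsi.
have hPsi n := schwartz_Psi_approx k m lam bet n hphi.
have [] := @Cdominated_convergence _ mR R mu
  (fun n t => Psi_approx k m lam bet n phi t * fourier psi t)
  (fun t => Psi_kernel k m lam bet phi t * fourier psi t) (fun t => B * normc (fourier psi t)).
- move=> n; apply: CmeasurableM => //; exact: schwartz_Cmeasurable (hPsi n).
- move=> t; apply: ccvgM; last exact: ccvg_cst.
  exact: (Psi_approx_cvg k_loc k_gt0 k_der dk_le0).
- by apply: intZ => //; exact: Cintegrable_norm.
- by move=> n t; rewrite ComplexField.Normc.normcM ler_wpM2r ?normc_ge0.
move=> _ c1.
have [] := @Cdominated_convergence _ mR R mu (fun n w => approx n w * psi w)
  (fun w => symbol w * psi w) (fun w => M * normc (psi w)).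
- by move=> n; apply: CmeasurableM => //; exact: schwartz_Cmeasurable.
- by move=> w; apply: ccvgM; [exact: approx_cvg|exact: ccvg_cst].
- by apply: intZ => //; exact: Cintegrable_norm.
- by move=> n w; rewrite ComplexField.Normc.normcM ler_wpM2r ?normc_ge0// (hM n w).1.
(* both sequences are the same by the multiplication formula *)
move=> _ c2; apply: (ccvg_unique c1); apply: ccvg_eq c2 => n.
rewrite (fourier_mul_formula (schwartz_Cintegrable (hPsi n)) ipsi).
by congr Cint; apply/funext => w; rewrite fourier_Psi_approx.
Qed.

End memory_symbol_limit.

(** * Point evaluations *)

Section point_evaluation.
Context {R : realType} {d : measure_display} {Omega : measurableType d}.
Variables (P : probability Omega R) (nu : spectral_measure R).
Variable Z : 'I_2 -> set (measurableTypeR R) -> Omega -> R[i].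
Hypothesis Z_random : random_measure P nu Z.
Hypothesis Phi_real : stat_op_real P nu Z.
Local Notation mu := (@lebesgue_measure R).
Local Notation mR := (measurableTypeR R).
Variable i : 'I_2.
Hypothesis mass_fin : (sm_diag nu i setT < +oo)%E.

Lemma tempered_delta (t : R) : tempered (delta t).
Proof.
split; first by [].
exists 0%N, 1 => phi M hp hM; rewrite mul1r.
have := hM 0%N 0%N t (leqnn _) (leqnn _); rewrite expr0 mul1r.
by rewrite /delta /Cderive /=; case: (phi t).
Qed.

Let norm2_cis (t : R) : norm2 (sm_diag nu i) (fun w => cis (- (w * t))) = sm_diag nu i setT.
Proof.
rewrite /norm2; under eq_integral do rewrite normc_cis expr1n.
by rewrite integral_cst// mul1e.
Qed.

(** The transform of a point mass is a pure phase, which is square integrable as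
    soon as the spectral measure is finite. *)
Lemma is_symbol_delta (t : R) : is_symbol nu i (delta t) (fun w => cis (- (w * t))).
Proof.
have mc := Cmeasurable_cis t.
split; last by apply/L2cP; split => //; rewrite norm2_cis.
split => // phi hp; have h := fourier_Cintegrable t (schwartz_Cintegrable hp).
have e : (fun w => cis (- (w * t)) * phi w) = (fun w => phi w * cis (- (w * t))).
  by apply/funext => w; rewrite mulrC.
by rewrite /dist_of_fun e.
Qed.

Lemma stat_dom_delta (t : R) : stat_dom nu i (delta t).
Proof. by split; [exact: tempered_delta|exists (fun w => cis (- (w * t))); exact: is_symbol_delta]. Qed.

Let x0 := stat_op P nu Z i (delta 0).

Let x0_L2c : L2c P x0.
Proof. exact: (stat_op_L2c Z_random (is_symbol_delta 0)). Qed.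

Lemma norm2_delta : norm2 P x0 = sm_diag nu i setT.
Proof. by rewrite (stat_op_norm2 Z_random (is_symbol_delta 0)) norm2_cis. Qed.

Let approx (n : nat) (t : R) : R[i] :=
  ((cos_transform (rgauss n.+1%:R) 0 0)^-1)%:C * cgauss 0 n.+1%:R t.

Let approx_schwartz n : schwartz (approx n).
Proof. by apply: schwartzZ; exact: schwartz_cgauss. Qed.

Let approx_real n t : Im (approx n t) = 0.
Proof. by rewrite /approx /cgauss !complexE' /= mul0r sin0; ring. Qed.

Let fourier_approx n w : fourier (approx n) w = (expR (- (w ^+ 2 / (4 * n.+1%:R))))%:C.
Proof.
have n0 : 0 < n.+1%:R :> R by [].
rewrite fourierZ; last by apply: schwartz_Cintegrable; exact: schwartz_cgauss.
rewrite fourier_cgauss// subr0 -rmorphM mulrA mulVf ?mul1r//.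
by rewrite gt_eqF// rgauss_mass_gt0.
Qed.

(** Approximate identities exhibit the point evaluation as a mean-square limit
    of pairings with real test functions. *)
Lemma stat_op_delta_real : {ae P, forall w, Im (x0 w) = 0}.
Proof.
have c1 : L2c (sm_diag nu i) (fun w => 1 : R[i]) /\
    norm2 (sm_diag nu i) (fun w => fourier (approx n) w - 1) @[n --> \oo] --> 0%E.
  apply: (@norm2_dominated _ _ _ (sm_diag nu i) (fun n w => fourier (approx n) w) _ (fun=> 1)).
  - by move=> n; apply: fourier_Cmeasurable; exact: schwartz_Cintegrable.
  - move=> w; apply: (@ccvg_eq R (fun n => (expR (- (w ^+ 2 / (4 * n.+1%:R))))%:C)).
      by move=> n; rewrite fourier_approx.
    have h : (fun n : nat => n.+1%:R^-1 : R) @ \oo --> 0 by exact: (@cvg_harmonic R).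
    have h2 := cvgseqN (cvgseqZ (c := w ^+ 2 / 4) h).
    split; last exact: cvg_cst.
    have := cvgseq_continuous (@continuous_expR R _) h2.
    rewrite mulr0 oppr0 expR0; apply: cvgseq_eq => n.
    by rewrite ReCE invfM mulrA.
  - apply/L2cP; split; first exact: Cmeasurable_cst.
    rewrite /norm2; under eq_integral do rewrite normcC normr1 expr1n.
    by rewrite integral_cst// mul1e.
  - move=> n w; rewrite fourier_approx !normcC normr1 ger0_norm ?expR_ge0//.
    by rewrite -[leRHS]expR0 ler_expR oppr_le0 divr_ge0 ?sqr_ge0.
have {c1} [_ c1] := c1.
pose y w : R[i] := (Im (x0 w))%:C.
have [mx1 mx2] := L2c_measurable x0_L2c.
have my : Cmeasurable y by exact: CmeasurableC.
(* distance to a real variable bounds the imaginary part *)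
have ub n : (norm2 P y <= norm2 (sm_diag nu i) (fun w => fourier (approx n) w - 1)%R)%E.
  have sn := is_symbol_schwartz nu i (approx_schwartz n).
  have := stat_op_norm2_sub Z_random sn (is_symbol_delta 0).
  have -> : (fun w : mR => fourier (approx n) w - cis (- (w * 0))) =
      (fun w => fourier (approx n) w - 1).
    by apply/funext => w; rewrite mulr0 oppr0 /cis cos0 sin0.
  move=> <-.
  set U := stat_op P nu Z i _; have [mU1 mU2] := L2c_measurable (stat_op_L2c Z_random sn).
  pose U' w : R[i] := (Re (U w))%:C.
  have mU' : Cmeasurable U' by exact: CmeasurableC.
  have -> : norm2 P (fun w => U w - x0 w) = norm2 P (fun w => U' w - x0 w).
    apply: norm2_ae; [exact: CmeasurableB|exact: CmeasurableB|].
    apply: filterS (Phi_real i (approx_schwartz n) (approx_real n)) => w e.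
    by congr (_ - _); apply: complex_eqP; rewrite !complexE'.
  apply: norm2_le => //; first exact: CmeasurableB.
  move=> w; rewrite /y normcC; apply: le_trans (Im_le_normc _).
  by rewrite !complexE' sub0r normrN.
have y0 : norm2 P y = 0%E.
  apply/eqP; rewrite eq_le norm2_ge0 andbT; apply/lee_addgt0Pr => e e0; rewrite add0e.
  by have [N hN] := ecvg0_near c1 e0; exact: le_trans (ub N) (hN N (leqnn N)).
have y0' : (\int[P]_w `|((normc (y w)) ^+ 2)%:E| = 0)%E.
  rewrite -[RHS]y0; apply: eq_integral => w _.
  by rewrite gee0_abs// lee_fin sqr_ge0.
have /ae_eq_integral_abs := y0' => /(_ measurableT (emeasurable_normc2 my)).
apply: filterS => w /(_ I) [] /eqP; rewrite sqrf_eq0 => /eqP.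
by rewrite /= expr0n addr0 sqrtr_sqr => /eqP; rewrite normr_eq0 => /eqP.
Qed.

(** By reality, the square of the variable is the square of its modulus, whose
    expectation is the mass of the spectral measure. *)
Lemma Cexpectation_sqr_delta (b c : R) : sm_diag nu i setT = c%:E ->
  Cexpectation P (fun w => b%:C * x0 w ^+ 2) = (b * c)%:C.
Proof.
move=> nc; have hx := L2c_measurable x0_L2c.
have mF : Cmeasurable (fun w => b%:C * x0 w ^+ 2).
  by apply: CmeasurableZ; under eq_fun do rewrite expr2; exact: CmeasurableM.
have mG : Cmeasurable (fun w => b%:C * (x0 w * conjc (x0 w))).
  by apply: CmeasurableZ; apply: CmeasurableM => //; exact: CmeasurableJ.
have ae : {ae P, forall w, b%:C * x0 w ^+ 2 = b%:C * (x0 w * conjc (x0 w))}.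
  apply: filterS stat_op_delta_real => w e; congr (_ * _); rewrite expr2; congr (_ * _).
  by apply: complex_eqP; rewrite !complexE' ?e ?oppr0.
have -> : Cexpectation P (fun w => b%:C * x0 w ^+ 2) =
    Cexpectation P (fun w => b%:C * (x0 w * conjc (x0 w))).
  apply: complex_eqP; rewrite !complexE' /Rintegral; congr fine;
    apply: ae_eq_integral => //.
  - by apply/measurable_EFinP; case: mF.
  - by apply/measurable_EFinP; case: mG.
  - by apply: filterS ae => w e _; rewrite e.
  - by apply/measurable_EFinP; case: mF.
  - by apply/measurable_EFinP; case: mG.
  - by apply: filterS ae => w e _; rewrite e.
rewrite /Cexpectation CintZ; last exact: cinner_integrable.
have := cinner_norm2 x0_L2c; rewrite norm2_delta nc /= /cinner => ->.
by rewrite rmorphM.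
Qed.

End point_evaluation.

(** * The spectral equations *)

Section gaussian_norms.
Context {R : realType}.
Local Notation mu := (@lebesgue_measure R).
Local Notation mR := (measurableTypeR R).
Implicit Types (n : {measure set mR -> \bar R}) (c : R -> R[i]).

Lemma mule_pos_inj (c : R) (x y : \bar R) : 0 < c -> (c%:E * x = c%:E * y)%E -> x = y.
Proof.
move=> c0 e; have := congr1 (fun z => (c^-1)%:E * z)%E e.
by rewrite !muleA -EFinM mulVf ?gt_eqF// !mul1e.
Qed.

Let mass (q : R) := cos_transform (rgauss (2 * q)^-1) 0 0.

Let inv2q (q : R) : 0 < q -> 0 < (2 * q)^-1.
Proof. by move=> q0; rewrite invr_gt0 mulr_gt0. Qed.

Let mgauss q a : measurable_fun (setT : set mR) (fun w : mR => expR (- (q * (w - a) ^+ 2))).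
Proof.
apply: measurable_continuous => w.
exact: (der_cvg (der_expR (derN (derZ q (derX 2 (derB (der_id w) (der_cst a w))))))).
Qed.

(** The transform of a modulated Gaussian is a Gaussian centred at the frequency
    of the modulation; the parameter is such that its square is [e^{- q (w - a)^2}]. *)
Lemma norm2_gauss n c q a : 0 < q -> Cmeasurable (c : mR -> R[i]) ->
  norm2 n (fun w => c w * fourier (cgauss a (2 * q)^-1) w) =
  ((mass q ^+ 2)%:E * \int[n]_w (normc (c w) ^+ 2 * expR (- (q * (w - a) ^+ 2)))%:E)%E.
Proof.
move=> q0 mc; pose G (w : mR) := (normc (c w) ^+ 2 * expR (- (q * (w - a) ^+ 2)))%:E.
have mG : measurable_fun setT G.
  by apply/measurable_EFinP; apply: measurable_funM (mgauss q a); exact: measurable_normc2.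
have G0 w : (setT : set mR) w -> (0 <= G w)%E.
  by move=> _; rewrite lee_fin mulr_ge0// ?expR_ge0// sqr_ge0.
rewrite -(ge0_integralZl_EFin n measurableT G0 mG (sqr_ge0 _)).
apply: eq_integral => w _; rewrite /G -EFinM; congr EFin.
rewrite ComplexField.Normc.normcM exprMn fourier_cgauss ?inv2q// normcC real_normK ?num_real//.
rewrite exprMn mulrCA; congr (_ * (_ * _)); rewrite expr2 -expRD; congr expR.
by field; rewrite gt_eqF.
Qed.

(** The squared transforms of modulated Gaussians are Gaussians of every centre
    and width, and integrals against these determine a measure. *)
Lemma gauss_norm2_unique n1 n2 c1 c2 :
  (forall a, n1 [set a] = 0%E) -> (forall a, n2 [set a] = 0%E) ->
  Cmeasurable (c1 : mR -> R[i]) -> Cmeasurable (c2 : mR -> R[i]) ->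
  (forall a q, 0 < q ->
    (norm2 n1 (fun w => c1 w * fourier (cgauss a q) w)%R < +oo)%E /\
    norm2 n1 (fun w => c1 w * fourier (cgauss a q) w) =
    norm2 n2 (fun w => c2 w * fourier (cgauss a q) w)) ->
  forall G : mR -> \bar R, measurable_fun setT G -> (forall w, 0 <= G w)%E ->
  (\int[n1]_w (G w * (normc (c1 w) ^+ 2)%:E) =
   \int[n2]_w (G w * (normc (c2 w) ^+ 2)%:E))%E.
Proof.
move=> at1 at2 m1 m2 H.
have mass0 (q : R) : 0 < q -> 0 < mass q ^+ 2.
  by move=> q0; rewrite exprn_gt0// rgauss_mass_gt0// inv2q.
have eqG q a : 0 < q -> (\int[n1]_w (normc (c1 w) ^+ 2 * expR (- (q * (w - a) ^+ 2)))%:E =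
    \int[n2]_w (normc (c2 w) ^+ 2 * expR (- (q * (w - a) ^+ 2)))%:E)%E.
  move=> q0; have [_] := H a _ (inv2q q0); rewrite !norm2_gauss//.
  by apply: mule_pos_inj; exact: mass0.
have e1 : (fun w : mR => (normc (c1 w) ^+ 2 * expR (- w ^+ 2))%:E) =
    (fun w => (normc (c1 w) ^+ 2 * expR (- (1 * (w - 0) ^+ 2)))%:E).
  by apply/funext => w; rewrite subr0 mul1r.
have e2 : (fun w : mR => (normc (c2 w) ^+ 2 * expR (- w ^+ 2))%:E) =
    (fun w => (normc (c2 w) ^+ 2 * expR (- (1 * (w - 0) ^+ 2)))%:E).
  by apply/funext => w; rewrite subr0 mul1r.
have fin1 : (\int[n1]_w (normc (c1 w) ^+ 2 * expR (- (1 * (w - 0) ^+ 2)))%:E < +oo)%E.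
  have [+ _] := H 0 _ (inv2q ltr01); rewrite norm2_gauss//.
  set I := (\int[n1]_w _)%E.
  have : (0 <= I)%E by apply: integral_ge0 => w _; rewrite lee_fin mulr_ge0 ?expR_ge0 ?sqr_ge0.
  case: I => [r _ _|_|//]; first exact: ltry.
  by rewrite gt0_muley ?lte_fin ?mass0.
apply: gauss_test_unique => //.
- exact: measurable_normc2.
- exact: measurable_normc2.
- by move=> w; rewrite sqr_ge0.
- by move=> w; rewrite sqr_ge0.
- by rewrite e1.
- by rewrite e2 -eqG.
Qed.

End gaussian_norms.

Section mean_square_equality.
Context d (T : measurableType d) (R : realType).
Variable mu : {measure set T -> \bar R}.
Implicit Types (f g : T -> R[i]).

Lemma norm2_subC f g : norm2 mu (fun x => f x - g x) = norm2 mu (fun x => g x - f x).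
Proof. by rewrite -norm2N; congr norm2; apply/funext => x; rewrite opprB. Qed.

(** Equality case of the Cauchy-Schwarz inequality. *)
Lemma cinner_eq_norm2_sub0 f g : L2c mu f -> L2c mu g -> cinner mu f f = cinner mu g g ->
  cinner mu g g = cinner mu f g -> norm2 mu (fun x => f x - g x) = 0%E.
Proof.
move=> hf hg e1 e2; rewrite norm2_sub// e1 e2; congr EFin.
by move: (Re _) => r; ring.
Qed.

Lemma norm2_sub0_eq f g : L2c mu f -> L2c mu g ->
  norm2 mu (fun x => f x - g x) = 0%E -> norm2 mu f = norm2 mu g.
Proof.
move=> hf hg e; have h : norm2 mu (fun x => f x - g x) @[n --> \oo] --> 0%E.
  by rewrite e; exact: cvg_cst.
have c : (fun _ : nat => norm2 mu f) @ \oo --> norm2 mu f by exact: cvg_cst.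
exact: (cvg_unique _ c (norm2_cvg (F := fun=> f) (fun=> hf) hg h)).
Qed.

Lemma norm2_limits_sub0 (u v : nat -> T -> R[i]) f g :
  (forall n, L2c mu (u n)) -> (forall n, L2c mu (v n)) -> L2c mu f -> L2c mu g ->
  norm2 mu (fun x => u n x - f x) @[n --> \oo] --> 0%E ->
  norm2 mu (fun x => v n x - g x) @[n --> \oo] --> 0%E ->
  (forall n, norm2 mu (fun x => v n x - u n x) = 0%E) ->
  norm2 mu (fun x => f x - g x) = 0%E.
Proof.
move=> hu hv hf hg cu cv uv.
have e f' g' : (fun x : T => f' x + -1 * g' x) = (fun x => f' x - g' x :> R[i]).
  by apply/funext => x; rewrite mulN1r.
have hD n : L2c mu (fun x => u n x + -1 * v n x) by apply: L2cD => //; exact: L2cZ.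
have hL : L2c mu (fun x => f x + -1 * g x) by apply: L2cD => //; exact: L2cZ.
have c1 := norm2_cvg hD hL (norm2_cvgD (-1) hu hv hf hg cu cv).
have c2 : (fun n => norm2 mu (fun x => u n x + -1 * v n x)) @ \oo --> 0%E.
  rewrite (_ : (fun n => _) = (fun=> 0%E)); first exact: cvg_cst.
  by apply/funext => n; rewrite e norm2_subC uv.
by rewrite -e; exact: (cvg_unique _ c1 c2).
Qed.

End mean_square_equality.

Section stationary_solution.
Context {R : realType} {d : measure_display} {Omega : measurableType d}.
Variables (P : probability Omega R).
Variables (m lam bet gam kBT : R) (K : R -> \bar R).
Variables (F W : (R -> R[i]) -> Omega -> R[i]).
Variables (nu : spectral_measure R).
Variable Z : 'I_2 -> set (measurableTypeR R) -> Omega -> R[i].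
Hypotheses (m_gt0 : 0 < m) (lam_gt0 : 0 < lam) (bet_gt0 : 0 < bet).
Hypotheses (gam_gt0 : 0 < gam) (kBT_gt0 : 0 < kBT).
Hypothesis FW_noise : noise_pair P K F W.
Hypothesis Z_random : random_measure P nu Z.
Hypothesis Phi_sol : weak_stationary_solution P m lam bet gam kBT K F W nu Z.
Local Notation mu := (@lebesgue_measure R).
Local Notation mR := (measurableTypeR R).
Local Notation k := (real_kernel K).
Variables (dk : R -> R) (a C : R).
Hypothesis k_loc : forall T, mu.-integrable `[0, T] (EFin \o k).
Hypothesis k_gt0 : forall t, 0 < t -> 0 < k t.
Hypothesis k_der : forall t : R, 0 < t -> is_derive t 1 k (dk t).
Hypothesis dk_le0 : forall t, 0 < t -> dk t <= 0.
Hypothesis dk_cont : forall t, 0 < t -> {for t, continuous dk}.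
Hypothesis a01 : 0 < a < 1.
Hypothesis k_decay : forall t, 1 <= t -> k t <= C * t `^ (- a).
Hypothesis k_Kcos : forall w, w != 0 -> ktrans k 0 0 w = Kcos K w.
Hypothesis k_cos : forall w, w != 0 -> 0 <= ktrans k 0 0 w.
Implicit Types (phi g : R -> R[i]).

Let X phi := stat_op P nu Z 0 (dist_of_fun phi).
Let V phi := stat_op P nu Z 1 (dist_of_fun phi).
Let dX phi := X (fun t => - Cderive 1 phi t).
Let force phi w := V (Psi m lam bet K phi) w + X (fun t => gam%:C * phi t) w.
Let n0 := sm_diag nu 0.
Let n1 := sm_diag nu 1.
Let imp := impedance k m lam bet.

Let schwartz_opp_der phi : schwartz phi -> schwartz (fun t => - Cderive 1 phi t).
Proof.
move=> hp; have := schwartzZ (-1) (schwartz_Cderive hp).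
by apply: schwartz_eq => t; rewrite mulN1r.
Qed.

Let fourier_opp_der phi w : schwartz phi ->
  fourier (fun t => - Cderive 1 phi t) w = - (0 +i* w) * fourier phi w.
Proof.
move=> hp; have -> : (fun t => - Cderive 1 phi t) = (fun t => -1 * Cderive 1 phi t).
  by apply/funext => t; rewrite mulN1r.
rewrite fourierZ; last exact: schwartz_Cintegrable (schwartz_Cderive hp).
by rewrite fourier_Cderive// mulN1r mulNr.
Qed.

Let symbol_dX phi : schwartz phi ->
  is_symbol nu 0 (dist_of_fun (fun t => - Cderive 1 phi t)) (fun w => - (0 +i* w) * fourier phi w).
Proof.
move=> hp; have := is_symbol_schwartz nu 0 (schwartz_opp_der hp).
by congr is_symbol; apply/funext => w; rewrite fourier_opp_der.
Qed.

(** The covariance identities of a weak solution say exactly that [dot x = v] holds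
    in mean square on each test function. *)
Lemma velocity_eq phi : schwartz phi -> norm2 P (fun w => dX phi w - V phi w) = 0%E.
Proof.
move=> hp; have hX := stat_op_L2c Z_random (symbol_dX hp).
have hV := stat_op_L2c Z_random (is_symbol_schwartz nu 1 hp).
have [_ /(_ phi phi hp hp)[e1 e2] _] := Phi_sol.
have {}e1 : cinner P (dX phi) (dX phi) = cinner P (V phi) (V phi) by exact: e1.
have {}e2 : cinner P (V phi) (V phi) = cinner P (dX phi) (V phi) by exact: e2.
exact: (cinner_eq_norm2_sub0 hX hV e1 e2).
Qed.

Let n_atom (n : {measure set mR -> \bar R}) (b : R) :
  (forall E, measurable E -> mu E = 0%E -> n E = 0%E) -> n [set b] = 0%E.
Proof. by apply; [exact: measurable_set1|exact: lebesgue_measure_set1]. Qed.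

Let at_ i (b : R) : sm_diag nu i [set b] = 0%E.
Proof. by apply: n_atom => E; exact: sm_abs_cont. Qed.

Let at_leb (b : R) : mu [set b] = 0%E. Proof. exact: lebesgue_measure_set1. Qed.

Let mI : Cmeasurable ((fun w => 0 +i* w) : mR -> R[i]).
Proof. by split => /=; [exact: measurable_cst|exact: measurable_id]. Qed.

Let normI (w : R) : normc (0 +i* w : R[i]) ^+ 2 = w ^+ 2.
Proof. by rewrite normc_sqr /=; ring. Qed.

(** On the Fourier side [dot x = v] multiplies the spectrum by [w ^ 2]. *)
Lemma spectral_velocity (G : mR -> \bar R) : measurable_fun setT G -> (forall w, 0 <= G w)%E ->
  (\int[n1]_w G w = \int[n0]_w (G w * (w ^+ 2)%:E))%E.
Proof.
move=> mG G0.
have := @gauss_norm2_unique R n0 n1 (fun w => - (0 +i* w)) (fun=> 1) (at_ 0) (at_ 1).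
move=> /(_ (CmeasurableN mI) (Cmeasurable_cst _ 1)) h.
have {h} := h _ G mG G0.
under eq_integral do rewrite normcN normI.
have -> : (\int[n1]_w (G w * (normc (1 : R[i]) ^+ 2)%:E) = \int[n1]_w G w)%E.
  by apply: eq_integral => w _; rewrite normcC normr1 expr1n mule1.
move=> h; apply/esym/h => b q q0; have hg := schwartz_cgauss b q0; split.
  by have /L2cP[] := (symbol_dX hg).2.
rewrite -(stat_op_norm2 Z_random (symbol_dX hg)).
have -> : (fun w : mR => 1 * fourier (cgauss b q) w) = fourier (cgauss b q).
  by apply/funext => w; rewrite mul1r.
rewrite -(stat_op_norm2 Z_random (is_symbol_schwartz nu 1 hg)).
apply: norm2_sub0_eq; last exact: velocity_eq.
  exact: (stat_op_L2c Z_random (symbol_dX hg)).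
exact: (stat_op_L2c Z_random (is_symbol_schwartz nu 1 hg)).
Qed.

Let symbol_Psi g : schwartz g -> is_symbol nu 1 (dist_of_fun (Psi m lam bet K (Cderive 1 g)))
  (fun w => imp w * fourier (Cderive 1 g) w).
Proof.
move=> hg.
exact: (is_symbol_Psi k_loc k_gt0 k_der dk_le0 dk_cont a01 k_decay m_gt0 lam_gt0 bet_gt0 hg nu 1).
Qed.

Let symbol_gX phi : schwartz phi ->
  is_symbol nu 0 (dist_of_fun (fun t => gam%:C * phi t)) (fun w => gam%:C * fourier phi w).
Proof.
move=> hp; have := is_symbol_schwartz nu 0 (schwartzZ gam%:C hp).
by congr is_symbol; apply/funext => w; rewrite fourierZ//; exact: schwartz_Cintegrable.
Qed.

(** The velocity of the Schwartz approximations of [Psi phi] may be replaced by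
    the derivative of the position. Hence, on test functions whose transform
    vanishes at the origin, the force is governed by the position spectrum alone. *)
Lemma norm2_force g : schwartz g ->
  norm2 P (force (Cderive 1 g)) =
  norm2 n0 (fun w => (- (0 +i* w) * imp w + gam%:C) * fourier (Cderive 1 g) w).
Proof.
move=> hg; set phi := Cderive 1 g; have hp : schwartz phi := schwartz_Cderive hg.
pose S w := imp w * fourier phi w.
pose S_ n w := impedance_approx k m lam bet n w * fourier phi w.
have cvgS := Psi_symbol_cvg k_loc k_gt0 k_der dk_le0 dk_cont a01 k_decay m_gt0 lam_gt0 bet_gt0 hg nu.
have [S1 c1] : L2c n1 S /\ norm2 n1 (fun w => S_ n w - S w) @[n --> \oo] --> 0%E.
  have [] := cvgS 1 (fun=> 1) 0%N (Cmeasurable_cst _ 1).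
    by move=> w; rewrite expr0 normcC normr1.
  rewrite -/phi; under eq_fun do rewrite mul1r.
  under [X in _ -> X @ _ --> _ -> _]eq_fun do under eq_fun do rewrite !mul1r.
  by [].
have [S0 c0] : L2c n0 (fun w => - (0 +i* w) * S w) /\
    norm2 n0 (fun w => - (0 +i* w) * S_ n w - - (0 +i* w) * S w) @[n --> \oo] --> 0%E.
  have [] := cvgS 0 (fun w => - (0 +i* w)) 1%N (CmeasurableN mI).
    move=> w; rewrite normcN expr1.
    by rewrite -[leLHS]add0r lerD//= expr0n add0r sqrtr_sqr.
  by [].
pose Y := stoch_int P nu Z 0 (fun w => - (0 +i* w) * S w).
have hY : is_stoch_int P nu Z 0 (fun w => - (0 +i* w) * S w) Y by exact: stoch_intP.
pose phi_ n := Psi_approx k m lam bet n phi.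
have hphi n : schwartz (phi_ n) by exact: schwartz_Psi_approx.
have fphi n w : fourier (phi_ n) w = S_ n w by rewrite /phi_ fourier_Psi_approx.
have sV n : is_symbol nu 1 (dist_of_fun (phi_ n)) (S_ n).
  by have := is_symbol_schwartz nu 1 (hphi n); congr is_symbol; apply/funext => w; exact: fphi.
have sdX n : is_symbol nu 0 (dist_of_fun (fun t => - Cderive 1 (phi_ n) t))
    (fun w => - (0 +i* w) * S_ n w).
  by have := symbol_dX (hphi n); congr is_symbol; apply/funext => w; rewrite fphi.
have sP := symbol_Psi hg; rewrite -/phi in sP.
pose VP := V (Psi m lam bet K phi).
have hVP : L2c P VP := stat_op_L2c Z_random sP.
have YL : L2c P Y by case: hY.
(* V (phi_ n) and X (- (phi_ n)') coincide, and tend to VP and Y respectively *)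
have VY : norm2 P (fun w => VP w - Y w) = 0%E.
  have d1 : norm2 P (fun w => V (phi_ n) w - VP w) @[n --> \oo] --> 0%E.
    apply: cvg_trans c1; apply: near_eq_cvg; apply: nearW => n.
    by rewrite (stat_op_norm2_sub Z_random (sV n) sP).
  have d2 : norm2 P (fun w => dX (phi_ n) w - Y w) @[n --> \oo] --> 0%E.
    apply: cvg_trans c0; apply: near_eq_cvg; apply: nearW => n.
    by rewrite (stoch_int_norm2_sub Z_random (sdX n).2 S0 (stat_op_symbol Z_random (sdX n)) hY).
  have hVn n : L2c P (V (phi_ n)) := stat_op_L2c Z_random (sV n).
  have hXn n : L2c P (dX (phi_ n)) := stat_op_L2c Z_random (sdX n).
  exact: (norm2_limits_sub0 hVn hXn hVP YL d1 d2 (fun n => velocity_eq (hphi n))).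
have sG := symbol_gX hp.
pose GX := X (fun t => gam%:C * phi t).
have hGX : L2c P GX := stat_op_L2c Z_random sG.
have hf : L2c P (fun w => VP w + GX w) := L2cD hVP hGX.
have hh : L2c P (fun w => Y w + 1 * GX w) := L2cD YL (L2cZ 1 hGX).
have ef : norm2 P (fun w => (VP w + GX w) - (Y w + 1 * GX w)) = 0%E.
  rewrite -[RHS]VY; congr norm2; apply/funext => w.
  by move: (VP w) (Y w) (GX w) => u v z; ring.
transitivity (norm2 P (fun w => Y w + 1 * GX w)); first exact: (norm2_sub0_eq hf hh ef).
have hYG := is_stoch_intD Z_random 1 S0 sG.2 hY (stat_op_symbol Z_random sG).
rewrite (stoch_int_norm2 Z_random (L2cD S0 (L2cZ 1 sG.2)) hYG).
congr norm2; apply/funext => w; rewrite /S.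
by move: (fourier phi w) (imp w) => u v; ring.
Qed.

Let force_L2c g : schwartz g -> L2c P (force (Cderive 1 g)).
Proof.
move=> hg; have h1 := stat_op_L2c Z_random (symbol_Psi hg).
have h2 := stat_op_L2c Z_random (symbol_gX (schwartz_Cderive hg)).
exact: (L2cD h1 h2).
Qed.

Let cos_part_bound : exists2 M, 0 <= M & forall w,
  `|w| * cos_part k w <= M * (1 + `|w|).
Proof.
have [M M0 hM] := kbound_mulr k_gt0 a01 k_decay.
exists M => // w; have [->|w0] := eqVneq w 0.
  by rewrite normr0 mul0r addr0 mulr1.
apply: le_trans (hM w); rewrite ler_wpM2l// /cos_part (negbTE w0).
apply: (le_trans (ler_norm _)).
exact: (ktrans_bound k_loc k_gt0 k_der dk_le0 dk_cont a01 k_decay).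
Qed.

Let mcos : measurable_fun (setT : set mR) (cos_part k).
Proof. exact: (measurable_cos_part k_loc k_gt0 k_der dk_le0 dk_cont a01 k_decay). Qed.

Let sqr_integrable phi : schwartz phi ->
  mu.-integrable setT (EFin \o (fun w => normc (fourier phi w) ^+ 2)).
Proof.
move=> hp; have ip := schwartz_Cintegrable hp; have mf := fourier_Cmeasurable ip.
have [M hM] := rapid_bounded (rapid_fourier hp).
have r : rapid (fun w => conjc (fourier phi w) * fourier phi w).
  apply: (rapid_mul (C := M) (p := 0)); first exact: rapid_fourier.
  by move=> w; rewrite normc_conj expr0 mulr1.
have [+ _] := rapid_Cintegrable (CmeasurableM (CmeasurableJ mf) mf) r.
congr (_.-integrable _ _); apply/funext => w; rewrite /comp; congr EFin.
by rewrite normc_sqr; move: (fourier phi w) => z; rewrite !complexE'; ring.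
Qed.

Let cos_sqr_integrable g : schwartz g -> mu.-integrable setT
  (EFin \o (fun w => cos_part k w * normc (fourier (Cderive 1 g) w) ^+ 2)).
Proof.
move=> hg; have ig := schwartz_Cintegrable hg; have mg := fourier_Cmeasurable ig.
have ip := schwartz_Cintegrable (schwartz_Cderive hg); have mf := fourier_Cmeasurable ip.
have [M M0 hM] := cos_part_bound.
have [M' hM'] := rapid_bounded (rapid_fourier (schwartz_Cderive hg)).
have M'0 : 0 <= M' by exact: le_trans (normc_ge0 _) (hM' 0).
have r : rapid (fun w => ((cos_part k w)%:C * (0 +i* w) * conjc (fourier (Cderive 1 g) w))
    * fourier g w).
  apply: (rapid_mul (C := M * M') (p := 1)); first exact: rapid_fourier.
  move=> w; rewrite !ComplexField.Normc.normcM normc_conj normcC expr1.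
  have -> : normc (0 +i* w) = `|w| by rewrite /= expr0n add0r sqrtr_sqr.
  rewrite ger0_norm; last exact: cos_part_ge0.
  rewrite [X in _ <= X]mulrAC; apply: ler_pM (hM' w); rewrite ?normc_ge0//.
    by rewrite mulr_ge0// cos_part_ge0.
  by rewrite mulrC.
have [+ _] := rapid_Cintegrable (CmeasurableM (CmeasurableM (CmeasurableM (CmeasurableC mcos) mI)
  (CmeasurableJ mf)) mg) r.
congr (_.-integrable _ _); apply/funext => w; rewrite /comp; congr EFin.
rewrite normc_sqr (fourier_Cderive w hg); move: (fourier g w) (cos_part k w) => z c.
by rewrite !complexE' /=; ring.
Qed.

Let Re_density phi (rho : R -> R) :
  Re (Cint mu setT (fun w => (rho w)%:C * fourier phi w * conjc (fourier phi w))) =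
  \int[mu]_w (rho w * normc (fourier phi w) ^+ 2).
Proof.
rewrite RePE; apply: eq_Rintegral => w _.
by rewrite normc_sqr !complexE'; ring.
Qed.

(** The spectral density of the total noise. *)
Let gain w := kBT / pi * resistance k lam bet w.

Let gain_ge0 w : 0 <= gain w.
Proof. by rewrite mulr_ge0 ?divr_ge0 ?pi_ge0 ?(ltW kBT_gt0)// ltW// resistance_gt0. Qed.

(** The fluctuation-dissipation relation: the spectrum of the noise is the
    dissipative part of the impedance. *)
Lemma norm2_force_noise g : schwartz g ->
  norm2 P (force (Cderive 1 g)) =
  norm2 mu (fun w => (Num.sqrt (gain w))%:C * fourier (Cderive 1 g) w).
Proof.
move=> hg; have hp := schwartz_Cderive hg.
pose A := \int[mu]_w normc (fourier (Cderive 1 g) w) ^+ 2.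
pose B := \int[mu]_w (cos_part k w * normc (fourier (Cderive 1 g) w) ^+ 2).
have iA := sqr_integrable hp; have iB := cos_sqr_integrable hg.
have [_ _ dW dF _] := FW_noise.
have [_ _ /(_ _ _ hp hp)] := Phi_sol; rewrite (dW _ _ hp hp) (dF _ _ hp hp).
move/(congr1 (fun z : R[i] => Re z)).
have pi0 : pi != 0 :> R by rewrite gt_eqF// pi_gt0.
have eA : Re (Cint mu setT (fun w => (1 : R)%:C * fourier (Cderive 1 g) w *
    conjc (fourier (Cderive 1 g) w))) = A.
  by rewrite (Re_density _ (fun=> 1)); apply: eq_Rintegral => w _; rewrite mul1r.
have eB : Re (Cint mu setT (fun w => (2 * Kcos K w)%:C * fourier (Cderive 1 g) w *
    conjc (fourier (Cderive 1 g) w))) = 2 * B.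
  rewrite (Re_density _ (fun w => 2 * Kcos K w)) -RintegralZl//.
  apply: eq_Rintegral => w _; have [->|w0] := eqVneq w 0.
    rewrite (fourier_Cderive 0 hg) (_ : 0 +i* 0 = 0 :> R[i])// mul0r.
    by rewrite ComplexField.Normc.normc0 expr0n !mulr0.
  by rewrite /cos_part (negbTE w0) k_Kcos// mulrA.
have key (x y z u : R) (U U' : R[i]) :
    Re (x%:C * (y%:C * (z%:C * U) + 2 * u%:C * (z%:C * U'))) =
    x * (y * (z * Re U) + 2 * u * (z * Re U')).
  by rewrite !complexE' /=; ring.
move=> h; rewrite (norm2_cinner (force_L2c hg)).
transitivity ((kBT / pi * (lam * A + bet * B))%:E).
  congr EFin; rewrite [LHS]h key eA eB.
  by move: (A) (B) (@pi R) pi0 => u v p p0; field.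
have iG : mu.-integrable setT (EFin \o
    (fun w => gain w * normc (fourier (Cderive 1 g) w) ^+ 2)).
  have := intZ (kBT / pi) measurableT (intD measurableT (intZ lam measurableT iA)
    (intZ bet measurableT iB)).
  congr (_.-integrable _ _); apply/funext => w /=; congr EFin.
  by rewrite /gain /resistance; ring.
transitivity ((\int[mu]_w (gain w * normc (fourier (Cderive 1 g) w) ^+ 2))%:E).
  congr EFin; have iA' := intZ lam measurableT iA; have iB' := intZ bet measurableT iB.
  rewrite -(RintegralZl lam measurableT iA) -(RintegralZl bet measurableT iB).
  rewrite -(RintegralD measurableT iA' iB') -RintegralZl//; last exact: intD.
  by apply: eq_Rintegral => w _; rewrite /gain /resistance; ring.
rewrite /Rintegral fineK; last exact: integrable_fin_num iG.
apply: eq_integral => w _; congr EFin.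
rewrite ComplexField.Normc.normcM exprMn normcC ger0_norm ?sqrtr_ge0//.
by rewrite (sqr_sqrtr (gain_ge0 w)).
Qed.

Let mres : measurable_fun (setT : set mR) (resistance k lam bet).
Proof. exact: (measurable_resistance k_loc k_gt0 k_der dk_le0 dk_cont a01 k_decay). Qed.

Let mreac : measurable_fun (setT : set mR) (reactance k m bet gam).
Proof. exact: (measurable_reactance k_loc k_gt0 k_der dk_le0 dk_cont a01 k_decay). Qed.

Let mimp : Cmeasurable (imp : mR -> R[i]).
Proof.
split => //=; apply: measurable_funD; first exact: measurable_funM.
apply: measurable_funM => //.
exact: (measurable_sin_part k_loc k_gt0 k_der dk_le0 dk_cont a01 k_decay).
Qed.

Let modulus w := resistance k lam bet w ^+ 2 + reactance k m bet gam w ^+ 2.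

Let modulus_gt0 w : 0 < modulus w.
Proof. by rewrite ltr_pwDl ?sqr_ge0// exprn_gt0// resistance_gt0. Qed.

Let mmod : measurable_fun (setT : set mR) modulus.
Proof. by apply: measurable_funD; exact: measurable_funX. Qed.

(** The two factors compared by the force balance on the transform of [g], of which
    the test function is the derivative. *)
Let c1 w : R[i] := (- (0 +i* w) * imp w + gam%:C) * (0 +i* w).
Let c2 w : R[i] := (Num.sqrt (gain w))%:C * (0 +i* w).

(** The force multiplies the position symbol by [- i w] times the full impedance. *)
Let c1E w : normc (c1 w) ^+ 2 = w ^+ 4 * modulus w.
Proof.
rewrite /c1 ComplexField.Normc.normcM exprMn normI normc_sqr /imp /impedance /modulus.
have [->|w0] := eqVneq w 0; first by rewrite !expr0n/= mulr0 mul0r.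
have -> : reactance k m bet gam w = (- m * w + bet * sin_part k w) + gam * w^-1 by [].
move: (resistance k lam bet w) (- m * w + bet * sin_part k w) => r s.
by rewrite !complexE' /=; field.
Qed.

Let c2E w : normc (c2 w) ^+ 2 = gain w * w ^+ 2.
Proof.
rewrite /c2 ComplexField.Normc.normcM exprMn normI normcC ger0_norm ?sqrtr_ge0//.
by rewrite sqr_sqrtr.
Qed.

(** Force balance for the spectra, obtained by testing with derivatives of
    Gaussians. *)
Lemma spectral_position (G : mR -> R) : measurable_fun setT G -> (forall w, 0 <= G w) ->
  (\int[n0]_w (G w * (w ^+ 4 * modulus w))%:E = \int[mu]_w (G w * (gain w * w ^+ 2))%:E)%E.
Proof.
move=> mG G0.
have mc1 : Cmeasurable (c1 : mR -> R[i]).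
  apply: CmeasurableM mI; apply: CmeasurableD (Cmeasurable_cst _ _).
  by apply: CmeasurableM mimp; exact: CmeasurableN.
have mc2 : Cmeasurable (c2 : mR -> R[i]).
  apply: CmeasurableM mI; apply: CmeasurableC; apply: measurableT_comp.
    exact: (measurable_continuous (@sqrt_continuous R)).
  exact: measurable_funM.
have h := @gauss_norm2_unique R n0 mu c1 c2 (at_ 0) at_leb mc1 mc2.
have hG b q : 0 < q ->
    (norm2 n0 (fun w => c1 w * fourier (cgauss b q) w)%R < +oo)%E /\
    norm2 n0 (fun w => c1 w * fourier (cgauss b q) w) =
    norm2 mu (fun w => c2 w * fourier (cgauss b q) w).
  move=> q0; have hg := schwartz_cgauss b q0.
  have e1 : (fun w : mR => c1 w * fourier (cgauss b q) w) =
      (fun w => (- (0 +i* w) * imp w + gam%:C) * fourier (Cderive 1 (cgauss b q)) w).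
    by apply/funext => w; rewrite /c1 fourier_Cderive// mulrA.
  have e2 : (fun w : mR => c2 w * fourier (cgauss b q) w) =
      (fun w => (Num.sqrt (gain w))%:C * fourier (Cderive 1 (cgauss b q)) w).
    by apply/funext => w; rewrite /c2 fourier_Cderive// mulrA.
  rewrite e1 e2 -(norm2_force hg) -(norm2_force_noise hg); split => //.
  by have /L2cP[] := force_L2c hg.
have mGE : measurable_fun (setT : set mR) (EFin \o G) by exact/measurable_EFinP.
have G0E w : (0 <= (EFin \o G) w)%E by rewrite lee_fin.
have := h hG _ mGE G0E.
have -> : (\int[n0]_w ((EFin \o G) w * (normc (c1 w) ^+ 2)%:E) =
    \int[n0]_w (G w * (w ^+ 4 * modulus w))%:E)%E.
  by apply: eq_integral => w _; rewrite c1E EFinM.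
move=> ->; by apply: eq_integral => w _; rewrite c2E EFinM.
Qed.

Let int_gain_conductance : (\int[mu]_w (kBT / pi * conductance k m lam bet gam w)%:E = (kBT / m)%:E)%E.
Proof.
have h := int_conductance k_loc k_gt0 k_der dk_le0 dk_cont a01 k_decay k_cos m_gt0 lam_gt0 bet_gt0 gam_gt0.
have c0 : 0 <= kBT / pi by rewrite divr_ge0 ?pi_ge0// ltW.
have mE : measurable_fun (setT : set mR) (fun w => (conductance k m lam bet gam w)%:E).
  apply/measurable_EFinP.
  exact: (measurable_conductance k_loc k_gt0 k_der dk_le0 dk_cont a01 k_decay).
have E0 w : (setT : set mR) w -> (0 <= (conductance k m lam bet gam w)%:E)%E.
  by move=> _; rewrite lee_fin conductance_ge0.
transitivity ((kBT / pi)%:E * \int[mu]_w (conductance k m lam bet gam w)%:E)%E.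
  rewrite -(ge0_integralZl_EFin mu measurableT E0 mE c0).
  by apply: eq_integral => w _; rewrite EFinM.
rewrite h -EFinM; congr EFin; have := @pi_gt0 R; move: (@pi R) => p p0.
by field; rewrite !gt_eqF.
Qed.

(** Testing with [1 / (w ^ 2 |H| ^ 2)] turns the force balance into the integral
    of the conductance. *)
Lemma velocity_mass : n1 setT = (kBT / m)%:E.
Proof.
have -> : n1 setT = (\int[n1]_w (cst 1 w))%E by rewrite integral_cst// mul1e.
rewrite spectral_velocity//.
pose G w := (w ^+ 2 * modulus w)^-1.
have mG : measurable_fun (setT : set mR) G.
  by apply: (measurableT_comp measurable_invr); apply: measurable_funM => //; exact: measurable_funX.
have G0 w : 0 <= G w by rewrite invr_ge0 mulr_ge0 ?sqr_ge0// ltW.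
have := spectral_position mG G0.
have -> : (\int[n0]_w (G w * (w ^+ 4 * modulus w))%:E = \int[n0]_w (cst 1 w * (w ^+ 2)%:E))%E.
  apply: eq_integral => w _; rewrite mul1e; congr EFin; rewrite /G.
  have [->|w0] := eqVneq w 0; first by rewrite !expr0n/= mul0r mulr0.
  by have := modulus_gt0 w; move: (modulus w) => x x0; field; rewrite w0 gt_eqF.
move=> ->; rewrite -int_gain_conductance.
apply: ge0_ae_eq_integral => //.
- apply/measurable_EFinP; apply: measurable_funM => //; apply: measurable_funM.
    exact: measurable_funM.
  exact: measurable_funX.
- apply/measurable_EFinP; apply: measurable_funM => //.
  exact: (measurable_conductance k_loc k_gt0 k_der dk_le0 dk_cont a01 k_decay).
- by move=> w _; rewrite lee_fin mulr_ge0// mulr_ge0 ?sqr_ge0.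
- move=> w _; rewrite lee_fin; apply: mulr_ge0; last exact: conductance_ge0.
  by rewrite divr_ge0 ?pi_ge0// ltW.
- apply: (@ae_except R 0) => w w0 _; congr EFin.
  rewrite /G /gain /conductance -/(modulus w).
  have := modulus_gt0 w; move: (modulus w) (resistance k lam bet w) => x r x0.
  have := @pi_gt0 R; move: (@pi R) => p p0.
  by field; rewrite w0 !gt_eqF.
Qed.

(** Testing with [1 / (w ^ 4 |H| ^ 2)] gives the total mass of the position
    spectrum, up to the origin, which carries no mass. *)
Lemma position_mass : n0 setT = (kBT / gam)%:E.
Proof.
pose G w := (w ^+ 4 * modulus w)^-1.
have mG : measurable_fun (setT : set mR) G.
  by apply: (measurableT_comp measurable_invr); apply: measurable_funM => //; exact: measurable_funX.
have w40 (w : R) : 0 <= w ^+ 4 by rewrite (exprM w 2 2) sqr_ge0.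
have G0 w : 0 <= G w by rewrite invr_ge0 mulr_ge0// ltW.
have := spectral_position mG G0.
have -> : (\int[n0]_w (G w * (w ^+ 4 * modulus w))%:E = n0 setT)%E.
  have -> : n0 setT = (\int[n0]_w (cst 1 w))%E by rewrite integral_cst// mul1e.
  apply: ge0_ae_eq_integral => //.
  - apply/measurable_EFinP; apply: measurable_funM mG _; apply: measurable_funM mmod.
    exact: measurable_funX.
  - by move=> w _; rewrite lee_fin mulr_ge0// mulr_ge0// ltW.
  - apply: sm_ae; apply: (@ae_except R 0) => w w0 _; congr EFin; rewrite /G mulVf//.
    by rewrite mulf_neq0 ?expf_neq0// gt_eqF.
move=> ->.
have h := int_conductance_div_sqr k_loc k_gt0 k_der dk_le0 dk_cont a01 k_decay k_cos
  m_gt0 lam_gt0 bet_gt0 gam_gt0.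
have c0 : 0 <= kBT / pi by rewrite divr_ge0 ?pi_ge0// ltW.
have mE : measurable_fun (setT : set mR) (fun w => (conductance k m lam bet gam w / w ^+ 2)%:E).
  apply/measurable_EFinP; apply: measurable_funM.
    exact: (measurable_conductance k_loc k_gt0 k_der dk_le0 dk_cont a01 k_decay).
  by apply: (measurableT_comp measurable_invr); exact: measurable_funX.
have E0 w : (setT : set mR) w -> (0 <= (conductance k m lam bet gam w / w ^+ 2)%:E)%E.
  by move=> _; rewrite lee_fin divr_ge0 ?sqr_ge0// conductance_ge0.
transitivity ((kBT / pi)%:E * \int[mu]_w (conductance k m lam bet gam w / w ^+ 2)%:E)%E.
  rewrite -(ge0_integralZl_EFin mu measurableT E0 mE c0).
  apply: eq_integral => w _; rewrite -EFinM; congr EFin.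
  rewrite /G /gain /conductance -/(modulus w).
  have := modulus_gt0 w; move: (modulus w) (resistance k lam bet w) => x r x0.
  have [->|w0] := eqVneq w 0; first by rewrite !expr0n/= !(mul0r, mulr0, invr0).
  have := @pi_gt0 R; move: (@pi R) => p p0.
  by field; rewrite w0 !gt_eqF.
rewrite h -EFinM; congr EFin; have := @pi_gt0 R; move: (@pi R) => p p0.
by field; rewrite !gt_eqF.
Qed.

End stationary_solution.

(** * Equipartition *)

Theorem theorem3p5 (R : realType) (d : measure_display)
    (Omega : measurableType d) (P : probability Omega R)
    (m lambda beta gamma kBT : R) (K : R -> \bar R)
    (F W : (R -> R[i]) -> Omega -> R[i])
    (nu : spectral_measure R)
    (Z : 'I_2 -> set (measurableTypeR R) -> Omega -> R[i])
    (m_gt0 : 0 < m) (lambda_gt0 : 0 < lambda) (beta_gt0 : 0 < beta)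
    (gamma_gt0 : 0 < gamma) (kBT_gt0 : 0 < kBT)
    (K_fun : kernel_function K)
    (K_I : kernel_I K) (K_II : kernel_II K) (K_III : kernel_III K)
    (FW_noise : noise_pair P K F W)
    (Z_random : random_measure P nu Z)
    (Phi_real : stat_op_real P nu Z)
    (Phi_sol : weak_stationary_solution P m lambda beta gamma kBT K F W nu Z) :
  let x (t : R) := stat_op P nu Z 0 (delta t) in
  let v (t : R) := stat_op P nu Z 1 (delta t) in
  (forall t, stat_dom nu 0 (delta t) /\ stat_dom nu 1 (delta t)) /\
  Cexpectation P (fun w => gamma%:C * x 0 w ^+ 2) = kBT%:C /\
  Cexpectation P (fun w => m%:C * v 0 w ^+ 2) = kBT%:C.
Proof.
have k_loc := real_kernel_integrable K_I.
have k_gt0 := real_kernel_gt0 K_fun K_I.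
have [dk hdk] := real_kernel_der K_III.
have k_der (t : R) : 0 < t -> is_derive t 1 (real_kernel K) (dk t) by case/hdk.
have dk_le0 (t : R) : 0 < t -> dk t <= 0 by case/hdk.
have dk_cont (t : R) : 0 < t -> {for t, continuous dk} by case/hdk.
have [a a01 [C k_decay]] := real_kernel_decay K_fun K_I K_II K_III.
have k_Kcos := ktrans_Kcos K_I.
have k_cos := ktrans_cos_ge0 K_I.
have e0 := position_mass m_gt0 lambda_gt0 beta_gt0 gamma_gt0 kBT_gt0 FW_noise Z_random Phi_sol
  k_loc k_gt0 k_der dk_le0 dk_cont a01 k_decay k_Kcos k_cos.
have e1 := velocity_mass m_gt0 lambda_gt0 beta_gt0 gamma_gt0 kBT_gt0 FW_noise Z_random Phi_sol
  k_loc k_gt0 k_der dk_le0 dk_cont a01 k_decay k_Kcos k_cos.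
have f0 : (sm_diag nu 0%R setT < +oo)%E by rewrite e0 ltry.
have f1 : (sm_diag nu 1%R setT < +oo)%E by rewrite e1 ltry.
move=> x v; split; first by move=> t; split; exact: stat_dom_delta.
split.
  rewrite (Cexpectation_sqr_delta Z_random Phi_real f0 gamma e0).
  by rewrite mulrC divfK// gt_eqF.
rewrite (Cexpectation_sqr_delta Z_random Phi_real f1 m e1).
by rewrite mulrC divfK// gt_eqF.
Qed.
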